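(* Let $Q$ be an analytic manifold. Consider a regular Lagrangian $L\in \mathcal{C}^a(TQ,\mathbb{R})$ and a consistent variational integrator $I$. There exists a formal power series $L_{\mathrm{invmod}}$ in the step size $h$ such that for any truncation index $k$, writing $L_{\mathrm{invmod}}^{[[k]]}$ for the truncation of $L_{\mathrm{invmod}}$ after terms of order $h^k$, the following statements hold. \begin{itemize} \item The modified equation to $I(L_{\mathrm{invmod}}^{[[k]]})$ is equivalent to the exact Euler--Lagrange equations $\mathcal{E}(L)=0$ up to terms of order $\mathcal{O}(h^{k+1})$. \item The modified Lagrangian $(L_{\mathrm{invmod}}^{[[k]]})_{\mathrm{mod}}$ to the variational discretisation $I(L_{\mathrm{invmod}}^{[[k]]})$ coincides with $L$ up to terms of order $\mathcal{O}(h^{k+1})$. \end{itemize}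
   Context: Notation. $\mathcal{C}^a(M,\mathbb{R})$ is the space of real analytic functions on $M$; $\mathrm{Jet}^m(Q)$ is the space of $m$-jets over $Q$. One works in local coordinates identifying $Q$ with a subset of $\mathbb{R}^n$, with coordinates $q^{[m]}=(q,\dot q,\ddot q,q^{(3)},\ldots,q^{(m)})$ on $\mathrm{Jet}^m(Q)$ and $(q,\dot q)$ on $TQ$. $R[[s]]$ denotes formal power series in a formal variable $s$ with coefficients in $R$. The coefficients of $L_{\mathrm{invmod}}$ are elements of $\mathcal{C}^a(TQ,\mathbb{R})$. Euler--Lagrange operator. For $\Lambda\in\mathcal{C}^a(\mathrm{Jet}^m(Q),\mathbb{R})$, $\mathcal{E}(\Lambda)=\sum_{j=0}^m(-1)^j\frac{\mathrm{d}^j}{\mathrm{d}t^j}\frac{\partial \Lambda}{\partial q^{(j)}}$, where $\frac{\mathrm d^j}{\mathrm dt^j}$ is the total derivative; $\mathcal{E}$ is extended linearly to formal power series. Regularity. $L\in \mathcal{C}^a(TQ,\mathbb{R})$ is regular if the matrix $\left(\frac{\partial^2L}{\partial\dot q^i\partial\dot q^j}\right)_{i,j}$ is invertible (at $h=0$); a formal power series $\sum_{j\ge 0} s^jL_j$ with $L_0\in\mathcal{C}^a(TQ,\mathbb{R})$ is regular if $L_0$ is regular. Variational integrators. A variational integrator is a bounded linear map $I\colon \mathcal{C}^a(TQ,\mathbb{R})\to\mathcal{C}^a(Q\times Q\times\mathbb{R},\mathbb{R})$. Its images $L_\Delta=I(L)$ are called discrete Lagrangians; the last argument is the discretisation parameter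 or step size and is sometimes left implicit, $L_\Delta(q_0,q_1)=L_\Delta(q_0,q_1,h)$. A discrete Lagrangian $L_\Delta=I(L)$ is a consistent variational discretisation of $L\in\mathcal{C}^a(TQ,\mathbb{R})$ if there exist an open set $U\subset TQ$ with compact closure and constants $c,\tau>0$ such that for all solutions $q$ of $\mathcal{E}(L)=0$ with $(q(0),\dot q(0))\in U$ one has $\left\|L_\Delta(q(0),q(h))-\int_0^hL(q(t),\dot q(t))\,\mathrm{d}t\right\|\le c\,h^2$ for all $h\le\tau$. $I$ is consistent if for all regular Lagrangians $L\in\mathcal{C}^a(TQ,\mathbb{R})$ the discrete Lagrangian $I(L)$ is a consistent variational discretisation of $L$. Variational integrators are extended linearly to formal power series in $\mathcal{C}^a(TQ,\mathbb{R})[[s]]$; there $I$ is consistent if for any $\sum_{j}s^jL_j\in\mathcal{C}^a(TQ,\mathbb{R})[[s]]$ the discrete Lagrangian $I(L_j)$ is a consistent variational discretisation of $L_j$. Modified equation. Given a regular Lagrangian series $\sum_{j\ge0} s^jL_j$ with $L_0\in\mathcal{C}^a(TQ,\mathbb{R})$ and $L_j\in\mathcal{C}^a(\mathrm{Jet}^{m_j}(Q),\mathbb{R})$, $m_j<\infty$, there is a formal power series $\sum_{j\ge0}s^jg_j(q,\dot q)$ with analytic $g_j$ such that for every $k$ all solutions of $\ddot q=\sum_{j=0}^ks^jg_j(q,\dot q)$ solve $\mathcal{E}(\sum_{j=0}^ks^jL_j)=0$ up to an error of order $\mathcal{O}(s^{k+1})$; it is obtained by solving the Euler--Lagrange equation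 for $\ddot q$ and repeatedly substituting the equation and its time derivatives to eliminate $q^{(l)}$, $l\ge 2$, on the right hand side. For a consistent variational discretisation $L_\Delta=I(L)$ of a regular Lagrangian $L$, applying this to the series expansion of $L_\Delta(q(t),q(t+s))$ around $s=0$ gives the modified equation $\ddot q=\sum_{j\ge0}s^jg_j(q,\dot q)$ for $L_\Delta$. Modified Lagrangian. For a regular $L$ and a consistent variational discretisation $L_\Delta=I(L)$, the modified Lagrangian $L_{\mathrm{mod}}$ is a formal power series in $h$ such that for any truncation $L_{\mathrm{mod}}^{[[k]]}$ after order $\mathcal{O}(h^k)$ the equation $\mathcal{E}(L_{\mathrm{mod}}^{[[k]]})=0$, solved for $\ddot q$, coincides with the modified equation to $I(L)$ up to an error of order $\mathcal{O}(h^{k+1})$. It is constructed as follows: let $\mathcal{L}_\Delta^{[[k]]}(q^{[m]})$ be the series expansion around $h=0$ of $L_\Delta(q(t-\tfrac h2),q(t+\tfrac h2),h)$, truncated after order $\mathcal{O}(h^k)$, and define the meshed Lagrangian $$\mathcal{L}^{[[k]]}_{\mathrm{mesh}}=\sum_{j=0}^{\lfloor k/2\rfloor}\left(2^{1-2j}-1\right)h^{2j}\frac{B_{2j}}{(2j)!}\frac{\mathrm{d}^{2j}}{\mathrm{d}t^{2j}}\mathcal{L}_\Delta^{[[k]]}(q^{[m]})$$ with terms of order $\mathcal{O}(h^{k+1})$ truncated, where $B_{2j}$ are the Bernoulli numbers. Eliminating all $q^{(l)}$ with $l\ge2$ by iteratively substituting the modified equation for $L_\Delta$ and its derivatives, and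 truncating terms of order $\mathcal{O}(h^{k+1})$, gives $L_{\mathrm{mod}}^{[[k]]}$. For Lagrangians that are polynomials in the step size, such as $L_{\mathrm{invmod}}^{[[k]]}$, the same constructions are applied using the linear extension of $I$.
   Formalization: Q is taken connected and U nonempty (otherwise false); discrete Lagrangians may be singular at h=0 if (x,v,h)→L_Δ(x,x+hv,h) extends analytically; series are those of L_Δ/h, as consistency gives L_Δ≈hL; consistency is required for all L whose velocity Hessian is somewhere invertible. *)

(* Defs.v *)
From HB Require Import structures.
From mathcomp Require Import all_boot all_order all_algebra.
From mathcomp Require Import all_classical all_reals all_analysis.

Set Implicit Arguments.
Unset Strict Implicit.
Unset Printing Implicit Defensive.

Import Order.TTheory GRing.Theory Num.Theory numFieldNormedType.Exports.

Local Open Scope classical_set_scope.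
Local Open Scope ring_scope.

Section RealAnalytic.
Context {R : realType} {N : nat}.
Implicit Types (f : 'rV[R]_N -> R) (A K : set 'rV[R]_N).

(* the degree-m homogeneous part of the power series with coefficients c *)
Definition homogeneous_part (c : {ffun 'I_N -> nat} -> R) (m : nat)
    (y : 'rV[R]_N) : R :=
  \sum_(a : {ffun 'I_N -> 'I_m.+1} | (\sum_i (a i : nat) == m)%N)
     c [ffun i => a i : nat] * \prod_i y 0 i ^+ a i.

(* The Cauchy bound gives absolute convergence on the open polydisc of
   radius r, so grouping the monomials by degree is immaterial. *)
Definition power_series_at f (x : 'rV[R]_N) (C r : R) : Prop :=
  exists c : {ffun 'I_N -> nat} -> R,
    (forall a, `|c a| * r ^+ (\sum_i a i)%N <= C) /\
    (forall y : 'rV[R]_N, (forall i, `|y 0 i| < r) ->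
       series (fun m => homogeneous_part c m y) @ \oo --> f (x + y)).

Definition analytic_on A f : Prop :=
  forall x, A x -> exists C r : R, 0 < r /\ power_series_at f x C r.

(* Bounded subsets of C^a(A) for its usual locally convex topology (the
   projective limit over compact K of the spaces of germs along K): Cauchy
   estimates that are uniform in the function and in the points of K. *)
Definition bounded_analytic A (B : set ('rV[R]_N -> R)) : Prop :=
  forall K, compact K -> K `<=` A ->
    exists C r : R, 0 < r /\
      forall f, B f -> forall x, K x -> power_series_at f x C r.

End RealAnalytic.

(* As in mathlib's charted spaces, a chart around each point is part of the
   data; the two maps of a chart are total, and meaningful on chart_dom and
   on its image only. *)
Record analyticManifold (R : realType) (n : nat) := AnalyticManifold {
  carrier :> topologicalType;
  chart_index : Type;
  chart_dom : chart_index -> set carrier;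
  chart : chart_index -> carrier -> 'rV[R]_n;
  param : chart_index -> 'rV[R]_n -> carrier;
  chart_at : carrier -> chart_index;
  chart_atP : forall m, chart_dom (chart_at m) m;
  chart_dom_open : forall i, open (chart_dom i);
  chart_image_open : forall i, open (chart i @` chart_dom i);
  chartK : forall i, {in chart_dom i, cancel (chart i) (param i)};
  chart_continuous : forall i m, chart_dom i m -> {for m, continuous (chart i)};
  param_continuous : forall i x,
    (chart i @` chart_dom i) x -> {for x, continuous (param i)};
  transition_analytic : forall i j (a : 'I_n),
    analytic_on (chart i @` (chart_dom i `&` chart_dom j))
      (fun x => chart j (param i x) 0 a);
  manifold_hausdorff : hausdorff_space carrier;
  manifold_second_countable : @second_countable carrier
}.

Section TangentBundle.
Context {R : realType} {n : nat} (Q : analyticManifold R n).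

Definition chart_image (i : chart_index Q) : set 'rV[R]_n :=
  chart i @` chart_dom i.

Definition transition_diff (i j : chart_index Q) (x v : 'rV[R]_n) : 'rV[R]_n :=
  \row_a derive1 (fun t : R => chart j (param i (x + t *: v)) 0 a) 0.

(* (m, w) is the tangent vector at m with components w in chart_at m *)
Definition tangent : Type := (Q * 'rV[R]_n)%type.

Definition tangent_param (i : chart_index Q) (x v : 'rV[R]_n) : tangent :=
  (param i x, transition_diff i (chart_at (param i x)) x v).

Definition tangent_open (U : set tangent) : Prop :=
  forall i, open [set p : 'rV[R]_n * 'rV[R]_n |
                   chart_image i p.1 /\ U (tangent_param i p.1 p.2)].

Lemma tangent_openT : tangent_open setT.
Proof.
move=> i; rewrite (_ : mkset _ = fst @^-1` chart_image i).
  by apply: open_comp => [p _|]; [exact: cvg_fst|exact: chart_image_open].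
by apply/seteqP; split=> p //= [].
Qed.

Lemma tangent_openI : setI_closed tangent_open.
Proof.
move=> U V oU oV i.
rewrite (_ : mkset _ = [set p | chart_image i p.1 /\ U (tangent_param i p.1 p.2)]
   `&` [set p | chart_image i p.1 /\ V (tangent_param i p.1 p.2)]).
  by apply: openI; [exact: oU|exact: oV].
apply/seteqP; split=> p /=; first by case=> ? [].
by move=> [[? ?] [? ?]].
Qed.

Lemma tangent_open_bigU (I : Type) (F : I -> set tangent) :
  (forall k, tangent_open (F k)) -> tangent_open (\bigcup_k F k).
Proof.
move=> oF i.
rewrite (_ : mkset _ = \bigcup_k
   [set p | chart_image i p.1 /\ F k (tangent_param i p.1 p.2)]).
  by apply: bigcup_open => k _; exact: oF.
apply/seteqP; split=> p /=; first by case=> ip [k _ Fk]; exists k.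
by case=> k _ [ip Fk]; split=> //; exists k.
Qed.

HB.instance Definition _ := Choice.copy tangent (Q * 'rV[R]_n)%type.
HB.instance Definition _ :=
  isOpenTopological.Build tangent tangent_openT tangent_openI tangent_open_bigU.

Definition local_lagrangian (L : tangent -> R) (i : chart_index Q)
    (x v : 'rV[R]_n) : R := L (tangent_param i x v).

Definition flat2 (f : 'rV[R]_n -> 'rV[R]_n -> R) (w : 'rV[R]_(n + n)) : R :=
  f (lsubmx w) (rsubmx w).

Definition tangent_domain (i : chart_index Q) : set 'rV[R]_(n + n) :=
  [set w | chart_image i (lsubmx w)].

Definition lagrangian (L : tangent -> R) : Prop :=
  forall i, analytic_on (tangent_domain i) (flat2 (local_lagrangian L i)).

Definition bounded_lagrangians (B : set (tangent -> R)) : Prop :=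
  forall i, bounded_analytic (tangent_domain i)
              [set flat2 (local_lagrangian L i) | L in B].

Definition velocity_hessian (f : 'rV[R]_n -> 'rV[R]_n -> R)
    (x v : 'rV[R]_n) : 'M[R]_n :=
  \matrix_(a, b)
    derive1 (fun s : R => derive1 (fun r : R =>
      f x (v + s *: delta_mx 0 a + r *: delta_mx 0 b)) 0) 0.

Definition regular (L : tangent -> R) : Prop :=
  forall i x v, chart_image i x ->
    velocity_hessian (local_lagrangian L i) x v \in unitmx.

Definition somewhere_regular (L : tangent -> R) : Prop :=
  exists i x v, chart_image i x /\
    velocity_hessian (local_lagrangian L i) x v \in unitmx.

End TangentBundle.

(* An infinite jet (q, q', q'', ...); functions on Jet^m are functions of an
   infinite jet that depend on its first m+1 entries only. *)
Definition jet (R : realType) (n : nat) := nat -> 'rV[R]_n.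

Section JetCalculus.
Context {R : realType} {n : nat}.
Implicit Types (F : jet R n -> R) (z : jet R n).

Definition jet_of (x : R -> 'rV[R]_n) (t : R) : jet R n :=
  fun l => \row_a derive1n l (fun s => x s 0 a) t.

Definition jet_partial (l : nat) (a : 'I_n) F : jet R n -> R := fun z =>
  derive1 (fun s : R =>
    F (fun l' => if l' == l then z l' + s *: delta_mx 0 a else z l')) 0.

(* the vector field sum_l q^(l+1) d/dq^(l) applied to F *)
Definition total_derivative F : jet R n -> R := fun z =>
  derive1 (fun t : R => F (fun l => z l + t *: z l.+1)) 0.

(* component a of the Euler-Lagrange operator on functions on Jet^m *)
Definition euler (m : nat) F (a : 'I_n) : jet R n -> R := fun z =>
  \sum_(j < m.+1) (-1) ^+ j * iter j total_derivative (jet_partial j a F) z.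

Definition taylor_curve (p : nat) z (t : R) : 'rV[R]_n :=
  \sum_(l < p.+1) (t ^+ l / l`!%:R) *: z l.

(* jets of the solutions of q'' = f(q, q'), by repeated total
   differentiation and substitution *)
Fixpoint prolong (f : 'rV[R]_n -> 'rV[R]_n -> 'rV[R]_n) (l : nat)
    : 'rV[R]_n -> 'rV[R]_n -> 'rV[R]_n :=
  if l is l'.+1 then fun q v =>
    \row_a derive1 (fun t : R =>
      prolong f l' (q + t *: v) (v + t *: f q v) 0 a) 0
  else fun q _ => q.

Definition truncated_field (g : nat -> 'rV[R]_n -> 'rV[R]_n -> 'rV[R]_n)
    (k : nat) (h : R) (q v : 'rV[R]_n) : 'rV[R]_n :=
  \sum_(j < k.+1) h ^+ j *: g j q v.

(* x solves x'' = f(x, x') on a neighbourhood of 0 *)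
Definition ode_solution (f : 'rV[R]_n -> 'rV[R]_n -> 'rV[R]_n)
    (x : R -> 'rV[R]_n) : Prop :=
  \forall t \near (0 : R), forall a,
    derivable (fun s => x s 0 a) t 1 /\
    derivable (derive1 (fun s => x s 0 a)) t 1 /\
    jet_of x t 2%N 0 a = f (x t) (jet_of x t 1%N) 0 a.

End JetCalculus.

Section Expansion.
Context {R : realType}.

(* u(h) = sum_(j < p) c_j h^j + h^p * series_remainder u p h,
   where c_j = series_coef u j; u need not be defined at h = 0 *)
Fixpoint series_remainder (u : R -> R) (p : nat) : R -> R :=
  if p is p'.+1 then fun h =>
    (series_remainder u p' h - lim (series_remainder u p' @ 0^')) / h
  else u.

Definition series_coef (u : R -> R) (p : nat) : R :=
  lim (series_remainder u p @ 0^').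

(* B_(m+1) = - (sum_(j < m+1) C(m+2, j) B_j) / (m+2) *)
Fixpoint bernoulli_seq (m : nat) : seq R :=
  if m is m'.+1 then
    let s := bernoulli_seq m' in
    rcons s (- (\sum_(j < m'.+1) 'C(m'.+2, j)%:R * s`_j) / m'.+2%:R)
  else [:: 1].

Definition bernoulli (m : nat) : R := (bernoulli_seq m)`_m.

End Expansion.

Section Variational.
Context {R : realType} {n : nat} (Q : analyticManifold R n).
Implicit Types (L : tangent Q -> R) (G : Q -> Q -> R -> R)
  (i : chart_index Q).

Definition coordinates i (q : R -> Q) (t : R) : 'rV[R]_n := chart i (q t).

Definition tangent_lift (q : R -> Q) (t : R) : tangent Q :=
  (q t, jet_of (coordinates (chart_at (q t)) q) t 1%N).

Definition el_operator L i : 'I_n -> jet R n -> R :=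
  euler 1 (fun z => local_lagrangian L i (z 0%N) (z 1%N)).

Definition el_solution L (q : R -> Q) (a b : R) : Prop :=
  forall t, a < t < b ->
    {for t, continuous q} /\
    forall i, chart_dom i (q t) -> forall c : 'I_n,
      (\forall s \near t, derivable (fun r => coordinates i q r 0 c) s 1) /\
      derivable (derive1 (fun r => coordinates i q r 0 c)) t 1 /\
      el_operator L i c (jet_of (coordinates i q) t) = 0.

Definition consistent_discretisation L G : Prop :=
  exists U : set (tangent Q), [/\ open U, U !=set0, compact (closure U) &
    exists c tau : R, 0 < tau /\
      forall (q : R -> Q) (a b : R), a < 0 < b -> el_solution L q a b ->
        U (tangent_lift q 0) -> forall h : R, 0 < h <= tau -> h < b ->
          `|G (q 0) (q h) h
             - \int[lebesgue_measure]_(t in `[0, h]) L (tangent_lift q t)|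
          <= c * h ^+ 2].

Definition flat3 (f : 'rV[R]_n -> 'rV[R]_n -> R -> R)
    (w : 'rV[R]_(n + n + 1)) : R :=
  f (lsubmx (lsubmx w)) (rsubmx (lsubmx w)) (rsubmx w 0 0).

Definition pair_domain (i j : chart_index Q) : set 'rV[R]_(n + n + 1) :=
  [set w | [/\ chart_image i (lsubmx (lsubmx w)),
               chart_image j (rsubmx (lsubmx w)) & rsubmx w 0 0 != 0]].

Definition blowup_domain i : set 'rV[R]_(n + n + 1) :=
  [set w | let x := lsubmx (lsubmx w) in
           chart_image i x /\
           chart_image i (x + rsubmx w 0 0 *: rsubmx (lsubmx w))].

(* F extends (x, v, h) |-> G(x, x + hv, h) analytically across h = 0 *)
Definition blowup G i (F : 'rV[R]_n -> 'rV[R]_n -> R -> R) : Prop :=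
  analytic_on (blowup_domain i) (flat3 F) /\
  forall x v h, chart_image i x -> chart_image i (x + h *: v) -> h != 0 ->
    G (param i x) (param i (x + h *: v)) h = F x v h.

Definition local_discrete G (i j : chart_index Q) (x y : 'rV[R]_n) (h : R) : R :=
  G (param i x) (param j y) h.

(* Discrete Lagrangians such as h * L(q0, (q1 - q0) / h) are singular at
   h = 0, and a function analytic on all of Q x Q x R is consistent only with
   an L affine in the velocities. So G is analytic for h != 0, and its values
   along q1 = q0 + hv extend analytically across h = 0, which provides the
   expansions of G(q(t), q(t + h), h) in powers of h. Every element of
   C^a(Q x Q x R) has these properties. *)
Definition discrete_lagrangian G : Prop :=
  (forall i j, analytic_on (pair_domain i j) (flat3 (local_discrete G i j))) /\
  forall i, exists F, blowup G i F.

Definition bounded_discrete_lagrangians (B : set (Q -> Q -> R -> R)) : Prop :=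
  (forall i j, bounded_analytic (pair_domain i j)
                 [set flat3 (local_discrete G i j) | G in B]) /\
  forall i, bounded_analytic (blowup_domain i)
              [set flat3 F | F in [set F | exists2 G, B G & blowup G i F]].

Definition variational_integrator
    (I : (tangent Q -> R) -> Q -> Q -> R -> R) : Prop :=
  [/\ forall L, lagrangian L -> discrete_lagrangian (I L),
      forall (c : R) L1 L2, lagrangian L1 -> lagrangian L2 ->
        forall q0 q1 (h : R), h != 0 ->
          I (fun p => c * L1 p + L2 p) q0 q1 h
          = c * I L1 q0 q1 h + I L2 q0 q1 h
    & forall B : set (tangent Q -> R), (forall L, B L -> lagrangian L) ->
        bounded_lagrangians B -> bounded_discrete_lagrangians [set I L | L in B]].

(* The coefficients of a power series of Lagrangians need not be regular, so
   consistency is required beyond regular L; it is not required when the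
   velocity Hessian is everywhere singular, as the Euler-Lagrange equation then
   leaves q'' undetermined and the bound over all its solutions is not met
   by the usual integrators. *)
Definition consistent_integrator
    (I : (tangent Q -> R) -> Q -> Q -> R -> R) : Prop :=
  forall L, lagrangian L -> somewhere_regular L ->
    consistent_discretisation L (I L).

(* I applied to sum_(j <= k) h^j L_j *)
Definition integrate_truncation (I : (tangent Q -> R) -> Q -> Q -> R -> R)
    (Ls : nat -> tangent Q -> R) (k : nat) : Q -> Q -> R -> R :=
  fun q0 q1 h => \sum_(j < k.+1) h ^+ j * I (Ls j) q0 q1 h.

(* The coefficient of h^(j+1) in the expansion of G(q(ah), q(bh), h), for q
   with jet z at 0. It involves q through its Taylor polynomial of degree j+2
   only. As G approximates an action over a time h, the Lagrangian densities
   below are those of G / h, whence the shift of the exponent. *)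
Definition expansion G i (a b : R) (j : nat) : jet R n -> R := fun z =>
  series_coef (fun h => G (param i (taylor_curve j.+2 z (a * h)))
                          (param i (taylor_curve j.+2 z (b * h))) h) j.+1.

(* g is the family of coefficients of the modified equation
   q'' = sum_j s^j g_j(q, q') of G in chart i *)
Definition modified_equation G i
    (g : nat -> 'rV[R]_n -> 'rV[R]_n -> 'rV[R]_n) : Prop :=
  (forall j (c : 'I_n), analytic_on (tangent_domain i)
                          (flat2 (fun q v => g j q v 0 c))) /\
  forall K q0 v0, chart_image i q0 ->
    exists C delta : R, 0 < delta /\
      forall s, `|s| < delta -> forall x : R -> 'rV[R]_n,
        ode_solution (truncated_field g K s) x ->
        x 0 = q0 -> jet_of x 0 1%N = v0 ->
        forall c : 'I_n,
          `|\sum_(j < K.+1) s ^+ j *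
                euler j.+2 (expansion G i 0 1 j) c (jet_of x 0)|
          <= C * `|s| ^+ K.+1.

(* coefficient of h^p in the meshed Lagrangian *)
Definition meshed G i (p : nat) : jet R n -> R := fun z =>
  \sum_(j < p./2.+1)
    (2 / 2 ^+ (2 * j) - 1) * (bernoulli (2 * j) / (2 * j)`!%:R) *
    iter (2 * j) total_derivative
      (expansion G i (- 2^-1) 2^-1 (p - 2 * j)) z.

(* coefficient of h^p, for p <= k, in the modified Lagrangian truncated after
   h^k, for the modified equation with coefficients g *)
Definition modified_lagrangian G i
    (g : nat -> 'rV[R]_n -> 'rV[R]_n -> 'rV[R]_n) (k p : nat)
    (q v : 'rV[R]_n) : R :=
  series_coef (fun h => \sum_(j < k.+1) h ^+ j *
    meshed G i j (fun l => prolong (truncated_field g k h) l q v)) p.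

Definition equivalent_to_el L i
    (g : nat -> 'rV[R]_n -> 'rV[R]_n -> 'rV[R]_n) (k : nat) : Prop :=
  (forall z : jet R n, chart_image i (z 0%N) ->
     (forall c, el_operator L i c z = 0) <-> z 2%N = g 0%N (z 0%N) (z 1%N)) /\
  forall j q v, (0 < j <= k)%N -> chart_image i q -> g j q v = 0.

Definition coincides_with L i (M : nat -> 'rV[R]_n -> 'rV[R]_n -> R)
    (k : nat) : Prop :=
  forall p q v, (p <= k)%N -> chart_image i q ->
    M p q v = if p == 0%N then local_lagrangian L i q v else 0.

End Variational.

(* Main.v *)
(** Write X for the vector field of the exact Euler-Lagrange equation on TQ and
    Phi_p for the coefficient of h^(p+1) in G(q(0), q(h), h), a function of jets.
    The generating function of the exact flow, the integral of L over [0, h], has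
    the coefficients X^p L / (p+1)! on shell. Consistency, with the identity
    theorem on the connected manifold TQ, says that the blow-up F of I(M)
    satisfies F = 0 and dF/dh = M at h = 0, for every Lagrangian M; hence the
    term h^k I(L_k) adds exactly L_k to Phi_k and does not change Phi_p for
    p < k, and one can choose L_0, L_1, ... successively so that
    Phi_p = X^p L / (p+1)! on shell. The choice does not depend on the chart
    because both sides are coefficients of expansions along actual solutions.

    Since Phi_p depends on q', q'', ... only through the end point q(h), the
    on-shell identity determines the derivatives of Phi_p with respect to all jet
    coordinates on shell, and the Euler operator of Phi_p vanishes there by a
    binomial sum: the modified equation is the exact one. Centring at the midpoint
    replaces Phi_p by sum_i (-1/2)^i / i! D^i Phi_(p-i), so on shell the meshed
    Lagrangian has the coefficients sigma_p X^p L, and sigma_p = 0 for p > 0 is the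
    identity (2 b(x/2) - b(x)) (e^(x/2) - e^(-x/2)) / x = 1 for b(x) = x / (e^x - 1). *)

From HB Require Import structures.
Require Import Defs.
From mathcomp Require Import all_boot all_order all_algebra.
From mathcomp Require Import all_classical all_reals all_analysis.
From mathcomp Require Import ring lra zify.

Set Implicit Arguments.
Unset Strict Implicit.
Unset Printing Implicit Defensive.

Import Order.TTheory GRing.Theory Num.Theory numFieldNormedType.Exports.

Local Open Scope classical_set_scope.
Local Open Scope ring_scope.

(** Consistency is a bound of order [h ^ 2] for initial data in some unknown open set, so it yields
    only the coefficients of [h ^ 0] and [h ^ 1] of a blow-up, and only locally. To spread this over
    all of TQ, only the vanishing of a quantity has to be independent of the chart, not its value;
    the Hessian determinant is handled in the same way.

    On-shell information fixes off-shell derivatives for a triangular reason: the derivative of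
    [Phi p] in [q^(l+1)] is [b (p - l) / (l+1)!] for a single family [b], and differentiating the
    on-shell identity in the velocity leaves [b p] as the only new unknown at stage [p].

    The modified equation is stated through solutions of truncated equations for each small [s],
    with constants that depend on the initial state. It is converted into congruences modulo powers
    of [s] between polynomials in [s] with analytic coefficients. There [g_p] enters linearly with
    an invertible matrix, which gives existence and uniqueness; the exact field satisfies the
    congruences up to order [k], so it is the only candidate. *)

(** * Course-of-values recursion *)

Section StrongRecursion.
Context {T : Type} (x0 : T) (Phi : nat -> (nat -> T) -> T).

(** A table of the first [m] values, with [x0] beyond. Since [Phi] receives a whole function, values
    of any type, such as vector fields or Lagrangians, can depend on all earlier ones. *)
Fixpoint history (m : nat) : nat -> T :=
  if m is m'.+1 then
    fun j => if j == m' then Phi m' (history m') else history m' j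
  else fun=> x0.

Definition strong_rec (m : nat) : T := history m.+1 m.

Lemma historyE m j : history m j = if (j < m)%N then strong_rec j else x0.
Proof.
elim: m => [|m IH] //=; case: eqVneq => [->|jm].
  by rewrite ltnSn /strong_rec /= eqxx.
by rewrite IH [in RHS]ltnS [in RHS]leq_eqVlt (negPf jm).
Qed.

Lemma strong_recE m :
  strong_rec m = Phi m (fun j => if (j < m)%N then strong_rec j else x0).
Proof.
rewrite {1}/strong_rec /= eqxx; congr Phi.
by apply/funext => j; rewrite historyE.
Qed.

End StrongRecursion.

(** * Derivatives of functions of one real variable *)

Section RealDerivative.
Context {R : realType}.
Implicit Types (f g : R -> R) (t d : R).

Lemma near0P (P : R -> Prop) t :
  (\forall s \near t, P s) <->
  exists2 e : R, 0 < e & forall h, `|h| < e -> P (t + h).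
Proof.
split=> [/nbhs_ballP[e /= e0 He]|[e e0 He]].
  by exists e => // h he; apply: He; rewrite /ball /= opprD addNKr normrN.
apply/nbhs_ballP; exists e => // s; rewrite /ball /= => se.
by rewrite -(subrKC t s); apply: He; rewrite distrC.
Qed.

(** Multiplying the difference quotient out removes the exception at [h = 0] and gives error bounds
    in the form in which the later estimates use them. *)
Definition isd f t d : Prop :=
  forall e : R, 0 < e -> exists2 r : R, 0 < r &
    forall h, `|h| < r -> `|f (t + h) - f t - d * h| <= e * `|h|.

Lemma isdP f t d : isd f t d <-> is_derive t 1 f d.
Proof.
split=> [fd|[df <-]].
  suff fl : (fun h => h^-1 *: (f (h *: 1 + t) - f t)) @ 0^' --> d.
    by apply: DeriveDef; [apply/cvg_ex; exists d|exact/cvg_lim].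
  apply/cvgrPdist_le => e e0; have [r r0 fr] := fd _ e0.
  apply/nbhs_ballP; exists r => // h; rewrite /ball /= sub0r normrN => hr h0.
  have h0' : 0 < `|h| by rewrite normr_gt0.
  rewrite -(ler_pM2r h0') -normrM mulrBl.
  rewrite [_ *: 1]mulr1 [_ *: (_ - _)]mulrC divfK // distrC [h + t]addrC.
  by move/fr: hr; rewrite [d * h]mulrC.
move=> e e0; have /cvgrPdist_le /(_ _ e0) : (fun h => h^-1 *: (f (h *: 1 + t) - f t)) @ 0^' --> 'D_1 f t.
  by [].
move=> /nbhs_ballP[r /= r0 fr]; exists r => // h hr.
have [->|h0] := eqVneq h 0; first by rewrite addr0 mulr0 !subrr normr0 mulr0.
have h0' : 0 < `|h| by rewrite normr_gt0.
have := fr h; rewrite /ball /= sub0r normrN => /(_ hr h0).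
rewrite -(ler_pM2r h0') -normrM mulrBl.
by rewrite [_ *: 1]mulr1 [_ *: (_ - _)]mulrC divfK // distrC [h + t]addrC.
Qed.

Lemma isd_derive1 f t d : isd f t d -> derive1 f t = d.
Proof. by move=> /isdP fd; rewrite derive1E; exact: derive_val. Qed.

Lemma isd_derivable f t d : isd f t d -> derivable f t 1.
Proof. by move=> /isdP []. Qed.

Lemma derivable_isd f t : derivable f t 1 -> isd f t (derive1 f t).
Proof. by move=> fd; apply/isdP; rewrite derive1E; exact: derivableP. Qed.

Lemma isd_unique f t d d' : isd f t d -> isd f t d' -> d = d'.
Proof. by move=> /isd_derive1 <- /isd_derive1 <-. Qed.

Lemma isd_near f g t d :
  (exists2 e : R, 0 < e & forall h, `|h| < e -> f (t + h) = g (t + h)) ->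
  isd f t d -> isd g t d.
Proof.
by move=> fg /isdP fd; apply/isdP; apply: near_eq_is_derive fd; exact/near0P.
Qed.

Lemma isd_ext f g t d : f =1 g -> isd f t d -> isd g t d.
Proof. by move=> /funext ->. Qed.

Lemma isd_cst (c t : R) : isd (fun=> c) t 0.
Proof. by apply/isdP; exact: is_derive_cst. Qed.

Lemma isd_id t : isd id t 1.
Proof. by apply/isdP; exact: is_derive_id. Qed.

Lemma isdD f g t d d' : isd f t d -> isd g t d' -> isd (fun s => f s + g s) t (d + d').
Proof. by move=> /isdP ? /isdP ?; apply/isdP; exact: is_deriveD. Qed.

Lemma isdM f g t d d' : isd f t d -> isd g t d' ->
  isd (fun s => f s * g s) t (d * g t + f t * d').
Proof.
move=> /isdP fd /isdP gd; apply/isdP.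
have := @is_deriveM _ _ f g t 1 d d' fd gd.
by rewrite addrC [_ *: d]mulrC.
Qed.

Lemma isdZ (c : R) f t d : isd f t d -> isd (fun s => c * f s) t (c * d).
Proof. by move=> fd; have := isdM (isd_cst c t) fd; rewrite mul0r add0r. Qed.

Lemma isdN f t d : isd f t d -> isd (fun s => - f s) t (- d).
Proof.
move=> /(isdZ (-1)); rewrite mulN1r; apply: isd_ext => s; by rewrite mulN1r.
Qed.

Lemma isdB f g t d d' : isd f t d -> isd g t d' -> isd (fun s => f s - g s) t (d - d').
Proof. by move=> fd /isdN; exact: isdD. Qed.

Lemma isd_sum (J : finType) (P : pred J) (f : J -> R -> R) t (d : J -> R) :
  (forall j, P j -> isd (f j) t (d j)) ->
  isd (fun s => \sum_(j | P j) f j s) t (\sum_(j | P j) d j).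
Proof.
move=> fd; rewrite (_ : (fun s => _) = \sum_(j | P j) f j); last first.
  by apply/funext => s; rewrite fct_sumE.
apply: (big_ind2 (fun (g : R -> R) e => isd g t e)) => //; first exact: isd_cst.
by move=> ? ? ? ?; exact: isdD.
Qed.

Lemma isdX (m : nat) t : isd (fun s => s ^+ m) t (m%:R * t ^+ m.-1).
Proof.
elim: m => [|m IH]; first by rewrite mul0r; exact: isd_cst.
rewrite (_ : (fun s => _) = fun s => s * s ^+ m); last first.
  by apply/funext => s; rewrite exprS.
rewrite (_ : _ * _ = 1 * t ^+ m + t * (m%:R * t ^+ m.-1)); last first.
  case: m {IH} => [|m] /=; rewrite ?exprS; ring.
exact: isdM (isd_id t) IH.
Qed.

Lemma isd_lin (a b t : R) : isd (fun s => a + s * b) t b.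
Proof.
have := isdD (isd_cst a t) (isdM (isd_id t) (isd_cst b t)).
by rewrite add0r mul1r mulr0 addr0.
Qed.

Lemma isd_comp_lin f (a b t d : R) : isd f (a + t * b) d ->
  isd (fun s => f (a + s * b)) t (d * b).
Proof.
move=> fd e e0; have b1 : 0 < `|b| + 1 by rewrite ltr_wpDl.
have [r r0 fr] := fd (e / (`|b| + 1)) (divr_gt0 e0 b1).
exists (r / (`|b| + 1)); first exact: divr_gt0.
move=> h hr; have hb : `|h * b| <= `|h| * (`|b| + 1).
  by rewrite normrM ler_wpM2l // lerDl.
rewrite mulrDl addrA -mulrA [b * h]mulrC.
apply: (le_trans (fr (h * b) _)).
  by rewrite (le_lt_trans hb) // -ltr_pdivlMr.
rewrite mulrAC ler_pdivrMr // -mulrA ler_wpM2l // ltW //.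
Qed.

Lemma isd_lipschitz f t d : isd f t d -> exists K r : R,
  [/\ 0 <= K, 0 < r & forall h, `|h| < r -> `|f (t + h) - f t| <= K * `|h|].
Proof.
move=> fd; have [r r0 fr] := fd 1 ltr01; exists (1 + `|d|), r; split=> //.
move=> h /fr; rewrite mul1r => H.
rewrite mulrDl mul1r -normrM -(subrK (d * h) (f _ - f _)).
by rewrite (le_trans (ler_normD _ _)) // lerD2r.
Qed.

Lemma isd_continuous f t d : isd f t d -> {for t, continuous f}.
Proof.
by move=> /isd_derivable /derivable1_diffP; exact: differentiable_continuous.
Qed.

(** The mean value theorem wants ordered end points, hence the cases by the sign of [h]; the
    hypotheses are put on [|t| <= |h|] so that callers need not know that sign. *)
Lemma mvt0 f (df : R -> R) (h B : R) :
  (forall t, `|t| <= `|h| -> isd f t (df t)) ->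
  (forall t, `|t| <= `|h| -> `|df t| <= B) -> `|f h - f 0| <= B * `|h|.
Proof.
move=> fd fB.
have [h0|h0|->] := ltgtP h 0; last by rewrite subrr normr0 mulr0.
- have bd t : t \in `]h, 0[%R -> `|t| <= `|h|.
    by rewrite in_itv /= => /andP[? ?]; rewrite !ltr0_norm //; lra.
  have [||c hc E] := @MVT R f df h 0 h0.
  + by move=> t /bd /fd /isdP.
  + apply: continuous_in_subspaceT => t; rewrite inE /= in_itv /= => /andP[? ?].
    by apply: (@isd_continuous _ _ (df t)); apply: fd; rewrite !ler0_norm //; lra.
  by rewrite distrC E sub0r normrM normrN ler_wpM2r // fB // bd.
- have bd t : t \in `]0, h[%R -> `|t| <= `|h|.
    by rewrite in_itv /= => /andP[? ?]; rewrite !gtr0_norm //; lra.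
  have [||c hc E] := @MVT R f df 0 h h0.
  + by move=> t /bd /fd /isdP.
  + apply: continuous_in_subspaceT => t; rewrite inE /= in_itv /= => /andP[? ?].
    by apply: (@isd_continuous _ _ (df t)); apply: fd; rewrite !ger0_norm //; lra.
  by rewrite E subr0 normrM ler_wpM2r // fB // bd.
Qed.

End RealDerivative.

(** * The sup norm on row vectors *)

Section RowNorm.
Context {R : realType} {N : nat}.
Implicit Types (y : 'rV[R]_N) (e : R).

Lemma coord_le_norm y a : `|y 0 a| <= `|y|.
Proof.
rewrite [leRHS]/Num.norm /= mx_normrE.
exact: (le_bigmax _ (fun ij : 'I_1 * 'I_N => `|y ij.1 ij.2|) (0, a)).
Qed.

Lemma norm_rV_le y e : 0 <= e -> (forall a, `|y 0 a| <= e) -> `|y| <= e.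
Proof.
move=> e0 ye; rewrite [leLHS]/Num.norm /= mx_normrE.
by apply/bigmax_leP; split=> // -[i a] _ /=; rewrite ord1.
Qed.

Lemma norm_rV_lt y e : 0 < e -> (forall a, `|y 0 a| < e) -> `|y| < e.
Proof.
move=> e0 ye; rewrite [ltLHS]/Num.norm /= mx_normrE.
by apply/bigmax_ltP; split=> // -[i a] _ /=; rewrite ord1.
Qed.

Lemma norm_delta_rV a : `|delta_mx 0 a : 'rV[R]_N| <= 1.
Proof.
apply: norm_rV_le => // b; rewrite mxE eqxx /=.
by case: eqP; rewrite ?normr1 ?normr0.
Qed.

End RowNorm.

(** * Geometric domination and Cauchy products of series *)

Section GeometricSeries.
Context {R : realType}.
Implicit Types (u : nat -> R) (C q : R).

Lemma geometric_sum_le q n : 0 <= q <= 2^-1 -> \sum_(i < n) q ^+ i <= 2.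
Proof.
move=> /andP[q0 q1].
(* The stronger bound makes the induction close: its step only needs [2 * q ^+ n.+1 <= q ^+ n]. *)
suff : \sum_(i < n) q ^+ i <= 2 - 2 * q ^+ n.
  by move/le_trans; apply; rewrite gerBl mulr_ge0 // exprn_ge0.
elim: n => [|n IH]; first by rewrite big_ord0 expr0; lra.
rewrite big_ord_recr /= (le_trans (lerD IH (lexx _))) //.
rewrite exprS; have := exprn_ge0 n q0; nra.
Qed.

Lemma series_geo_le u C q n : 0 <= C -> 0 <= q <= 2^-1 ->
  (forall m, `|u m| <= C * q ^+ m) -> `|series u n| <= 2 * C.
Proof.
move=> C0 q01 uC; rewrite /series /= big_mkord.
apply: (le_trans (ler_norm_sum _ _ _)).
apply: (@le_trans _ _ (\sum_(i < n) C * q ^+ i)); first exact: ler_sum.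
by rewrite -mulr_sumr mulrC ler_wpM2r // geometric_sum_le.
Qed.

Lemma cvg_series_geo u C q : 0 <= C -> 0 <= q <= 2^-1 ->
  (forall m, `|u m| <= C * q ^+ m) -> cvgn (series u).
Proof.
move=> C0 /andP[q0 q1] uC; apply: normed_cvg.
apply: (@series_le_cvg _ _ (geometric C q)).
- by move=> n /=.
- by move=> n /=; rewrite /geometric /= mulr_ge0 // exprn_ge0.
- by move=> n /=; exact: uC.
by apply: is_cvg_geometric_series; rewrite ger0_norm //; lra.
Qed.

Lemma lim_norm_le (v : nat -> R) (l B : R) :
  v @ \oo --> l -> (forall n, `|v n| <= B) -> `|l| <= B.
Proof.
move=> vl vB; have nvl : (fun n => `|v n|) @ \oo --> `|l| by exact: cvg_norm.
rewrite -(cvg_lim _ nvl) //; apply: limr_le; first by apply/cvg_ex; exists `|l|.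
exact: nearW.
Qed.

Lemma cvg_unique_R (v : nat -> R) (l l' : R) :
  v @ \oo --> l -> v @ \oo --> l' -> l = l'.
Proof. by move=> vl vl'; rewrite -(cvg_lim _ vl) // -(cvg_lim _ vl'). Qed.

Lemma natr_le_exp2 n : n%:R <= (2 : R) ^+ n.
Proof. by rewrite -natrX ler_nat ltnW // ltn_expl. Qed.

(** The partial sum of the convolution differs from the product of the partial sums by [n] terms,
    each a coefficient of [u] times a tail of [v], hence of order [q ^ n]. With [q <= 1/4] the
    factor [n <= 2 ^ n] is absorbed and [(1/2) ^ n] remains. *)
Lemma cauchy_product u v C D q (U V : R) : 0 <= C -> 0 <= D ->
  0 <= q <= 4^-1 ->
  (forall m, `|u m| <= C * q ^+ m) -> (forall m, `|v m| <= D * q ^+ m) ->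
  series u @ \oo --> U -> series v @ \oo --> V ->
  series (fun m => \sum_(i < m.+1) u i * v (m - i)%N) @ \oo --> U * V.
Proof.
move=> C0 D0 /andP[q0 q1] uC vD uU vV.
have q01 : 0 <= q <= 2^-1 by rewrite q0 /=; lra.
have H n : series (fun m => \sum_(i < m.+1) u i * v (m - i)%N) n =
    series u n * series v n - \sum_(i < n) u i * (series v n - series v (n - i)%N).
  transitivity (\sum_(i < n) u i * series v (n - i)%N); last first.
    rewrite [series u n]/series /= big_mkord mulr_suml -sumrB.
    by apply: eq_bigr => i _; rewrite mulrBr opprB addrC subrK.
  elim: n => [|n IH]; first by rewrite /series /= big_geq // big_ord0.
  rewrite seriesSr IH big_ord_recr [in RHS]big_ord_recr /= subnn subSnn.
  rewrite addrA -big_split /=; congr (_ + _); last first.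
    by rewrite /series /= big_nat1.
  by apply: eq_bigr => i _; rewrite subSn 1?ltnW // seriesSr mulrDr.
have tail n i : (i < n)%N -> `|series v n - series v (n - i)%N| <= 2 * D * q ^+ (n - i)%N.
  move=> lin; rewrite sub_series_geq ?leq_subr //.
  rewrite -{2}[n](subnK (ltnW lin)) addnC -{1}[(n - i)%N]add0n big_addn addnK.
  rewrite big_mkord.
  apply: (le_trans (ler_norm_sum _ _ _)).
  apply: (@le_trans _ _ (\sum_(j < i) D * q ^+ (n - i)%N * q ^+ j)).
    by apply: ler_sum => j _; rewrite -mulrA -exprD addnC.
  by rewrite -mulr_sumr mulrC -!mulrA ler_wpM2r ?geometric_sum_le // mulr_ge0 // exprn_ge0.
rewrite (_ : U * V = U * V - 0); last by rewrite subr0.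
rewrite (_ : series _ = fun n => series u n * series v n -
   \sum_(i < n) u i * (series v n - series v (n - i)%N)); last exact/funext.
apply: cvgB; first exact: cvgM.
apply/cvgrPdist_le => e e0.
have [n0 _ Hn0] : \forall n \near \oo, `|geometric (2 * C * D) (2^-1) n| <= e.
  have := @cvg_geometric _ (2 * C * D) (2^-1 : R) => /(_ _) /cvgrPdist_le.
  rewrite ger0_norm => [/(_ _ _ e0)|]; last by lra.
  move=> /(_ ltac:(lra)) [n0 _ H0]; exists n0 => // n /H0.
  by rewrite sub0r normrN.
exists n0 => // n /Hn0 /=; rewrite sub0r normrN; apply: le_trans.
apply: (le_trans (ler_norm_sum _ _ _)).
apply: (@le_trans _ _ (\sum_(i < n) 2 * C * D * q ^+ n)).
  apply: ler_sum => i _; rewrite normrM.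
  apply: (le_trans (ler_pM (normr_ge0 _) (normr_ge0 _) (uC i) (tail _ _ (ltn_ord i)))).
  have -> : C * q ^+ i * (2 * D * q ^+ (n - i)) = 2 * C * D * (q ^+ i * q ^+ (n - i)) by ring.
  by rewrite -exprD subnKC // ltnW.
rewrite sumr_const card_ord -[_ *+ n]mulr_natr /geometric /= ger0_norm; last first.
  by rewrite !mulr_ge0 // exprn_ge0.
rewrite -mulrA ler_wpM2l ?mulr_ge0 //.
apply: (@le_trans _ _ ((4^-1) ^+ n * 2 ^+ n)).
  by rewrite ler_pM ?exprn_ge0 // ?natr_le_exp2 // lerXn2r ?nnegrE.
by rewrite -exprMn (_ : 4^-1 * 2 = 2^-1 :> R) //; field.
Qed.

End GeometricSeries.

(** * Analytic germs *)

Section HomogeneousPolynomials.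
Context {R : realType} {N : nat}.
Implicit Types (P Q : 'rV[R]_N -> R) (y w : 'rV[R]_N) (B rho : R).

(* homogeneous polynomial functions of degree m whose coefficients have
   absolute values summing to at most B *)
Inductive hpoly : nat -> R -> ('rV[R]_N -> R) -> Prop :=
| hp_cst c B P : `|c| <= B -> (forall y, P y = c) -> hpoly 0 B P
| hp_var m B P Q a : hpoly m B P -> (forall y, Q y = y 0 a * P y) ->
    hpoly m.+1 B Q
| hp_add m B1 B2 B P1 P2 Q : hpoly m B1 P1 -> hpoly m B2 P2 -> B1 + B2 <= B ->
    (forall y, Q y = P1 y + P2 y) -> hpoly m B Q
| hp_zero m B Q : 0 <= B -> (forall y, Q y = 0) -> hpoly m B Q.

Lemma hp_ge0 m B P : hpoly m B P -> 0 <= B.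
Proof.
elim=> {m B P} // [c B P cB _|m B1 B2 B P1 P2 Q _ B10 _ B20 H _].
  exact: le_trans cB.
exact: le_trans (addr_ge0 B10 B20) H.
Qed.

Lemma hp_weak m B B' P : hpoly m B P -> B <= B' -> hpoly m B' P.
Proof.
move=> hP BB'; apply: (hp_add hP (@hp_zero m 0 (fun=> 0) _ _)) => //.
- by rewrite addr0.
- by move=> y; rewrite addr0.
Qed.

Lemma hp_ext m B P Q : hpoly m B P -> (forall y, Q y = P y) -> hpoly m B Q.
Proof.
move=> hP QP; apply: (hp_add hP (@hp_zero m 0 (fun=> 0) _ _)) => //.
- by rewrite addr0.
- by move=> y; rewrite addr0.
Qed.

Lemma hp_bound m B P rho y : hpoly m B P -> `|y| <= rho -> `|P y| <= B * rho ^+ m.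
Proof.
move=> hP yr; have r0 : 0 <= rho by exact: le_trans yr.
elim: hP => {m B P} [c B P cB ->|m B P Q a hP IH ->|m B1 B2 B P1 P2 Q h1 IH1 h2 IH2 HB ->|m B Q B0 ->].
- by rewrite expr0 mulr1.
- rewrite normrM exprS mulrCA ler_pM //.
  exact: le_trans (coord_le_norm _ _) yr.
- rewrite (le_trans (ler_normD _ _)) // (le_trans (lerD IH1 IH2)) //.
  by rewrite -mulrDl ler_wpM2r // exprn_ge0.
- by rewrite normr0 mulr_ge0 // exprn_ge0.
Qed.

Lemma hp_scale m B P k : hpoly m B P -> hpoly m (`|k| * B) (fun y => k * P y).
Proof.
elim=> {m B P} [c B P cB Pc|m B P Q a hP IH Qe|m B1 B2 B P1 P2 Q h1 IH1 h2 IH2 HB Qe|m B Q B0 Qe].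
- apply: (@hp_cst (k * c)); first by rewrite normrM ler_wpM2l.
  by move=> y; rewrite Pc.
- by apply: (hp_var (a := a) IH) => y; rewrite Qe mulrCA.
- apply: (hp_add IH1 IH2); first by rewrite -mulrDr ler_wpM2l.
  by move=> y; rewrite Qe mulrDr.
- by apply: hp_zero => [|y]; rewrite ?mulr_ge0 // Qe mulr0.
Qed.

Lemma hp_mul m B P n B' Q : hpoly m B P -> hpoly n B' Q ->
  hpoly (m + n) (B * B') (fun y => P y * Q y).
Proof.
move=> hP hQ; have B'0 := hp_ge0 hQ.
elim: hP => {m B P} [c B P cB Pc|m B P Q' a hP IH Qe|m B1 B2 B P1 P2 Q' h1 IH1 h2 IH2 HB Qe|m B Q' B0 Qe].
- have /(@hp_weak _ _ (B * B')) := hp_scale c hQ; rewrite ler_wpM2r // => /(_ erefl).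
  by rewrite add0n => /hp_ext; apply => y; rewrite Pc.
- by rewrite addSn; apply: (hp_var (a := a) IH) => y; rewrite Qe mulrA.
- apply: (hp_add IH1 IH2); first by rewrite -mulrDl ler_wpM2r.
  by move=> y; rewrite Qe mulrDl.
- by apply: hp_zero => [|y]; rewrite ?mulr_ge0 // Qe mul0r.
Qed.

Lemma hp_sum m n (B : 'I_n -> R) (P : 'I_n -> 'rV[R]_N -> R) :
  (forall i, hpoly m (B i) (P i)) ->
  hpoly m (\sum_(i < n) B i) (fun y => \sum_(i < n) P i y).
Proof.
elim: n B P => [|n IH] B P hP.
  by apply: hp_zero => [|y]; rewrite big_ord0.
apply: (hp_add (IH _ _ (fun i => hP (widen_ord (leqnSn n) i))) (hP ord_max)).
  by rewrite big_ord_recr.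
by move=> y; rewrite big_ord_recr.
Qed.

Lemma hp_grad m B P : hpoly m B P -> exists d : 'I_N -> 'rV[R]_N -> R,
  (forall a, hpoly m.-1 (m%:R * B) (d a)) /\
  forall rho y w, `|y| <= rho -> `|y + w| <= rho ->
    rho * `|P (y + w) - P y| <= m%:R * B * rho ^+ m * `|w| /\
    rho ^+ 2 * `|P (y + w) - P y - \sum_a d a y * w 0 a|
      <= m%:R ^+ 2 * B * rho ^+ m * `|w| ^+ 2.
Proof.
elim=> {m B P} [c B P cB Pc|m B P Q a hP [d [hd IH]] Qe|m B1 B2 B P1 P2 Q h1 [d1 [hd1 IH1]] h2 [d2 [hd2 IH2]] HB Qe|m B Q B0 Qe].
- exists (fun _ _ => 0); split=> [a|rho y w _ _].
    by rewrite mul0r; apply: hp_zero.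
  rewrite big1 => [|? _]; last by rewrite mul0r.
  by rewrite !Pc subrr subr0 normr0 expr0n /= !(mul0r, mulr0).
- have B0 := hp_ge0 hP.
  exists (fun b y => (b == a)%:R * P y + y 0 a * d b y); split=> [b|rho y w yr ywr].
    (* In degree 0 the gradient of [P] is bounded by [0 * B], hence zero, and only the new variable
       contributes. *)
    case: m {IH} hP hd => [|m] hP hd /=.
      have hd0 := hd b; rewrite mul0r /= in hd0.
      have d0 y : d b y = 0.
        apply/eqP; rewrite -normr_le0 (le_trans (hp_bound hd0 (lexx _))) // mul0r.
      apply: (@hp_weak _ (`|(b == a)%:R| * B)); last first.
        by rewrite ler_wpM2r // normr_nat; case: eqP.
      apply: (hp_ext (hp_scale (b == a)%:R hP)) => y.
      by rewrite d0 mulr0 addr0.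
    apply: (hp_add (hp_scale (b == a)%:R hP) (hp_var (a := a) (hd b) (fun=> erefl))) => //.
    rewrite [m.+2%:R](natrD _ 1 m.+1) mulrDl lerD2r ler_wpM2r // normr_nat.
    by case: eqP.
  have [L1 L2] := IH rho y w yr ywr; have r0 : 0 <= rho by exact: le_trans yr.
  have wa := coord_le_norm w a; have ya := le_trans (coord_le_norm y a) yr.
  have ywa := le_trans (coord_le_norm (y + w) a) ywr.
  have Py := hp_bound hP yr.
  have m0 : (0 : R) <= m%:R by [].
  have X0 : 0 <= B * rho ^+ m by rewrite mulr_ge0 // exprn_ge0.
  split.
    have -> : Q (y + w) - Q y = (y + w) 0 a * (P (y + w) - P y) + w 0 a * P y.
      by rewrite !Qe !mxE; ring.
    rewrite (le_trans (ler_wpM2l r0 (ler_normD _ _))) // mulrDr !normrM.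
    apply: (@le_trans _ _ (rho * (m%:R * B * rho ^+ m * `|w|) + rho * (`|w| * (B * rho ^+ m)))).
      apply: lerD.
        rewrite mulrCA; apply: ler_pM => //.
        by rewrite mulr_ge0.
      by apply: ler_wpM2l => //; apply: ler_pM.
    by rewrite exprS -[m.+1]addn1 natrD le_eqVlt; apply/orP; left; apply/eqP; ring.
  have E : \sum_b ((b == a)%:R * P y + y 0 a * d b y) * w 0 b =
      w 0 a * P y + y 0 a * \sum_b d b y * w 0 b.
    under eq_bigr do rewrite mulrDl -!mulrA.
    rewrite big_split /= -mulr_sumr; congr (_ + _).
    rewrite (bigD1 a) //= eqxx mul1r big1 ?addr0; first by rewrite mulrC.
    by move=> b /negPf ->; rewrite mul0r.
  rewrite {}E !Qe.
  set S := \sum_b _ in L2 *.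
  have -> : (y + w) 0 a * P (y + w) - y 0 a * P y - (w 0 a * P y + y 0 a * S) =
     w 0 a * (P (y + w) - P y) + y 0 a * (P (y + w) - P y - S).
    by rewrite !mxE; ring.
  rewrite (le_trans (ler_wpM2l (exprn_ge0 2 r0) (ler_normD _ _))) // mulrDr !normrM.
  apply: (@le_trans _ _ (rho * (`|w| * (m%:R * B * rho ^+ m * `|w|)) +
      rho * (m%:R ^+ 2 * B * rho ^+ m * `|w| ^+ 2))).
    apply: lerD.
      rewrite expr2 -mulrA ler_wpM2l // mulrCA ler_pM // mulr_ge0 //.
    by rewrite mulrCA ler_pM // mulr_ge0 // exprn_ge0.
  have -> : rho * (`|w| * (m%:R * B * rho ^+ m * `|w|)) + rho * (m%:R ^+ 2 * B * rho ^+ m * `|w| ^+ 2)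
     = (m%:R + m%:R ^+ 2) * (rho * (B * rho ^+ m) * `|w| ^+ 2) by ring.
  have -> : m.+1%:R ^+ 2 * B * rho ^+ m.+1 * `|w| ^+ 2 =
     m.+1%:R ^+ 2 * (rho * (B * rho ^+ m) * `|w| ^+ 2) :> R by rewrite [rho ^+ m.+1]exprS; ring.
  apply: ler_wpM2r; first by rewrite !mulr_ge0 // exprn_ge0.
  by rewrite -[m.+1]addn1 natrD; nra.
- exists (fun a y => d1 a y + d2 a y); split=> [a|rho y w yr ywr].
    apply: (hp_add (hd1 a) (hd2 a)) => //; by rewrite -mulrDr ler_wpM2l.
  have [L1 L2] := IH1 rho y w yr ywr; have [M1 M2] := IH2 rho y w yr ywr.
  have r0 : 0 <= rho by exact: le_trans yr.
  have X0 : 0 <= rho ^+ m by rewrite exprn_ge0.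
  split.
    have -> : Q (y + w) - Q y = (P1 (y + w) - P1 y) + (P2 (y + w) - P2 y) by rewrite !Qe; ring.
    rewrite (le_trans (ler_wpM2l r0 (ler_normD _ _))) // mulrDr (le_trans (lerD L1 M1)) //.
    by rewrite -!mulrDl -mulrDr !ler_wpM2r // ler_wpM2l.
  under eq_bigr do rewrite mulrDl.
  rewrite big_split /=.
  set S1 := \sum_a _ in L2 *; set S2 := \sum_a _ in M2 *.
  have -> : Q (y + w) - Q y - (S1 + S2) = (P1 (y + w) - P1 y - S1) + (P2 (y + w) - P2 y - S2).
    by rewrite !Qe; ring.
  rewrite (le_trans (ler_wpM2l (exprn_ge0 2 r0) (ler_normD _ _))) // mulrDr (le_trans (lerD L2 M2)) //.
  by rewrite -!mulrDl -mulrDr !ler_wpM2r ?exprn_ge0 // ler_wpM2l // exprn_ge0.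
- exists (fun _ _ => 0); split=> [a|rho y w yr _].
    by apply: hp_zero; rewrite ?mulr_ge0.
  have r0 : 0 <= rho by exact: le_trans yr.
  rewrite big1 => [|? _]; last by rewrite mul0r.
  rewrite !Qe subrr subr0 normr0 !mulr0; split; rewrite !mulr_ge0 // exprn_ge0 //.
Qed.

End HomogeneousPolynomials.

(** * Partial derivatives and the chain rule along curves *)

HB.lock Definition pd {R : realType} {N : nat} (a : 'I_N) (f : 'rV[R]_N -> R) :
    'rV[R]_N -> R :=
  fun x => derive1 (fun t => f (x + t *: delta_mx 0 a)) 0.
Canonical pd_unlockable := Unlockable pd.unlock.

Lemma pdE {R : realType} {N : nat} (a : 'I_N) (f : 'rV[R]_N -> R) x :
  pd a f x = derive1 (fun t => f (x + t *: delta_mx 0 a)) 0.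
Proof. by rewrite unlock. Qed.

Lemma isd_pd {R : realType} {N : nat} (a : 'I_N) (f : 'rV[R]_N -> R) x d :
  isd (fun t => f (x + t *: delta_mx 0 a)) 0 d -> pd a f x = d.
Proof. by rewrite pdE; exact: isd_derive1. Qed.

Section ChainRule.
Context {R : realType}.

Lemma finite_radius (J : finType) (P : J -> R -> Prop) :
  (forall a, exists2 r : R, 0 < r & forall h, `|h| < r -> P a h) ->
  exists2 r : R, 0 < r & forall h, `|h| < r -> forall a, P a h.
Proof.
move=> HP; have /choice[r Hr] a : exists r : R, 0 < r /\ forall h, `|h| < r -> P a h.
  by have [r r0 Hr] := HP a; exists r.
(* The neutral value [1] keeps the radius positive when [J] is empty. *)
exists (\big[Num.min/1]_a r a).
  by elim/big_ind: _ => // [x y x0 y0|a _]; [rewrite lt_min x0|case: (Hr a)].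
move=> h hr a; have [_] := Hr a; apply; apply: lt_le_trans hr _.
exact: bigmin_le.
Qed.

Lemma isd_quad (f g : R -> R) (t d K r : R) : 0 < r ->
  (forall h, `|h| < r -> `|f (t + h) - f t - (g (t + h) - g t)| <= K * `|h| ^+ 2) ->
  isd g t d -> isd f t d.
Proof.
move=> r0 fg gd e e0; have [r1 r10 gr] := gd (e / 2) (divr_gt0 e0 (ltr0Sn _ 1)).
pose K' := `|K| + 1; have K'0 : 0 < K' by rewrite ltr_wpDl.
exists (Num.min (Num.min r r1) (e / 2 / K')).
  by rewrite !lt_min r0 r10 !divr_gt0.
move=> h; rewrite !lt_min => /andP[/andP[hr hr1] hK].
have -> : f (t + h) - f t - d * h =
  (f (t + h) - f t - (g (t + h) - g t)) + (g (t + h) - g t - d * h) by ring.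
rewrite (le_trans (ler_normD _ _)) // (le_trans (lerD (fg _ hr) (gr _ hr1))) //.
rewrite [leRHS](_ : _ = e / 2 * `|h| + e / 2 * `|h|); last by field.
rewrite lerD2r expr2 mulrA ler_wpM2r //.
apply: (@le_trans _ _ (K' * `|h|)).
  by rewrite ler_wpM2r // /K' (le_trans (ler_norm _)) // lerDl.
by rewrite mulrC -ler_pdivlMr // ltW.
Qed.

Lemma curve_lipschitz N (c : R -> 'rV[R]_N) (c' : 'I_N -> R) t :
  (forall a, isd (fun s => c s 0 a) t (c' a)) ->
  exists K r : R, [/\ 0 <= K, 0 < r &
    forall h, `|h| < r -> `|c (t + h) - c t| <= K * `|h|].
Proof.
move=> cd; have /choice[K HK] := fun a => isd_lipschitz (cd a).
have [r r0 Hr] : exists2 r : R, 0 < r & forall h, `|h| < r ->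
    forall a, `|c (t + h) 0 a - c t 0 a| <= K a * `|h|.
  apply: finite_radius => a; have [r [_ r0 Hr]] := HK a; by exists r.
have K0 a : 0 <= K a by case: (HK a) => ? [].
exists (\sum_a K a), r; split=> //; first exact: sumr_ge0.
move=> h hr; apply: norm_rV_le => [|a]; first by rewrite mulr_ge0 ?sumr_ge0.
rewrite !mxE (le_trans (Hr _ hr a)) // ler_wpM2r // (bigD1 a) //= lerDl.
exact: sumr_ge0.
Qed.

(** A curve with differentiable coordinates is Lipschitz at [t], so the remainder of [f] is
    quadratic in the parameter and [f] may be replaced by its linear part. *)
Lemma isd_chain_quad N (f : 'rV[R]_N -> R) (c : R -> 'rV[R]_N) (c' d : 'I_N -> R)
    (K rho t : R) : 0 < rho ->
  (forall u, `|u| <= rho ->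
     `|f (c t + u) - f (c t) - \sum_a d a * u 0 a| <= K * `|u| ^+ 2) ->
  (forall a, isd (fun s => c s 0 a) t (c' a)) ->
  isd (fun s => f (c s)) t (\sum_a d a * c' a).
Proof.
move=> rho0 fq cd; have [L [r [L0 r0 Lr]]] := curve_lipschitz cd.
have gd : isd (fun s => \sum_a d a * c s 0 a) t (\sum_a d a * c' a).
  by apply: isd_sum => a _; exact: isdZ.
apply: (@isd_quad _ _ _ _ (`|K| * L ^+ 2) (Num.min r (rho / (L + 1))) _ _ gd).
  by rewrite lt_min r0 divr_gt0 // ltr_wpDl.
move=> h; rewrite lt_min => /andP[hr hL].
have ch := Lr _ hr.
have hrho : `|c (t + h) - c t| <= rho.
  rewrite (le_trans ch) // (@le_trans _ _ ((L + 1) * `|h|)) //.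
    by rewrite ler_wpM2r // lerDl.
  by rewrite mulrC -ler_pdivlMr ?ltr_wpDl // ltW.
have := fq _ hrho; rewrite subrKC -sumrB.
under eq_bigr do rewrite !mxE mulrBr.
move/le_trans; apply.
apply: (@le_trans _ _ (`|K| * `|c (t + h) - c t| ^+ 2)).
  by rewrite ler_wpM2r ?exprn_ge0 // ler_norm.
by rewrite -mulrA -exprMn ler_wpM2l // lerXn2r ?nnegrE ?mulr_ge0.
Qed.

Lemma isd_line N (x w : 'rV[R]_N) (t : R) a :
  isd (fun s => (x + s *: w) 0 a) t (w 0 a).
Proof.
apply: (@isd_ext _ (fun s => x 0 a + s * w 0 a)) => [s|]; last exact: isd_lin.
by rewrite !mxE.
Qed.

End ChainRule.

Section AnalyticGerms.
Context {R : realType} {N : nat}.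
Implicit Types (P Q : nat -> 'rV[R]_N -> R) (f g : 'rV[R]_N -> R)
  (x y w : 'rV[R]_N) (C s rho : R).

(** The normalisation [s * rho <= 1/8] leaves room for the losses to come: a Taylor remainder costs
    a factor [m ^ 2 <= 4 ^ m], after which the ratio of the dominating geometric series is still at
    most [1/2]. *)
Definition expands x f C s rho P : Prop :=
  [/\ [/\ 0 <= C, 0 < s, 0 < rho & s * rho <= 8^-1],
      forall m, hpoly m (C * s ^+ m) (P m) &
      forall y, `|y| <= rho -> series (fun m => P m y) @ \oo --> f (x + y)].

Definition an x f : Prop := exists C s rho P, expands x f C s rho P.

Lemma expands_weak x f C s rho P C' s' rho' : expands x f C s rho P ->
  C <= C' -> s <= s' -> 0 < rho' -> rho' <= rho -> s' * rho' <= 8^-1 ->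
  expands x f C' s' rho' P.
Proof.
move=> [[C0 s0 r0 sr] hP fP] CC ss r'0 rr sr'; split.
- by split=> //; [exact: le_trans CC|exact: lt_le_trans ss].
- move=> m; apply: (hp_weak (hP m)).
  have s'0 : 0 < s' by exact: lt_le_trans ss.
  by apply: ler_pM; rewrite ?exprn_ge0 ?(ltW s0) // lerXn2r ?nnegrE ?(ltW s0) ?(ltW s'0).
- by move=> y yr; apply: fP; exact: le_trans rr.
Qed.

Lemma expands_common x f g C s rho P D s' rho' Q :
  expands x f C s rho P -> expands x g D s' rho' Q ->
  exists t sigma, expands x f C t sigma P /\ expands x g D t sigma Q.
Proof.
move=> fP gQ; case: (fP) => -[C0 s0 r0 sr] _ _; case: (gQ) => -[D0 s'0 r'0 sr'] _ _.
have t0 : 0 < s + s' by rewrite addr_gt0.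
exists (s + s'), (Num.min (Num.min rho rho') (8^-1 / (s + s'))).
have sg : 0 < Num.min (Num.min rho rho') (8^-1 / (s + s')).
  by rewrite !lt_min r0 r'0 divr_gt0.
have H : (s + s') * Num.min (Num.min rho rho') (8^-1 / (s + s')) <= 8^-1.
  by rewrite mulrC -ler_pdivlMr // ge_min lexx orbT.
split.
- apply: (expands_weak fP) => //; first by rewrite lerDl ltW.
  by rewrite !ge_min lexx.
- apply: (expands_weak gQ) => //; first by rewrite lerDr ltW.
  by rewrite !ge_min lexx orbT.
Qed.

Lemma an_common x f g : an x f -> an x g -> exists C s rho P Q,
  expands x f C s rho P /\ expands x g C s rho Q.
Proof.
move=> [C [s [rho [P fP]]]] [D [s' [rho' [Q gQ]]]].
have [t [sigma [fP' gQ']]] := expands_common fP gQ.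
case: (fP') => -[C0 t0 sg0 ts] _ _; case: (gQ') => -[D0 _ _ _] _ _.
exists (C + D), t, sigma, P, Q; split.
- by apply: (expands_weak fP') => //; rewrite lerDl.
- by apply: (expands_weak gQ') => //; rewrite lerDr.
Qed.

Lemma an_ext x f g : an x f ->
  (exists2 e : R, 0 < e & forall y, `|y| < e -> f (x + y) = g (x + y)) -> an x g.
Proof.
move=> [C [s [rho [P fP]]]] [e e0 fg]; case: (fP) => -[C0 s0 r0 sr] hP cP.
exists C, s, (Num.min rho (e / 2)), P; split=> //.
  split=> //; first by rewrite lt_min r0 divr_gt0.
  by rewrite (le_trans _ sr) // ler_wpM2l ?(ltW s0) // ge_min lexx.
move=> y; rewrite le_min => /andP[yr ye]; rewrite -fg; first exact: cP.
by apply: (le_lt_trans ye); lra.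
Qed.

Lemma an_eq x f g : (forall y, f y = g y) -> an x f -> an x g.
Proof. by move=> fg fx; apply: (an_ext fx); exists 1. Qed.

Lemma series_fin (u : nat -> R) n : (forall m, (n <= m)%N -> u m = 0) ->
  series u @ \oo --> series u n.
Proof.
move=> u0; apply: cvg_near_cst; exists n => // m /= nm.
rewrite -(subnKC nm); elim: (m - n)%N => [|k IH]; first by rewrite addn0.
by rewrite addnS seriesSr IH u0 ?addr0 // leq_addr.
Qed.

Lemma an_cst x (c : R) : an x (fun=> c).
Proof.
exists `|c|, 1, 8^-1, (fun m _ => if m == 0%N then c else 0); split.
- by split=> //; rewrite mul1r.
- move=> [|m]; last by apply: hp_zero => //; rewrite expr1n mulr1.
  by apply: (@hp_cst _ _ c) => //; rewrite expr0 mulr1.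
- move=> y _; have := @series_fin (fun m => if m == 0%N then c else 0) 1.
  by rewrite {2}/series /= big_nat1 /=; apply; case.
Qed.

Lemma an_coord x a : an x (fun y => y 0 a).
Proof.
exists (`|x 0 a| + 1), 1, 8^-1,
  (fun m y => if m == 0%N then x 0 a else if m == 1%N then y 0 a else 0); split.
- by split=> //; rewrite ?addr_ge0 // mul1r.
- move=> [|[|m]]; rewrite expr1n mulr1.
  + by apply: (@hp_cst _ _ (x 0 a)) => //; rewrite lerDl.
  + apply: (@hp_var _ _ _ _ (fun=> 1) _ a); last by move=> y; rewrite mulr1.
    by apply: (@hp_cst _ _ 1) => //; rewrite normr1 lerDr.
  + by apply: hp_zero => //; rewrite addr_ge0.
- move=> y _; have := @series_fin (fun m => if m == 0%N then x 0 a else if m == 1%N then y 0 a else 0) 2.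
  rewrite {2}/series /= big_nat_recr //= big_nat1 /= mxE; apply.
  by case=> // -[].
Qed.

Lemma an_add x f g : an x f -> an x g -> an x (fun y => f y + g y).
Proof.
move=> /an_common /[apply] -[C [s [rho [P [Q [[[C0 s0 r0 sr] hP fP] [_ hQ gQ]]]]]]].
exists (C + C), s, rho, (fun m y => P m y + Q m y); split.
- by split=> //; rewrite addr_ge0.
- by move=> m; apply: (hp_add (hP m) (hQ m)) => //; rewrite mulrDl.
- move=> y yr; rewrite (_ : series _ = series (P^~ y) \+ series (Q^~ y)); last first.
    by apply/funext => n; rewrite /series /= big_split.
  by apply: cvgD; [exact: fP|exact: gQ].
Qed.

Lemma an_scale x k f : an x f -> an x (fun y => k * f y).
Proof.
move=> [C [s [rho [P [[C0 s0 r0 sr] hP fP]]]]].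
exists (`|k| * C), s, rho, (fun m y => k * P m y); split.
- by split=> //; rewrite mulr_ge0.
- by move=> m; rewrite -mulrA; exact: hp_scale.
- move=> y yr; rewrite (_ : series _ = fun n => k * series (P^~ y) n); last first.
    by apply/funext => n; rewrite /series /= mulr_sumr.
  by apply: cvgMr; exact: fP.
Qed.

Lemma an_mul x f g : an x f -> an x g -> an x (fun y => f y * g y).
Proof.
move=> /an_common /[apply] -[C [s [rho [P [Q [[[C0 s0 r0 sr] hP fP] [_ hQ gQ]]]]]]].
(* The convolution of degree [m] has [m.+1 <= 2 ^ m] terms, whence the doubled rate; halving [rho]
   keeps [s * rho] unchanged. *)
exists (C * C), (2 * s), (rho / 2),
  (fun m y => \sum_(i < m.+1) P i y * Q (m - i)%N y); split.
- split; rewrite ?mulr_ge0 ?mulr_gt0 ?divr_gt0 //.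
  by rewrite (_ : _ * _ = s * rho) //; field.
- move=> m; have hs i : (i <= m)%N -> hpoly m (C * C * s ^+ m) (fun y => P i y * Q (m - i)%N y).
    move=> im; have := hp_mul (hP i) (hQ (m - i)%N); rewrite subnKC //.
    by rewrite mulrACA -exprD subnKC.
  have := hp_sum (fun i : 'I_m.+1 => hs i (ltn_ord i : (i <= m)%N)).
  move/hp_weak; apply; rewrite sumr_const card_ord -[_ *+ _]mulr_natr.
  rewrite -mulrA ler_wpM2l ?mulr_ge0 // exprMn mulrC ler_wpM2r ?exprn_ge0 ?(ltW s0) //.
  by rewrite -natrX ler_nat ltn_expl.
- move=> y yr; have yr' : `|y| <= rho by rewrite (le_trans yr) // ler_pdivrMr // ler_peMr ?(ltW r0) // ler1n.
  have bnd (S : nat -> 'rV[R]_N -> R) : (forall m, hpoly m (C * s ^+ m) (S m)) ->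
      forall m, `|S m y| <= C * (s * rho) ^+ m.
    by move=> hS m; have := hp_bound (hS m) yr'; rewrite -mulrA -exprMn.
  have q4 : 0 <= s * rho <= 4^-1 by rewrite mulr_ge0 ?(ltW s0) ?(ltW r0) //=; lra.
  exact: (cauchy_product C0 C0 q4 (bnd _ hP) (bnd _ hQ) (fP _ yr') (gQ _ yr')).
Qed.

Lemma an_opp x f : an x f -> an x (fun y => - f y).
Proof. by move=> /(an_scale (-1)); apply: an_eq => y; rewrite mulN1r. Qed.

Lemma an_sub x f g : an x f -> an x g -> an x (fun y => f y - g y).
Proof. by move=> fx /an_opp; exact: an_add. Qed.

Lemma an_sum x (J : finType) (p : pred J) (f : J -> 'rV[R]_N -> R) :
  (forall j, p j -> an x (f j)) -> an x (fun y => \sum_(j | p j) f j y).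
Proof.
move=> fx; rewrite (_ : (fun y => _) = \sum_(j | p j) f j); last first.
  by apply/funext => y; rewrite fct_sumE.
apply: big_ind => //; [exact: an_cst|by move=> ? ?; exact: an_add].
Qed.

Lemma an_prod x (J : finType) (p : pred J) (f : J -> 'rV[R]_N -> R) :
  (forall j, p j -> an x (f j)) -> an x (fun y => \prod_(j | p j) f j y).
Proof.
move=> fx; elim: (index_enum J) => [|j r IH].
  by apply: (an_eq _ (an_cst x 1)) => y; rewrite big_nil.
have [pj|pj] := boolP (p j).
  by apply: (an_eq _ (an_mul (fx j pj) IH)) => y; rewrite big_cons pj.
by apply: (an_eq _ IH) => y; rewrite big_cons (negPf pj).
Qed.

End AnalyticGerms.

(** * Reciprocals and derivatives of analytic germs *)

Section AnalyticCalculus.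
Context {R : realType} {N : nat}.
Implicit Types (P Q : nat -> 'rV[R]_N -> R) (f g : 'rV[R]_N -> R)
  (x y w : 'rV[R]_N) (C s rho : R).

Lemma cvg_sum_fin (J : finType) (u : J -> nat -> R) (l : J -> R) :
  (forall j, u j @ \oo --> l j) ->
  (fun n => \sum_j u j n) @ \oo --> \sum_j l j.
Proof.
move=> ul; rewrite (_ : (fun n => _) = \sum_j u j); last first.
  by apply/funext => n; rewrite fct_sumE.
apply: (big_ind2 (fun (v : nat -> R) e => v @ \oo --> e)) => //; first exact: cvg_cst.
by move=> ? ? ? ? ? ?; exact: cvgD.
Qed.

Lemma expands0 x f C s rho P y : expands x f C s rho P -> P 0%N y = f x.
Proof.
case=> -[C0 s0 r0 sr] hP cP.
have P00 : P 0%N y = P 0%N 0.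
  have [d [_ H]] := hp_grad (hP 0%N).
  have [||+ _] := H (`|y| + 1) 0 y; rewrite ?normr0 ?add0r ?lerDl ?addr_ge0 //.
  by rewrite !mul0r pmulr_rle0 ?ltr_wpDl // normr_le0 subr_eq0 => /eqP ->.
have := cP 0; rewrite normr0 ltW // => /(_ erefl); rewrite addr0.
move=> H; rewrite P00 (cvg_unique_R H (_ : _ --> series (P^~ 0) 1%N)).
  by rewrite /series /= big_nat1.
apply: (@series_fin _ _ 1) => -[//|m] _; apply/eqP; rewrite -normr_le0.
by rewrite (le_trans (hp_bound (hP m.+1) (lexx _))) // normr0 expr0n /= mulr0.
Qed.

Lemma an_inv x f : an x f -> f x != 0 -> an x (fun y => (f y)^-1).
Proof.
move=> [C [s [rho [P fP]]]] fx0.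
have [[C0 s0 r0 sr] hP cP] := fP.
have P0 y : P 0%N y = f x by exact: expands0 fP.
(* Coefficients of the reciprocal: the product with [f] is made equal to 1 degree by degree,
   dividing by the constant term [f x]. *)
pose Q := strong_rec (T := 'rV[R]_N -> R) (fun=> 0) (fun m q y =>
  if m is m'.+1 then - (f x)^-1 * \sum_(i < m'.+1) P i.+1 y * q (m' - i)%N y
  else (f x)^-1).
have Q0 y : Q 0%N y = (f x)^-1 by rewrite /Q strong_recE.
have QS m y : Q m.+1 y = - (f x)^-1 * \sum_(i < m.+1) P i.+1 y * Q (m - i)%N y.
  rewrite /Q strong_recE; congr (_ * _); apply: eq_bigr => i _.
  by rewrite ltnS leq_subr.
have nf0 : 0 < `|f x| by rewrite normr_gt0.
(* With this rate the recursion bounds each [Q m] by a geometric sum of ratio [s / t <= 1/2], and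
   [C / |f x| * (s / t) * 2 <= 1] closes the induction. *)
pose t := 2 * s * (C / `|f x| + 1).
have CF : 0 <= C / `|f x| by rewrite divr_ge0.
have t0 : 0 < t by rewrite !mulr_gt0 // ltr_wpDl.
have st : s / t <= 2^-1.
  rewrite /t ler_pdivrMr //; have : 0 <= s * (C / `|f x|) by rewrite mulr_ge0 // ltW.
  lra.
have hQ m : hpoly m (`|f x|^-1 * t ^+ m) (Q m).
  have [k] := ubnP m; elim: k m => // k IH [|m] mk.
    by apply: (@hp_cst _ _ (f x)^-1) => //; rewrite expr0 mulr1 normrV ?unitfE.
  have hs i : (i <= m)%N ->
      hpoly m.+1 (C * s ^+ i.+1 * (`|f x|^-1 * t ^+ (m - i)))
        (fun y => P i.+1 y * Q (m - i)%N y).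
    move=> im; have := hp_mul (hP i.+1) (IH (m - i)%N _).
    rewrite addSn subnKC //; apply; rewrite ltnS in mk.
    by rewrite (leq_ltn_trans (leq_subr _ _)).
  have := hp_scale (- (f x)^-1) (hp_sum (fun i : 'I_m.+1 => hs i (ltn_ord i : (i <= m)%N))).
  move=> /hp_ext /(_ (QS m)) /hp_weak; apply.
  rewrite normrN normrV ?unitfE // ler_wpM2l ?invr_ge0 //.
  apply: (@le_trans _ _ (\sum_(i < m.+1) (C / `|f x|) * (s / t) * t ^+ m.+1 * (s / t) ^+ i)).
    apply: ler_sum => i _; rewrite le_eqVlt; apply/orP; left; apply/eqP.
    have -> : t ^+ m.+1 = t ^+ i.+1 * t ^+ (m - i).
      by rewrite -exprD addSn subnKC // -ltnS.
    rewrite expr_div_n !exprS; field.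
    by rewrite !gt_eqF // exprn_gt0.
  rewrite -mulr_sumr.
  set S := \sum_(i < _) _; have S2 : S <= 2.
    by apply: geometric_sum_le; rewrite st divr_ge0 // ltW.
  have key : C / `|f x| * (s / t) * 2 <= 1.
    have -> : s / t = (2 * (C / `|f x| + 1))^-1.
      by rewrite /t; field; rewrite !gt_eqF // ?ltr_wpDl // addr_gt0.
    rewrite mulrAC ler_pdivrMr; last by rewrite mulr_gt0 // ltr_wpDl.
    by lra.
  rewrite mulrAC ler_piMl //; first by rewrite exprn_ge0 // ltW.
  apply: le_trans key; rewrite ler_wpM2l // mulr_ge0 // divr_ge0 // ltW //.
exists `|f x|^-1, (t + s), (Num.min rho (8^-1 / (t + s))), Q.
have sg : 0 < Num.min rho (8^-1 / (t + s)) by rewrite lt_min r0 divr_gt0 // addr_gt0.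
have ts : (t + s) * Num.min rho (8^-1 / (t + s)) <= 8^-1.
  by rewrite mulrC -ler_pdivlMr ?addr_gt0 // ge_min lexx orbT.
split.
- by split=> //; rewrite ?addr_gt0 // invr_ge0.
- move=> m; apply: (hp_weak (hQ m)).
  by rewrite ler_wpM2l ?invr_ge0 // lerXn2r ?nnegrE ?lerDl ?addr_ge0 // ltW.
move=> y; rewrite le_min => /andP[yr yt].
pose q := (t + s) * Num.min rho (8^-1 / (t + s)).
have ym : `|y| <= Num.min rho (8^-1 / (t + s)) by rewrite le_min yr.
have q04 : 0 <= q <= 4^-1.
  rewrite mulr_ge0 ?(ltW sg) //=; last by rewrite ltW // addr_gt0.
  by apply: (le_trans ts); lra.
have q02 : 0 <= q <= 2^-1 by case/andP: q04 => -> /=; lra.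
have bP m : `|P m y| <= C * q ^+ m.
  rewrite exprMn mulrA; apply: (hp_bound (hp_weak (hP m) _)) => //.
  by rewrite ler_wpM2l // lerXn2r ?nnegrE ?lerDr ?addr_ge0 // ltW.
have bQ m : `|Q m y| <= `|f x|^-1 * q ^+ m.
  rewrite exprMn mulrA; apply: (hp_bound (hp_weak (hQ m) _)) => //.
  by rewrite ler_wpM2l ?invr_ge0 // lerXn2r ?nnegrE ?lerDl ?addr_ge0 // ltW.
have F0 : 0 <= `|f x|^-1 by rewrite invr_ge0.
have cQ : cvgn (series (Q^~ y)) by exact: cvg_series_geo bQ.
have := cauchy_product C0 F0 q04 bP bQ (cP y yr) cQ.
move/cvg_unique_R => /(_ 1) H.
have one : f (x + y) * limn (series (Q^~ y)) = 1.
  apply: H.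
  suff : (fun m => \sum_(i < m.+1) P i y * Q (m - i)%N y) =
         (fun m => if m == 0%N then 1 else 0 : R).
    move=> ->; have := @series_fin R (fun m => if m == 0%N then 1 else 0) 1.
    by rewrite {2}/series /= big_nat1 /=; apply; case.
  apply/funext => -[|m].
    by rewrite big_ord_recl big_ord0 addr0 /= P0 Q0 divff.
  rewrite big_ord_recl /= subn0 P0 QS mulrA mulrN divff // mulN1r.
  by under [X in _ + X]eq_bigr do rewrite /bump /= add1n subSS; rewrite addNr.
suff -> : (f (x + y))^-1 = limn (series (Q^~ y)) by [].
have fxy0 : f (x + y) != 0.
  by apply: contra_eq_neq one => ->; rewrite mul0r eq_sym oner_neq0.
by apply: (mulfI fxy0); rewrite one divff.
Qed.

Lemma natS_le_exp2 n : n.+1%:R <= (2 : R) ^+ n.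
Proof. by rewrite -natrX ler_nat ltn_expl. Qed.

(** Term by term differentiation. The bounds hold for all pairs of points in the ball, not only
    around [x], so that they give at once Lipschitz continuity and differentiability at all nearby
    points. [K] is the sum of the constants of the two estimates. *)
Lemma an_grad x f : an x f -> exists d : 'I_N -> 'rV[R]_N -> R,
  (forall a, an x (fun z => d a (z - x))) /\
  exists K rho : R, [/\ 0 <= K, 0 < rho &
    forall y w, `|y| <= rho -> `|y + w| <= rho ->
      `|f (x + (y + w)) - f (x + y)| <= K * `|w| /\
      `|f (x + (y + w)) - f (x + y) - \sum_a d a y * w 0 a| <= K * `|w| ^+ 2].
Proof.
move=> [C [s [rho [P fP]]]]; have [[C0 s0 r0 sr] hP cP] := fP.
have /choice[D HD] := fun m => hp_grad (hP m).
have hD m a : hpoly m.-1 (m%:R * (C * s ^+ m)) (D m a) by case: (HD m).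
have D0 a y : D 0%N a y = 0.
  apply/eqP; rewrite -normr_le0 (le_trans (hp_bound (hD 0%N a) (lexx _))) //.
  by rewrite mul0r mul0r.
have hE m a : hpoly m (C * s * (2 * s) ^+ m) (D m.+1 a).
  apply: (hp_weak (hD m.+1 a)); rewrite exprS exprMn.
  have -> : m.+1%:R * (C * (s * s ^+ m)) = (C * s * s ^+ m) * m.+1%:R by ring.
  rewrite [2 ^+ m * _]mulrC mulrA ler_wpM2l ?natS_le_exp2 //.
  by rewrite !mulr_ge0 ?exprn_ge0 // ltW.
have s20 : 0 < 2 * s by rewrite mulr_gt0.
have r20 : 0 < rho / 2 by rewrite divr_gt0.
have sr2 : 2 * s * (rho / 2) = s * rho by field.
have bE m a y : `|y| <= rho / 2 -> `|D m.+1 a y| <= C * s * (s * rho) ^+ m.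
  by move=> yr; rewrite -sr2 exprMn mulrA; exact: hp_bound (hE m a) yr.
have q2 : 0 <= s * rho <= 2^-1.
  by rewrite mulr_ge0 ?(ltW s0) ?(ltW r0) //=; apply: (le_trans sr); lra.
have Cs : 0 <= C * s by rewrite mulr_ge0 // ltW.
have cE a y : `|y| <= rho / 2 -> cvgn (series (fun m => D m.+1 a y)).
  by move=> yr; apply: (@cvg_series_geo _ _ (C * s) (s * rho)) => // m; exact: bE.
exists (fun a y => limn (series (fun m => D m.+1 a y))); split.
  move=> a; exists (C * s), (2 * s), (rho / 2), (fun m => D m.+1 a); split=> //.
    by split=> //; rewrite sr2.
  by move=> y yr; rewrite addrAC subrr add0r; exact: cE.
have rho_le : rho / 2 <= rho by rewrite ler_pdivrMr // ler_peMr ?(ltW r0) // ler1n.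
exists (2 * (C / rho) + 2 * (C / rho ^+ 2)), (rho / 2); split=> //.
  by rewrite addr_ge0 // mulr_ge0 // divr_ge0 // ?exprn_ge0 // ltW.
move=> y w yr ywr; have yr1 := le_trans yr rho_le; have ywr1 := le_trans ywr rho_le.
have H m := (HD m).2 rho y w yr1 ywr1.
have A1 : 0 <= 2 * (C / rho) by rewrite mulr_ge0 // divr_ge0 // ltW.
have A2 : 0 <= 2 * (C / rho ^+ 2) by rewrite mulr_ge0 // divr_ge0 // ?exprn_ge0 // ltW.
have q4 : 0 <= 4 * (s * rho) <= 2^-1.
  by rewrite mulr_ge0 ?mulr_ge0 ?(ltW s0) ?(ltW r0) //=; lra.
have m4 m : m%:R ^+ 2 <= (4 : R) ^+ m.
  rewrite (_ : 4 = 2 * 2 :> R); last by rewrite -natrM.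
  by rewrite exprMn expr2 ler_pM // natr_le_exp2.
have m4' m : m%:R <= (4 : R) ^+ m.
  by rewrite (le_trans (natr_le_exp2 _)) // lerXn2r ?nnegrE // ler_nat.
split.
- apply: (@le_trans _ _ (2 * (C / rho) * `|w|)); last by rewrite ler_wpM2r // lerDl.
  rewrite (_ : 2 * (C / rho) * `|w| = 2 * (C / rho * `|w|)); last by ring.
  apply: (@lim_norm_le _ (fun n => series (fun m => P m (y + w) - P m y) n)).
    rewrite (_ : (fun n => _) = fun n => series (P^~ (y + w)) n - series (P^~ y) n); last first.
      by apply/funext => n; rewrite /series /= sumrB.
    by apply: cvgB; exact: cP.
  move=> n; apply: (@series_geo_le _ _ _ (4 * (s * rho))) => //.
    by rewrite mulr_ge0 // divr_ge0 // ltW.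
  move=> m; have [L _] := H m; rewrite -(ler_pM2l r0) (le_trans L) //.
  have -> : rho * (C / rho * `|w| * (4 * (s * rho)) ^+ m) =
      4 ^+ m * (C * s ^+ m * rho ^+ m * `|w|).
    by rewrite !exprMn; field; rewrite gt_eqF.
  have -> : m%:R * (C * s ^+ m) * rho ^+ m * `|w| = m%:R * (C * s ^+ m * rho ^+ m * `|w|) by ring.
  by rewrite ler_wpM2r // !mulr_ge0 ?exprn_ge0 // ltW.
- apply: (@le_trans _ _ (2 * (C / rho ^+ 2) * `|w| ^+ 2)).
    2: by rewrite ler_wpM2r ?exprn_ge0 // lerDr.
  rewrite (_ : 2 * (C / rho ^+ 2) * `|w| ^+ 2 = 2 * (C / rho ^+ 2 * `|w| ^+ 2)); last by ring.
  apply: (@lim_norm_le _ (fun n => series (fun m => P m (y + w) - P m y - \sum_a D m a y * w 0 a) n)).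
    rewrite (_ : (fun n => _) = fun n => series (P^~ (y + w)) n - series (P^~ y) n
         - \sum_a series (fun m => D m a y) n * w 0 a); last first.
      apply/funext => n; rewrite /series /= !sumrB exchange_big /=; congr (_ - _).
      by apply: eq_bigr => a _; rewrite mulr_suml.
    apply: cvgB; first by apply: cvgB; exact: cP.
    apply: cvg_sum_fin => a; apply: cvgMl.
    rewrite -cvg_shiftS /=.
    rewrite (_ : (fun n => _) = series (fun m => D m.+1 a y)); first exact: cE.
    by apply/funext => n; rewrite /series /= big_nat_recl //= D0 add0r.
  move=> n; apply: (@series_geo_le _ _ _ (4 * (s * rho))) => //.
    by rewrite mulr_ge0 ?exprn_ge0 // divr_ge0 ?exprn_ge0 // ltW.
  move=> m; have [_ L] := H m; rewrite -(ler_pM2l (exprn_gt0 2 r0)) (le_trans L) //.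
  have -> : rho ^+ 2 * (C / rho ^+ 2 * `|w| ^+ 2 * (4 * (s * rho)) ^+ m) =
      4 ^+ m * (C * s ^+ m * rho ^+ m * `|w| ^+ 2).
    by rewrite !exprMn; field; rewrite gt_eqF.
  have -> : m%:R ^+ 2 * (C * s ^+ m) * rho ^+ m * `|w| ^+ 2 =
     m%:R ^+ 2 * (C * s ^+ m * rho ^+ m * `|w| ^+ 2) by ring.
  by rewrite ler_wpM2r // !mulr_ge0 ?exprn_ge0 // ltW.
Qed.

(** The gradient series of [an_grad] is an auxiliary function; testing it along coordinate lines
    identifies it with [pd] at every nearby point. *)
Lemma an_near_pd x f : an x f -> exists2 e : R, 0 < e & forall y, `|y| < e ->
  exists K rho : R, [/\ 0 <= K, 0 < rho &
    forall w, `|w| <= rho ->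
      `|f (x + y + w) - f (x + y) - \sum_a pd a f (x + y) * w 0 a| <= K * `|w| ^+ 2].
Proof.
move=> /an_grad[d [_ [K [rho [K0 r0 H]]]]]; exists (rho / 2); first exact: divr_gt0.
move=> y yr; have yr1 : `|y| <= rho by apply: ltW; apply: (lt_le_trans yr); lra.
have r2 : 0 < rho / 2 by lra.
have E w : `|w| <= rho / 2 ->
    `|f (x + y + w) - f (x + y) - \sum_a d a y * w 0 a| <= K * `|w| ^+ 2.
  move=> wr; rewrite -[x + y + w]addrA; apply: (H y w yr1 _).2.
  by rewrite (le_trans (ler_normD _ _)) // [leRHS](splitr rho) lerD // ltW.
exists K, (rho / 2); split=> // w wr.
suff pdE a : pd a f (x + y) = d a y by under eq_bigr do rewrite pdE; exact: E.
have := isd_chain_quad (c := fun t => x + y + t *: delta_mx 0 a) (t := 0)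
   (f := f) (d := d^~ y) (K := K) r2 _ (fun b => isd_line (x + y) (delta_mx 0 a) 0 b).
rewrite scale0r addr0 => /(_ E)/isd_pd ->; rewrite (bigD1 a) //= mxE !eqxx mulr1 big1 ?addr0 //.
by move=> b /negPf ba; rewrite mxE ba andbF mulr0.
Qed.

End AnalyticCalculus.

Definition germ_eq {R : realType} {N : nat} (x : 'rV[R]_N) (f g : 'rV[R]_N -> R) :=
  exists2 e : R, 0 < e & forall y, `|y| < e -> f (x + y) = g (x + y).

Section AnalyticCalculus.
Context {R : realType} {N : nat}.
Implicit Types (f g : 'rV[R]_N -> R) (x y w : 'rV[R]_N).

Lemma an_chain f (c : R -> 'rV[R]_N) (c' : 'I_N -> R) t :
  an (c t) f -> (forall a, isd (fun s => c s 0 a) t (c' a)) ->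
  isd (fun s => f (c s)) t (\sum_a pd a f (c t) * c' a).
Proof.
move=> /an_near_pd[e e0 H] cd; have [|K [rho [K0 r0 E]]] := H 0; first by rewrite normr0.
by rewrite !addr0 in E; exact: isd_chain_quad r0 E cd.
Qed.

Lemma an_chain_near f x : an x f -> exists2 e : R, 0 < e &
  forall (c : R -> 'rV[R]_N) (c' : 'I_N -> R) t, `|c t - x| < e ->
    (forall a, isd (fun s => c s 0 a) t (c' a)) ->
    isd (fun s => f (c s)) t (\sum_a pd a f (c t) * c' a).
Proof.
move=> /an_near_pd[e e0 H]; exists e => // c c' t ce cd.
have [K [rho [K0 r0 E]]] := H _ ce; rewrite subrKC in E.
exact: isd_chain_quad r0 E cd.
Qed.

Lemma an_isd_line f x w : an x f ->
  isd (fun t => f (x + t *: w)) 0 (\sum_a pd a f x * w 0 a).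
Proof.
move=> fx; have := @an_chain f (fun t => x + t *: w) (fun a => w 0 a) 0.
rewrite scale0r addr0; apply=> // a; exact: isd_line.
Qed.

Lemma sum_delta (d : 'I_N -> R) a : \sum_b d b * (delta_mx 0 a : 'rV[R]_N) 0 b = d a.
Proof.
rewrite (bigD1 a) //= mxE !eqxx mulr1 big1 ?addr0 // => b /negPf ba.
by rewrite mxE ba andbF mulr0.
Qed.

Lemma an_isd_pd f x a : an x f ->
  isd (fun t => f (x + t *: delta_mx 0 a)) 0 (pd a f x).
Proof. by move=> fx; have := an_isd_line (delta_mx 0 a) fx; rewrite sum_delta. Qed.

Lemma an_isd_near f x : an x f -> exists2 e : R, 0 < e & forall y, `|y| < e ->
  forall a, isd (fun t => f (x + y + t *: delta_mx 0 a)) 0 (pd a f (x + y)).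
Proof.
move=> /an_near_pd[e e0 H]; exists e => // y ye a.
have [K [rho [K0 r0 E]]] := H y ye.
have := @isd_chain_quad _ _ f (fun t => x + y + t *: delta_mx 0 a) _ _ K rho 0 r0 _
  (fun b => isd_line (x + y) (delta_mx 0 a) 0 b).
by rewrite scale0r addr0 => /(_ _ E); rewrite sum_delta.
Qed.

Lemma an_pd f x a : an x f -> an x (pd a f).
Proof.
move=> fx; have [d [dx [K [rho [K0 r0 H]]]]] := an_grad fx.
apply: (an_ext (dx a)); exists (rho / 2); first exact: divr_gt0.
move=> y yr; rewrite addrAC subrr add0r.
have yr1 : `|y| <= rho by apply: ltW; apply: (lt_le_trans yr); lra.
have r2 : 0 < rho / 2 by lra.
have E w : `|w| <= rho / 2 ->
    `|f (x + y + w) - f (x + y) - \sum_b d b y * w 0 b| <= K * `|w| ^+ 2.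
  move=> wr; rewrite -[x + y + w]addrA; apply: (H y w yr1 _).2.
  by rewrite (le_trans (ler_normD _ _)) // [leRHS](splitr rho) lerD // ltW.
have := isd_chain_quad (c := fun t => x + y + t *: delta_mx 0 a) (t := 0)
   (f := f) (d := d^~ y) (K := K) r2 _ (fun b => isd_line (x + y) (delta_mx 0 a) 0 b).
by rewrite scale0r addr0 => /(_ E)/isd_pd ->; rewrite sum_delta.
Qed.

Lemma an_lipschitz f x : an x f -> exists K rho : R, [/\ 0 <= K, 0 < rho &
  forall y y', `|y| <= rho -> `|y'| <= rho ->
    `|f (x + y') - f (x + y)| <= K * `|y' - y|].
Proof.
move=> /an_grad[d [_ [K [rho [K0 r0 H]]]]]; exists K, rho; split=> // y y' yr yr'.
by have := H y (y' - y) yr; rewrite subrKC => /(_ yr') [].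
Qed.

Lemma pd_ext f g x a : germ_eq x f g -> pd a f x = pd a g x.
Proof.
move=> [e e0 fg]; rewrite !pdE !derive1E; apply: near_eq_derive.
apply/near0P; exists e => // t te; rewrite add0r; apply: fg.
rewrite normrZ; apply: le_lt_trans te; rewrite ler_piMr //; exact: norm_delta_rV.
Qed.

Lemma germ_eq_at f g x : germ_eq x f g -> exists2 e : R, 0 < e &
  forall y, `|y| < e -> germ_eq (x + y) f g.
Proof.
move=> [e e0 fg]; exists e => // y ye; exists (e - `|y|) => [|u ue].
  by rewrite subr_gt0.
rewrite -addrA; apply: fg.
by rewrite (le_lt_trans (ler_normD _ _)) // -ltrBrDl.
Qed.

Lemma germ_eq_pd f g x a : germ_eq x f g -> germ_eq x (pd a f) (pd a g).
Proof.
by move=> /germ_eq_at[e e0 fg]; exists e => // y /fg; exact: pd_ext.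
Qed.

Lemma germ_eq_val f g x : germ_eq x f g -> f x = g x.
Proof. by move=> [e e0 /(_ 0)]; rewrite normr0 addr0; apply. Qed.

Lemma pdD f g x a : an x f -> an x g ->
  pd a (fun y => f y + g y) x = pd a f x + pd a g x.
Proof.
by move=> fx gx; apply: isd_pd; apply: isdD; exact: an_isd_pd.
Qed.

Lemma pdZ k f x a : an x f -> pd a (fun y => k * f y) x = k * pd a f x.
Proof. by move=> fx; apply: isd_pd; apply: isdZ; exact: an_isd_pd. Qed.

Lemma pd_coord b x a : pd a (fun y => y 0 b) x = (a == b)%:R :> R.
Proof.
apply: isd_pd; have := isd_line x (delta_mx 0 a) 0 b.
by rewrite mxE eqxx [b == a]eq_sym.
Qed.

End AnalyticCalculus.

(** * Symmetry of second derivatives *)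

Section Schwarz.
Context {R : realType} {N : nat}.
Implicit Types (f g : 'rV[R]_N -> R) (x y w : 'rV[R]_N).

Lemma mvt_at (f df : R -> R) (s h : R) :
  (forall t, `|t| <= `|h| -> isd f (s + t) (df t)) ->
  exists2 t, `|t| <= `|h| & f (s + h) - f s = df t * h.
Proof.
move=> fd; pose g t := f (s + t).
have gd t : `|t| <= `|h| -> isd g t (df t).
  move=> th; have := @isd_comp_lin _ f s 1 t (df t).
  rewrite !mulr1 => /(_ (fd t th)); apply: isd_ext => u; by rewrite mulr1.
have -> : f s = g 0 by rewrite /g addr0.
rewrite -/(g h).
have [h0|h0|->] := ltgtP h 0; last by exists 0; rewrite ?subrr ?mulr0.
- have bd t : h <= t <= 0 -> `|t| <= `|h|.
    by move=> /andP[? ?]; rewrite !ler0_norm //; lra.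
  have [||c hc E] := @MVT R g df h 0 h0.
  + by move=> t; rewrite in_itv /= => /andP[? ?]; apply/isdP; apply: gd; apply: bd; lra.
  + apply: continuous_in_subspaceT => t; rewrite inE /= in_itv /= => /andP[? ?].
    by apply: (@isd_continuous _ _ _ (df t)); apply: gd; apply: bd; lra.
  exists c; first by move: hc; rewrite in_itv /= => /andP[? ?]; apply: bd; lra.
  by rewrite -opprB E sub0r mulrN opprK.
- have bd t : 0 <= t <= h -> `|t| <= `|h|.
    by move=> /andP[? ?]; rewrite !ger0_norm //; lra.
  have [||c hc E] := @MVT R g df 0 h h0.
  + by move=> t; rewrite in_itv /= => /andP[? ?]; apply/isdP; apply: gd; apply: bd; lra.
  + apply: continuous_in_subspaceT => t; rewrite inE /= in_itv /= => /andP[? ?].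
    by apply: (@isd_continuous _ _ _ (df t)); apply: gd; apply: bd; lra.
  exists c; first by move: hc; rewrite in_itv /= => /andP[? ?]; apply: bd; lra.
  by rewrite E subr0.
Qed.

(** The mean value theorem in direction [a] turns the second difference into [h] times a difference
    of [pd a f], whose two values are expanded to first order. Their displacements are at most
    [2 * |h|] and [|h|], which gives [5 = 2 ^ 2 + 1]. *)
Lemma second_difference f x a b :
  (exists2 e : R, 0 < e & forall y, `|y| < e -> forall a,
    isd (fun t => f (x + y + t *: delta_mx 0 a)) 0 (pd a f (x + y))) ->
  (exists K rho : R, [/\ 0 <= K, 0 < rho &
    forall w, `|w| <= rho -> `|pd a f (x + w) - pd a f x
      - \sum_c pd c (pd a f) x * w 0 c| <= K * `|w| ^+ 2]) ->
  exists K e : R, [/\ 0 <= K, 0 < e &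
  forall h, `|h| < e ->
    `|f (x + h *: delta_mx 0 b + h *: delta_mx 0 a) - f (x + h *: delta_mx 0 b)
      - (f (x + h *: delta_mx 0 a) - f x) - pd b (pd a f) x * h ^+ 2| <= K * `|h| ^+ 3].
Proof.
move=> [e e0 He] [K [rho [K0 r0 E]]].
exists (5 * K), (Num.min e rho / 2); split; rewrite ?mulr_ge0 ?divr_gt0 ?lt_min ?e0 //.
move=> h; rewrite ltr_pdivlMr // lt_min => /andP[he hr].
pose ea : 'rV[R]_N := delta_mx 0 a; pose eb : 'rV[R]_N := delta_mx 0 b.
have hn (t : R) c : `|t *: delta_mx 0 c : 'rV[R]_N| <= `|t|.
  by rewrite normrZ ler_piMr // norm_delta_rV.
have sm u t : `|u| <= `|h| -> `|t| <= `|h| -> `|u *: eb + t *: ea| <= 2 * `|h|.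
  move=> uh th; rewrite (le_trans (ler_normD _ _)) // mulr_natl mulr2n.
  by rewrite lerD // (le_trans (hn _ _)).
have D u t : `|u| <= `|h| -> `|t| <= `|h| ->
    isd (fun t => f (x + u *: eb + t *: ea)) t (pd a f (x + u *: eb + t *: ea)).
  move=> uh th; have := He (u *: eb + t *: ea) _ a.
  rewrite (le_lt_trans (sm u t uh th)) 1?mulrC // => /(_ erefl).
  rewrite addrA => H0.
  have := @isd_comp_lin _ (fun s => f (x + u *: eb + t *: ea + s *: ea)) (- t) 1 t _ .
  rewrite mulr1 addNr => /(_ _ H0); rewrite mulr1; apply: isd_ext => s.
  by rewrite mulr1 -addrA -scalerDl addrA subrr add0r.
have [|t th] := @mvt_at (fun t => f (x + h *: eb + t *: ea) - f (x + 0 *: eb + t *: ea))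
    (fun t => pd a f (x + h *: eb + t *: ea) - pd a f (x + 0 *: eb + t *: ea)) 0 h.
  by move=> t th; rewrite add0r; apply: isdB; apply: D; rewrite ?normr0.
rewrite add0r !scale0r !addr0 => M.
rewrite [X in `|X - _|](_ : _ = (pd a f (x + h *: eb + t *: ea) - pd a f (x + t *: ea)) * h);
  last by rewrite -M /ea /eb; ring.
have -> : pd a f (x + h *: eb + t *: ea) = pd a f (x + (h *: eb + t *: ea)) by rewrite addrA.
have E1 := E (h *: eb + t *: ea).
have E2 := E (t *: ea).
have S1 : \sum_c pd c (pd a f) x * (h *: eb + t *: ea) 0 c =
   h * pd b (pd a f) x + t * pd a (pd a f) x.
  under eq_bigr do rewrite !mxE mulrDr !(mulrCA (pd _ _ _)).
  have dE c : ((0 == 0 :> 'I_1) && (c == a))%:R = (delta_mx 0 a : 'rV[R]_N) 0 c :> R by rewrite mxE.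
  have dE' c : ((0 == 0 :> 'I_1) && (c == b))%:R = (delta_mx 0 b : 'rV[R]_N) 0 c :> R by rewrite mxE.
  under eq_bigr do rewrite dE dE'.
  by rewrite big_split /= -!mulr_sumr !sum_delta.
have S2 : \sum_c pd c (pd a f) x * (t *: ea) 0 c = t * pd a (pd a f) x.
  under eq_bigr do rewrite mxE mulrCA.
  by rewrite -mulr_sumr sum_delta.
rewrite S1 in E1; rewrite S2 in E2.
set A := pd a f (x + _) in E1 *; set B := pd a f (x + _) in E2 *.
set P := pd b _ _ in E1 *; set Q := pd a (pd a f) x in E1 E2; set Z := pd a f x in E1 E2.
have n1 : `|h *: eb + t *: ea| <= 2 * `|h| by exact: sm.
have n2 : `|t *: ea| <= `|h| by rewrite (le_trans (hn _ _)).
have {}E1 : `|A - Z - (h * P + t * Q)| <= 4 * K * `|h| ^+ 2.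
  apply: (le_trans (E1 _)); first by rewrite (le_trans n1) // mulrC ltW.
  rewrite [4 * K]mulrC -mulrA ler_wpM2l // (_ : 4 = 2 ^+ 2 :> R); last by rewrite -natrX.
  by rewrite -exprMn lerXn2r ?nnegrE ?mulr_ge0.
have {}E2 : `|B - Z - t * Q| <= K * `|h| ^+ 2.
  apply: (le_trans (E2 _)).
    by rewrite (le_trans n2) // (le_trans _ (ltW hr)) // ler_peMr // ler1n.
  by rewrite ler_wpM2l // lerXn2r ?nnegrE.
clearbody A B P Q Z.
have -> : (A - B) * h - P * h ^+ 2 = h * ((A - Z - (h * P + t * Q)) - (B - Z - t * Q)) by ring.
rewrite normrM exprS mulrCA ler_wpM2l // (le_trans (ler_normB _ _)) // (le_trans (lerD E1 E2)) //.
by rewrite -mulrDl (_ : 5 * K = 4 * K + K) //; ring.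
Qed.

(** The second difference is symmetric in [a] and [b], so both mixed derivatives equal its quotient
    by [h ^ 2] up to an error linear in [h]. *)
Lemma schwarz f x a b :
  (exists2 e : R, 0 < e & forall y, `|y| < e -> forall a,
    isd (fun t => f (x + y + t *: delta_mx 0 a)) 0 (pd a f (x + y))) ->
  (exists K rho : R, [/\ 0 <= K, 0 < rho &
    forall w, `|w| <= rho -> `|pd a f (x + w) - pd a f x
      - \sum_c pd c (pd a f) x * w 0 c| <= K * `|w| ^+ 2]) ->
  (exists K rho : R, [/\ 0 <= K, 0 < rho &
    forall w, `|w| <= rho -> `|pd b f (x + w) - pd b f x
      - \sum_c pd c (pd b f) x * w 0 c| <= K * `|w| ^+ 2]) ->
  pd a (pd b f) x = pd b (pd a f) x.
Proof.
move=> fx fa fb; have [K [e [K0 e0 H1]]] := second_difference b fx fa.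
have [L [r [L0 r0 H2]]] := second_difference a fx fb.
apply/eqP; rewrite -subr_eq0 -normr_le0; apply/ler_addgt0Pl => s s0; rewrite addr0.
pose h := Num.min (Num.min e r) (s / (K + L + 1)) / 2.
have KL : 0 < K + L + 1 by rewrite ltr_wpDl // addr_ge0.
have m0 : 0 < Num.min (Num.min e r) (s / (K + L + 1)) by rewrite !lt_min e0 r0 divr_gt0.
have h0 : 0 < h by rewrite divr_gt0.
have : h < Num.min (Num.min e r) (s / (K + L + 1)) by rewrite /h; lra.
rewrite !lt_min => /andP[/andP[he hr] hs].
have := H1 h; have := H2 h; rewrite gtr0_norm // => /(_ hr) + /(_ he).
rewrite [x + h *: delta_mx 0 a + _]addrAC.
set F := f _; set A := f (_ + _); set B := f (_ + _).
move: F A B (f x) (pd a _ x) (pd b _ x) => F A B Z D1 D2 h2 h1.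
rewrite -(ler_pM2r (exprn_gt0 2 h0)) -[X in `|_| * X]gtr0_norm ?exprn_gt0 // -normrM.
have -> : (D1 - D2) * h ^+ 2 =
  (F - B - (A - Z) - D2 * h ^+ 2) - (F - A - (B - Z) - D1 * h ^+ 2) by ring.
rewrite (le_trans (ler_normB _ _)) //.
apply: (@le_trans _ _ ((K + L) * h ^+ 3)); first by rewrite mulrDl lerD.
rewrite exprS mulrA ler_wpM2r ?exprn_ge0 ?(ltW h0) //.
rewrite mulrC (@le_trans _ _ (h * (K + L + 1))) //; first by rewrite ler_wpM2l ?(ltW h0) // lerDl.
by rewrite -ler_pdivlMr // ltW.
Qed.

Lemma an_pdC_near f x a b : an x f ->
  germ_eq x (pd a (pd b f)) (pd b (pd a f)).
Proof.
move=> fx; have [e e0 He] := an_isd_near fx.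
have [ea ea0 Ha] := an_near_pd (an_pd a fx).
have [eb eb0 Hb] := an_near_pd (an_pd b fx).
exists (Num.min e (Num.min ea eb)); first by rewrite !lt_min e0 ea0.
move=> y; rewrite !lt_min => /and3P[ye ya yb].
apply: schwarz; [|exact: Ha|exact: Hb].
exists (e - `|y|) => [|u ue]; first by rewrite subr_gt0.
rewrite -[x + y + u]addrA; apply: He.
by rewrite (le_lt_trans (ler_normD _ _)) // -ltrBrDl.
Qed.

Lemma an_pdC f x a b : an x f -> pd a (pd b f) x = pd b (pd a f) x.
Proof.
by move=> /(an_pdC_near a b)[e e0 /(_ 0)]; rewrite normr0 addr0; apply.
Qed.
End Schwarz.

(** * Vanishing of analytic functions along segments *)

Section IdentityTheorem.
Context {R : realType} {N : nat}.
Implicit Types (f g : 'rV[R]_N -> R) (x y w d : 'rV[R]_N).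

Lemma hp_homog m B (P : 'rV[R]_N -> R) t y :
  hpoly m B P -> P (t *: y) = t ^+ m * P y.
Proof.
elim=> {m B P} [c B P cB Pc|m B P Q a hP IH Qe|m B1 B2 B P1 P2 Q h1 IH1 h2 IH2 HB Qe|m B Q B0 Qe].
- by rewrite !Pc mul1r.
- by rewrite !Qe IH mxE exprS; ring.
- by rewrite !Qe IH1 IH2 mulrDr.
- by rewrite !Qe mulr0.
Qed.

(** If some homogeneous part is nonzero at [d], the first such part dominates the tail of the series
    for small [t]; otherwise every term of the series vanishes on the line near [x]. *)
Lemma an_line_zero f x d : an x f ->
  (exists2 e : R, 0 < e & forall t, `|t| < e -> f (x + t *: d) = 0) \/
  (exists2 e : R, 0 < e & forall t, 0 < `|t| < e -> f (x + t *: d) != 0).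
Proof.
move=> [C [s [rho [P [[C0 s0 r0 sr] hP cP]]]]].
(* The factor 2 makes the terms beyond degree [m] decrease like powers of [1/2] relative to
   [(sg * |t|) ^ m.+1]. *)
pose sg := 2 * s * (`|d| + 1); have d1 : 0 < `|d| + 1 by rewrite ltr_wpDl.
have sg0 : 0 < sg by rewrite !mulr_gt0.
pose e := Num.min (rho / (`|d| + 1)) sg^-1.
have e0 : 0 < e by rewrite lt_min divr_gt0 // invr_gt0.
have small t : `|t| < e -> `|t *: d| <= rho /\ sg * `|t| <= 1.
  rewrite lt_min => /andP[t1 t2]; split; last by rewrite mulrC -ler_pdivlMr // div1r ltW.
  rewrite normrZ (@le_trans _ _ (`|t| * (`|d| + 1))) ?ler_wpM2l ?lerDl //.
  by rewrite -ler_pdivlMr // ltW.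
have [a0|/existsNP na0] := pselect (forall m, P m d = 0).
  left; exists e => // t /small[tr _]; have := cP _ tr.
  move/cvg_unique_R => H; apply: H.
  have := @series_fin R (fun m => P m (t *: d)) 0; rewrite {2}/series /= big_geq //.
  by apply=> m _ /=; rewrite (hp_homog _ _ (hP m)) a0 mulr0.
right; have {}na0 : exists m, P m d != 0 by case: na0 => m /eqP; exists m.
case: (ex_minnP na0) => m am minm.
pose K := 2 * C * sg ^+ m.+1; have K0 : 0 <= K by rewrite !mulr_ge0 // exprn_ge0 // ltW.
exists (Num.min e (`|P m d| / (K + 1))).
  by rewrite lt_min e0 divr_gt0 ?normr_gt0 // ltr_wpDl.
move=> t /andP[t0]; rewrite lt_min => /andP[/small[tr ts] tK].
have key : `|f (x + t *: d) - t ^+ m * P m d| <= K * `|t| ^+ m.+1.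
  pose v j := if j == m then t ^+ m * P m d else 0.
  have cv : series v @ \oo --> t ^+ m * P m d.
    suff <- : series v m.+1 = t ^+ m * P m d.
      by apply: series_fin => j mj; rewrite /v gtn_eqF.
    rewrite /series /= big_nat_recr //= /v eqxx big_nat_cond big1 ?add0r //.
    by move=> i; rewrite andbT => /andP[_ im]; rewrite ltn_eqF.
  have cu : series (fun j => P j (t *: d) - v j) @ \oo --> f (x + t *: d) - t ^+ m * P m d.
    rewrite (_ : series _ = fun n => series (P^~ (t *: d)) n - series v n); last first.
      by apply/funext => n; rewrite /series /= sumrB.
    by apply: cvgB => //; exact: cP.
  have half : 0 <= (2^-1 : R) <= 2^-1 by rewrite lexx invr_ge0 ler0n.
  have st0 : 0 <= sg * `|t| by rewrite mulr_ge0 // ltW.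
  apply: (lim_norm_le cu) => n.
  have -> : K * `|t| ^+ m.+1 = 2 * (C * (sg * `|t|) ^+ m.+1) by rewrite /K [(sg * _) ^+ _]exprMn !mulrA.
  apply: (series_geo_le _ _ half); first by rewrite mulr_ge0 // exprn_ge0.
  move=> j; rewrite /v; case: (ltngtP j m) => jm.
  - rewrite subr0 (hp_homog _ _ (hP j)) (_ : P j d = 0) ?mulr0 ?normr0 ?mulr_ge0 ?exprn_ge0 //.
      by apply/eqP/negP => /negP /minm; rewrite leqNgt jm.
  - rewrite subr0 (le_trans (hp_bound (hP j) (lexx _))) //.
    rewrite -[C * s ^+ j * _]mulrA -[C * _ ^+ m.+1 * _]mulrA ler_wpM2l // normrZ.
    rewrite -exprMn (@le_trans _ _ ((sg * `|t|) ^+ j * 2^-1 ^+ j)) //.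
      rewrite -exprMn lerXn2r ?nnegrE ?mulr_ge0 ?(ltW s0) ?(ltW sg0) //.
      rewrite (_ : sg * `|t| / 2 = s * (`|t| * (`|d| + 1))); last by rewrite /sg; field.
      by rewrite ler_wpM2l ?(ltW s0) // ler_wpM2l // lerDl.
    by rewrite ler_wpM2r ?exprn_ge0 // ler_wiXn2l.
  - by rewrite jm (hp_homog _ _ (hP m)) subrr normr0 !mulr_ge0 // exprn_ge0.
apply: contraTneq tK => f0; rewrite -leNgt ler_pdivrMr ?ltr_wpDl //.
move: key; rewrite f0 sub0r normrN normrM normrX exprS mulrA [leRHS]mulrC.
rewrite ler_pM2l ?exprn_gt0 // => /le_trans; apply.
by rewrite mulrC ler_wpM2l // lerDl.
Qed.

(** At the supremum [T] of the parameters up to which [f] vanishes, an isolated zero is excluded by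
    the zeros just before [T], or by the hypothesis near 0 if [T = 0]. So [f] vanishes on both sides
    of [T], which contradicts [T < 1]. *)
Lemma an_segment_zero f x d :
  (forall t : R, 0 <= t <= 1 -> an (x + t *: d) f) ->
  (exists2 e : R, 0 < e & forall t, `|t| < e -> f (x + t *: d) = 0) ->
  f (x + d) = 0.
Proof.
move=> fan [e e0 fe].
pose S : set R := [set t | 0 <= t <= 1 /\ forall s, 0 <= s <= t -> f (x + s *: d) = 0].
have S0 : S 0.
  split=> [|s /andP[s0 s1]]; first by rewrite lexx ler01.
  by apply: fe; rewrite (_ : s = 0) ?normr0 //; apply/eqP; rewrite eq_le s1.
have Sub : ubound S 1 by move=> t [/andP[]].
have hS : has_sup S by split; [exists 0|exists 1].
pose T := sup S.
have T0 : 0 <= T by apply: ub_le_sup => //; exists 1.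
have T1 : T <= 1 by apply: ge_sup => //; exists 0.
have zT s : 0 <= s < T -> f (x + s *: d) = 0.
  move=> /andP[s0 sT]; have [|t [_ tz] st] := @sup_adherent _ S (T - s) _ hS.
    by rewrite subr_gt0.
  by apply: tz; rewrite s0 ltW //; move: st; rewrite -/T; lra.
have fT : an (x + T *: d) f by apply: fan; rewrite T0.
have shift u : x + T *: d + u *: d = x + (T + u) *: d by rewrite scalerDl addrA.
have [[r r0 fr]|[r r0 fr]] := an_line_zero d fT; last first.
  have [TT|TT] := ltP 0 T.
    pose u := Num.min T r / 2; have u0 : 0 < u by rewrite divr_gt0 // lt_min TT.
    have uT : u < T /\ u < r.
      have : u < Num.min T r by rewrite /u ltr_pdivrMr // ltr_pMr ?ltr1n // lt_min TT.
      by rewrite lt_min => /andP.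
    have := fr (- u); rewrite normrN gtr0_norm // u0 uT.2 => /(_ erefl).
    by rewrite shift zT ?eqxx //; case: uT => ? _; apply/andP; split; lra.
  have TE : T = 0 by apply/eqP; rewrite eq_le TT.
  pose u := Num.min e r / 2; have u0 : 0 < u by rewrite divr_gt0 // lt_min e0.
  have : u < Num.min e r by rewrite /u ltr_pdivrMr // ltr_pMr ?ltr1n // lt_min e0.
  rewrite lt_min => /andP[ue ur].
  have := fr u; rewrite gtr0_norm // u0 ur => /(_ erefl).
  by rewrite shift TE add0r fe ?eqxx // gtr0_norm.
have zTr s : 0 <= s < T + r -> f (x + s *: d) = 0.
  move=> /andP[s0 sT]; have [sT'|sT'] := ltP s T; first by apply: zT; rewrite s0.
  have := fr (s - T); rewrite shift subrKC; apply.
  by rewrite ger0_norm ?subr_ge0 //; lra.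
have [lt1|] := ltP T 1; last first.
  move=> T1'; have := zTr 1; rewrite scale1r; apply.
  by rewrite ler01 /=; lra.
have : S (Num.min 1 (T + r / 2)).
  split=> [|s /andP[s0]].
    by rewrite le_min ler01 ge_min lexx addr_ge0 // divr_ge0 // ltW.
  by rewrite le_min => /andP[_ s1]; apply: zTr; rewrite s0 /=; lra.
move=> /(@ub_le_sup _ S _ _) -/(_ ltac:(by exists 1)); rewrite -/T leNgt lt_min lt1 /=.
by rewrite ltrDl divr_gt0.
Qed.

End IdentityTheorem.

(** * Multi-index power series and graded germs *)

Section PowerSeries.
Context {R : realType} {N : nat}.
Implicit Types (f g : 'rV[R]_N -> R) (x y w d : 'rV[R]_N).

Lemma hp_sumT (J : finType) (p : pred J) m (B : J -> R) (P : J -> 'rV[R]_N -> R) :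
  (forall j, p j -> hpoly m (B j) (P j)) ->
  hpoly m (\sum_(j | p j) B j) (fun y => \sum_(j | p j) P j y).
Proof.
move=> hP; elim: (index_enum J) => [|j r IH].
  by apply: hp_zero => [|y]; rewrite big_nil.
have [pj|pj] := boolP (p j); last first.
  by rewrite big_cons (negPf pj); apply: (hp_ext IH) => y; rewrite big_cons (negPf pj).
apply: (hp_add (hP j pj) IH); first by rewrite big_cons pj.
by move=> y; rewrite big_cons pj.
Qed.

Lemma hp_coordX a k : hpoly k 1 (fun y : 'rV[R]_N => y 0 a ^+ k).
Proof.
elim: k => [|k IH]; first by apply: (@hp_cst _ _ 1); rewrite ?normr1.
by apply: (hp_var (a := a) IH) => y; rewrite exprS.
Qed.

Lemma hp_monomial (r : seq 'I_N) (k : 'I_N -> nat) :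
  hpoly (\sum_(i <- r) k i) 1 (fun y : 'rV[R]_N => \prod_(i <- r) y 0 i ^+ k i).
Proof.
elim: r => [|i r IH].
  by rewrite big_nil; apply: (@hp_cst _ _ 1) => [|y]; rewrite ?normr1 ?big_nil.
have := hp_mul (hp_coordX i (k i)) IH; rewrite big_cons mulr1.
by move/hp_ext; apply => y; rewrite big_cons.
Qed.

(** Each multi-index of degree [m] has weight [2 ^ m * prod_i 2 ^ (- a i) = 1]. Dropping the
    constraint on the degree lets the sum factor into [N] geometric sums, each at most 2. *)
Lemma card_degree m :
  #|[pred a : {ffun 'I_N -> 'I_m.+1} | (\sum_i (a i : nat) == m)%N]|%:R
    <= 2 ^+ N * (2 : R) ^+ m.
Proof.
rewrite -sum1_card natr_sum.
apply: (@le_trans _ _ (\sum_(a : {ffun 'I_N -> 'I_m.+1} | (\sum_i (a i : nat) == m)%N)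
   2 ^+ m * \prod_i (2^-1 : R) ^+ a i)).
  rewrite le_eqVlt; apply/orP; left; apply/eqP; apply: eq_bigr => a /eqP am.
  by rewrite -expr_sum am -exprMn divff ?expr1n.
rewrite -mulr_sumr mulrC ler_wpM2r ?exprn_ge0 //.
apply: (@le_trans _ _ (\sum_(a : {ffun 'I_N -> 'I_m.+1}) \prod_i (2^-1 : R) ^+ a i)).
  rewrite big_mkcond; apply: ler_sum => a _; case: ifP => // _.
  by apply: prodr_ge0 => i _; rewrite exprn_ge0 ?invr_ge0.
rewrite -(bigA_distr_bigA (fun (_ : 'I_N) (j : 'I_m.+1) => (2^-1 : R) ^+ j)) /=.
rewrite prodr_const card_ord lerXn2r ?nnegrE ?sumr_ge0 //.
by apply: geometric_sum_le; rewrite lexx invr_ge0 ler0n.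
Qed.

Lemma an_power_series f x C r : 0 < r -> power_series_at f x C r -> an x f.
Proof.
move=> r0 [c [cC cf]].
have C0 : 0 <= C.
  apply: le_trans (cC [ffun=> 0%N]).
  by rewrite mulr_ge0 // exprn_ge0 // ltW.
(* [2 ^ N] and the 2 in [2 / r] pay for the number of monomials in each degree; [r / 16] then meets
   the normalisation [1/8]. *)
exists (C * 2 ^+ N), (2 / r), (r / 16), (homogeneous_part c); split.
- split; rewrite ?mulr_ge0 ?exprn_ge0 ?divr_gt0 //.
  by rewrite (_ : 2 / r * (r / 16) = 8^-1) //; field; rewrite gt_eqF.
- move=> m; have hs (a : {ffun 'I_N -> 'I_m.+1}) : (\sum_i (a i : nat) == m)%N ->
      hpoly m (C * r ^- m) (fun y => c [ffun i => a i : nat] * \prod_i y 0 i ^+ a i).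
    move=> /eqP am; have := hp_scale (c [ffun i => a i : nat])
      (hp_monomial (index_enum 'I_N) (fun i => a i : nat)).
    rewrite am => /hp_weak; apply; rewrite mulr1 ler_pdivlMr ?exprn_gt0 //.
    have := cC [ffun i => a i : nat]; under eq_bigr do rewrite ffunE.
    by rewrite am.
  move/(@hp_sumT _ _ _ (fun=> C * r ^- m)): hs => /hp_weak; apply.
  rewrite sumr_const -[_ *+ _]mulr_natr mulrAC expr_div_n mulrA -mulrA -[leRHS]mulrA.
  have := card_degree m; set k := #|_|%:R => kle.
  have -> : C * 2 ^+ N * (2 ^+ m * r ^- m) = C * (2 ^+ N * 2 ^+ m) * r ^- m by ring.
  by rewrite mulrA ler_wpM2r ?invr_ge0 ?exprn_ge0 ?(ltW r0) // ler_wpM2l.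
- move=> y yr; apply: cf => i; apply: (le_lt_trans (coord_le_norm y i)).
  apply: (le_lt_trans yr); lra.
Qed.

(** The inductive description builds sums in which a monomial may occur repeatedly; the list keeps
    the repetitions, so that the bound on the sum of absolute values passes through unchanged. *)
Lemma hp_list m B (P : 'rV[R]_N -> R) : hpoly m B P ->
  exists l : seq (R * {ffun 'I_N -> nat}),
    [/\ all (fun p : R * {ffun 'I_N -> nat} => (\sum_i p.2 i == m)%N) l, \sum_(p <- l) `|p.1| <= B &
        forall y, P y = \sum_(p <- l) p.1 * \prod_i y 0 i ^+ p.2 i].
Proof.
elim=> {m B P} [c B P cB Pc|m B P Q a hP [l [l1 l2 l3]] Qe|m B1 B2 B P1 P2 Q h1 [l [l1 l2 l3]] h2 [k [k1 k2 k3]] HB Qe|m B Q B0 Qe].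
- exists [:: (c, [ffun=> 0%N])]; split=> [||y].
  + by rewrite /= andbT; apply/eqP; apply: big1 => i _; rewrite ffunE.
  + by rewrite big_seq1.
  + by rewrite Pc big_seq1 /= big1 ?mulr1 // => i _; rewrite ffunE.
- exists [seq (p.1, [ffun i => (p.2 i + (i == a))%N]) | p : R * {ffun 'I_N -> nat} <- l]; split=> [||y].
  + rewrite all_map; apply: sub_all l1 => p /= /eqP pm; apply/eqP.
    under eq_bigr do rewrite ffunE.
    rewrite big_split /= pm (bigD1 a) //= eqxx big1 ?addn1 ?addn0 //.
    by move=> i /negPf ->.
  + by rewrite big_map.
  + rewrite Qe l3 big_map mulr_sumr; apply: eq_bigr => p _ /=.
    rewrite mulrCA; congr (_ * _).
    under [RHS]eq_bigr do rewrite ffunE exprD.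
    rewrite big_split /= mulrC; congr (_ * _).
    by rewrite (bigD1 a) //= eqxx big1 ?mulr1 // => i /negPf ->.
- exists (l ++ k); split=> [||y].
  + by rewrite all_cat l1.
  + by rewrite big_cat /= (le_trans _ HB) // lerD.
  + by rewrite Qe l3 k3 big_cat.
- exists [::]; split=> // [|y]; first by rewrite big_nil.
  by rewrite Qe big_nil.
Qed.

Lemma power_series_an f x : an x f -> exists C r, 0 < r /\ power_series_at f x C r.
Proof.
move=> [C [s [rho [P [[C0 s0 r0 sr] hP cP]]]]].
have /choice[l Hl] := fun m => hp_list (hP m).
(* Repeated monomials are collected here; the degree of [a] selects the homogeneous part in whose
   list to look. *)
pose c (a : {ffun 'I_N -> nat}) := \sum_(p <- l (\sum_i a i)%N | p.2 == a) p.1.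
exists C, rho; split=> //; exists c; split.
- move=> a; set m := (\sum_i a i)%N.
  have [_ l2 _] := Hl m.
  apply: (@le_trans _ _ (C * s ^+ m * rho ^+ m)).
    rewrite ler_wpM2r ?exprn_ge0 ?(ltW r0) // (le_trans _ l2) //.
    rewrite (le_trans (ler_norm_sum _ _ _)) // big_mkcond; apply: ler_sum => p _.
    by case: ifP.
  rewrite -mulrA -exprMn ler_piMr // exprn_ile1 ?mulr_ge0 ?(ltW r0) ?(ltW s0) //.
  by rewrite (le_trans sr) //; lra.
- move=> y yr; have ynr : `|y| <= rho.
    by apply: norm_rV_le => [|a]; [exact: ltW|exact/ltW/yr].
  suff -> : (fun m => homogeneous_part c m y) = (fun m => P m y) by exact: cP.
  apply/funext => m; have [l1 _ ->] := Hl m.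
  transitivity (\sum_(a : {ffun 'I_N -> 'I_m.+1} | (\sum_i (a i : nat) == m)%N)
     \sum_(p <- l m | p.2 == [ffun i => a i : nat]) p.1 * \prod_i y 0 i ^+ p.2 i).
    apply: eq_bigr => a /eqP am; rewrite /c.
    under [(\sum_i _ i)%N]eq_bigr do rewrite ffunE.
    rewrite am mulr_suml; apply: eq_bigr => p /eqP ->; congr (_ * _).
    by apply: eq_bigr => i _; rewrite ffunE.
  rewrite (exchange_big_dep xpredT) //=.
  rewrite !big_seq; apply: eq_bigr => p /(allP l1) /eqP pm.
  have pim i : (p.2 i < m.+1)%N by rewrite ltnS -pm (bigD1 i) //= leq_addr.
  have E (a : {ffun 'I_N -> 'I_m.+1}) :
      ((\sum_i (a i : nat) == m)%N && (p.2 == [ffun i => a i : nat])) =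
      (a == [ffun i => inord (p.2 i)]).
    apply/andP/eqP => [[_ /eqP pa]|->].
      by apply/ffunP => i; rewrite ffunE pa ffunE inord_val.
    split; last by apply/eqP/ffunP => i; rewrite !ffunE inordK.
    by under eq_bigr do rewrite ffunE inordK //; rewrite pm.
  by rewrite (eq_bigl _ _ E) big_pred1_eq.
Qed.

(** The bridge from the multi-index definition of analyticity to germs, with which the later
    arguments work. *)
Lemma analytic_onP (A : set 'rV[R]_N) f :
  analytic_on A f <-> forall x, A x -> an x f.
Proof.
split=> [fA x /fA[C [r [r0]]]|fA x /fA]; first exact: an_power_series.
exact: power_series_an.
Qed.

End PowerSeries.

(** * Restriction of germs to a coordinate subspace *)

Section Restriction.
Context {R : realType} {N K : nat}.

Lemma hp_restrict m B (P : 'rV[R]_(N + K) -> R) : hpoly m B P ->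
  hpoly m B (fun y : 'rV[R]_N => P (row_mx y 0)).
Proof.
elim=> {m B P} [c B P cB Pc|m B P Q a hP IH Qe|m B1 B2 B P1 P2 Q h1 IH1 h2 IH2 HB Qe|m B Q B0 Qe].
- by apply: (hp_cst cB) => y.
- have [b ab|b ab] := splitP a.
    apply: (hp_var (a := b) IH) => y; rewrite Qe; congr (_ * _).
    by rewrite (_ : a = lshift K b) ?row_mxEl //; exact: val_inj.
  apply: hp_zero => [|y]; first exact: hp_ge0 hP.
  rewrite Qe (_ : a = rshift N b); last exact: val_inj.
  by rewrite row_mxEr mxE mul0r.
- by apply: (hp_add IH1 IH2 HB) => y.
- by apply: hp_zero => // y.
Qed.

Lemma norm_row_mx0 (y : 'rV[R]_N) : `|row_mx y (0 : 'rV[R]_K)| <= `|y|.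
Proof.
apply: norm_rV_le => // a; rewrite mxE; case: splitP => b _.
  exact: coord_le_norm.
by rewrite mxE normr0.
Qed.

Lemma an_restrict (f : 'rV[R]_(N + K) -> R) (w : 'rV[R]_N) :
  an (row_mx w 0) f -> an w (fun y => f (row_mx y 0)).
Proof.
move=> [C [s [rho [P [H hP cP]]]]].
exists C, s, rho, (fun m y => P m (row_mx y 0)); split=> //.
  by move=> m; exact: hp_restrict.
move=> y yr; have := cP (row_mx y 0) (le_trans (norm_row_mx0 y) yr).
by rewrite add_row_mx addr0.
Qed.

End Restriction.

(** * Expansions in the step size *)

Section AsymptoticExpansions.
Context {R : realType}.
Implicit Types (u v : R -> R) (c d : nat -> R).

(** The point [h = 0] is left out, because discrete Lagrangians and difference quotients carry
    information for [h != 0] only. *)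
Definition asym u c (P : nat) : Prop := exists K e : R, [/\ 0 <= K, 0 < e &
  forall h, 0 < `|h| < e ->
    `|u h - \sum_(p < P.+1) c p * h ^+ p| <= K * `|h| ^+ P.+1].

Lemma asym_near u v c P :
  (exists2 e : R, 0 < e & forall h, 0 < `|h| < e -> u h = v h) ->
  asym u c P -> asym v c P.
Proof.
move=> [e e0 uv] [K [r [K0 r0 H]]]; exists K, (Num.min e r); split=> //.
  by rewrite lt_min e0.
by move=> h; rewrite lt_min => /and3P[h0 he hr]; rewrite -uv ?H ?h0.
Qed.

Lemma asym_coef u c d P : (forall p, (p <= P)%N -> c p = d p) ->
  asym u c P -> asym u d P.
Proof.
move=> cd [K [r [K0 r0 H]]]; exists K, r; split=> // h /H.
rewrite (eq_bigr (fun p : 'I_P.+1 => d p * h ^+ p)) // => p _.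
by rewrite cd // -ltnS.
Qed.

Lemma asym_trunc u c P : asym u c P.+1 -> asym u c P.
Proof.
move=> [K [r [K0 r0 H]]]; exists (K + `|c P.+1|), (Num.min r 1); split.
- by rewrite addr_ge0.
- by rewrite lt_min r0 ltr01.
move=> h; rewrite lt_min => /and3P[h0 hr h1]; have := H h; rewrite h0 hr => /(_ erefl).
rewrite (@big_ord_recr _ _ _ P.+1) /= opprD addrA; set X := u h - _ => HX.
rewrite -(subrK (c P.+1 * h ^+ P.+1) X) (le_trans (ler_normD _ _)) //.
rewrite mulrDl lerD ?normrM ?normrX // (le_trans HX) //.
by rewrite ler_wpM2l // exprS ler_piMl ?exprn_ge0 // ltW.
Qed.

Lemma asym_weak u c P P' : (P' <= P)%N -> asym u c P -> asym u c P'.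
Proof.
move=> PP; rewrite -(subnK PP); elim: (P - P')%N => // k IH.
by rewrite addSn => /asym_trunc.
Qed.

Lemma asym_poly c M P : (P < M)%N -> asym (fun h => \sum_(p < M) c p * h ^+ p) c P.
Proof.
move=> PM; have : asym (fun h => \sum_(p < M) c p * h ^+ p) c M.-1; last first.
  by apply: asym_weak; rewrite -ltnS (ltn_predK PM).
exists 0, 1; split=> // h _.
by rewrite (ltn_predK PM) subrr normr0 mul0r.
Qed.

Lemma asym_shift u c P : asym u c P.+1 ->
  asym (fun h => (u h - c 0%N) / h) (fun p => c p.+1) P.
Proof.
move=> [K [r [K0 r0 H]]]; exists K, r; split=> // h hr.
have h0 : h != 0 by case/andP: hr; rewrite normr_gt0.
rewrite -(ler_pM2r (x := `|h|)) ?normr_gt0 // -normrM mulrBl divfK //.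
rewrite -mulrA -exprSr (le_trans _ (H h hr)) //.
rewrite (@big_ord_recl _ _ _ P.+1) expr0 mulr1 opprD addrA mulr_suml.
rewrite (eq_bigr (fun i : 'I_P.+1 => c (lift ord0 i) * h ^+ lift ord0 i)) // => i _.
by rewrite -mulrA -exprSr.
Qed.

Lemma asym_lim u c P : asym u c P -> lim (u @ 0^') = c 0%N.
Proof.
move=> /(asym_weak (leq0n P))[K [r [K0 r0 H]]]; apply: cvg_lim => //.
apply/cvgrPdist_le => e e0.
have m0 : 0 < Num.min r (e / (K + 1)) by rewrite lt_min r0 divr_gt0 // ltr_wpDl.
apply/nbhs_ballP; exists (Num.min r (e / (K + 1))) => //.
move=> h; rewrite /ball /= sub0r normrN lt_min => /andP[hr he] h0.
have := H h; rewrite normr_gt0 h0 hr => /(_ erefl).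
rewrite big_ord1 expr0 mulr1 expr1 distrC => /le_trans; apply.
rewrite (@le_trans _ _ (`|h| * (K + 1))) //; first by rewrite mulrC ler_wpM2l // lerDl.
by rewrite -ler_pdivlMr ?ltW // ltr_wpDl.
Qed.

Lemma asym_remainder u c p P : asym u c (p + P) ->
  asym (series_remainder u p) (fun j => c (p + j)%N) P.
Proof.
elim: p P => [|p IH] P //=; rewrite addSnnS => /IH uc.
have L := asym_lim uc; rewrite addn0 in L.
rewrite -/(series_remainder u p) L.
have := asym_shift uc; rewrite addn0 => /asym_coef; apply => j _.
by rewrite addSnnS.
Qed.

(** Each [series_remainder] has the shifted expansion, and its limit at 0 is the leading
    coefficient; so an expansion, however it was found, computes the iterated limits. *)
Lemma series_coef_asym u c P p : (p <= P)%N -> asym u c P -> series_coef u p = c p.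
Proof.
move=> pP; rewrite -(subnKC pP) => /asym_remainder /asym_lim.
by rewrite addn0.
Qed.

Lemma series_coef_near u v p :
  (exists2 e : R, 0 < e & forall h, 0 < `|h| < e -> u h = v h) ->
  series_coef u p = series_coef v p.
Proof.
move=> [e e0 uv]; rewrite /series_coef.
have lim_near (a b : R -> R) : (forall h, 0 < `|h| < e -> a h = b h) ->
    lim (a @ 0^') = lim (b @ 0^').
  move=> ab; suff E : {near 0^', a =1 b}.
    congr lim; rewrite eqEsubset; split; apply: near_eq_cvg => //.
    by near=> h; apply/esym; near: h; exact: E.
  apply/nbhs_ballP; exists e => // h; rewrite /ball /= sub0r normrN => he h0.
  by apply: ab; rewrite normr_gt0 h0.
suff : forall h, 0 < `|h| < e -> series_remainder u p h = series_remainder v p h.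
  exact: lim_near.
elim: p => [|p IH] //= h he.
by rewrite IH // (lim_near _ _ IH).
Unshelve. all: by end_near. Qed.

Lemma asymD u v c d P : asym u c P -> asym v d P ->
  asym (fun h => u h + v h) (fun p => c p + d p) P.
Proof.
move=> [K [r [K0 r0 H]]] [L [s [L0 s0 G]]]; exists (K + L), (Num.min r s); split.
- by rewrite addr_ge0.
- by rewrite lt_min r0.
move=> h; rewrite lt_min => /and3P[h0 hr hs].
under eq_bigr do rewrite mulrDl.
rewrite big_split /= opprD addrACA mulrDl (le_trans (ler_normD _ _)) // lerD //.
  by apply: H; rewrite h0.
by apply: G; rewrite h0.
Qed.

Lemma asymZ k u c P : asym u c P -> asym (fun h => k * u h) (fun p => k * c p) P.
Proof.
move=> [K [r [K0 r0 H]]]; exists (`|k| * K), r; split; rewrite ?mulr_ge0 //.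
move=> h /H; under [X in _ -> `|_ - X| <= _]eq_bigr do rewrite -mulrA.
by rewrite -mulr_sumr -mulrBr normrM -mulrA => /ler_wpM2l; apply.
Qed.

Lemma asym0 P : asym (fun=> 0) (fun=> 0) P.
Proof.
exists 0, 1; split=> // h _; rewrite big1 => [|? _]; last by rewrite mul0r.
by rewrite subrr normr0 mul0r.
Qed.

Lemma asym_sum (J : finType) (u : J -> R -> R) (c : J -> nat -> R) P :
  (forall j, asym (u j) (c j) P) ->
  asym (fun h => \sum_j u j h) (fun p => \sum_j c j p) P.
Proof.
move=> H; elim: (index_enum J) => [|j r IH].
  apply: asym_near (asym_coef _ (asym0 P)); last by move=> p _; rewrite big_nil.
  by exists 1 => // h _; rewrite big_nil.
apply: asym_near (asym_coef _ (asymD (H j) IH)); last by move=> p _; rewrite big_cons.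
by exists 1 => // h _; rewrite big_cons.
Qed.

Lemma asymX u c P : asym u c P ->
  asym (fun h => h * u h) (fun p => if p is p'.+1 then c p' else 0) P.+1.
Proof.
move=> [K [r [K0 r0 H]]]; exists K, r; split=> // h /H.
rewrite (@big_ord_recl _ _ _ P.+1) mul0r add0r.
rewrite [X in _ -> `|_ - X| <= _](_ : _ = h * \sum_(p < P.+1) c p * h ^+ p); last first.
  by rewrite mulr_sumr; apply: eq_bigr => i _ /=; rewrite exprS mulrCA.
rewrite -mulrBr normrM [`|h| ^+ P.+2]exprS mulrCA => /ler_wpM2l; exact.
Qed.

Lemma asymXn j u c P : asym u c P ->
  asym (fun h => h ^+ j * u h) (fun p => if (j <= p)%N then c (p - j)%N else 0) (j + P).
Proof.
move=> uc; elim: j => [|j IH].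
  apply: asym_near (asym_coef _ uc); last by move=> p _; rewrite subn0.
  by exists 1 => // h _; rewrite mul1r.
apply: asym_near (asym_coef _ (asymX IH)); first by exists 1 => // h _; rewrite exprS mulrA.
by case.
Qed.

Lemma triangle_sum (P : nat) (F : nat -> nat -> R) :
  \sum_(m < P.+1) \sum_(k < (P - m).+1) F m k =
  \sum_(k < P.+1) \sum_(m < (P - k).+1) F m k.
Proof.
have E (G : nat -> nat -> R) : \sum_(m < P.+1) \sum_(k < (P - m).+1) G m k =
    \sum_(m < P.+1) \sum_(k < P.+1 | (m + k <= P)%N) G m k.
  apply: eq_bigr => m _; rewrite (big_ord_widen P.+1 (G m)) ?ltnS ?leq_subr //.
  by apply: eq_bigl => k; rewrite ltnS leq_subRL // -ltnS.
rewrite E (E (fun m k => F k m)) (exchange_big_dep xpredT) //=.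
by apply: eq_bigr => k _; apply: eq_bigl => m; rewrite addnC.
Qed.

Lemma asym_bounded u c P : asym u c P -> exists B e : R, [/\ 0 <= B, 0 < e &
  forall h, 0 < `|h| < e -> `|u h| <= B].
Proof.
move=> /(asym_weak (leq0n P))[K [r [K0 r0 H]]].
exists (K + `|c 0%N|), (Num.min r 1); split; rewrite ?addr_ge0 ?lt_min ?r0 //=.
move=> h; rewrite lt_min => /and3P[h0 hr h1].
have := H h; rewrite h0 hr big_ord1 expr0 mulr1 expr1 => /(_ erefl) Hh.
rewrite -(subrK (c 0%N) (u h)) (le_trans (ler_normD _ _)) // lerD2r.
by rewrite (le_trans Hh) // ler_piMr // ltW.
Qed.

(** Induction on the order through [u * v = c 0 * v + h * ((u - c 0) / h) * v], where the quotient
    has the shifted expansion of one order less. *)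
Lemma asymM u v c d P : asym u c P -> asym v d P ->
  asym (fun h => u h * v h) (fun p => \sum_(i < p.+1) c i * d (p - i)%N) P.
Proof.
move=> uc vd; elim: P u c uc vd => [|P IH] u c uc vd.
  have [B [e [B0 e0 HB]]] := asym_bounded vd.
  case: uc vd => K [r [K0 r0 H]] [L [s [L0 s0 G]]].
  exists (K * B + `|c 0%N| * L), (Num.min (Num.min r s) e); split.
  - by rewrite addr_ge0 ?mulr_ge0.
  - by rewrite !lt_min r0 s0.
  move=> h; rewrite !lt_min => /and3P[h0 /andP[hr hs] he].
  have := H h; have := G h; have := HB h; rewrite h0 hr hs he !big_ord1 !expr0 !mulr1 !expr1 subn0.
  move=> /(_ erefl) A /(_ erefl) C /(_ erefl) D.
  rewrite [X in `|X|](_ : _ = (u h - c 0%N) * v h + c 0%N * (v h - d 0%N)); last by ring.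
  rewrite (le_trans (ler_normD _ _)) // !normrM mulrDl lerD //.
    by rewrite mulrAC ler_pM.
  by rewrite -mulrA ler_wpM2l.
have S := IH _ _ (asym_shift uc) (asym_trunc vd).
apply: asym_near (asym_coef _ (asymD (asymZ (c 0%N) vd) (asymX S))).
  exists 1 => // h /andP[]; rewrite normr_gt0 => h0 _.
  by field.
case=> [|p] _; first by rewrite big_ord1 addr0 subn0.
by rewrite (@big_ord_recl _ _ _ p.+1) subn0.
Qed.

(** The mean value inequality is applied to [u] minus the primitive of the polynomial part of [v].
    The value [v 0] is prescribed separately, since [asym] says nothing there. *)
Lemma asym_int u v c P : v 0 = c 0%N ->
  (exists2 e : R, 0 < e & forall t, `|t| < e -> isd u t (v t)) ->
  asym v c P ->
  asym u (fun p => if p is p'.+1 then c p' / p'.+1%:R else u 0) P.+1.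
Proof.
move=> v0 [e e0 uv] [K [r [K0 r0 H]]]; exists K, (Num.min e r); split=> //.
  by rewrite lt_min e0.
move=> h; rewrite lt_min => /and3P[h0 he hr].
pose w t := u t - \sum_(p < P.+1) c p / p.+1%:R * t ^+ p.+1.
have wd t : `|t| <= `|h| -> isd w t (v t - \sum_(p < P.+1) c p * t ^+ p).
  move=> th; apply: isdB; first by apply: uv; exact: le_lt_trans he.
  apply: isd_sum => p _; have := isdZ (c p / p.+1%:R) (isdX p.+1 t).
  by rewrite mulrA divfK.
have := mvt0 (B := K * `|h| ^+ P.+1) wd; rewrite /w.
under [in X in _ - X]eq_bigr do rewrite expr0n /= mulr0.
rewrite big1_eq subr0 (@big_ord_recl _ _ _ P.+1) expr0 mulr1 => Hw.
rewrite opprD addrCA addrC [K * _ ^+ P.+2](_ : _ = K * `|h| ^+ P.+1 * `|h|); last first.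
  by rewrite [`|h| ^+ P.+2]exprSr mulrA.
apply: Hw => t th.
have [->|t0] := eqVneq t 0.
  rewrite v0 big_ord_recl expr0 mulr1 big1 ?addr0 ?subrr ?normr0.
    by rewrite mulr_ge0 // exprn_ge0.
  by move=> i _; rewrite expr0n /= mulr0.
rewrite (le_trans (H t _)) ?normr_gt0 ?t0 ?(le_lt_trans th) //.
by rewrite ler_wpM2l // lerXn2r ?nnegrE.
Qed.

End AsymptoticExpansions.

(* the coefficient of h^p in f(A_0 + h A_1 + h^2 A_2 + ...) *)
HB.lock Definition taylor_coef {R : realType} {N : nat} (p : nat)
    (f : 'rV[R]_N -> R) (A : nat -> 'rV[R]_N) : R :=
  strong_rec (T := ('rV[R]_N -> R) -> (nat -> 'rV[R]_N) -> R) (fun _ _ => 0)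
    (fun p t f A => if p is p'.+1 then
       (\sum_b \sum_(m < p'.+1) m.+1%:R * A m.+1 0 b * t (p' - m)%N (pd b f) A) / p'.+1%:R
     else f (A 0%N)) p f A.
Canonical taylor_coef_unlockable := Unlockable taylor_coef.unlock.

(** * Taylor coefficients of compositions with curves *)

Section TaylorCoefficients.
Context {R : realType} {N : nat}.
Implicit Types (f g : 'rV[R]_N -> R) (A : nat -> 'rV[R]_N).

Lemma taylor_coef0 f A : taylor_coef 0 f A = f (A 0%N).
Proof. by rewrite unlock strong_recE. Qed.

(** This is [d/dh f(A(h)) = sum_b A_b'(h) * (pd b f)(A(h))], read coefficient by coefficient. The
    recursion passes from [f] to [pd b f], which is why the function is an argument of the
    recursively defined object. *)
Lemma taylor_coefS p f A : taylor_coef p.+1 f A =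
  (\sum_b \sum_(m < p.+1) m.+1%:R * A m.+1 0 b * taylor_coef (p - m) (pd b f) A) / p.+1%:R.
Proof.
rewrite unlock strong_recE; congr (_ / _).
apply: eq_bigr => b _; apply: eq_bigr => m _.
by rewrite ltnS leq_subr.
Qed.

Lemma taylor_coef_germ p f g A : germ_eq (A 0%N) f g ->
  taylor_coef p f A = taylor_coef p g A.
Proof.
have [k] := ubnP p; elim: k p f g => // k IH [|p] f g pk fg.
  by rewrite !taylor_coef0; exact: germ_eq_val fg.
rewrite !taylor_coefS; congr (_ / _).
apply: eq_bigr => b _; apply: eq_bigr => m _; congr (_ * _).
apply: IH; last exact: germ_eq_pd.
by rewrite (leq_ltn_trans (leq_subr _ _)).
Qed.

Lemma taylor_coef_ext p f g A : (forall y, f y = g y) ->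
  taylor_coef p f A = taylor_coef p g A.
Proof. by move=> fg; apply: taylor_coef_germ; exists 1. Qed.

Lemma taylor_coef_pdC p a b f A : an (A 0%N) f ->
  taylor_coef p (pd a (pd b f)) A = taylor_coef p (pd b (pd a f)) A.
Proof. by move=> fA; apply: taylor_coef_germ; exact: an_pdC_near. Qed.

Definition jet_curve A (M : nat) (h : R) : 'rV[R]_N :=
  \sum_(m < M.+1) h ^+ m *: A m.

Lemma jet_curveE A M h b :
  jet_curve A M h 0 b = \sum_(m < M.+1) A m 0 b * h ^+ m.
Proof.
by rewrite summxE; apply: eq_bigr => m _; rewrite mxE mulrC.
Qed.

Lemma jet_curve0 A M : jet_curve A M 0 = A 0%N.
Proof.
rewrite /jet_curve big_ord_recl expr0 scale1r big1 ?addr0 // => i _.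
by rewrite expr0n /= scale0r.
Qed.

Lemma isd_jet_curve A M b t : isd (fun h => jet_curve A M h 0 b) t
  (\sum_(m < M) m.+1%:R * A m.+1 0 b * t ^+ m).
Proof.
apply: (@isd_ext _ (fun h => A 0%N 0 b + \sum_(m < M) A m.+1 0 b * h ^+ m.+1)).
  by move=> h; rewrite jet_curveE big_ord_recl expr0 mulr1.
rewrite -[X in isd _ _ X]add0r; apply: isdD; first exact: isd_cst.
apply: isd_sum => m _; have := isdZ (A m.+1 0 b) (isdX m.+1 t).
by rewrite mulrA [A _ _ _ * _]mulrC.
Qed.

(** Induction on the order for all [f] at once: the derivative of the composition is a sum of
    products whose factors [pd b f] fall under the induction hypothesis, and [asym_int] integrates
    it. *)
Lemma taylor_coef_jet_curve P M f A : (P <= M)%N -> an (A 0%N) f ->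
  asym (fun h => f (jet_curve A M h)) (fun p => taylor_coef p f A) P.
Proof.
elim: P f => [|P IH] f PM fA.
  have fA' : an (jet_curve A M 0) f by rewrite jet_curve0.
  have [K [r [K0 r0 H]]] := isd_lipschitz (an_chain fA' (fun b => isd_jet_curve A M b 0)).
  exists K, r; split=> // h /andP[_ hr].
  rewrite big_ord1 taylor_coef0 expr0 mulr1 expr1.
  by have := H h hr; rewrite add0r jet_curve0.
have [e e0 He] := an_chain_near fA.
have [K [r [K0 r0 Hr]]] := curve_lipschitz (fun b => isd_jet_curve A M b 0).
pose v t := \sum_b (\sum_(m < M) m.+1%:R * A m.+1 0 b * t ^+ m) * pd b f (jet_curve A M t).
have vas : asym v (fun p => \sum_b \sum_(m < p.+1)
    m.+1%:R * A m.+1 0 b * taylor_coef (p - m) (pd b f) A) P.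
  apply: asym_sum => b.
  have H1 := asym_poly (fun m => m.+1%:R * A m.+1 0 b) PM.
  exact: asymM H1 (IH _ (ltnW PM) (an_pd b fA)).
have uv : exists2 e : R, 0 < e & forall t, `|t| < e ->
    isd (fun h => f (jet_curve A M h)) t (v t).
  exists (Num.min r (e / (K + 1))); first by rewrite lt_min r0 divr_gt0 // ltr_wpDl.
  move=> t; rewrite lt_min => /andP[tr te].
  have := He _ _ t _ (fun b => isd_jet_curve A M b t).
  rewrite /v; under eq_bigr do rewrite mulrC; apply.
  have := Hr t tr; rewrite add0r jet_curve0 => /le_lt_trans; apply.
  rewrite (@le_lt_trans _ _ (`|t| * (K + 1))) //; first by rewrite mulrC ler_wpM2l // lerDl.
  by rewrite -ltr_pdivlMr // ltr_wpDl.
have v0 : v 0 = \sum_b \sum_(m < 1) m.+1%:R * A m.+1 0 b * taylor_coef (0 - m) (pd b f) A.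
  apply: eq_bigr => b _; rewrite big_ord1 taylor_coef0 jet_curve0; congr (_ * _).
  case: M PM {IH fA He Hr v vas uv} => // M _.
  rewrite big_ord_recl expr0 mulr1 big1 ?addr0 // => i _.
  by rewrite expr0n /= mulr0.
apply: asym_coef (asym_int v0 uv vas) => -[|p] _.
  by rewrite taylor_coef0 jet_curve0.
by rewrite taylor_coefS.
Qed.

Lemma asym_uniform (J : finType) (u : J -> R -> R) (c : J -> nat -> R) P :
  (forall j, asym (u j) (c j) P) -> exists K e : R, [/\ 0 <= K, 0 < e &
  forall h, 0 < `|h| < e -> forall j,
    `|u j h - \sum_(p < P.+1) c j p * h ^+ p| <= K * `|h| ^+ P.+1].
Proof.
move=> /choice[K HK].
have K0 j : 0 <= K j by case: (HK j) => ? [].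
have [r r0 Hr] : exists2 r : R, 0 < r & forall h, `|h| < r -> forall j, 0 < `|h| ->
    `|u j h - \sum_(p < P.+1) c j p * h ^+ p| <= K j * `|h| ^+ P.+1.
  apply: finite_radius => j; have [r [_ r0 Hr]] := HK j; exists r => // h hr h0.
  by apply: Hr; rewrite h0.
exists (\sum_j K j), r; split=> //; first exact: sumr_ge0.
move=> h /andP[h0 hr] j; rewrite (le_trans (Hr h hr j h0)) // ler_wpM2r ?exprn_ge0 //.
by rewrite (bigD1 j) //= lerDl sumr_ge0.
Qed.

(** [f] is Lipschitz near [A 0], so replacing the curve by its polynomial part costs only an error
    of the order of the remainder. *)
Lemma taylor_coef_asym P f A (a : R -> 'rV[R]_N) : an (A 0%N) f ->
  (forall b, asym (fun h => a h 0 b) (fun m => A m 0 b) P) ->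
  asym (fun h => f (a h)) (fun p => taylor_coef p f A) P.
Proof.
move=> fA aA; have [K [e [K0 e0 H]]] := asym_uniform aA.
have [C [r [C0 r0 Hr]]] := taylor_coef_jet_curve (leqnn P) fA.
have [L [s [L0 s0 Hs]]] := curve_lipschitz (fun b => isd_jet_curve A P b 0).
have [D [rho [D0 rho0 Hf]]] := an_lipschitz fA.
pose q := Num.min (Num.min e r) (Num.min (Num.min s 1) (rho / (K + L + 1))).
have KL : 0 < K + L + 1 by rewrite ltr_wpDl // addr_ge0.
exists (D * K + C), q; split; first by rewrite addr_ge0 ?mulr_ge0.
  by rewrite !lt_min e0 r0 s0 ltr01 divr_gt0.
move=> h; rewrite !lt_min => /and3P[h0 /andP[he hr] /andP[/andP[hs h1] hq]].
have hK : `|a h - jet_curve A P h| <= K * `|h| ^+ P.+1.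
  apply: norm_rV_le => [|b]; first by rewrite mulr_ge0 ?exprn_ge0.
  by rewrite !mxE -[X in _ - X]/(jet_curve A P h 0 b) jet_curveE H // h0.
have hL : `|jet_curve A P h - A 0%N| <= L * `|h|.
  by have := Hs h hs; rewrite add0r jet_curve0.
have hK1 : K * `|h| ^+ P.+1 <= K * `|h|.
  by rewrite ler_wpM2l // exprS ler_piMr // exprn_ile1 // ltW.
have KLh : (K + L) * `|h| <= rho.
  rewrite (@le_trans _ _ (`|h| * (K + L + 1))) //; first by rewrite mulrC ler_wpM2l // lerDl.
  by rewrite -ler_pdivlMr // ltW.
have b1 : `|jet_curve A P h - A 0%N| <= rho.
  by rewrite (le_trans hL) // (le_trans _ KLh) // ler_wpM2r // lerDr.
have b2 : `|a h - A 0%N| <= rho.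
  rewrite -(subrK (jet_curve A P h) (a h)) -addrA (le_trans (ler_normD _ _)) //.
  by rewrite (le_trans _ KLh) // mulrDl lerD // (le_trans hK).
have := Hf _ _ b1 b2; rewrite !subrKC.
rewrite (_ : a h - A 0%N - (jet_curve A P h - A 0%N) = a h - jet_curve A P h); last first.
  by rewrite opprB addrA subrK.
move=> fd; rewrite -(subrK (f (jet_curve A P h)) (f (a h))) -addrA.
rewrite (le_trans (ler_normD _ _)) // mulrDl lerD //; last by rewrite Hr // h0.
by rewrite (le_trans fd) // -mulrA ler_wpM2l.
Qed.

Lemma taylor_coef_unique P p f A (c : nat -> R) : (p <= P)%N -> an (A 0%N) f ->
  asym (fun h => f (jet_curve A P h)) c P -> taylor_coef p f A = c p.
Proof.
move=> pP fA /(series_coef_asym pP) <-; apply/esym.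
exact: (series_coef_asym pP (taylor_coef_jet_curve (leqnn P) fA)).
Qed.

Lemma taylor_coefD p f g A : an (A 0%N) f -> an (A 0%N) g ->
  taylor_coef p (fun y => f y + g y) A = taylor_coef p f A + taylor_coef p g A.
Proof.
move=> fA gA; apply: (taylor_coef_unique (leqnn p) (an_add fA gA)
   (c := fun p => taylor_coef p f A + taylor_coef p g A)).
by apply: asymD; exact: taylor_coef_jet_curve.
Qed.

(** The coefficient form of [d/ds f(A_s(h)) = sum_b (d/ds A_s)_b * (pd b f)(A_s(h))].
    Differentiating the recursion produces second derivatives of [f], which their symmetry allows to
    regroup into coefficients of first derivatives. *)
Lemma taylor_coef_isd p f (A : R -> nat -> 'rV[R]_N) (A' : nat -> 'rV[R]_N) t :
  an (A t 0%N) f -> (forall m b, isd (fun s => A s m 0 b) t (A' m 0 b)) ->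
  isd (fun s => taylor_coef p f (A s)) t
    (\sum_b \sum_(m < p.+1) A' m 0 b * taylor_coef (p - m) (pd b f) (A t)).
Proof.
move=> + Ad; have [k] := ubnP p; elim: k p f => // k IH [|p] f pk fA.
  apply: (@isd_ext _ (fun s => f (A s 0%N))) => [s|]; first by rewrite taylor_coef0.
  have := an_chain fA (Ad 0%N); under eq_bigr do rewrite mulrC.
  by under [in X in _ -> X]eq_bigr do rewrite big_ord1 taylor_coef0.
have pS : p.+1%:R != 0 :> R by rewrite pnatr_eq0.
apply: (@isd_ext _ (fun s => p.+1%:R^-1 * \sum_b \sum_(m < p.+1) m.+1%:R * A s m.+1 0 b *
    taylor_coef (p - m) (pd b f) (A s))) => [s|].
  by rewrite taylor_coefS mulrC.
pose T m b := taylor_coef m (pd b f) (A t).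
pose TT m b b' := taylor_coef m (pd b' (pd b f)) (A t).
have D b (m : 'I_p.+1) : isd (fun s => m.+1%:R * A s m.+1 0 b * taylor_coef (p - m) (pd b f) (A s)) t
   (m.+1%:R * A' m.+1 0 b * T (p - m)%N b + m.+1%:R * A t m.+1 0 b *
     \sum_b' \sum_(j < (p - m).+1) A' j 0 b' * TT (p - m - j)%N b b').
  apply: isdM; first exact: isdZ.
  apply: IH; last exact: an_pd.
  by rewrite (leq_ltn_trans (leq_subr _ _)).
have /(isdZ p.+1%:R^-1) := isd_sum (P := xpredT)
  (fun b _ => isd_sum (P := xpredT) (fun m _ => D b m)).
rewrite [X in isd _ _ X -> _](_ : _ = \sum_b \sum_(m < p.+2) A' m 0 b * T (p.+1 - m)%N b) //.
apply: (mulfI pS); rewrite mulrA divff // mul1r.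
under eq_bigr do rewrite big_split /=.
rewrite big_split /= mulr_sumr.
have E b b' : \sum_(m < p.+1) m.+1%:R * A t m.+1 0 b *
      \sum_(j < (p - m).+1) A' j 0 b' * TT (p - m - j)%N b b' =
    \sum_(j < p.+1) A' j 0 b' * \sum_(m < (p - j).+1)
      m.+1%:R * A t m.+1 0 b * TT (p - j - m)%N b b'.
  under eq_bigr do rewrite mulr_sumr.
  rewrite (triangle_sum p (fun m j => m.+1%:R * A t m.+1 0 b * (A' j 0 b' * TT (p - m - j)%N b b'))).
  apply: eq_bigr => j _; rewrite mulr_sumr; apply: eq_bigr => m _.
  by rewrite mulrCA subnAC.
have F b' (j : 'I_p.+1) : \sum_b \sum_(m < (p - j).+1)
      m.+1%:R * A t m.+1 0 b * TT (p - j - m)%N b b' = (p.+1 - j)%:R * T (p.+1 - j)%N b'.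
  have jp : (j <= p)%N by rewrite -ltnS.
  rewrite (subSn jp) /T (taylor_coefS (p - j) (pd b' f) (A t)) [RHS]mulrC divfK; last first.
    by rewrite pnatr_eq0.
  apply: eq_bigr => b _; apply: eq_bigr => m _.
  have C := @taylor_coef_pdC (p - j - m) b' b f (A t) fA.
  rewrite /TT.
  rewrite C.
  reflexivity.
rewrite [X in _ + X](_ : _ = \sum_b' \sum_(j < p.+1) A' j 0 b' * ((p.+1 - j)%:R * T (p.+1 - j)%N b')); last first.
  transitivity (\sum_b \sum_b' \sum_(j < p.+1) A' j 0 b' * \sum_(m < (p - j).+1)
      m.+1%:R * A t m.+1 0 b * TT (p - j - m)%N b b').
    apply: eq_bigr => b _; under [RHS]eq_bigr do rewrite -E.
    rewrite exchange_big /=; apply: eq_bigr => m _.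
    by rewrite -mulr_sumr.
  rewrite exchange_big /=; apply: eq_bigr => b' _; rewrite exchange_big /=.
  by apply: eq_bigr => j _; rewrite -mulr_sumr F.
rewrite -big_split /=; apply: eq_bigr => b _.
rewrite mulr_sumr [X in X + _](_ : _ = \sum_(m < p.+2) m%:R * (A' m 0 b * T (p.+1 - m)%N b)); last first.
  rewrite [RHS]big_ord_recl mul0r add0r; apply: eq_bigr => m _ /=.
  by rewrite subSS mulrA.
rewrite [X in _ + X](_ : _ = \sum_(m < p.+2) (p.+1 - m)%:R * (A' m 0 b * T (p.+1 - m)%N b)); last first.
  rewrite [RHS]big_ord_recr /= subnn mul0r addr0; apply: eq_bigr => m _ /=.
  by rewrite mulrCA.
(* The weights [m] and [p.+1 - m] of the two groups of terms add up to [p.+1], which cancels the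
   denominator of the recursion. *)
rewrite -big_split /=; apply: eq_bigr => m _.
by rewrite -mulrDl -natrD subnKC // -ltnS.
Qed.

End TaylorCoefficients.

(** * Differential polynomials on jets *)

Lemma open_box {R : realType} {n : nat} (A : set 'rV[R]_n) x : open A -> A x ->
  exists2 e : R, 0 < e & forall y, `|y| < e -> A (x + y).
Proof.
move=> oA Ax; have /nbhs_ballP[e /= e0 He] : nbhs x A.
  exact: open_nbhs_nbhs (conj oA Ax).
exists e => // y ye; apply: He.
by rewrite -ball_normE /ball_ /= opprD addNKr normrN.
Qed.

(* Locked copies: unification would otherwise unfold the derivatives. *)
HB.lock Definition jp {R : realType} {n : nat} (l : nat) (a : 'I_n)
    (F : jet R n -> R) : jet R n -> R := jet_partial l a F.
Canonical jp_unlockable := Unlockable jp.unlock.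

HB.lock Definition tot {R : realType} {n : nat} (F : jet R n -> R) :
    jet R n -> R := total_derivative F.
Canonical tot_unlockable := Unlockable tot.unlock.

Lemma jpE {R : realType} {n : nat} l (a : 'I_n) (F : jet R n -> R) :
  jet_partial l a F = jp l a F.
Proof. by rewrite jp.unlock. Qed.

Lemma totE {R : realType} {n : nat} : @total_derivative R n = tot.
Proof. by apply/funext => F; rewrite tot.unlock. Qed.

Lemma isd_jp {R : realType} {n : nat} l (a : 'I_n) (F : jet R n -> R) z d :
  isd (fun s => F (fun l' => if l' == l then z l' + s *: delta_mx 0 a else z l')) 0 d ->
  jp l a F z = d.
Proof. by rewrite -jpE; exact: isd_derive1. Qed.

Lemma isd_tot {R : realType} {n : nat} (F : jet R n -> R) z d :
  isd (fun t => F (fun l => z l + t *: z l.+1)) 0 d -> tot F z = d.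
Proof. by rewrite -totE; exact: isd_derive1. Qed.

Section DifferentialPolynomials.
Context {R : realType} {n : nat}.
Variable Omega : set 'rV[R]_n.
Hypothesis Omega_open : open Omega.
Implicit Types (F G H : jet R n -> R) (z : jet R n) (f : 'rV[R]_(n + n) -> R).

Definition state z : 'rV[R]_(n + n) := row_mx (z 0%N) (z 1%N).

Definition tan (f : 'rV[R]_(n + n) -> R) := forall w, Omega (lsubmx w) -> an w f.

Definition eqO F G := forall z, Omega (z 0%N) -> F z = G z.

(* functions that are polynomial in q^(l), l >= 2, with coefficients analytic
   in (q, q') *)
Inductive dp : (jet R n -> R) -> Prop :=
| dp_an_ f F : tan f -> (forall z, Omega (z 0%N) -> F z = f (state z)) -> dp F
| dp_coord_ l a F : (forall z, Omega (z 0%N) -> F z = z l 0 a) -> dp F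
| dp_add_ F G H : dp F -> dp G -> (forall z, Omega (z 0%N) -> H z = F z + G z) -> dp H
| dp_mul_ F G H : dp F -> dp G -> (forall z, Omega (z 0%N) -> H z = F z * G z) -> dp H.

Lemma dp_ext F G : dp F -> eqO G F -> dp G.
Proof.
move=> dF GF; apply: (dp_add_ dF (@dp_an_ (fun=> 0) (fun=> 0) _ _)) => //.
  by move=> w _; exact: an_cst.
by move=> z zO; rewrite addr0 GF.
Qed.

Lemma dp_an f : tan f -> dp (fun z => f (state z)).
Proof. by move=> fO; exact: dp_an_ fO _. Qed.

Lemma dp_coord l a : dp (fun z => z l 0 a).
Proof. by apply: (@dp_coord_ l a). Qed.

Lemma dp_cst c : dp (fun=> c).
Proof. by apply: (@dp_an_ (fun=> c)) => // w _; exact: an_cst. Qed.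

Lemma dp_add F G : dp F -> dp G -> dp (fun z => F z + G z).
Proof. by move=> dF dG; exact: dp_add_ dF dG _. Qed.

Lemma dp_mul F G : dp F -> dp G -> dp (fun z => F z * G z).
Proof. by move=> dF dG; exact: dp_mul_ dF dG _. Qed.

Lemma dp_scale c F : dp F -> dp (fun z => c * F z).
Proof. by move=> dF; exact: dp_mul (dp_cst c) dF. Qed.

Lemma dp_sum (J : finType) (p : pred J) (F : J -> jet R n -> R) :
  (forall j, p j -> dp (F j)) -> dp (fun z => \sum_(j | p j) F j z).
Proof.
move=> dF; elim: (index_enum J) => [|j r IH].
  by apply: (dp_ext (dp_cst 0)) => z _; rewrite big_nil.
have [pj|pj] := boolP (p j); last first.
  by apply: (dp_ext IH) => z _; rewrite big_cons (negPf pj).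
by apply: (dp_ext (dp_add (dF j pj) IH)) => z _; rewrite big_cons pj.
Qed.

Lemma isd_state (Z : R -> jet R n) (Z' : jet R n) t :
  (forall l a, isd (fun s => Z s l 0 a) t (Z' l 0 a)) ->
  forall b, isd (fun s => state (Z s) 0 b) t (state Z' 0 b).
Proof.
move=> Zd b; rewrite /state.
have [c bc|c bc] := splitP b.
  rewrite (_ : b = lshift n c) ?row_mxEl; last exact: val_inj.
  by apply: (isd_ext _ (Zd 0%N c)) => s; rewrite row_mxEl.
rewrite (_ : b = rshift n c) ?row_mxEr; last exact: val_inj.
by apply: (isd_ext _ (Zd 1%N c)) => s; rewrite row_mxEr.
Qed.

Lemma curve_in_Omega (c : R -> 'rV[R]_n) (c' : 'I_n -> R) t : Omega (c t) ->
  (forall a, isd (fun s => c s 0 a) t (c' a)) ->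
  exists2 e : R, 0 < e & forall h, `|h| < e -> Omega (c (t + h)).
Proof.
move=> /(open_box Omega_open)[r r0 Hr] /curve_lipschitz[K [e [K0 e0 He]]].
exists (Num.min e (r / (K + 1))); first by rewrite lt_min e0 divr_gt0 // ltr_wpDl.
move=> h; rewrite lt_min => /andP[he hr]; rewrite -(subrKC (c t) (c (t + h))).
apply: Hr; rewrite (le_lt_trans (He _ he)) // (@le_lt_trans _ _ (`|h| * (K + 1))) //.
  by rewrite mulrC ler_wpM2l // lerDl.
by rewrite -ltr_pdivlMr // ltr_wpDl.
Qed.

(** The chain rule is required along arbitrary differentiable curves of jets, which covers partial
    and total derivatives at once; that the components are again differential polynomials makes the
    class closed under both. *)
Definition gradient F (M : nat) (d : nat -> 'I_n -> jet R n -> R) : Prop :=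
  [/\ forall l a, dp (d l a),
      forall l a z, (M <= l)%N -> Omega (z 0%N) -> d l a z = 0 &
      forall (Z : R -> jet R n) (Z' : jet R n) t, Omega (Z t 0%N) ->
        (forall l a, isd (fun s => Z s l 0 a) t (Z' l 0 a)) ->
        isd (fun s => F (Z s)) t (\sum_(l < M) \sum_a d l a (Z t) * Z' l 0 a)].

Lemma gradient_weak F M M' d : (M <= M')%N -> gradient F M d -> gradient F M' d.
Proof.
move=> MM [d1 d2 d3]; split=> // [l a z Ml zO|Z Z' t ZO Zd].
  by rewrite d2 // (leq_trans MM).
have := d3 Z Z' t ZO Zd; rewrite (big_ord_widen M' (fun l => \sum_a d l a (Z t) * Z' l 0 a)) //.
rewrite big_mkcond /=; rewrite (eq_bigr (fun l : 'I_M' => \sum_a d l a (Z t) * Z' l 0 a)) // => l _.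
case: ifPn => //; rewrite -leqNgt => Ml; rewrite big1 // => a _.
by rewrite d2 ?mul0r.
Qed.

Lemma isd_eqO F G (Z : R -> jet R n) (Z' : jet R n) t D : eqO G F -> Omega (Z t 0%N) ->
  (forall l a, isd (fun s => Z s l 0 a) t (Z' l 0 a)) ->
  isd (fun s => F (Z s)) t D -> isd (fun s => G (Z s)) t D.
Proof.
move=> GF ZO Zd; apply: isd_near.
have [e e0 He] := curve_in_Omega ZO (Zd 0%N).
by exists e => // h /He hO; rewrite GF.
Qed.

Lemma dp_gradient F : dp F -> exists M d, gradient F M d.
Proof.
elim=> {F} [f F fO Ff|l a F Fl|F G H dF [M1 [d1 g1]] dG [M2 [d2 g2]] HFG|F G H dF [M1 [d1 g1]] dG [M2 [d2 g2]] HFG].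
- exists 2, (fun l a z => if l == 0%N then pd (lshift n a) f (state z)
    else if l == 1%N then pd (rshift n a) f (state z) else 0); split.
  + move=> l a; case: l => [|[|l]] /=; last exact: dp_cst.
      by apply: dp_an => w wO; apply: an_pd; exact: fO.
    by apply: dp_an => w wO; apply: an_pd; exact: fO.
  + by move=> [|[|l]].
  + move=> Z Z' t ZO Zd; apply: (isd_eqO Ff ZO Zd).
    have sO : Omega (lsubmx (state (Z t))) by rewrite row_mxKl.
    have := an_chain (fO _ sO) (isd_state Zd).
    rewrite big_split_ord /= big_ord_recl big_ord1 /=.
    under eq_bigr do rewrite row_mxEl; under [X in _ + X]eq_bigr do rewrite row_mxEr.
    by [].
- exists l.+1, (fun l' a' _ => ((l' == l) && (a' == a))%:R); split.
  + by move=> l' a'; exact: dp_cst.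
  + by move=> l' a' z ll _; rewrite gtn_eqF.
  + move=> Z Z' t ZO Zd; apply: (isd_eqO Fl ZO Zd).
    rewrite (_ : \sum_(_ < _) _ = Z' l 0 a); first exact: Zd.
    rewrite big_ord_recr /= big1 ?add0r => [|l' _].
      rewrite eqxx (bigD1 a) //= eqxx mul1r big1 ?addr0 // => a' /negPf ->.
      by rewrite mul0r.
    by rewrite big1 // => a' _; rewrite ltn_eqF //= mul0r.
- have := gradient_weak (leq_maxl M1 M2) g1; have := gradient_weak (leq_maxr M1 M2) g2.
  set M := maxn M1 M2 => -[c1 c2 c3] [b1 b2 b3].
  exists M, (fun l a z => d1 l a z + d2 l a z); split.
  + by move=> l a; exact: dp_add.
  + by move=> l a z Ml zO; rewrite b2 // c2 // addr0.
  + move=> Z Z' t ZO Zd; apply: (isd_eqO HFG ZO Zd).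
    have := isdD (b3 Z Z' t ZO Zd) (c3 Z Z' t ZO Zd).
    rewrite -big_split /=; under eq_bigr do rewrite -big_split /=.
    by under eq_bigr do under eq_bigr do rewrite -mulrDl.
- have := gradient_weak (leq_maxl M1 M2) g1; have := gradient_weak (leq_maxr M1 M2) g2.
  set M := maxn M1 M2 => -[c1 c2 c3] [b1 b2 b3].
  exists M, (fun l a z => d1 l a z * G z + F z * d2 l a z); split.
  + by move=> l a; apply: dp_add; exact: dp_mul.
  + by move=> l a z Ml zO; rewrite b2 // c2 // mul0r mulr0 addr0.
  + move=> Z Z' t ZO Zd; apply: (isd_eqO HFG ZO Zd).
    have := isdM (b3 Z Z' t ZO Zd) (c3 Z Z' t ZO Zd).
    rewrite mulr_suml mulr_sumr -big_split /=.
    under eq_bigr do rewrite mulr_suml mulr_sumr -big_split /=.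
    under eq_bigr do under eq_bigr do rewrite mulrAC mulrA -mulrDl.
    by [].
Qed.

Lemma gradientE F M d l a z : gradient F M d -> Omega (z 0%N) ->
  isd (fun s => F (fun l' => if l' == l then z l' + s *: delta_mx 0 a else z l')) 0 (d l a z).
Proof.
move=> [d1 d2 d3] zO.
pose Z s : jet R n := fun l' => if l' == l then z l' + s *: delta_mx 0 a else z l'.
pose Z' : jet R n := fun l' => if l' == l then delta_mx 0 a else 0.
have Z0 : Z 0 = z by apply/funext => l'; rewrite /Z scale0r addr0 if_same.
have Zd l' b : isd (fun s => Z s l' 0 b) 0 (Z' l' 0 b).
  rewrite /Z /Z'; case: eqP => _; first exact: isd_line.
  by rewrite mxE; exact: isd_cst.
have := d3 Z Z' 0; rewrite Z0 => /(_ zO Zd).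
rewrite (_ : \sum_(_ < _) _ = d l a z) //.
have [Ml|lM] := leqP M l.
  rewrite (d2 l a z Ml zO) big1 // => l' _; rewrite big1 // => b _.
  by rewrite /Z' ltn_eqF ?mxE ?mulr0 // (leq_trans (ltn_ord l')).
rewrite (bigD1 (Ordinal lM)) //= [X in _ + X]big1 ?addr0 => [|l' /negPf ll].
  by rewrite /Z' eqxx sum_delta.
rewrite big1 // => b _; rewrite /Z' (_ : (l' == l :> nat) = false) ?mxE ?mulr0 //.
Qed.

Lemma gradient_jp F M d l a z : gradient F M d -> Omega (z 0%N) ->
  jp l a F z = d l a z.
Proof. by move=> g zO; apply: isd_jp; exact: gradientE g zO. Qed.

Lemma dp_jet_partial l a F : dp F -> dp (jp l a F).
Proof.
move=> /dp_gradient[M [d g]]; case: (g) => d1 _ _.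
by apply: (dp_ext (d1 l a)) => z zO; exact: gradient_jp g zO.
Qed.

Definition order F (M : nat) : Prop :=
  forall l a z, (M <= l)%N -> Omega (z 0%N) -> jp l a F z = 0.

Lemma dp_order F : dp F -> exists M, order F M.
Proof.
move=> /dp_gradient[M [d g]]; exists M => l a z Ml zO.
by rewrite (gradient_jp _ _ g zO); case: g => _ d2 _; exact: d2.
Qed.

Lemma sum_order F M M' (c : nat -> 'I_n -> R) z : order F M -> (M <= M')%N ->
  Omega (z 0%N) ->
  \sum_(l < M) \sum_a jp l a F z * c l a =
  \sum_(l < M') \sum_a jp l a F z * c l a.
Proof.
move=> oF MM zO; rewrite (big_ord_widen M' (fun l => \sum_a jp l a F z * c l a)) //.
rewrite big_mkcond /=; apply: eq_bigr => l _.
case: ifPn => //; rewrite -leqNgt => Ml; rewrite big1 // => a _.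
by rewrite oF ?mul0r.
Qed.

Lemma dp_chain F M (Z : R -> jet R n) (Z' : jet R n) t : dp F -> order F M ->
  Omega (Z t 0%N) -> (forall l a, isd (fun s => Z s l 0 a) t (Z' l 0 a)) ->
  isd (fun s => F (Z s)) t (\sum_(l < M) \sum_a jp l a F (Z t) * Z' l 0 a).
Proof.
move=> /dp_gradient[M' [d g]] oF ZO Zd.
have := gradient_weak (leq_maxr M M') g; case=> _ _ /(_ Z Z' t ZO Zd).
rewrite (sum_order (fun l a => Z' l 0 a) oF (leq_maxl M M') ZO).
under eq_bigr do under eq_bigr do rewrite -(gradient_jp _ _ g ZO).
by [].
Qed.

Lemma dp_isd_partial F l a z : dp F -> Omega (z 0%N) ->
  isd (fun s => F (fun l' => if l' == l then z l' + s *: delta_mx 0 a else z l')) 0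
    (jp l a F z).
Proof.
move=> /dp_gradient[M [d g]] zO; rewrite (gradient_jp _ _ g zO).
exact: gradientE g zO.
Qed.

Lemma dp_isd_total F z : dp F -> Omega (z 0%N) ->
  isd (fun t => F (fun l => z l + t *: z l.+1)) 0 (tot F z).
Proof.
move=> dF zO; have [M oF] := dp_order dF.
have := @dp_chain F M (fun t l => z l + t *: z l.+1) (fun l => z l.+1) 0 dF oF.
rewrite scale0r addr0 => /(_ zO) /(_ (fun l a => isd_line (z l) (z l.+1) 0 a)) D.
by have := D; rewrite -(isd_tot D).
Qed.

Lemma tot_order F M z : dp F -> order F M -> Omega (z 0%N) ->
  tot F z = \sum_(l < M) \sum_a jp l a F z * z l.+1 0 a.
Proof.
move=> dF oF zO; apply: isd_tot.
have := @dp_chain F M (fun t l => z l + t *: z l.+1) (fun l => z l.+1) 0 dF oF.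
rewrite scale0r addr0 => /(_ zO) /(_ (fun l a => isd_line (z l) (z l.+1) 0 a)).
rewrite (_ : (fun l => z l + 0 *: z l.+1) = z) //.
by apply/funext => l; rewrite scale0r addr0.
Qed.

Lemma dp_total_derivative F : dp F -> dp (tot F).
Proof.
move=> dF; have [M oF] := dp_order dF.
apply: (@dp_ext (fun z => \sum_(l < M) \sum_a jp l a F z * z l.+1 0 a)).
  apply: dp_sum => l _; apply: dp_sum => a _; apply: dp_mul; first exact: dp_jet_partial.
  exact: dp_coord.
by move=> z zO; exact: tot_order.
Qed.

Lemma eqO_partial F G l a : eqO F G -> eqO (jp l a F) (jp l a G).
Proof.
move=> FG z zO; rewrite -!jpE /jet_partial !derive1E; apply: near_eq_derive; apply/near0P.
have [e e0 He] := open_box Omega_open zO.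
exists e => // h he; rewrite add0r; apply: FG; case: eqP => // _; apply: He.
rewrite normrZ; apply: le_lt_trans he; rewrite ler_piMr //; exact: norm_delta_rV.
Qed.

Lemma eqO_total F G : eqO F G -> eqO (tot F) (tot G).
Proof.
move=> FG z zO; rewrite -!totE /total_derivative !derive1E; apply: near_eq_derive.
have [||e e0 He] := @curve_in_Omega (fun t => z 0%N + t *: z 1%N) (fun a => z 1%N 0 a) 0.
- by rewrite scale0r addr0.
- by move=> a; exact: isd_line.
apply/near0P; exists e => // h he; rewrite add0r; apply: FG.
by have := He h he; rewrite add0r.
Qed.

Lemma eqO_iter_total F G j : eqO F G ->
  eqO (iter j tot F) (iter j tot G).
Proof. by move=> FG; elim: j => //= j; exact: eqO_total. Qed.

Lemma dp_iter_total F j : dp F -> dp (iter j tot F).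
Proof. by move=> dF; elim: j => //= j; exact: dp_total_derivative. Qed.

Lemma partialD l a F G z : dp F -> dp G -> Omega (z 0%N) ->
  jp l a (fun z => F z + G z) z = jp l a F z + jp l a G z.
Proof.
by move=> dF dG zO; apply: isd_jp; apply: isdD; exact: dp_isd_partial.
Qed.

Lemma partialM l a F G z : dp F -> dp G -> Omega (z 0%N) ->
  jp l a (fun z => F z * G z) z =
  jp l a F z * G z + F z * jp l a G z.
Proof.
move=> dF dG zO; apply: isd_jp.
have := isdM (dp_isd_partial l a dF zO) (dp_isd_partial l a dG zO).
rewrite (_ : (fun l' => if l' == l then z l' + 0 *: delta_mx 0 a else z l') = z) //.
by apply/funext => l'; rewrite scale0r addr0 if_same.
Qed.

Lemma partial_sum l a (J : finType) (p : pred J) (F : J -> jet R n -> R) z :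
  (forall j, p j -> dp (F j)) -> Omega (z 0%N) ->
  jp l a (fun z => \sum_(j | p j) F j z) z = \sum_(j | p j) jp l a (F j) z.
Proof.
move=> dF zO; apply: isd_jp; apply: isd_sum => j pj.
exact: dp_isd_partial (dF j pj) zO.
Qed.

Lemma partial_cst l a c z : jp l a (fun=> c : R) z = 0.
Proof. by apply: isd_jp; exact: isd_cst. Qed.

Lemma partial_coord l a m b z :
  jp l a (fun z => z m 0 b) z = ((m == l) && (b == a))%:R.
Proof.
apply: isd_jp; case: eqP => _ /=; last exact: isd_cst.
by have := isd_line (z m) (delta_mx 0 a : 'rV[R]_n) 0 b; rewrite mxE eqxx.
Qed.

Lemma totalD F G z : dp F -> dp G -> Omega (z 0%N) ->
  tot (fun z => F z + G z) z = tot F z + tot G z.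
Proof.
by move=> dF dG zO; apply: isd_tot; apply: isdD; exact: dp_isd_total.
Qed.

Lemma total_scale c F z : dp F -> Omega (z 0%N) ->
  tot (fun z => c * F z) z = c * tot F z.
Proof.
by move=> dF zO; apply: isd_tot; apply: isdZ; exact: dp_isd_total.
Qed.

Lemma total_sum (J : finType) (p : pred J) (F : J -> jet R n -> R) z :
  (forall j, p j -> dp (F j)) -> Omega (z 0%N) ->
  tot (fun z => \sum_(j | p j) F j z) z = \sum_(j | p j) tot (F j) z.
Proof.
move=> dF zO; apply: isd_tot; apply: isd_sum => j pj.
exact: dp_isd_total (dF j pj) zO.
Qed.

Lemma partial_an l a f z : tan f -> Omega (z 0%N) ->
  jp l a (fun z => f (state z)) z =
  if l == 0%N then pd (lshift n a) f (state z)
  else if l == 1%N then pd (rshift n a) f (state z) else 0.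
Proof.
move=> fO zO; apply: isd_jp.
pose Z s : jet R n := fun l' => if l' == l then z l' + s *: delta_mx 0 a else z l'.
pose Z' : jet R n := fun l' => if l' == l then delta_mx 0 a else 0.
have Z0 : Z 0 = z by apply/funext => l'; rewrite /Z scale0r addr0 if_same.
have Zd l' b : isd (fun s => Z s l' 0 b) 0 (Z' l' 0 b).
  rewrite /Z /Z'; case: eqP => _; first exact: isd_line.
  by rewrite mxE; exact: isd_cst.
have sO : an (state (Z 0)) f by apply: fO; rewrite Z0 row_mxKl.
have := an_chain sO (isd_state Zd); rewrite Z0 big_split_ord /=.
rewrite [X in isd _ _ X -> _](_ : _ = if l == 0%N then pd (lshift n a) f (state z)
  else if l == 1%N then pd (rshift n a) f (state z) else 0) //.
under eq_bigr do rewrite row_mxEl; under [X in _ + X]eq_bigr do rewrite row_mxEr.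
rewrite /Z'; case: l {Z Z' Z0 Zd sO} => [|[|l]] /=.
- rewrite (sum_delta (fun b => pd (lshift n b) f (state z))) big1 ?addr0 // => b _.
  by rewrite mxE mulr0.
- rewrite (sum_delta (fun b => pd (rshift n b) f (state z))) big1 ?add0r // => b _.
  by rewrite mxE mulr0.
- by rewrite !big1 ?addr0 // => b _; rewrite mxE mulr0.
Qed.

Lemma tan_pd a f : tan f -> tan (pd a f).
Proof. by move=> fO w wO; apply: an_pd; exact: fO. Qed.

Lemma partialC l a m b F : dp F ->
  eqO (jp l a (jp m b F)) (jp m b (jp l a F)).
Proof.
elim=> {F} [f F fO Ff|k c F Fl|F G H dF IHF dG IHG HFG|F G H dF IHF dG IHG HFG] z zO.
- have E l' a' : eqO (jp l' a' F) (fun z => if l' == 0%N then pd (lshift n a') f (state z)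
      else if l' == 1%N then pd (rshift n a') f (state z) else 0).
    by move=> y yO; rewrite (eqO_partial _ _ Ff yO) partial_an.
  have sO : an (state z) f by apply: fO; rewrite row_mxKl.
  have C l' a' f' : tan f' -> jp l' a' (fun z => f' (state z)) z =
    if l' == 0%N then pd (lshift n a') f' (state z)
    else if l' == 1%N then pd (rshift n a') f' (state z) else 0.
    by move=> f'O; rewrite partial_an.
  rewrite (eqO_partial l a (E m b) zO) (eqO_partial m b (E l a) zO).
  case: m l => [|[|m]] [|[|l]] /=; rewrite ?C ?partial_cst //=; try exact: tan_pd;
  by rewrite an_pdC.
- have E l' a' : eqO (jp l' a' F) (fun=> ((k == l') && (c == a'))%:R).
    by move=> y yO; rewrite (eqO_partial _ _ Fl yO) partial_coord.
  by rewrite (eqO_partial l a (E m b) zO) (eqO_partial m b (E l a) zO) !partial_cst.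
- have E l' a' : eqO (jp l' a' H) (fun z => jp l' a' F z + jp l' a' G z).
    by move=> y yO; rewrite (eqO_partial _ _ HFG yO) partialD.
  rewrite (eqO_partial l a (E m b) zO) (eqO_partial m b (E l a) zO).
  have dl := dp_jet_partial l a dF; have dm := dp_jet_partial m b dF.
  have el := dp_jet_partial l a dG; have em := dp_jet_partial m b dG.
  by rewrite (partialD l a dm em zO) (partialD m b dl el zO) IHF // IHG.
- have E l' a' : eqO (jp l' a' H) (fun z => jp l' a' F z * G z + F z * jp l' a' G z).
    by move=> y yO; rewrite (eqO_partial _ _ HFG yO) partialM.
  rewrite (eqO_partial l a (E m b) zO) (eqO_partial m b (E l a) zO).
  have dl := dp_jet_partial l a dF; have dm := dp_jet_partial m b dF.
  have el := dp_jet_partial l a dG; have em := dp_jet_partial m b dG.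
  rewrite (partialD l a (dp_mul dm dG) (dp_mul dF em) zO) (partialD m b (dp_mul dl dG) (dp_mul dF el) zO).
  rewrite (partialM l a dm dG zO) (partialM l a dF em zO) (partialM m b dl dG zO) (partialM m b dF el zO).
  rewrite IHF // IHG //; ring.
Qed.

(** In [tot F = sum_k d_k F * z k.+1] the coordinate [z l] also occurs as an explicit factor, for
    [k = l - 1]; this gives the extra term. The other terms agree because partial derivatives
    commute. *)
Lemma partial_total l a F z : dp F -> Omega (z 0%N) ->
  jp l a (tot F) z =
  tot (jp l a F) z +
  (if l is l'.+1 then jp l' a F z else 0).
Proof.
move=> dF zO; have [M0 oF0] := dp_order dF; have [M1 oF1] := dp_order (dp_jet_partial l a dF).
(* Large enough for the orders of [F] and of its derivative, and for the index [l - 1] to occur in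
   the sum. *)
pose M := maxn (maxn M0 M1) l.+1.
have oF : order F M.
  by move=> k b y Mk; apply: oF0; apply: leq_trans Mk; rewrite /M -maxnA leq_maxl.
have oF' : order (jp l a F) M.
  by move=> k b y Mk; apply: oF1; apply: leq_trans Mk; rewrite /M (maxnC M0) -maxnA leq_maxl.
have E : eqO (tot F) (fun z => \sum_(k < M) \sum_b jp k b F z * z k.+1 0 b).
  by move=> y yO; exact: tot_order.
rewrite (eqO_partial l a E zO) partial_sum //; last first.
  by move=> k _; apply: dp_sum => b _; apply: dp_mul; [exact: dp_jet_partial|exact: dp_coord].
rewrite (tot_order (dp_jet_partial l a dF) oF' zO).
under eq_bigr => k _.
  rewrite partial_sum //; last first.
    by move=> b _; apply: dp_mul; [exact: dp_jet_partial|exact: dp_coord].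
  under eq_bigr => b _.
    rewrite partialM //; [|exact: dp_jet_partial|exact: dp_coord].
    rewrite (partialC _ _ _ _ dF zO) partial_coord; over.
  rewrite big_split /=; over.
rewrite big_split /=; congr (_ + _).
have lM : (l < M)%N by rewrite /M leq_maxr.
clearbody M; case: l {oF1 oF'} lM => [|l] lM.
  by rewrite big1 // => k _; rewrite big1 // => b _; rewrite mulr0.
rewrite (bigD1 (Ordinal (ltnW lM))) //= [X in _ + X]big1 ?addr0 => [|k kl].
  rewrite (bigD1 a) //= !eqxx mulr1 big1 ?addr0 // => b /negPf ->.
  by rewrite andbF mulr0.
rewrite big1 // => b _; rewrite eqSS (_ : (k == l :> nat) = false) ?mulr0 //.
by apply: contraNF kl => /eqP kl; apply/eqP/val_inj.
Qed.

End DifferentialPolynomials.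

(** * Reduction of jets along a second-order equation *)

Section Tangential.
Context {R : realType} {n : nat}.
Variable Omega : set 'rV[R]_n.
Hypothesis Omega_open : open Omega.
Implicit Types (f : 'rV[R]_(n + n) -> R) (w : 'rV[R]_(n + n)).

Definition eqT (f g : 'rV[R]_(n + n) -> R) := forall w, Omega (lsubmx w) -> f w = g w.

Lemma lsubmxD (w y : 'rV[R]_(n + n)) : lsubmx (w + y) = lsubmx w + lsubmx y.
Proof. by apply/rowP => a; rewrite !mxE. Qed.

Lemma norm_lsubmx (y : 'rV[R]_(n + n)) : `|lsubmx y| <= `|y|.
Proof. by apply: norm_rV_le => // a; rewrite mxE coord_le_norm. Qed.

Lemma eqT_germ f g w : eqT f g -> Omega (lsubmx w) -> germ_eq w f g.
Proof.
move=> fg /(open_box Omega_open)[e e0 He]; exists e => // y ye; apply: fg.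
by rewrite lsubmxD; apply: He; exact: le_lt_trans (norm_lsubmx y) ye.
Qed.

Lemma tan_ext f g : tan Omega f -> eqT f g -> tan Omega g.
Proof.
by move=> fO fg w wO; apply: an_ext (fO w wO) _; exact: eqT_germ.
Qed.

Lemma eqT_pd f g b : eqT f g -> eqT (pd b f) (pd b g).
Proof. by move=> fg w wO; apply: pd_ext; exact: eqT_germ. Qed.

Variable f0 : 'rV[R]_n -> 'rV[R]_n -> 'rV[R]_n.

(** The vector field on states that represents [q'' = f0 q q']; [lie] is the derivative along it,
    and [on_shell w] the infinite jet of its integral curve through [w]. *)
Definition direction w : 'rV[R]_(n + n) := row_mx (rsubmx w) (f0 (lsubmx w) (rsubmx w)).

Definition lie f w : R := \sum_b pd b f w * direction w 0 b.

Definition on_shell w : jet R n := fun l => prolong f0 l (lsubmx w) (rsubmx w).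

Definition flat_prolong l a w : R := on_shell w l 0 a.

Definition tan_field := forall a, tan Omega (fun w => f0 (lsubmx w) (rsubmx w) 0 a).

Lemma tan_direction b : tan_field -> tan Omega (fun w => direction w 0 b).
Proof.
move=> fO; rewrite /direction; have [c bc|c bc] := splitP b.
  apply: (@tan_ext (fun w => w 0 (rshift n c))) => w wO; first exact: an_coord.
  by rewrite (_ : b = lshift n c) ?row_mxEl ?mxE //; exact: val_inj.
apply: (@tan_ext (fun w => f0 (lsubmx w) (rsubmx w) 0 c)) => w wO; first exact: fO.
by rewrite (_ : b = rshift n c) ?row_mxEr //; exact: val_inj.
Qed.

Lemma tan_lie f : tan_field -> tan Omega f -> tan Omega (lie f).
Proof.
move=> f0O fO w wO; apply: an_sum => b _; apply: an_mul.
  by apply: an_pd; exact: fO.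
exact: tan_direction.
Qed.

Lemma isd_lie f w : tan Omega f -> Omega (lsubmx w) ->
  isd (fun t => f (w + t *: direction w)) 0 (lie f w).
Proof. by move=> fO wO; apply: an_isd_line; exact: fO. Qed.

Lemma eqT_lie f g : eqT f g -> eqT (lie f) (lie g).
Proof. by move=> fg w wO; apply: eq_bigr => b _; rewrite (eqT_pd b fg wO). Qed.

Lemma eqT_iter_lie f g j : eqT f g -> eqT (iter j lie f) (iter j lie g).
Proof. by move=> fg; elim: j => //= j; exact: eqT_lie. Qed.

Lemma tan_iter_lie f j : tan_field -> tan Omega f -> tan Omega (iter j lie f).
Proof. by move=> f0O fO; elim: j => //= j; exact: tan_lie. Qed.

Lemma lie_scale c f : tan Omega f -> eqT (lie (fun w => c * f w)) (fun w => c * lie f w).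
Proof.
move=> fO w wO; rewrite /lie mulr_sumr; apply: eq_bigr => b _.
by rewrite pdZ ?mulrA //; exact: fO.
Qed.

Lemma iter_lie_scale c f j : tan_field -> tan Omega f ->
  eqT (iter j lie (fun w => c * f w)) (fun w => c * iter j lie f w).
Proof.
move=> f0O fO; elim: j => [|j IH] // w wO /=.
by rewrite (eqT_lie IH wO) lie_scale //; exact: tan_iter_lie.
Qed.

Lemma prolong1 q v : prolong f0 1 q v = v.
Proof.
apply/rowP => a; rewrite mxE /=; apply: isd_derive1.
exact: isd_line.
Qed.

Lemma prolong2 q v : prolong f0 2 q v = f0 q v.
Proof.
apply/rowP => a; rewrite mxE; apply: isd_derive1.
apply: isd_ext (isd_line v (f0 q v) 0 a) => t.
by rewrite -/(prolong f0 1 (q + t *: v) (v + t *: f0 q v)) prolong1.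
Qed.

Lemma flat_prolongS l a : tan Omega (flat_prolong l a) ->
  eqT (flat_prolong l.+1 a) (lie (flat_prolong l a)).
Proof.
move=> lO w wO; rewrite /flat_prolong /on_shell /= mxE; apply: isd_derive1.
apply: isd_ext (isd_lie lO wO) => t.
rewrite /flat_prolong /on_shell /direction; congr (prolong f0 l _ _ 0 a).
  by apply/rowP => b; rewrite !mxE (unsplitK (inl _)) mxE.
by apply/rowP => b; rewrite !mxE (unsplitK (inr _)).
Qed.

Lemma tan_flat_prolong l a : tan_field -> tan Omega (flat_prolong l a).
Proof.
move=> f0O; elim: l => [|l IH].
  apply: (@tan_ext (fun w => w 0 (lshift n a))) => w wO; first exact: an_coord.
  by rewrite /flat_prolong /on_shell /= mxE.
by apply: (tan_ext (tan_lie f0O IH)) => w wO; rewrite (flat_prolongS IH wO).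
Qed.

Lemma state_on_shell w : state (on_shell w) = w.
Proof. by rewrite /state /on_shell prolong1 /= hsubmxK. Qed.

Definition pull (F : jet R n -> R) w : R := F (on_shell w).

Lemma tan_pull F : tan_field -> dp Omega F -> tan Omega (pull F).
Proof.
move=> f0O; elim=> {F} [f F fO Ff|l a F Fl|F G H dF IHF dG IHG HFG|F G H dF IHF dG IHG HFG].
- by apply: (tan_ext fO) => w wO; rewrite /pull Ff // state_on_shell.
- by apply: (tan_ext (tan_flat_prolong l a f0O)) => w wO; rewrite /pull Fl.
- apply: (@tan_ext (fun w => pull F w + pull G w)) => w wO.
    by apply: an_add; [exact: IHF|exact: IHG].
  by rewrite /pull HFG.
- apply: (@tan_ext (fun w => pull F w * pull G w)) => w wO.
    by apply: an_mul; [exact: IHF|exact: IHG].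
  by rewrite /pull HFG.
Qed.

Lemma isd_pull F M w u : tan_field -> dp Omega F -> order Omega F M -> Omega (lsubmx w) ->
  isd (fun t => pull F (w + t *: u)) 0
    (\sum_(l < M) \sum_a jp l a F (on_shell w) * \sum_b pd b (flat_prolong l a) w * u 0 b).
Proof.
move=> f0O dF oF wO.
have := dp_chain Omega_open (Z := fun t => on_shell (w + t *: u))
  (Z' := fun l => \row_a \sum_b pd b (flat_prolong l a) w * u 0 b) (t := 0) dF oF.
rewrite scale0r addr0 => /(_ wO); under eq_bigr do under eq_bigr do rewrite mxE.
apply=> l a; rewrite mxE.
by apply: (an_isd_line (f := flat_prolong l a)); exact: tan_flat_prolong.
Qed.

Lemma pd_pull F M w b : tan_field -> dp Omega F -> order Omega F M -> Omega (lsubmx w) ->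
  pd b (pull F) w =
  \sum_(l < M) \sum_a jp l a F (on_shell w) * pd b (flat_prolong l a) w.
Proof.
move=> f0O dF oF wO; apply: isd_pd; have := isd_pull (delta_mx 0 b) f0O dF oF wO.
by under eq_bigr do under eq_bigr do rewrite sum_delta.
Qed.

(** On shell every jet coordinate is the derivative of the previous one along the flow, by
    [flat_prolongS], so the total derivative becomes [lie]. *)
Lemma lie_pull F : tan_field -> dp Omega F -> eqT (lie (pull F)) (pull (tot F)).
Proof.
move=> f0O dF w wO; have [M oF] := dp_order Omega_open dF.
have := isd_pull (direction w) f0O dF oF wO.
move/isd_unique => /(_ _ (isd_lie (tan_pull f0O dF) wO)) <-.
rewrite /pull (tot_order Omega_open dF oF) //.
apply: eq_bigr => l _; apply: eq_bigr => a _; congr (_ * _).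
rewrite -[RHS]/(flat_prolong l.+1 a w) (flat_prolongS _ wO) //.
exact: tan_flat_prolong.
Qed.

Lemma iter_lie_pull F j : tan_field -> dp Omega F ->
  eqT (iter j lie (pull F)) (pull (iter j tot F)).
Proof.
move=> f0O dF; elim: j => [|j IH] // w wO /=.
rewrite (eqT_lie IH wO); apply: lie_pull => //.
exact: dp_iter_total.
Qed.

Lemma pd_flat0 b a w : pd b (flat_prolong 0 a) w = (b == lshift n a)%:R.
Proof.
rewrite (pd_ext (g := fun w => w 0 (lshift n a))) ?pd_coord //.
by exists 1 => // y _; rewrite /flat_prolong /on_shell /= mxE.
Qed.

Lemma pd_flat1 b a w : pd b (flat_prolong 1 a) w = (b == rshift n a)%:R.
Proof.
rewrite (pd_ext (g := fun w => w 0 (rshift n a))) ?pd_coord //.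
by exists 1 => // y _; rewrite /flat_prolong /on_shell prolong1 mxE.
Qed.

End Tangential.

(** * Discrete Lagrangians exact on shell *)

Section ExactDiscreteLagrangian.
Context {R : realType} {n : nat}.
Variable Omega : set 'rV[R]_n.
Hypothesis Omega_open : open Omega.
Variable f0 : 'rV[R]_n -> 'rV[R]_n -> 'rV[R]_n.
Hypothesis f0_tan : tan_field Omega f0.
Variable lam : 'rV[R]_(n + n) -> R.
Hypothesis lam_tan : tan Omega lam.

Let Lam (z : jet R n) := lam (state z).
Let X := lie f0.
Let J := on_shell f0.
Let pi a w := jp 1 a Lam (J w).

Hypothesis lam_el : forall w a, Omega (lsubmx w) ->
  jp 0 a Lam (J w) = tot (jp 1 a Lam) (J w).

Lemma dp_Lam : dp Omega Lam.
Proof. exact: dp_an. Qed.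

Lemma jp_Lam l a z : (1 < l)%N -> Omega (z 0%N) -> jp l a Lam z = 0.
Proof. by move=> l1 zO; rewrite (partial_an l a lam_tan zO); case: l l1 => [|[|l]]. Qed.

(** Iterating the commutator [partial_total] produces Pascal's rule; only the derivatives of [Lam]
    in [q] and [q'] survive. *)
Lemma jp_iter_Lam p l a z : Omega (z 0%N) -> jp l a (iter p tot Lam) z =
  'C(p, l)%:R * iter (p - l) tot (jp 0 a Lam) z +
  (if l is l'.+1 then 'C(p, l')%:R * iter (p - l') tot (jp 1 a Lam) z else 0).
Proof.
have d0 := dp_jet_partial Omega_open 0 a dp_Lam.
have d1 := dp_jet_partial Omega_open 1 a dp_Lam.
elim: p l z => [|p IH] l z zO.
  case: l => [|[|l]]; rewrite ?mul1r ?mul0r ?addr0 ?add0r //.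
  by rewrite jp_Lam.
rewrite [iter p.+1 _ _]/= (partial_total Omega_open) //; last first.
  by apply: dp_iter_total => //; exact: dp_Lam.
have S (m : nat) (F : jet R n -> R) : dp Omega F ->
    'C(p, m)%:R * tot (iter (p - m) tot F) z = 'C(p, m)%:R * iter (p.+1 - m) tot F z.
  move=> dF; have [mp|pm] := leqP m p; first by rewrite subSn.
  by rewrite bin_small // !mul0r.
have dI F j : dp Omega F -> dp Omega (iter j tot F) by exact: dp_iter_total.
have T : tot (jp l a (iter p tot Lam)) z =
  'C(p, l)%:R * iter (p.+1 - l) tot (jp 0 a Lam) z +
  (if l is l'.+1 then 'C(p, l')%:R * iter (p.+1 - l') tot (jp 1 a Lam) z else 0).
  rewrite (eqO_total Omega_open (G := fun z => 'C(p, l)%:R * iter (p - l) tot (jp 0 a Lam) z +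
     (if l is l'.+1 then 'C(p, l')%:R * iter (p - l') tot (jp 1 a Lam) z else 0))) //; last first.
    by move=> y yO; exact: IH.
  have dA : dp Omega (fun z => 'C(p, l)%:R * iter (p - l) tot (jp 0 a Lam) z).
    by apply: dp_scale; exact: dI.
  have dB : dp Omega (fun z => if l is l'.+1 then 'C(p, l')%:R * iter (p - l') tot (jp 1 a Lam) z else 0).
    by case: (l) => [|l']; [exact: dp_cst|apply: dp_scale; exact: dI].
  rewrite (totalD Omega_open dA dB zO) (total_scale Omega_open _ (dI _ _ d0) zO) S //.
  congr (_ + _); case: (l) => [|l']; first by apply: isd_tot; exact: isd_cst.
  by rewrite (total_scale Omega_open _ (dI _ _ d1) zO) S.
rewrite T; case: l {T} => [|l]; first by rewrite !bin0 addr0.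
rewrite IH // binS natrD mulrDl -!addrA; congr (_ + _).
rewrite subSS addrCA; congr (_ + _).
case: l => [|l]; first by rewrite !bin0 addr0.
by rewrite subSS -mulrDl -natrD -binS.
Qed.

(** On shell the Euler-Lagrange equation turns the derivative of [Lam] in [q] into the time
    derivative of the momentum [pi]; the two binomial terms then merge into one. *)
Lemma pull_jp_iter p l a : eqT Omega (pull f0 (jp l a (iter p tot Lam)))
  (fun w => 'C(p.+1, l)%:R * iter (p.+1 - l) X (pi a) w).
Proof.
move=> w wO.
have d0 := dp_jet_partial Omega_open 0 a dp_Lam.
have d1 := dp_jet_partial Omega_open 1 a dp_Lam.
have E0 j : iter j tot (jp 0 a Lam) (J w) = iter j.+1 X (pi a) w.
  rewrite -[LHS]/(pull f0 (iter j tot (jp 0 a Lam)) w) -(iter_lie_pull Omega_open j f0_tan d0 wO).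
  rewrite iterSr; apply: (eqT_iter_lie Omega_open f0 j _ wO) => y yO.
  by rewrite -[RHS]/(lie f0 (pull f0 (jp 1 a Lam)) y) (lie_pull Omega_open f0_tan d1 yO) /pull -lam_el.
have E1 j : iter j tot (jp 1 a Lam) (J w) = iter j X (pi a) w.
  by rewrite -[LHS]/(pull f0 (iter j tot (jp 1 a Lam)) w) -(iter_lie_pull Omega_open j f0_tan d1 wO).
rewrite /pull jp_iter_Lam //= E0.
have [lp|pl] := leqP l p; last first.
  rewrite bin_small // mul0r add0r; case: l pl => [//|l pl].
  rewrite E1 subSS binS [X in _ = (X + _)%:R * _]bin_small // ?add0n //.
rewrite -subSn //; case: l lp => [|l] lp; first by rewrite !bin0 addr0.
by rewrite E1 subSS binS natrD mulrDl.
Qed.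

Lemma tan_pi a : tan Omega (pi a).
Proof.
by apply: (@tan_pull _ _ _ Omega_open f0 (jp 1 a Lam)) => //; apply: dp_jet_partial => //; exact: dp_Lam.
Qed.

(* Phi p is the coefficient of h^p in a discrete Lagrangian density; b m a is
   the coefficient of h^m in the derivative with respect to the end point *)
Variables (Phi : nat -> jet R n -> R) (b : nat -> 'I_n -> jet R n -> R).
Hypothesis Phi_dp : forall p, dp Omega (Phi p).
Hypothesis Phi_partial : forall p l a z, Omega (z 0%N) ->
  jp l.+1 a (Phi p) z = if (l <= p)%N then b (p - l) a z / l.+1`!%:R else 0.
Variable k : nat.
Hypothesis Phi_exact : forall p, (p <= k)%N -> eqT Omega (pull f0 (Phi p))
  (fun w => iter p X lam w / p.+1`!%:R).

Lemma Phi_order p : order Omega (Phi p) p.+2.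
Proof. by move=> [//|l] a z pl zO; rewrite Phi_partial // leqNgt (pl : (p < l)%N). Qed.

Lemma iter_Lam_order p : order Omega (iter p tot Lam) p.+2.
Proof.
move=> l a z pl zO; rewrite jp_iter_Lam // bin_small 1?ltnW // mul0r add0r.
by case: l pl => // l pl; rewrite bin_small ?mul0r.
Qed.

(* both sides of Phi_exact, differentiated in the state *)
Lemma Phi_exact_pd p c w : (p <= k)%N -> Omega (lsubmx w) ->
  \sum_(l < p.+2) \sum_a jp l a (Phi p) (J w) * pd c (flat_prolong f0 l a) w =
  \sum_(l < p.+2) \sum_a ('C(p.+1, l)%:R / p.+1`!%:R * iter (p.+1 - l) X (pi a) w)
     * pd c (flat_prolong f0 l a) w.
Proof.
move=> pk wO; rewrite -(pd_pull Omega_open c f0_tan (Phi_dp p) (@Phi_order p) wO).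
rewrite (eqT_pd Omega_open c (Phi_exact pk) wO).
have dL : dp Omega (iter p tot Lam) by apply: dp_iter_total => //; exact: dp_Lam.
rewrite (eqT_pd Omega_open c (g := fun w => p.+1`!%:R^-1 * pull f0 (iter p tot Lam) w)) //; last first.
  move=> y yO; rewrite -(iter_lie_pull Omega_open p f0_tan dp_Lam yO) mulrC; congr (_ * _).
  by apply: (eqT_iter_lie Omega_open f0 p _ yO) => u uO; rewrite /pull /Lam state_on_shell.
rewrite pdZ; last exact: (tan_pull Omega_open f0_tan dL).
rewrite (pd_pull Omega_open c f0_tan dL (@iter_Lam_order p) wO) mulr_sumr.
apply: eq_bigr => l _; rewrite mulr_sumr; apply: eq_bigr => a _.
rewrite -[jp l a _ (on_shell f0 w)]/(pull f0 (jp l a (iter p tot Lam)) w) pull_jp_iter //.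
by rewrite !mulrA; congr (_ * _ * _); rewrite mulrC.
Qed.

Lemma factorial_bin p l : (l <= p)%N ->
  'C(p, l)%:R / p`!%:R = (l`!%:R * (p - l)`!%:R)^-1 :> R.
Proof.
move=> lp; rewrite -(bin_fact lp) !natrM invfM mulrA divff ?mul1r //.
by rewrite pnatr_eq0 -lt0n bin_gt0.
Qed.

(** Differentiation in the velocity: [q] does not depend on it, [q'] contributes the unknown [b p a]
    alone, and every [q^(l)] with [l >= 2] carries a [b] of smaller index, so that these terms agree
    on both sides by induction and cancel. *)
Lemma b_on_shell p a w : (p <= k)%N -> Omega (lsubmx w) ->
  b p a (J w) = iter p X (pi a) w / p`!%:R.
Proof.
have [m] := ubnP p; elim: m p a w => // m IH p a w pm pk wO.
have := Phi_exact_pd (rshift n a) pk wO.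
rewrite !(big_ord_recl p.+1) !(big_ord_recl p) /=.
rewrite big1 ?add0r => [|c _]; last by rewrite pd_flat0 eq_rlshift mulr0.
rewrite [X in _ = X + _ -> _]big1 ?add0r => [|c _]; last first.
  by rewrite pd_flat0 eq_rlshift mulr0.
rewrite /bump /= !add1n.
have D (g : 'I_n -> R) : \sum_c g c * pd (rshift n a) (flat_prolong f0 1 c) w = g a.
  rewrite (bigD1 a) //= pd_flat1 eqxx mulr1 big1 ?addr0 // => c /negPf ca.
  by rewrite pd_flat1 eq_rshift eq_sym ca mulr0.
have f1 : (1`!)%:R = 1 :> R by [].
have H2 : \sum_(i < p) \sum_c jp (1 + (1 + i)) c (Phi p) (J w) *
      pd (rshift n a) (flat_prolong f0 (1 + (1 + i)) c) w =
    \sum_(i < p) \sum_c 'C(p.+1, 1 + (1 + i))%:R / p.+1`!%:R *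
      iter (p.+1 - (1 + (1 + i))) X (pi c) w *
      pd (rshift n a) (flat_prolong f0 (1 + (1 + i)) c) w.
  apply: eq_bigr => i _; apply: eq_bigr => c _; congr (_ * _).
  rewrite !add1n Phi_partial // ltn_ord IH //; last 2 first.
  - by have := ltn_ord i; lia.
  - by rewrite (leq_trans (leq_subr _ _)).
  rewrite factorial_bin ?ltnS // subSS.
  by rewrite invfM [RHS]mulrC [RHS]mulrA [LHS]mulrAC.
rewrite H2 => /addIr; rewrite !D Phi_partial // leq0n subn0 f1 divr1 => ->.
rewrite factorial_bin // subSS subn0 f1 mul1r; exact: mulrC.
Qed.

(** Differentiation in the position instead: with all [b] known, the derivative of [Phi p] in [q] is
    the only remaining unknown. *)
Lemma Phi0_on_shell p a w : (p <= k)%N -> Omega (lsubmx w) ->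
  jp 0 a (Phi p) (J w) = iter p.+1 X (pi a) w / p.+1`!%:R.
Proof.
move=> pk wO; have := Phi_exact_pd (lshift n a) pk wO.
rewrite !(big_ord_recl p.+1) /=.
have D (g : 'I_n -> R) : \sum_c g c * pd (lshift n a) (flat_prolong f0 0 c) w = g a.
  rewrite (bigD1 a) //= pd_flat0 eqxx mulr1 big1 ?addr0 // => c /negPf ca.
  by rewrite pd_flat0 eq_lshift eq_sym ca mulr0.
have H2 : \sum_(i < p.+1) \sum_c jp (bump 0 i) c (Phi p) (J w) *
      pd (lshift n a) (flat_prolong f0 (bump 0 i) c) w =
    \sum_(i < p.+1) \sum_c 'C(p.+1, bump 0 i)%:R / p.+1`!%:R *
      iter (p.+1 - bump 0 i) X (pi c) w *
      pd (lshift n a) (flat_prolong f0 (bump 0 i) c) w.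
  apply: eq_bigr => i _; apply: eq_bigr => c _; congr (_ * _).
  rewrite /bump /= add1n Phi_partial // -ltnS ltn_ord b_on_shell //; last first.
    by rewrite (leq_trans (leq_subr _ _)).
  rewrite factorial_bin // subSS.
  by rewrite invfM [RHS]mulrC [RHS]mulrA [LHS]mulrAC.
rewrite H2 => /addIr; rewrite !D => ->.
by rewrite bin0 mul1r mulrC.
Qed.

Lemma euler_on_shell p c w : (p <= k)%N -> Omega (lsubmx w) ->
  euler p.+2 (Phi p) c (J w) = 0.
Proof.
move=> pk wO; rewrite /euler totE.
under eq_bigr do rewrite jpE.
transitivity (\sum_(j < p.+3) (-1) ^+ j * 'C(p.+1, j)%:R *
    (iter p.+1 X (pi c) w / p.+1`!%:R)).
  apply: eq_bigr => j _; rewrite -mulrA; congr (_ * _).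
  have dj := dp_jet_partial Omega_open j c (Phi_dp p).
  rewrite -[LHS]/(pull f0 (iter j tot (jp j c (Phi p))) w).
  rewrite -(iter_lie_pull Omega_open j f0_tan dj wO).
  have E : eqT Omega (pull f0 (jp j c (Phi p)))
      (fun w => 'C(p.+1, j)%:R / p.+1`!%:R * iter (p.+1 - j) X (pi c) w).
    move=> y yO; rewrite /pull; case: (j : nat) => [|l].
      by rewrite Phi0_on_shell // bin0 subn0 mul1r mulrC.
    rewrite Phi_partial //; case: ifPn => lp.
      rewrite b_on_shell ?(leq_trans (leq_subr _ _)) // factorial_bin // subSS.
      by rewrite invfM [RHS]mulrC [RHS]mulrA [LHS]mulrAC.
    by rewrite bin_small ?mul0r // ltnS ltnNge.
  rewrite (eqT_iter_lie Omega_open f0 j E wO).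
  rewrite (iter_lie_scale Omega_open _ _ f0_tan (tan_iter_lie Omega_open _ f0_tan (tan_pi c)) wO).
  rewrite -iterD; have [jp1|jp1] := leqP j p.+1.
    by rewrite subnKC // -mulrA; congr (_ * _); rewrite mulrC.
  by rewrite bin_small // !mul0r.
(* The index [p.+2] contributes a zero binomial coefficient; what is left is [(1 - 1) ^ p.+1]. *)
rewrite -mulr_suml big_ord_recr /= bin_small // mulr0 addr0.
have := @exprDn R 1 (-1) p.+1; rewrite subrr expr0n /=.
under eq_bigr do rewrite expr1n mul1r -[_ *+ _]mulr_natr.
by move=> <-; rewrite mul0r.
Qed.

(* Psi p is the coefficient of h^p in the same density centred at the
   midpoint *)
Variable Psi : nat -> jet R n -> R.
Hypothesis Psi_shift : forall p, eqO Omega (Psi p)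
  (fun z => \sum_(i < p.+1) (- 2^-1) ^+ i / i`!%:R * iter i tot (Phi (p - i)) z).

(** The coefficients of [e^(-x/2) * (e^x - 1) / x]: the shift to the midpoint applied to the exact
    coefficients [1 / (p+1)!]. *)
Definition midpoint_coef (p : nat) : R :=
  \sum_(i < p.+1) (- 2^-1) ^+ i / i`!%:R / (p - i).+1`!%:R.

Lemma dp_Psi p : dp Omega (Psi p).
Proof.
apply: (dp_ext _ (@Psi_shift p)); apply: dp_sum => i _; apply: dp_scale.
exact: dp_iter_total.
Qed.

Lemma Psi_on_shell p : (p <= k)%N ->
  eqT Omega (pull f0 (Psi p)) (fun w => midpoint_coef p * iter p X lam w).
Proof.
move=> pk w wO; rewrite /pull Psi_shift // /midpoint_coef mulr_suml.
apply: eq_bigr => i _; rewrite -[RHS]mulrA; congr (_ * _).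
rewrite -[LHS]/(pull f0 (iter i tot (Phi (p - i))) w) -(iter_lie_pull Omega_open i f0_tan (Phi_dp _) wO).
have E : eqT Omega (pull f0 (Phi (p - i)))
    (fun w => (p - i).+1`!%:R^-1 * iter (p - i) X lam w).
  by move=> y yO; rewrite Phi_exact ?(leq_trans (leq_subr _ _)) // mulrC.
rewrite (eqT_iter_lie Omega_open f0 i E wO) (iter_lie_scale Omega_open _ _ f0_tan (tan_iter_lie Omega_open _ f0_tan lam_tan) wO).
by rewrite -iterD subnKC // -ltnS.
Qed.

Lemma mesh_on_shell p (c : nat -> R) w : (p <= k)%N -> Omega (lsubmx w) ->
  \sum_(j < p./2.+1) c j * iter (2 * j) total_derivative (Psi (p - 2 * j)) (J w) =
  (\sum_(j < p./2.+1) c j * midpoint_coef (p - 2 * j)) * iter p X lam w.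
Proof.
move=> pk wO; rewrite totE mulr_suml; apply: eq_bigr => j _; rewrite -mulrA; congr (_ * _).
rewrite -[LHS]/(pull f0 (iter (2 * j) tot (Psi (p - 2 * j))) w).
rewrite -(iter_lie_pull Omega_open (2 * j) f0_tan (dp_Psi _) wO).
rewrite (eqT_iter_lie Omega_open f0 (2 * j) (Psi_on_shell _) wO); last first.
  by rewrite (leq_trans (leq_subr _ _)).
rewrite (iter_lie_scale Omega_open _ _ f0_tan (tan_iter_lie Omega_open _ f0_tan lam_tan) wO).
have jp : (2 * j <= p)%N.
  rewrite mul2n (@leq_trans (p./2).*2) ?leq_double -1?ltnS //.
  by rewrite ltnS -{2}(odd_double_half p) leq_addl.
by rewrite -iterD subnKC.
Qed.

End ExactDiscreteLagrangian.

(** * Analytic dependence of determinants and inverses *)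

Section AnalyticMatrices.
Context {R : realType} {N : nat}.

Lemma an_det m (x : 'rV[R]_N) (A : 'rV[R]_N -> 'M[R]_m) :
  (forall i j, an x (fun y => A y i j)) -> an x (fun y => \det (A y)).
Proof.
move=> Ax; rewrite /determinant; apply: an_sum => s _; apply: an_mul.
  exact: an_cst.
by apply: an_prod => i _.
Qed.

Lemma an_invmx m (x : 'rV[R]_N) (A : 'rV[R]_N -> 'M[R]_m) i j :
  (forall i j, an x (fun y => A y i j)) ->
  (exists2 e : R, 0 < e & forall y, `|y| < e -> A (x + y) \in unitmx) ->
  an x (fun y => invmx (A y) i j).
Proof.
move=> Ax [e e0 Au].
(* Cramer's rule gives [invmx] at invertible matrices, whereas [invmx] returns singular matrices
   unchanged; hence the neighbourhood in the hypothesis. *)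
apply: (@an_ext _ _ _ (fun y => (\det (A y))^-1 * (\adj (A y)) i j)).
  apply: an_mul.
    apply: an_inv; first exact: an_det.
    by have := Au 0; rewrite normr0 addr0 unitmxE unitfE; apply.
  apply: (@an_eq _ _ _ (fun y => (-1) ^+ (j + i) * \det (row' j (col' i (A y))))).
    by move=> y; rewrite /adjugate mxE.
  apply: an_mul; first exact: an_cst.
  apply: an_det => k l.
  by apply: (an_eq _ (Ax (lift j k) (lift i l))) => y; rewrite !mxE.
by exists e => // y ye; rewrite /invmx Au // !mxE.
Qed.

End AnalyticMatrices.

(** * Elimination of higher derivatives *)

Section PolynomialFamilies.
Context {R : realType} {n : nat}.
Variable Omega : set 'rV[R]_n.
Hypothesis Omega_open : open Omega.
Implicit Types (w : 'rV[R]_(n + n)) (Phi Psi : R -> 'rV[R]_(n + n) -> R).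

(* polynomials in s with coefficients analytic in (q, q') *)
Inductive pol : (R -> 'rV[R]_(n + n) -> R) -> Prop :=
| pol_tan_ f Phi : tan Omega f ->
    (forall s w, Omega (lsubmx w) -> Phi s w = f w) -> pol Phi
| pol_X_ Psi Phi : pol Psi ->
    (forall s w, Omega (lsubmx w) -> Phi s w = s * Psi s w) -> pol Phi
| pol_add_ Phi1 Phi2 Phi : pol Phi1 -> pol Phi2 ->
    (forall s w, Omega (lsubmx w) -> Phi s w = Phi1 s w + Phi2 s w) -> pol Phi.

Lemma pol_tan f : tan Omega f -> pol (fun=> f).
Proof. by move=> fO; exact: pol_tan_ fO _. Qed.

Lemma pol_cst c : pol (fun _ _ => c).
Proof. by apply: pol_tan => w _; exact: an_cst. Qed.

Lemma pol_ext Phi Psi : pol Phi ->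
  (forall s w, Omega (lsubmx w) -> Psi s w = Phi s w) -> pol Psi.
Proof.
move=> pP H; apply: (pol_add_ pP (pol_cst 0)) => s w wO.
by rewrite addr0 H.
Qed.

Lemma pol_add Phi Psi : pol Phi -> pol Psi -> pol (fun s w => Phi s w + Psi s w).
Proof. by move=> p1 p2; exact: pol_add_ p1 p2 _. Qed.

Lemma pol_mulX Phi : pol Phi -> pol (fun s w => s * Phi s w).
Proof. by move=> p1; exact: pol_X_ p1 _. Qed.

Lemma pol_mulXn j Phi : pol Phi -> pol (fun s w => s ^+ j * Phi s w).
Proof.
move=> p1; elim: j => [|j /pol_mulX]; first by apply: (pol_ext p1) => s w _; rewrite mul1r.
by move=> p2; apply: (pol_ext p2) => s w _; rewrite exprS mulrA.
Qed.

Lemma pol_mul Phi Psi : pol Phi -> pol Psi -> pol (fun s w => Phi s w * Psi s w).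
Proof.
move=> p1; elim: p1 Psi => {Phi} [f Phi fO Pf|Phi' Phi _ IH PX|P1 P2 Phi _ IH1 _ IH2 PD] Psi p2.
- apply: (@pol_ext (fun s w => f w * Psi s w)); last by move=> s w wO; rewrite Pf.
  elim: p2 => {Psi} [g Psi gO Pg|Psi' Psi _ IH PX|P1 P2 Psi _ IH1 _ IH2 PD].
  + apply: (@pol_tan_ (fun w => f w * g w)) => [w wO|s w wO]; last by rewrite Pg.
    by apply: an_mul; [exact: fO|exact: gO].
  + by apply: (pol_X_ IH) => s w wO; rewrite PX // mulrCA.
  + by apply: (pol_add_ IH1 IH2) => s w wO; rewrite PD // mulrDr.
- by apply: (pol_X_ (IH _ p2)) => s w wO; rewrite PX // mulrA.
- by apply: (pol_add_ (IH1 _ p2) (IH2 _ p2)) => s w wO; rewrite PD // mulrDl.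
Qed.

Lemma pol_scale c Phi : pol Phi -> pol (fun s w => c * Phi s w).
Proof. exact: pol_mul (pol_cst c). Qed.

Lemma pol_sub Phi Psi : pol Phi -> pol Psi -> pol (fun s w => Phi s w - Psi s w).
Proof.
move=> p1 /(pol_scale (-1)) p2; apply: (pol_ext (pol_add p1 p2)) => s w _.
by rewrite mulN1r.
Qed.

Lemma pol_sum (J : finType) (p : pred J) (Phi : J -> R -> 'rV[R]_(n + n) -> R) :
  (forall j, p j -> pol (Phi j)) -> pol (fun s w => \sum_(j | p j) Phi j s w).
Proof.
move=> pP; elim: (index_enum J) => [|j r IH].
  by apply: (pol_ext (pol_cst 0)) => s w _; rewrite big_nil.
have [pj|pj] := boolP (p j); last first.
  by apply: (pol_ext IH) => s w _; rewrite big_cons (negPf pj).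
by apply: (pol_ext (pol_add (pP j pj) IH)) => s w _; rewrite big_cons pj.
Qed.

Lemma tan_pol Phi s : pol Phi -> tan Omega (Phi s).
Proof.
elim=> {Phi} [f Phi fO Pf|Phi' Phi _ IH PX|P1 P2 Phi _ IH1 _ IH2 PD].
- by apply: (tan_ext Omega_open fO) => w wO; rewrite Pf.
- apply: (@tan_ext _ _ _ Omega_open (fun w => s * Phi' s w)) => w wO; last by rewrite PX.
  by apply: an_scale; exact: IH.
- apply: (@tan_ext _ _ _ Omega_open (fun w => P1 s w + P2 s w)) => w wO; last by rewrite PD.
  by apply: an_add; [exact: IH1|exact: IH2].
Qed.

Lemma pol_pd b Phi : pol Phi -> pol (fun s => pd b (Phi s)).
Proof.
elim=> {Phi} [f Phi fO Pf|Phi' Phi p1 IH PX|P1 P2 Phi p1 IH1 p2 IH2 PD].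
- apply: (@pol_tan_ (pd b f)); first exact: tan_pd.
  by move=> s w wO; apply: (eqT_pd Omega_open) => // y yO; exact: Pf.
- apply: (pol_X_ IH) => s w wO.
  rewrite (eqT_pd Omega_open b (g := fun w => s * Phi' s w)) //; last first.
    by move=> y yO; exact: PX.
  by apply: pdZ; exact: (tan_pol s p1).
- apply: (pol_add_ IH1 IH2) => s w wO.
  rewrite (eqT_pd Omega_open b (g := fun w => P1 s w + P2 s w)) //; last first.
    by move=> y yO; exact: PD.
  by apply: pdD; [exact: (tan_pol s p1)|exact: (tan_pol s p2)].
Qed.

Lemma pol_split Phi : pol Phi -> exists f Psi, [/\ tan Omega f, pol Psi &
  forall s w, Omega (lsubmx w) -> Phi s w = f w + s * Psi s w].
Proof.
elim=> {Phi} [f Phi fO Pf|Phi' Phi p1 IH PX|P1 P2 Phi p1 [f1 [Q1 [h1 q1 E1]]] p2 [f2 [Q2 [h2 q2 E2]]] PD].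
- exists f, (fun _ _ => 0); split=> //; first exact: pol_cst.
  by move=> s w wO; rewrite mulr0 addr0 Pf.
- exists (fun=> 0), Phi'; split=> // [w wO|s w wO]; first exact: an_cst.
  by rewrite add0r PX.
- exists (fun w => f1 w + f2 w), (fun s w => Q1 s w + Q2 s w); split.
  + by move=> w wO; apply: an_add; [exact: h1|exact: h2].
  + exact: pol_add.
  + by move=> s w wO; rewrite PD // E1 // E2 //; ring.
Qed.

Lemma pol_bounded Phi w : pol Phi -> Omega (lsubmx w) ->
  exists B : R, 0 <= B /\ forall s, `|s| <= 1 -> `|Phi s w| <= B.
Proof.
move=> + wO; elim=> {Phi} [f Phi fO Pf|Phi' Phi p1 [B [B0 HB]] PX|P1 P2 Phi p1 [B1 [B10 H1]] p2 [B2 [B20 H2]] PD].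
- by exists `|f w|; split=> // s _; rewrite Pf.
- exists B; split=> // s s1; rewrite PX // normrM -[B]mul1r.
  by apply: ler_pM => //; exact: HB.
- exists (B1 + B2); split=> [|s s1]; first exact: addr_ge0.
  by rewrite PD // (le_trans (ler_normD _ _)) // lerD ?H1 ?H2.
Qed.

Lemma small_eq0 (c B e : R) : 0 < e -> 0 <= B ->
  (forall s : R, 0 < `|s| < e -> `|c| <= B * `|s|) -> c = 0.
Proof.
move=> e0 B0 H; apply/eqP; rewrite -normr_le0 leNgt; apply/negP => c0.
pose s := Num.min (e / 2) (`|c| / (2 * (B + 1))).
have B1 : 0 < 2 * (B + 1) by rewrite mulr_gt0 // ltr_wpDl.
have s0 : 0 < s by rewrite lt_min !divr_gt0.
have se : s < e.
  have : s <= e / 2 by rewrite /s ge_min lexx.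
  by lra.
have := H s; rewrite gtr0_norm // s0 se => /(_ erefl); apply/negP; rewrite -ltNge.
have : s <= `|c| / (2 * (B + 1)) by rewrite /s ge_min lexx orbT.
rewrite ler_pdivlMr // => h; have : 0 <= B * s by rewrite mulr_ge0 // ltW.
nra.
Qed.

(** Bounds at each state separately, with constants depending on the state, suffice: the constant
    term in [s] vanishes at every state, so one factor [s] splits off with an analytic quotient, and
    the argument repeats. *)
Lemma pol_small Phi p : pol Phi ->
  (forall w, Omega (lsubmx w) -> exists C e : R, 0 < e /\
     forall s, 0 < `|s| < e -> `|Phi s w| <= C * `|s| ^+ p) ->
  exists2 Psi, pol Psi & forall s w, Omega (lsubmx w) -> Phi s w = s ^+ p * Psi s w.
Proof.
elim: p Phi => [|p IH] Phi pP H.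
  by exists Phi => // s w _; rewrite mul1r.
have [f [Psi [fO pQ E]]] := pol_split pP.
have f0 w : Omega (lsubmx w) -> f w = 0.
  move=> wO; have [C [e [e0 HC]]] := H w wO; have [B [B0 HB]] := pol_bounded pQ wO.
  apply: (@small_eq0 _ (`|C| + B) (Num.min e 1)).
  - by rewrite lt_min e0 ltr01.
  - by rewrite addr_ge0.
  move=> s; rewrite lt_min => /and3P[s0 se s1].
  have -> : f w = Phi s w - s * Psi s w by rewrite E // addrK.
  rewrite (le_trans (ler_normB _ _)) // mulrDl lerD //.
    rewrite (le_trans (HC s _)) ?s0 // exprSr mulrA ler_wpM2r //.
    rewrite (le_trans (ler_wpM2r _ (ler_norm C))) ?exprn_ge0 //.
    by rewrite ler_piMr // exprn_ile1 // ltW.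
  by rewrite normrM mulrC ler_wpM2r // HB // ltW.
have [Psi' pQ' E'] : exists2 Psi', pol Psi' &
    forall s w, Omega (lsubmx w) -> Psi s w = s ^+ p * Psi' s w.
  apply: IH => // w wO; have [C [e [e0 HC]]] := H w wO.
  exists C, e; split=> // s /andP[s0 se]; have := HC s; rewrite s0 se => /(_ erefl).
  rewrite E // f0 // add0r normrM exprS mulrCA ler_pM2l //.
by exists Psi' => // s w wO; rewrite E // f0 // add0r E' // exprS mulrA.
Qed.

(** Congruence modulo [s ^ p]. The quotient has to be a [pol] family again, not merely bounded, so
    that congruences can be differentiated in the state. *)
Definition cong (p : nat) Phi Psi : Prop := exists2 D, pol D &
  forall s w, Omega (lsubmx w) -> Phi s w - Psi s w = s ^+ p * D s w.

Lemma cong_refl p Phi : cong p Phi Phi.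
Proof. by exists (fun _ _ => 0) => [|s w _]; [exact: pol_cst|rewrite subrr mulr0]. Qed.

Lemma cong_ext p Phi Psi Phi' Psi' :
  (forall s w, Omega (lsubmx w) -> Phi' s w = Phi s w) ->
  (forall s w, Omega (lsubmx w) -> Psi' s w = Psi s w) ->
  cong p Phi Psi -> cong p Phi' Psi'.
Proof. by move=> E1 E2 [D pD H]; exists D => // s w wO; rewrite E1 // E2 // H. Qed.

Lemma cong_trans p Phi Psi Xi : cong p Phi Psi -> cong p Psi Xi -> cong p Phi Xi.
Proof.
move=> [D pD H] [D' pD' H']; exists (fun s w => D s w + D' s w); first exact: pol_add.
by move=> s w wO; rewrite mulrDr -H // -H' // addrA subrK.
Qed.

Lemma cong_sym p Phi Psi : cong p Phi Psi -> cong p Psi Phi.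
Proof.
move=> [D pD H]; exists (fun s w => -1 * D s w); first exact: pol_scale.
by move=> s w wO; rewrite mulrCA -H // mulN1r opprB.
Qed.

Lemma cong_weak p q Phi Psi : (q <= p)%N -> cong p Phi Psi -> cong q Phi Psi.
Proof.
move=> qp [D pD H]; exists (fun s w => s ^+ (p - q) * D s w); first exact: pol_mulXn.
by move=> s w wO; rewrite H // mulrA -exprD subnKC.
Qed.

Lemma cong_add p Phi Psi Phi' Psi' : cong p Phi Psi -> cong p Phi' Psi' ->
  cong p (fun s w => Phi s w + Phi' s w) (fun s w => Psi s w + Psi' s w).
Proof.
move=> [D pD H] [D' pD' H']; exists (fun s w => D s w + D' s w); first exact: pol_add.
by move=> s w wO; rewrite opprD addrACA H // H' // mulrDr.
Qed.

Lemma cong_mul p Phi Psi Phi' Psi' : pol Phi' -> pol Psi ->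
  cong p Phi Psi -> cong p Phi' Psi' ->
  cong p (fun s w => Phi s w * Phi' s w) (fun s w => Psi s w * Psi' s w).
Proof.
move=> pP' pQ [D pD H] [D' pD' H'].
exists (fun s w => D s w * Phi' s w + Psi s w * D' s w).
  by apply: pol_add; exact: pol_mul.
move=> s w wO; rewrite mulrDr mulrA -H // [s ^+ p * (_ * _)]mulrCA -H' //; ring.
Qed.

Lemma cong_mulXn p j Phi Psi : cong p Phi Psi ->
  cong (j + p) (fun s w => s ^+ j * Phi s w) (fun s w => s ^+ j * Psi s w).
Proof.
by move=> [D pD H]; exists D => // s w wO; rewrite -mulrBr H // mulrA exprD.
Qed.

Lemma cong_sum p (J : finType) (P : pred J) (Phi Psi : J -> R -> 'rV[R]_(n + n) -> R) :
  (forall j, P j -> cong p (Phi j) (Psi j)) ->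
  cong p (fun s w => \sum_(j | P j) Phi j s w) (fun s w => \sum_(j | P j) Psi j s w).
Proof.
move=> H; elim: (index_enum J) => [|j r IH].
  by apply: (cong_ext _ _ (cong_refl p (fun _ _ => 0))) => s w _; rewrite big_nil.
have [Pj|Pj] := boolP (P j); last first.
  by apply: (cong_ext _ _ IH) => s w _; rewrite big_cons (negPf Pj).
by apply: (cong_ext _ _ (cong_add (H j Pj) IH)) => s w _; rewrite big_cons Pj.
Qed.

Lemma cong_pd p b Phi Psi : pol Phi -> pol Psi -> cong p Phi Psi ->
  cong p (fun s => pd b (Phi s)) (fun s => pd b (Psi s)).
Proof.
move=> pP pQ [D pD H]; exists (fun s => pd b (D s)); first exact: pol_pd.
move=> s w wO; rewrite -pdZ; last exact: (tan_pol s pD).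
rewrite -(eqT_pd Omega_open b (f := fun w => Phi s w - Psi s w)
  (g := fun w => s ^+ p * D s w)) //; last first.
  by move=> y yO; exact: H.
have an1 := tan_pol s pP wO; have an2 := tan_pol s pQ wO.
rewrite (_ : (fun w => Phi s w - Psi s w) = (fun w => Phi s w + -1 * Psi s w)).
  by rewrite pdD // ?pdZ ?mulN1r //; exact: an_scale.
by apply/funext => y; rewrite mulN1r.
Qed.

Lemma cong0_pol p Phi : cong p Phi (fun _ _ => 0) <->
  exists2 Psi, pol Psi & forall s w, Omega (lsubmx w) -> Phi s w = s ^+ p * Psi s w.
Proof.
by split=> -[D pD H]; exists D => // s w wO; [rewrite -H // subr0|rewrite subr0 H].
Qed.

Definition pol_field (f : R -> 'rV[R]_n -> 'rV[R]_n -> 'rV[R]_n) : Prop :=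
  forall a, pol (fun s w => f s (lsubmx w) (rsubmx w) 0 a).

Definition cong_field p (f g : R -> 'rV[R]_n -> 'rV[R]_n -> 'rV[R]_n) : Prop :=
  forall a, cong p (fun s w => f s (lsubmx w) (rsubmx w) 0 a)
                   (fun s w => g s (lsubmx w) (rsubmx w) 0 a).

Lemma tan_pol_field f s : pol_field f -> tan_field Omega (f s).
Proof. by move=> pf a; exact: (tan_pol s (pf a)). Qed.

Lemma directionE (f : 'rV[R]_n -> 'rV[R]_n -> 'rV[R]_n) w b :
  direction f w 0 b = match fintype.split b with
  | inl c => w 0 (rshift n c)
  | inr c => f (lsubmx w) (rsubmx w) 0 c
  end.
Proof.
rewrite /direction mxE; case: (fintype.split b) => c //.
by rewrite mxE.
Qed.

Lemma pol_direction f b : pol_field f -> pol (fun s w => direction (f s) w 0 b).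
Proof.
move=> pf; under eq_fun do under eq_fun do rewrite directionE.
case: (fintype.split b) => c; last exact: pf.
by apply: pol_tan => w _; exact: an_coord.
Qed.

Lemma cong_direction p f g b : cong_field p f g ->
  cong p (fun s w => direction (f s) w 0 b) (fun s w => direction (g s) w 0 b).
Proof.
move=> fg; under eq_fun do under eq_fun do rewrite directionE.
under [X in cong _ _ X]eq_fun do under eq_fun do rewrite directionE.
case: (fintype.split b) => c; last exact: fg.
exact: cong_refl.
Qed.

Lemma flat_prolong_lie f l a : pol_field f -> forall s w, Omega (lsubmx w) ->
  flat_prolong (f s) l.+1 a w = lie (f s) (flat_prolong (f s) l a) w.
Proof.
move=> pf s w wO; apply: (flat_prolongS _ wO).
by apply: tan_flat_prolong => //; exact: tan_pol_field.
Qed.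

Lemma pol_flat_prolong f l a : pol_field f -> pol (fun s => flat_prolong (f s) l a).
Proof.
move=> pf; elim: l => [|l IH].
  apply: (@pol_tan_ (fun w => w 0 (lshift n a))) => [w _|s w _]; first exact: an_coord.
  by rewrite /flat_prolong /on_shell /= mxE.
apply: (pol_ext _ (flat_prolong_lie l a pf)).
apply: pol_sum => b _; apply: pol_mul; [exact: pol_pd|exact: pol_direction].
Qed.

(** Prolongation is built from sums, products and derivatives in the state, and [cong] is stable
    under each of them. *)
Lemma cong_flat_prolong p f g l a : pol_field f -> pol_field g -> cong_field p f g ->
  cong p (fun s => flat_prolong (f s) l a) (fun s => flat_prolong (g s) l a).
Proof.
move=> pf pg fg; elim: l => [|l IH].
  by apply: (cong_ext _ _ (cong_refl p (fun s w => lsubmx w 0 a))).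
apply: (cong_ext (flat_prolong_lie l a pf) (flat_prolong_lie l a pg)).
apply: cong_sum => b _; apply: cong_mul.
- exact: pol_direction.
- by apply: pol_pd; exact: pol_flat_prolong.
- by apply: cong_pd => //; exact: pol_flat_prolong.
- exact: cong_direction.
Qed.

Lemma pol_pull F f : dp Omega F -> pol_field f -> pol (fun s => pull (f s) F).
Proof.
move=> + pf; elim=> {F} [f' F fO Ff|l a F Fl|F G H dF IHF dG IHG HFG|F G H dF IHF dG IHG HFG].
- by apply: (pol_tan_ fO) => s w wO; rewrite /pull Ff // state_on_shell.
- by apply: (pol_ext (pol_flat_prolong l a pf)) => s w wO; rewrite /pull Fl.
- by apply: (pol_ext (pol_add IHF IHG)) => s w wO; rewrite /pull HFG.
- by apply: (pol_ext (pol_mul IHF IHG)) => s w wO; rewrite /pull HFG.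
Qed.

Lemma cong_pull p F f g : dp Omega F -> pol_field f -> pol_field g -> cong_field p f g ->
  cong p (fun s => pull (f s) F) (fun s => pull (g s) F).
Proof.
move=> + pf pg fg; elim=> {F} [f' F fO Ff|l a F Fl|F G H dF IHF dG IHG HFG|F G H dF IHF dG IHG HFG].
- by apply: (cong_ext _ _ (cong_refl p (fun s w => f' w))) => s w wO;
    rewrite /pull Ff // state_on_shell.
- by apply: (cong_ext _ _ (cong_flat_prolong l a pf pg fg)) => s w wO; rewrite /pull Fl.
- by apply: (cong_ext _ _ (cong_add IHF IHG)) => s w wO; rewrite /pull HFG.
- apply: (cong_ext _ _ (cong_mul _ _ IHF IHG)).
  + by move=> s w wO; rewrite /pull HFG.
  + by move=> s w wO; rewrite /pull HFG.
  + exact: pol_pull.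
  + exact: pol_pull.
Qed.

End PolynomialFamilies.

Lemma linear_solve {R : realType} m (H : 'M[R]_m) (psi : 'I_m -> R) c : H \in unitmx ->
  \sum_b H c b * (\row_b \sum_d invmx H b d * psi d) 0 b = psi c.
Proof.
move=> Hu; pose P : 'cV[R]_m := \col_d psi d.
have : (H *m (invmx H *m P)) c 0 = P c 0 by rewrite mulKVmx.
rewrite !mxE => <-; apply: eq_bigr => b _; congr (_ * _).
by rewrite !mxE; apply: eq_bigr => d _; rewrite mxE.
Qed.

Section Elimination.
Context {R : realType} {n : nat}.
Variable Omega : set 'rV[R]_n.
Hypothesis Omega_open : open Omega.
Variable E : nat -> 'I_n -> jet R n -> R.
Hypothesis E_dp : forall j c, dp Omega (E j c).
Variables (alpha : 'I_n -> 'rV[R]_(n + n) -> R) (H : 'rV[R]_(n + n) -> 'M[R]_n).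
Hypothesis alpha_tan : forall c, tan Omega (alpha c).
Hypothesis H_tan : forall c b, tan Omega (fun w => H w c b).
Hypothesis H_unit : forall w, Omega (lsubmx w) -> H w \in unitmx.
Hypothesis E0 : forall c z, Omega (z 0%N) ->
  E 0 c z = alpha c (state z) - \sum_b H (state z) c b * z 2%N 0 b.

Implicit Types (g : nat -> 'rV[R]_n -> 'rV[R]_n -> 'rV[R]_n) (w : 'rV[R]_(n + n)).

Definition solve (psi : 'I_n -> 'rV[R]_(n + n) -> R) (q v : 'rV[R]_n) : 'rV[R]_n :=
  \row_b \sum_c invmx (H (row_mx q v)) b c * psi c (row_mx q v).

Lemma tan_solve psi : (forall c, tan Omega (psi c)) -> tan_field Omega (solve psi).
Proof.
move=> psi_tan b.
apply: (@tan_ext _ _ _ Omega_open (fun w => \sum_c invmx (H w) b c * psi c w)) => w wO.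
  apply: an_sum => c _; apply: an_mul; last exact: psi_tan.
  apply: an_invmx => [i j|]; first exact: H_tan.
  have [e e0 He] := open_box Omega_open wO; exists e => // y ye; apply: H_unit.
  by rewrite lsubmxD; apply: He; apply: le_lt_trans ye; exact: norm_lsubmx.
by rewrite mxE hsubmxK.
Qed.

Lemma solveP psi w c : Omega (lsubmx w) ->
  \sum_b H w c b * solve psi (lsubmx w) (rsubmx w) 0 b = psi c w.
Proof.
move=> wO; rewrite -[RHS](linear_solve (fun d => psi d w) c (H_unit wO)).
by apply: eq_bigr => b _; rewrite !mxE hsubmxK.
Qed.

Lemma solve_unique psi w (u : 'rV[R]_n) : Omega (lsubmx w) ->
  (forall c, \sum_b H w c b * u 0 b = psi c w) -> u = solve psi (lsubmx w) (rsubmx w).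
Proof.
move=> wO Hu; pose s := solve psi (lsubmx w) (rsubmx w).
have E' : H w *m u^T = H w *m s^T.
  apply/matrixP => c j; rewrite !ord1 !mxE.
  transitivity (psi c w).
    by rewrite -Hu; apply: eq_bigr => b _; rewrite mxE.
  by rewrite -(solveP psi c wO); apply: eq_bigr => b _; rewrite [in RHS]mxE.
have := congr1 (mulmx (invmx (H w))) E'; rewrite !mulKmx ?H_unit //.
exact: trmx_inj.
Qed.

Definition el_field := solve alpha.

Lemma el_fieldP z : Omega (z 0%N) ->
  (forall c, E 0 c z = 0) <-> z 2%N = el_field (z 0%N) (z 1%N).
Proof.
move=> zO; have sO : Omega (lsubmx (state z)) by rewrite row_mxKl.
have -> : el_field (z 0%N) (z 1%N) = solve alpha (lsubmx (state z)) (rsubmx (state z)).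
  by rewrite row_mxKl row_mxKr.
split=> [Ez|Ez c]; last by rewrite E0 // Ez solveP // subrr.
apply: solve_unique => // c; have /eqP := Ez c.
by rewrite E0 // subr_eq0 => /eqP.
Qed.

Definition tan_family g := forall j, tan_field Omega (g j).

(** The truncated modified equation evaluated on its own truncated field. With the derivatives from
    the second on eliminated, it is a polynomial in [s] over functions of the state. *)
Definition residual (K : nat) g (c : 'I_n) (s : R) w : R :=
  \sum_(j < K.+1) s ^+ j * E j c (on_shell (truncated_field g K s) w).

Lemma truncated_fieldE g K s q v a :
  truncated_field g K s q v 0 a = \sum_(j < K.+1) s ^+ j * g j q v 0 a.
Proof. by rewrite /truncated_field summxE; apply: eq_bigr => j _; rewrite mxE. Qed.

Lemma pol_truncated g K : tan_family g -> pol_field Omega (truncated_field g K).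
Proof.
move=> gO a.
apply: (@pol_ext _ _ _ (fun s w => \sum_(j < K.+1) s ^+ j * g j (lsubmx w) (rsubmx w) 0 a)).
  by apply: pol_sum => j _; apply: pol_mulXn; apply: pol_tan; exact: gO.
by move=> s w _; rewrite truncated_fieldE.
Qed.

Lemma pol_residual K g c : tan_family g -> pol Omega (residual K g c).
Proof.
move=> gO; apply: pol_sum => j _; apply: pol_mulXn.
by apply: (pol_pull Omega_open (E_dp j c)); exact: pol_truncated.
Qed.

Definition agree p g g' := forall j w, (j < p)%N -> Omega (lsubmx w) ->
  g j (lsubmx w) (rsubmx w) = g' j (lsubmx w) (rsubmx w).

Lemma truncated_diff p K g g' a : tan_family g -> tan_family g' -> (p <= K)%N ->
  agree p g g' ->
  cong Omega p.+1 (fun s w => truncated_field g K s (lsubmx w) (rsubmx w) 0 a -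
                   truncated_field g' K s (lsubmx w) (rsubmx w) 0 a)
    (fun s w => s ^+ p * (g p (lsubmx w) (rsubmx w) 0 a - g' p (lsubmx w) (rsubmx w) 0 a)).
Proof.
move=> gO gO' pK ag.
exists (fun s w => \sum_(j < K.+1 | (p < j)%N) s ^+ (j - p.+1) *
   (g j (lsubmx w) (rsubmx w) 0 a - g' j (lsubmx w) (rsubmx w) 0 a)).
  apply: pol_sum => j _; apply: pol_mulXn; apply: pol_tan => w wO.
  by apply: an_sub; [exact: gO|exact: gO'].
move=> s w wO; rewrite !truncated_fieldE -sumrB mulr_sumr.
pose Kp : 'I_K.+1 := Ordinal (pK : (p < K.+1)%N).
rewrite (bigD1 Kp) //= -mulrBr addrAC subrr add0r.
rewrite big_mkcond [RHS]big_mkcond; apply: eq_bigr => j _.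
have [jp|pj|jp] := ltngtP j p.
- by rewrite ag // subrr if_same.
- by rewrite mulrA -exprD subnKC // -mulrBr (_ : j != Kp) // -val_eqE /= gtn_eqF.
- by rewrite (_ : j = Kp) ?eqxx //; exact: val_inj.
Qed.

Lemma cong_truncated p K g g' : tan_family g -> tan_family g' -> (p <= K)%N ->
  agree p g g' -> cong_field Omega p (truncated_field g K) (truncated_field g' K).
Proof.
move=> gO gO' pK ag a.
have [D pD HD] := cong_weak (leqnSn p) (truncated_diff a gO gO' pK ag).
exists (fun s w => D s w + (g p (lsubmx w) (rsubmx w) 0 a - g' p (lsubmx w) (rsubmx w) 0 a)).
  apply: pol_add => //; apply: pol_tan => w wO.
  by apply: an_sub; [exact: gO|exact: gO'].
by move=> s w wO; rewrite mulrDr -HD // subrK.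
Qed.

(* the unknown g_p enters the coefficient of s^p linearly, through the term
   H g_p of the Euler-Lagrange equation *)
Lemma residual_diff p K g g' c : tan_family g -> tan_family g' -> (p <= K)%N ->
  agree p g g' ->
  cong Omega p.+1 (residual K g c) (fun s w => residual K g' c s w -
     s ^+ p * \sum_b H w c b * (g p (lsubmx w) (rsubmx w) 0 b - g' p (lsubmx w) (rsubmx w) 0 b)).
Proof.
move=> gO gO' pK ag.
have pg := pol_truncated K gO; have pg' := pol_truncated K gO'.
have L : cong Omega p.+1 (fun s w => E 0 c (on_shell (truncated_field g K s) w))
   (fun s w => E 0 c (on_shell (truncated_field g' K s) w) +
     - (s ^+ p * \sum_b H w c b * (g p (lsubmx w) (rsubmx w) 0 b - g' p (lsubmx w) (rsubmx w) 0 b))).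
  have /cong_sym : cong Omega p.+1
     (fun s w => \sum_b H w c b * (truncated_field g K s (lsubmx w) (rsubmx w) 0 b -
                   truncated_field g' K s (lsubmx w) (rsubmx w) 0 b))
     (fun s w => \sum_b H w c b * (s ^+ p * (g p (lsubmx w) (rsubmx w) 0 b - g' p (lsubmx w) (rsubmx w) 0 b))).
    apply: cong_sum => b _; apply: cong_mul.
    - by apply: pol_sub; [exact: pg|exact: pg'].
    - exact: pol_tan.
    - exact: cong_refl.
    - exact: truncated_diff.
  move=> [D pD HD]; exists D => // s w wO; rewrite -HD //.
  rewrite !E0 // !state_on_shell /on_shell !prolong2.
  rewrite [X in _ - (_ - _ + - X)](_ : _ = \sum_b H w c b * (s ^+ p * (g p (lsubmx w) (rsubmx w) 0 b
      - g' p (lsubmx w) (rsubmx w) 0 b))); last first.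
    by rewrite mulr_sumr; apply: eq_bigr => b _; rewrite mulrCA.
  under [X in _ = _ - X]eq_bigr do rewrite mulrBr.
  rewrite sumrB; ring.
(* Each of these terms has a positive power of [s] in front, so agreement of the fields modulo
   [s ^ p] is enough. *)
have Rst : cong Omega p.+1
    (fun s w => \sum_(j < K) s ^+ j.+1 * E j.+1 c (on_shell (truncated_field g K s) w))
    (fun s w => \sum_(j < K) s ^+ j.+1 * E j.+1 c (on_shell (truncated_field g' K s) w)).
  apply: cong_sum => j _; apply: (@cong_weak _ _ _ (j.+1 + p)); first by rewrite addSn ltnS leq_addl.
  apply: cong_mulXn; apply: (cong_pull Omega_open (E_dp j.+1 c) pg pg').
  exact: cong_truncated.
apply: (cong_ext _ _ (cong_add L Rst)) => s w wO.
- by rewrite /residual big_ord_recl mul1r.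
- by rewrite /residual big_ord_recl mul1r addrAC.
Qed.

Definition update g p gamma : nat -> 'rV[R]_n -> 'rV[R]_n -> 'rV[R]_n :=
  fun j => if j == p then gamma else g j.

(** With [g p = 0] the residual is [s ^ p * psi] modulo [s ^ p.+1], and a coefficient [gamma] at [p]
    changes it by [- s ^ p * H gamma]; the correction is the solution of [H gamma = psi]. *)
Lemma residual_step p g : tan_family g -> g p = (fun _ _ => 0) ->
  (forall c, cong Omega p (residual p g c) (fun _ _ => 0)) ->
  exists gamma, tan_field Omega gamma /\
    forall c, cong Omega p.+1 (residual p (update g p gamma) c) (fun _ _ => 0).
Proof.
move=> gO gp Hg.
have /choice[psi Hpsi] c : exists f, tan Omega f /\
    cong Omega p.+1 (residual p g c) (fun s w => s ^+ p * f w).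
  have /cong0_pol[Psi pPsi HPsi] := Hg c.
  have [f [D [fO pD HD]]] := pol_split pPsi.
  exists f; split=> //; exists D => // s w wO.
  by rewrite HPsi // HD // exprSr; ring.
have psi_tan c : tan Omega (psi c) by case: (Hpsi c).
exists (solve psi); split; first exact: tan_solve.
move=> c; have uO : tan_family (update g p (solve psi)).
  by move=> j; rewrite /update; case: eqP => _; [exact: tan_solve|exact: gO].
have ag : agree p (update g p (solve psi)) g.
  by move=> j w jp _; rewrite /update ltn_eqF.
apply: cong_trans (residual_diff c uO gO (leqnn p) ag) _.
have [_ [D pD HD]] := Hpsi c; exists D => // s w wO.
rewrite subr0 -HD // /update eqxx gp; congr (_ - s ^+ p * _).
rewrite -(solveP psi c wO); apply: eq_bigr => b _.
by rewrite [X in _ - X]mxE subr0.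
Qed.

Lemma residual_eq K g g' c : (forall j, (j <= K)%N -> g j = g' j) ->
  residual K g c = residual K g' c.
Proof.
move=> gg; apply/funext => s; apply/funext => w; rewrite /residual.
have -> : truncated_field g K s = truncated_field g' K s.
  apply/funext => q; apply/funext => v; apply: eq_bigr => j _.
  by rewrite gg // -ltnS.
by [].
Qed.

Lemma residual_exists : exists g, tan_family g /\
  forall p c, cong Omega p.+1 (residual p g c) (fun _ _ => 0).
Proof.
pose z0 : 'rV[R]_n -> 'rV[R]_n -> 'rV[R]_n := fun _ _ => 0.
pose good p h gamma := tan_field Omega gamma /\
    forall c, cong Omega p.+1 (residual p (update h p gamma) c) (fun _ _ => 0).
(* The recursion presents the earlier coefficients with [z0] at and after [p], the form that
   [residual_step] expects; [xget] picks one of the admissible values. *)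
pose g := strong_rec z0 (fun p h => xget z0 [set gamma | good p h gamma]).
suff G p : tan_field Omega (g p) /\ forall c, cong Omega p.+1 (residual p g c) (fun _ _ => 0).
  by exists g; split=> [j|p c]; [case: (G j)|case: (G p)].
have [m] := ubnP p; elim: m p => // m IH p pm.
pose h j := if (j < p)%N then g j else z0.
have hO : tan_family h.
  move=> j; rewrite /h; case: ifP => jp; first by case: (IH j) => //; lia.
  by move=> a w _; apply: (an_eq _ (an_cst w 0)) => y; rewrite mxE.
have hp : h p = z0 by rewrite /h ltnn.
have hE j : (j < p)%N -> h j = g j by rewrite /h => ->.
(* Compared with the previous order, the field gains a zero coefficient, which does not change it,
   and the sum gains a term that is itself divisible by the required power of [s]. *)
have Hh c : cong Omega p (residual p h c) (fun _ _ => 0).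
  apply/cong0_pol; clearbody h; case: p pm h hO hp hE => [|p] pm h hO hp hE.
    by exists (residual 0 h c) => [|s w _]; [exact: pol_residual|rewrite mul1r].
  have [_ /(_ c)/cong0_pol[Psi pPsi HPsi]] := IH p ltac:(lia).
  have T s : truncated_field h p.+1 s = truncated_field g p s.
    apply/funext => q; apply/funext => v; rewrite /truncated_field big_ord_recr /=.
    rewrite hp scaler0 addr0; apply: eq_bigr => j _.
    by rewrite hE.
  exists (fun s w => Psi s w + E p.+1 c (on_shell (truncated_field h p.+1 s) w)).
    apply: pol_add => //; apply: (pol_pull Omega_open (E_dp p.+1 c)).
    exact: pol_truncated.
  move=> s w wO; rewrite mulrDr -HPsi // /residual big_ord_recr /=; congr (_ + _).
  by apply: eq_bigr => j _; rewrite T.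
have [gamma Hgamma] := residual_step hO hp Hh.
have : good p h (g p).
  by rewrite /g strong_recE; apply: (xgetPex z0); exists gamma.
move=> [gp Hgp]; split=> // c; rewrite (_ : residual p g c = residual p (update h p (g p)) c) //.
apply: residual_eq => j jp; rewrite /update; case: eqP => [->//|/eqP jnp].
by rewrite hE // ltn_neqAle jnp jp.
Qed.

(** At the first index where the families could differ, [H] applied to their difference is of order
    [s]; being independent of [s], it vanishes, and [H] is invertible. *)
Lemma residual_unique k g g' : tan_family g -> tan_family g' ->
  (forall p c, (p <= k)%N -> cong Omega p.+1 (residual p g c) (fun _ _ => 0)) ->
  (forall p c, (p <= k)%N -> cong Omega p.+1 (residual p g' c) (fun _ _ => 0)) ->
  agree k.+1 g g'.
Proof.
move=> gO gO' Hg Hg'.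
suff A p : (p <= k.+1)%N -> agree p g g' by exact: A.
elim: p => [|p IH] pk j w; first by [].
rewrite ltnS leq_eqVlt => /orP[/eqP ->|jp] wO; last by apply: IH => //; exact: ltnW.
have ag := IH (ltnW pk).
have D c : \sum_b H w c b * (g p (lsubmx w) (rsubmx w) - g' p (lsubmx w) (rsubmx w)) 0 b = 0.
  have := cong_trans (cong_sym (residual_diff c gO gO' (leqnn p) ag)) (Hg p c pk).
  have := cong_sym (Hg' p c pk) => -[D' pD' HD'] [D pD HD].
  have [B [B0 HB]] := pol_bounded (pol_add pD pD') wO.
  apply: (@small_eq0 _ _ B 1) => // s /andP[s0 s1].
  have := HD s w wO; have := HD' s w wO; rewrite subr0 => h' h.
  have e : s ^+ p * (\sum_b H w c b * (g p (lsubmx w) (rsubmx w) 0 b - g' p (lsubmx w) (rsubmx w) 0 b))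
     = - (s ^+ p.+1 * (D s w + D' s w)).
    by rewrite mulrDr -h -h'; ring.
  have sn0 : s != 0 by rewrite -normr_gt0.
  have -> : \sum_b H w c b * (g p (lsubmx w) (rsubmx w) - g' p (lsubmx w) (rsubmx w)) 0 b
      = - (s * (D s w + D' s w)).
    apply: (mulfI (expf_neq0 p sn0)); rewrite mulrN mulrA -exprSr -e.
    by congr (_ * _); apply: eq_bigr => b _; rewrite !mxE.
  by rewrite normrN normrM mulrC ler_wpM2r // HB // ltW.
apply/eqP; rewrite -subr_eq0; apply/eqP.
have -> : 0 = solve (fun _ _ => 0) (lsubmx w) (rsubmx w) :> 'rV[R]_n.
  by apply: solve_unique => // c; rewrite big1 // => b _; rewrite mxE mulr0.
exact: solve_unique.
Qed.

End Elimination.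

(** * Existence of solutions *)

Section Picard.
Context {R : realType}.

Lemma primitive (g : R -> R) (rho : R) : 0 < rho -> continuous g ->
  exists G : R -> R, G 0 = 0 /\ forall t, `|t| < rho -> isd G t (g t).
Proof.
move=> r0 gc; pose mu := @lebesgue_measure R.
pose F t : R := (\int[mu]_(s in `[- rho, t]) g s)%R.
exists (fun t => F t - F 0); rewrite subrr; split=> // t; rewrite ltr_norml => /andP[t1 t2].
suff : isd F t (g t) by move=> /isdB /(_ (isd_cst _ t)); rewrite subr0.
have int : mu.-integrable `[- rho, rho] (EFin \o g).
  by apply: continuous_compact_integrable; [exact: segment_compact|exact: continuous_subspaceT].
have [dF <-] := continuous_FTC1_closed t2 int t1 (gc t).
exact: derivable_isd.
Qed.

(** Extends data on [[- r, r]] to the whole line without enlarging Lipschitz constants, so that the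
    iteration needs no bookkeeping of domains. *)
Definition clamp (r t : R) : R := if r < t then r else if t < - r then - r else t.

Lemma clamp_norm (r t : R) : 0 <= r -> `|clamp r t| <= r.
Proof.
move=> r0; rewrite /clamp ler_norml.
by case: (ltP r t) => ?; [|case: (ltP t) => ?]; apply/andP; split; lra.
Qed.

Lemma clamp_id (r t : R) : `|t| <= r -> clamp r t = t.
Proof.
rewrite ler_norml /clamp => /andP[? ?].
by case: (ltP r t) => ?; [|case: (ltP t) => ?]; lra.
Qed.

Lemma clamp_lipschitz (r s t : R) : 0 <= r -> `|clamp r t - clamp r s| <= `|t - s|.
Proof.
move=> r0; have := ler_norm (t - s); have := ler_norm (- (t - s)); rewrite normrN /clamp.
rewrite ler_norml => ? ?.
by case: (ltP r t) => ?; case: (ltP r s) => ?; do ?[case: (ltP t) => ?];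
  do ?[case: (ltP s) => ?]; apply/andP; split; lra.
Qed.

Lemma lipschitz_continuous (g : R -> R) K : (forall s t, `|g t - g s| <= K * `|t - s|) ->
  continuous g.
Proof.
move=> gK t; apply/cvgrPdist_le => e e0.
have K0 : 0 < `|K| + 1 by rewrite ltr_pwDr.
apply/near0P; exists (e / (`|K| + 1)); first exact: divr_gt0.
move=> h; rewrite ltr_pdivlMr // => hr; apply: le_trans (gK _ _) _.
rewrite opprD addNKr normrN; apply: le_trans (ltW hr).
by rewrite mulrC ler_wpM2l // (le_trans (ler_norm K)) // lerDl.
Qed.

Lemma rV_dist N (x y : 'rV[R]_N) a : `|x 0 a - y 0 a| <= `|x - y|.
Proof. by have := coord_le_norm (x - y) a; rewrite !mxE. Qed.

Lemma dist_rV_le N (x y : 'rV[R]_N) e : 0 <= e -> (forall a, `|x 0 a - y 0 a| <= e) ->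
  `|x - y| <= e.
Proof. by move=> e0 H; apply: norm_rV_le => // a; rewrite !mxE. Qed.

Section Iteration.
Variables (N : nat) (F : 'rV[R]_N -> 'rV[R]_N) (y0 : 'rV[R]_N) (K M : R).
Hypotheses (K0 : 0 <= K) (M0 : 0 <= M).
Hypothesis FK : forall x y a, `|F x 0 a - F y 0 a| <= K * `|x - y|.
Hypothesis FM : forall x a, `|F x 0 a| <= M.

(** On [[- r, r]] the integral operator contracts by [K * r <= 1/2]; the summand 1 covers
    [K = 0]. *)
Let r : R := (2 * (K + 1))^-1.

Let r0 : 0 < r. Proof. by rewrite invr_gt0 mulr_gt0 // ltr_wpDl. Qed.

Let Kr : K * r <= 2^-1.
Proof.
have K1 : K + 1 != 0 by rewrite gt_eqF // ltr_wpDl.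
have : 2 * (K + 1) * r = 1 by rewrite /r mulfV // mulf_neq0.
by have := r0; lra.
Qed.

Let steady (c : R -> 'rV[R]_N) := forall a, continuous (fun t => F (c (clamp r t)) 0 a).

Let lip (c : R -> 'rV[R]_N) := forall s t, `|s| <= r -> `|t| <= r -> `|c t - c s| <= M * `|t - s|.

Let lip_steady c : lip c -> steady c.
Proof.
move=> cl a; apply: (@lipschitz_continuous _ (K * M)) => s t.
apply: le_trans (FK _ _ _) _; rewrite -mulrA ler_wpM2l //.
apply: le_trans (cl _ _ (clamp_norm _ (ltW r0)) (clamp_norm _ (ltW r0))) _.
by rewrite ler_wpM2l // clamp_lipschitz // ltW.
Qed.

(** Differentiability is asked for up to [4 * r] because the mean value inequality between two times
    in [[- r, r]], started at one of them, visits points of absolute value up to [3 * r]. *)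
Let integrates c c' := c' 0 = y0 /\ forall t a, `|t| < 4 * r ->
  isd (fun s => c' s 0 a) t (F (c (clamp r t)) 0 a).

(** The hypothesis stands inside the existential, so that the axiom of choice yields a total
    operator on curves that can be iterated. *)
Let integral_exists c : exists c', steady c -> integrates c c'.
Proof.
have [sc|nsc] := pselect (steady c); last by exists c.
have r4 : 0 < 4 * r by rewrite mulr_gt0.
have /choice[G HG] := fun a => primitive r4 (sc a).
exists (fun t => \row_a (y0 0 a + G a t)) => _; split.
  by apply/rowP => a; rewrite mxE (HG a).1 addr0.
move=> t a tr; rewrite -[F _ 0 a]add0r.
apply: isd_ext (isdD (isd_cst (y0 0 a) t) ((HG a).2 t tr)) => s.
by rewrite mxE.
Qed.

Let integrates_lip c c' : integrates c c' -> lip c'.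
Proof.
move=> [_ cd] s t sr tr; apply: dist_rV_le => [|a]; first exact: mulr_ge0.
have := @mvt0 R (fun h => c' (s + h) 0 a) (fun h => F (c (clamp r (s + h))) 0 a) (t - s) M.
rewrite addr0 subrKC; apply=> h hr; last exact: FM.
have h3 : `|s + h| < 4 * r.
  apply: le_lt_trans (ler_normD _ _) _; have := le_trans hr (ler_normB _ _); have := r0; lra.
have /(_ h) := @isd_comp_lin R (fun s => c' s 0 a) s 1; rewrite mulr1 => /(_ _ (cd _ a h3)).
by rewrite mulr1; apply: isd_ext => u; rewrite mulr1.
Qed.

Lemma picard_global : exists2 y : R -> 'rV[R]_N, y 0 = y0 &
  forall t a, `|t| < r -> isd (fun s => y s 0 a) t (F (y t) 0 a).
Proof.
have [Phi HPhi] := choice integral_exists.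
pose Y m := iter m Phi (fun _ => y0).
have YL m : lip (Y m).
  elim: m => [|m IH]; first by move=> s t _ _; rewrite subrr normr0 mulr_ge0.
  exact: integrates_lip (HPhi _ (lip_steady IH)).
have YI m : integrates (Y m) (Y m.+1) := HPhi _ (lip_steady (YL m)).
have tr4 (t u : R) : `|t| <= r -> `|u| <= `|t| -> `|u| < 4 * r by have := r0; lra.
pose C := M * r; have C0 : 0 <= C by rewrite mulr_ge0 // ltW.
have q0 m : 0 <= C * 2^-1 ^+ m by rewrite mulr_ge0 // exprn_ge0 // invr_ge0.
have YC m t : `|t| <= r -> `|Y m.+1 t - Y m t| <= C * 2^-1 ^+ m.
  elim: m t => [|m IH] t tr; apply: dist_rV_le => [|a]; rewrite ?q0 //.
    rewrite mulr1 (_ : Y 0%N t = Y 1%N 0); last by rewrite (YI 0%N).1.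
    apply: (@le_trans _ _ (M * `|t|)); last by rewrite ler_wpM2l.
    apply: (mvt0 (f := fun t => Y 1%N t 0 a) (df := fun t => F (Y 0%N (clamp r t)) 0 a)) => u ut.
      by apply: (YI 0%N).2; exact: tr4 ut.
    exact: FM.
  have := @mvt0 R (fun t => Y m.+2 t 0 a - Y m.+1 t 0 a)
    (fun t => F (Y m.+1 (clamp r t)) 0 a - F (Y m (clamp r t)) 0 a) t (K * (C * 2^-1 ^+ m)).
  rewrite (YI m.+1).1 (YI m).1 subrr subr0 => H.
  apply: le_trans (H _ _) _ => [u ut|u ut|].
  - by apply: isdB; [apply: (YI m.+1).2|apply: (YI m).2]; exact: tr4 ut.
  - apply: le_trans (FK _ _ _) _; rewrite ler_wpM2l // IH // clamp_norm // ltW //.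
  - rewrite (_ : K * _ * _ = K * `|t| * (C * 2^-1 ^+ m)); last by ring.
    rewrite exprS [leRHS]mulrCA ler_wpM2r // (le_trans _ Kr) //.
    by rewrite ler_wpM2l.
have YB m k t : `|t| <= r -> `|Y (m + k)%N t - Y m t| <= 2 * C * 2^-1 ^+ m.
  move=> tr; have -> : Y (m + k)%N t - Y m t = \sum_(i < k) (Y (m + i).+1 t - Y (m + i)%N t).
    elim: k => [|k IH]; first by rewrite addn0 subrr big_ord0.
    by rewrite big_ord_recr /= -IH addnS addrC addrA subrK.
  apply: le_trans (ler_norm_sum _ _ _) _.
  apply: (@le_trans _ _ (\sum_(i < k) C * 2^-1 ^+ m * 2^-1 ^+ i)).
    by apply: ler_sum => i _; rewrite -mulrA -exprD; exact: YC.
  rewrite -mulr_sumr [2 * C]mulrC [leRHS]mulrAC ler_wpM2l //.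
  by apply: geometric_sum_le; lra.
have cvgY t a : `|t| <= r -> cvgn (fun m => Y m t 0 a).
  move=> tr; have : cvgn (series (fun m => Y m.+1 t 0 a - Y m t 0 a)).
    apply: (@cvg_series_geo _ _ C 2^-1) => //; first by lra.
    by move=> m; apply: le_trans (YC m t tr); exact: rV_dist.
  have -> : series (fun m => Y m.+1 t 0 a - Y m t 0 a) = (fun m => Y m t 0 a - y0 0 a).
    by apply/funext => m; rewrite /series /= telescope_sumr.
  move=> H; rewrite (_ : (fun m => Y m t 0 a) = (fun m => (Y m t 0 a - y0 0 a) + y0 0 a)).
    by apply: is_cvgD => //; exact: is_cvg_cst.
  by apply/funext => m; rewrite subrK.
pose y t : 'rV[R]_N := \row_a lim ((fun m => Y m (clamp r t) 0 a) @ \oo).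
have yE t a : `|t| <= r -> (fun m => Y m t 0 a) @ \oo --> y t 0 a.
  by move=> tr; rewrite mxE clamp_id //; exact: cvgY.
have yY m t : `|t| <= r -> `|y t - Y m t| <= 2 * C * 2^-1 ^+ m.
  move=> tr; apply: dist_rV_le => [|a]; first by rewrite -mulrA mulr_ge0.
  apply: (@lim_norm_le _ (fun k => Y (m + k)%N t 0 a - Y m t 0 a)) => [|k].
    apply: cvgB; last exact: cvg_cst.
    rewrite (_ : (fun k => Y (m + k)%N t 0 a) = (fun k => Y (k + m)%N t 0 a)); last first.
      by apply/funext => k; rewrite addnC.
    rewrite (cvg_shiftn m (fun k => Y k t 0 a)); exact: yE.
  by apply: le_trans (YB m k t tr); exact: rV_dist.
have yL : lip y.
  move=> s t sr tr; apply: dist_rV_le => [|a]; first exact: mulr_ge0.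
  apply: (@lim_norm_le _ (fun k => Y k t 0 a - Y k s 0 a)) => [|k].
    by apply: cvgB; exact: yE.
  by apply: le_trans (YL k s t sr tr); exact: rV_dist.
(* [G] is the image of the limit [y] under the integral operator. Both are within a multiple of
   [2 ^ - m] of [Y m.+1], hence equal, and [y] inherits the derivative of [G]. *)
have [G GI] := integral_exists y; have [G0 Gd] := GI (lip_steady yL).
have yG t a : `|t| <= r -> y t 0 a = G t 0 a.
  move=> tr; apply/eqP; rewrite -subr_eq0; apply/eqP.
  have bd m : `|y t 0 a - G t 0 a| <= (2 * C + K * (2 * C) * r) * 2^-1 ^+ m.
    have -> : y t 0 a - G t 0 a = (y t 0 a - Y m.+1 t 0 a) + (Y m.+1 t 0 a - G t 0 a) by ring.
    rewrite mulrDl (le_trans (ler_normD _ _)) // lerD //.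
      apply: le_trans (rV_dist _ _ _) _; apply: le_trans (yY m.+1 t tr) _.
      rewrite exprS; have := q0 m; lra.
    have := @mvt0 R (fun t => Y m.+1 t 0 a - G t 0 a)
      (fun t => F (Y m (clamp r t)) 0 a - F (y (clamp r t)) 0 a) t (K * (2 * C * 2^-1 ^+ m)).
    rewrite (YI m).1 G0 subrr subr0 => H.
    apply: le_trans (H _ _) _ => [u ut|u ut|].
    - by apply: isdB; [apply: (YI m).2|apply: Gd]; exact: tr4 ut.
    - apply: le_trans (FK _ _ _) _; rewrite ler_wpM2l // distrC yY // clamp_norm // ltW //.
    - rewrite (_ : K * _ * _ = K * (2 * C) * `|t| * 2^-1 ^+ m); last by ring.
      have KC : 0 <= K * (2 * C) by rewrite mulr_ge0 // mulr_ge0.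
      have qm : 0 <= 2^-1 ^+ m :> R by rewrite exprn_ge0 // invr_ge0.
      by apply: ler_wpM2r => //; apply: ler_wpM2l.
  have B0 : 0 <= 2 * C + K * (2 * C) * r by rewrite addr_ge0 ?mulr_ge0 // ltW.
  apply: (cvg_unique_R (v := fun _ => y t 0 a - G t 0 a)); first exact: cvg_cst.
  apply/cvgrPdist_le => e e0.
  have : (fun m => (2 * C + K * (2 * C) * r) * 2^-1 ^+ m) @ \oo --> 0.
    by apply: cvg_geometric; rewrite ger0_norm; lra.
  move=> /cvgrPdist_le /(_ _ e0); apply: filterS => m.
  rewrite !sub0r !normrN => h; apply: le_trans (bd m) _; apply: le_trans h.
  exact: ler_norm.
exists y; first by apply/rowP => a; rewrite yG ?normr0 ?(ltW r0) // G0.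
move=> t a tr; rewrite -[X in F (y X)](clamp_id (ltW tr)).
have tr' : `|t| < 4 * r by have := r0; lra.
apply: isd_near (Gd t a tr'); exists (r - `|t|); first by rewrite subr_gt0.
move=> h hr; rewrite yG // (le_trans (ler_normD _ _)) //; lra.
Qed.

End Iteration.

Lemma picard N (F : 'rV[R]_N -> 'rV[R]_N) (w0 : 'rV[R]_N) :
  (forall a, an w0 (fun w => F w 0 a)) ->
  exists2 y : R -> 'rV[R]_N, y 0 = w0 & exists2 r : R, 0 < r &
    forall t a, `|t| < r -> isd (fun s => y s 0 a) t (F (y t) 0 a).
Proof.
move=> Fan; have /choice[K HK] := fun a => an_lipschitz (Fan a).
have [rho rho0 Hrho] : exists2 rho : R, 0 < rho & forall u, `|u| <= rho ->
    forall a, forall u', `|u'| <= rho -> `|F (w0 + u') 0 a - F (w0 + u) 0 a| <= K a * `|u' - u|.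
  have : exists2 rho : R, 0 < rho & forall u : R, `|u| < rho ->
      forall a, forall y y', `|y| <= `|u| -> `|y'| <= `|u| -> `|F (w0 + y') 0 a - F (w0 + y) 0 a| <= K a * `|y' - y|.
    apply: finite_radius => a; have [r [_ r0 Hr]] := HK a; exists r => // u ur y y' yu y'u.
    by apply: Hr; lra.
  move=> [e e0 H]; exists (e / 2); first exact: divr_gt0.
  move=> u ur a u' u'r; have e2 : `|e / 2| = e / 2 by rewrite gtr0_norm // divr_gt0.
  by apply: (H (e / 2)); rewrite e2 //; lra.
(* Clamping the displacement from [w0] in each coordinate turns the local field into a bounded,
   globally Lipschitz one. The solution satisfies the original equation while it stays within [rho],
   which holds for [|t| < rho / (M + 1)]. *)
pose P (w : 'rV[R]_N) : 'rV[R]_N := \row_a clamp rho ((w - w0) 0 a).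
have Pn w : `|P w| <= rho by apply: norm_rV_le => [|a]; rewrite ?mxE ?clamp_norm // ltW.
have PL w w' : `|P w - P w'| <= `|w - w'|.
  apply: dist_rV_le => // a; rewrite !mxE; apply: le_trans (clamp_lipschitz _ _ (ltW rho0)) _.
  have -> : w 0 a - w0 0 a - (w' 0 a - w0 0 a) = w 0 a - w' 0 a by ring.
  exact: rV_dist.
have K0 a : 0 <= K a by have [? []] := HK a.
pose KK := \sum_a K a; have KK0 : 0 <= KK by apply: sumr_ge0.
have Kle a : K a <= KK by rewrite /KK (bigD1 a) //= lerDl sumr_ge0.
pose M := KK * rho + `|F w0|; have M0 : 0 <= M by rewrite addr_ge0 // mulr_ge0 // ltW.
have GK x y a : `|F (w0 + P x) 0 a - F (w0 + P y) 0 a| <= KK * `|x - y|.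
  apply: le_trans (Hrho _ (Pn y) a _ (Pn x)) _.
  by apply: ler_pM => //; exact: PL.
have GM x a : `|F (w0 + P x) 0 a| <= M.
  rewrite -[F _ 0 a](subrK (F w0 0 a)) (le_trans (ler_normD _ _)) // lerD ?coord_le_norm //.
  have := Hrho 0 _ a (P x) (Pn x); rewrite normr0 (ltW rho0) addr0 subr0 => /(_ isT) h.
  by apply: le_trans h _; apply: ler_pM.
have [y y0 yd] := picard_global w0 KK0 M0 GK GM.
have r0 : 0 < (2 * (KK + 1))^-1 by rewrite invr_gt0 mulr_gt0 // ltr_wpDl.
set r := (_)^-1 in yd r0.
have M1 : 0 < M + 1 by rewrite ltr_wpDl.
exists y => //; exists (Num.min r (rho / (M + 1))).
  by rewrite lt_min r0 divr_gt0.
move=> t a; rewrite lt_min => /andP[tr]; rewrite ltr_pdivlMr // => trho.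
rewrite (_ : y t = w0 + P (y t)); first exact: yd.
apply/rowP => b; rewrite !mxE clamp_id ?subrKC // -y0.
have tM : `|t| * M <= rho.
  by apply: le_trans (ltW trho); rewrite ler_wpM2l // lerDl.
apply: le_trans tM; rewrite mulrC.
apply: (mvt0 (f := fun s => y s 0 b) (df := fun s => F (w0 + P (y s)) 0 b)) => u ut //.
by apply: yd; exact: le_lt_trans tr.
Qed.

End Picard.

(** * Solutions of second-order equations and their jets *)

Section SecondOrder.
Context {R : realType} {n : nat}.
Variable Omega : set 'rV[R]_n.
Hypothesis Omega_open : open Omega.
Variable f : 'rV[R]_n -> 'rV[R]_n -> 'rV[R]_n.
Hypothesis fO : tan_field Omega f.

Lemma isd_row_mx (x v : R -> 'rV[R]_n) (x' v' : 'rV[R]_n) t b :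
  (forall a, isd (fun s => x s 0 a) t (x' 0 a)) ->
  (forall a, isd (fun s => v s 0 a) t (v' 0 a)) ->
  isd (fun s => (row_mx (x s) (v s)) 0 b) t ((row_mx x' v') 0 b).
Proof.
move=> xd vd; rewrite -[b]splitK; case: (fintype.split b) => a /=.
  by rewrite row_mxEl; apply: isd_ext (xd a) => s; rewrite row_mxEl.
by rewrite row_mxEr; apply: isd_ext (vd a) => s; rewrite row_mxEr.
Qed.

(** Differentiating the equation repeatedly determines all higher derivatives from the state. The
    claim covers a whole interval because the induction differentiates it in [t]. *)
Lemma ode_solution_on_shell x : ode_solution f x -> Omega (x 0) ->
  exists2 e : R, 0 < e & forall t, `|t| < e -> Omega (x t) /\
    jet_of x t = on_shell f (row_mx (x t) (jet_of x t 1%N)).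
Proof.
move=> /near0P[e e0 He] x0O.
have xd t a : `|t| < e -> isd (fun s => x s 0 a) t (jet_of x t 1%N 0 a).
  by move=> te; rewrite mxE; have [/derivable_isd] := He t te a; rewrite add0r.
have vd t a : `|t| < e -> isd (fun s => jet_of x s 1%N 0 a) t (f (x t) (jet_of x t 1%N) 0 a).
  move=> te; have [_ []] := He t te a; rewrite add0r => /derivable_isd h <-.
  by rewrite mxE; apply: isd_ext h => s; rewrite mxE.
have x0d a : isd (fun s => x s 0 a) 0 (jet_of x 0 1%N 0 a) by apply: xd; rewrite normr0.
have [r r0 Hr] := curve_in_Omega Omega_open x0O x0d.
exists (Num.min e r); first by rewrite lt_min e0.
have xO t : `|t| < Num.min e r -> Omega (x t).
  by rewrite lt_min => /andP[_ /Hr]; rewrite add0r.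
move=> t te; split; first exact: xO.
apply/funext => l; apply/rowP => a; elim: l a t te => [|l IH] a t te.
  by rewrite mxE /on_shell /= row_mxKl.
have te' : `|t| < e by move: te; rewrite lt_min => /andP[].
set c := fun t => row_mx (x t) (jet_of x t 1%N) in IH *.
have cO : Omega (lsubmx (c t)) by rewrite row_mxKl; exact: xO.
rewrite -[RHS]/(flat_prolong f l.+1 a (c t)).
rewrite (flat_prolongS _ cO); last by apply: tan_flat_prolong.
rewrite mxE derive1nS; apply: isd_derive1.
apply: (@isd_near _ (fun s => flat_prolong f l a (c s))).
  exists (Num.min e r - `|t|); first by rewrite subr_gt0.
  move=> h hr; have th : `|t + h| < Num.min e r by apply: le_lt_trans (ler_normD _ _) _; lra.
  by rewrite /flat_prolong /c -IH // mxE.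
apply: an_chain => [|b]; first by apply: (tan_flat_prolong Omega_open).
rewrite /direction row_mxKl row_mxKr; apply: isd_row_mx => d; first exact: xd.
exact: vd.
Qed.

Lemma ode_solution_exists q0 v0 : Omega q0 ->
  exists x, [/\ ode_solution f x, x 0 = q0 & jet_of x 0 1%N = v0].
Proof.
move=> q0O; pose w0 := row_mx q0 v0.
have w0O : Omega (lsubmx w0) by rewrite row_mxKl.
have [|y y0 [r r0 yd]] := @picard R _ (direction f) w0.
  by move=> a; apply: (tan_direction Omega_open a fO).
pose x t := lsubmx (y t).
have xd t a : `|t| < r -> isd (fun s => x s 0 a) t (rsubmx (y t) 0 a).
  move=> tr; have := yd t (lshift n a) tr; rewrite row_mxEl.
  by apply: isd_ext => s; rewrite mxE.
have vd t a : `|t| < r -> isd (fun s => rsubmx (y s) 0 a) t (f (x t) (rsubmx (y t)) 0 a).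
  move=> tr; have := yd t (rshift n a) tr; rewrite row_mxEr.
  by apply: isd_ext => s; rewrite mxE.
have jE t : `|t| < r -> jet_of x t 1%N = rsubmx (y t).
  by move=> tr; apply/rowP => a; rewrite mxE; exact: isd_derive1 (xd t a tr).
exists x; split; first last.
- by rewrite jE ?normr0 // y0 row_mxKr.
- by rewrite /x y0 row_mxKl.
apply/near0P; exists r => // t; rewrite add0r => tr a.
have dd : isd (derive1 (fun s => x s 0 a)) t (f (x t) (rsubmx (y t)) 0 a).
  apply: isd_near (vd t a tr); exists (r - `|t|); first by rewrite subr_gt0.
  move=> h hr; symmetry; apply: isd_derive1; apply: xd.
  by apply: le_lt_trans (ler_normD _ _) _; lra.
split; first exact: isd_derivable (xd t a tr).
split; first exact: isd_derivable dd.
by rewrite jE // mxE derive1nS; exact: isd_derive1 dd.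
Qed.

End SecondOrder.

(** * The Bernoulli numbers of the meshed Lagrangian *)

Section Bernoulli.
Context {R : realType}.

Lemma size_bernoulli_seq m : size (bernoulli_seq m : seq R) = m.+1.
Proof. by elim: m => //= m IH; rewrite size_rcons IH. Qed.

Lemma nth_bernoulli_seq m j : (j <= m)%N -> (bernoulli_seq m : seq R)`_j = bernoulli j.
Proof.
elim: m => [|m IH]; first by rewrite leqn0 => /eqP ->.
rewrite leq_eqVlt => /orP[/eqP -> //|jm].
by rewrite /= nth_rcons size_bernoulli_seq jm IH.
Qed.

Lemma bernoulliS m : \sum_(j < m.+2) 'C(m.+2, j)%:R * bernoulli j = 0 :> R.
Proof.
rewrite big_ord_recr /= [bernoulli m.+1]/bernoulli /= nth_rcons size_bernoulli_seq ltnn eqxx.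
rewrite [X in _ * (- X / _)](eq_bigr (fun j : 'I_m.+1 => 'C(m.+2, j)%:R * bernoulli j)); last first.
  by move=> j _; rewrite nth_bernoulli_seq // -ltnS.
by rewrite binSn mulrC divfK ?pnatr_eq0 // subrr.
Qed.

Lemma fact_neq0 m : m`!%:R != 0 :> R.
Proof. by rewrite pnatr_eq0 -lt0n fact_gt0. Qed.

Lemma bin_div_fact m i : (i <= m)%N ->
  'C(m, i)%:R / m`!%:R = (i`!%:R)^-1 * ((m - i)`!%:R)^-1 :> R.
Proof.
move=> im; have := fact_neq0 i; have := fact_neq0 (m - i); have := fact_neq0 m.
rewrite -(bin_fact im) !natrM => h h1 h2; field.
rewrite h1 h2 /= ; apply: contraNneq h => ->; by rewrite mul0r.
Qed.

Lemma bernoulli_sum p :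
  \sum_(j < p.+1) bernoulli j / j`!%:R / (p - j).+1`!%:R = (p == 0%N)%:R :> R.
Proof.
case: p => [|m]; first by rewrite big_ord1 /= !divr1.
transitivity ((\sum_(j < m.+2) 'C(m.+2, j)%:R * bernoulli j) / m.+2`!%:R : R); last first.
  by rewrite bernoulliS mul0r.
rewrite mulr_suml; apply: eq_bigr => j _.
have jm : (j <= m.+1)%N by rewrite -ltnS.
rewrite -subSn // [RHS]mulrAC bin_div_fact; last exact: ltnW.
by rewrite [RHS]mulrC mulrA.
Qed.

Lemma exp_sum (a b : R) p :
  \sum_(i < p.+1) a ^+ i / i`!%:R * (b ^+ (p - i) / (p - i)`!%:R) = (a + b) ^+ p / p`!%:R.
Proof.
rewrite addrC exprDn mulr_suml; apply: eq_bigr => i _.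
have im : (i <= p)%N by rewrite -ltnS.
rewrite -[_ *+ 'C(_, _)]mulr_natl [RHS]mulrAC bin_div_fact //; ring.
Qed.

Lemma exp_sumS (a b : R) p :
  \sum_(i < p.+1) a ^+ i / i`!%:R * (b ^+ (p - i).+1 / (p - i).+1`!%:R)
  = ((a + b) ^+ p.+1 - a ^+ p.+1) / p.+1`!%:R.
Proof.
have := exp_sum a b p.+1; rewrite big_ord_recr /= subnn expr0 fact0 divr1 mulr1 mulrBl => <-.
rewrite addrK; apply: eq_bigr => i _.
by rewrite subSn // -ltnS.
Qed.

Lemma midpoint_coefE p :
  midpoint_coef p = (2^-1 ^+ p.+1 - (- 2^-1) ^+ p.+1) / p.+1`!%:R :> R.
Proof.
have -> : 2^-1 = - 2^-1 + 1 :> R by lra.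
rewrite opprD opprK -[X in (X ^+ _ - _)]/(- 2^-1 + 1) -(_ : - 2^-1 = 2^-1 - 1 :> R); last lra.
rewrite -exp_sumS; apply: eq_bigr => i _.
by rewrite expr1n mul1r.
Qed.

Lemma midpoint_coef_odd p : odd p -> midpoint_coef p = 0 :> R.
Proof.
move=> op; rewrite midpoint_coefE exprNn -signr_odd /= op /= expr0 mul1r subrr mul0r //.
Qed.

(** Generating functions cut off after [N] coefficients. Identities between them hold modulo ['X^N],
    with an explicit cofactor, so that [ring] can combine them. *)
Definition lowpoly (N : nat) (f : nat -> R) : {poly R} := \poly_(i < N) f i.

Lemma lowpolyM N (f g h : nat -> R) : (forall p, (p < N)%N -> \sum_(i < p.+1) f i * g (p - i)%N = h p) ->
  exists u, lowpoly N f * lowpoly N g = lowpoly N h + u * 'X^N.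
Proof.
move=> H; exists (drop_poly N (lowpoly N f * lowpoly N g)).
rewrite -{1}[lowpoly N f * _](poly_take_drop N); congr (_ + _).
apply/polyP => p; rewrite coef_take_poly coef_poly; case: ifP => // pN.
rewrite -H // coefM; apply: eq_bigr => i _; rewrite !coef_poly.
have ip : (i <= p)%N by rewrite -ltnS.
by rewrite (leq_ltn_trans ip pN) (leq_ltn_trans (leq_subr _ _) pN).
Qed.

Lemma lowpoly_delta N : lowpoly N.+1 (fun p => (p == 0%N)%:R) = 1.
Proof. by apply/polyP => p; rewrite coef_poly coef1; case: p => // p; case: ifP. Qed.

(* the generating functions: b(x) (e^x - 1)/x = 1 and 2 b(x/2) - b(x) = x e^(x/2)/(e^x - 1) *)
Lemma bernoulli_midpoint_all p :
  \sum_(i < p.+1) (2 / 2 ^+ i - 1) * (bernoulli i / i`!%:R) * midpoint_coef (p - i) = (p == 0%N)%:R :> R.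
Proof.
pose N := p.+1; have h2 : (2 : R) != 0 by [].
(* In this and the next two lines, the coefficients of [b(x)], [b(x/2)], [E(x) = (e^x - 1)/x],
   [E(x/2)], [e^(x/2)] and [e^(-x/2)]. *)
pose b i : R := bernoulli i / i`!%:R; pose bh i : R := b i / 2 ^+ i.
pose E i : R := (i.+1`!%:R)^-1; pose Eh i : R := E i / 2 ^+ i.
pose e i : R := 2^-1 ^+ i / i`!%:R; pose em i : R := (- 2^-1) ^+ i / i`!%:R.
have [u1 H1] : exists u, lowpoly N b * lowpoly N E = 1 + u * 'X^N.
  rewrite -(lowpoly_delta p); apply: lowpolyM => q _; exact: bernoulli_sum.
have [u2 H2] : exists u, lowpoly N bh * lowpoly N Eh = 1 + u * 'X^N.
  rewrite -(lowpoly_delta p); apply: lowpolyM => q _.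
  transitivity ((q == 0%N)%:R / 2 ^+ q : R); last by case: q => [|q]; rewrite ?divr1 ?mul0r.
  rewrite -bernoulli_sum mulr_suml; apply: eq_bigr => i _.
  have iq : (i <= q)%N by rewrite -ltnS.
  have -> : (2 ^+ q)^-1 = (2 ^+ i)^-1 * (2 ^+ (q - i))^-1 :> R by rewrite -invfM -exprD subnKC.
  rewrite /bh /Eh /b /E; ring.
(* [E(x/2) * e^(x/2) = 2 * E(x) - E(x/2)], the identity that links the arguments [x] and [x/2]. *)
have [u3 H3] : exists u, lowpoly N Eh * lowpoly N e = (lowpoly N (fun i => 2 * E i - Eh i)) + u * 'X^N.
  apply: lowpolyM => q _.
  transitivity (2 * ((2^-1 + 2^-1) ^+ q.+1 - 2^-1 ^+ q.+1) / q.+1`!%:R : R); last first.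
    rewrite (_ : 2^-1 + 2^-1 = 1 :> R); last lra.
    rewrite expr1n /Eh /E exprS exprVn; have := fact_neq0 q.+1; have := expf_neq0 q h2.
    move: (2 ^+ q) (_`!%:R) => x y x0 y0; field.
    by rewrite x0 y0.
  rewrite -mulrA -exp_sumS mulr_sumr [RHS](reindex_inj rev_ord_inj) /=.
  apply: eq_bigr => i _; have iq : (i <= q)%N by rewrite -ltnS.
  rewrite subSS subKn // /Eh /e /E exprS !exprVn.
  move: (i.+1`!%:R^-1) ((2 ^+ i)^-1) ((2 ^+ (q - i))^-1) ((q - i)`!%:R^-1) => x1 x2 x3 x4; by field.
have [u4 H4] : exists u, lowpoly N em * lowpoly N e = 1 + u * 'X^N.
  rewrite -(lowpoly_delta p); apply: lowpolyM => q _.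
  rewrite exp_sum addNr expr0n; case: q => [|q]; by rewrite ?divr1 ?mul0r.
have [u5 H5] : exists u, lowpoly N em * lowpoly N E = lowpoly N midpoint_coef + u * 'X^N.
  by apply: lowpolyM => q _.
have [u6 H6] : exists u, lowpoly N (fun i => 2 * bh i - b i) * lowpoly N midpoint_coef
   = lowpoly N (fun q => \sum_(i < q.+1) (2 * bh i - b i) * midpoint_coef (q - i)) + u * 'X^N.
  exact: lowpolyM.
have L (a : R) f g : lowpoly N (fun i => a * f i - g i) = a *: lowpoly N f - lowpoly N g.
  by apply/polyP => q; rewrite coefB coefZ !coef_poly; case: ifP => _; rewrite ?mulr0 ?subrr.
rewrite !L // in H3 H6.
have : exists u, lowpoly N (fun q => \sum_(i < q.+1) (2 * bh i - b i) * midpoint_coef (q - i)) = 1 + u * 'X^N.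
  have -> : lowpoly N (fun q => \sum_(i < q.+1) (2 * bh i - b i) * midpoint_coef (q - i)) =
     (2 *: lowpoly N bh - lowpoly N b) * lowpoly N midpoint_coef - u6 * 'X^N.
    by rewrite H6 addrK.
  have -> : lowpoly N midpoint_coef = lowpoly N em * lowpoly N E - u5 * 'X^N by rewrite H5 addrK.
  move: H1 H2 H3 H4; set B := lowpoly N b; set Bh := lowpoly N bh; set E_ := lowpoly N E.
  set Eh_ := lowpoly N Eh; set e_ := lowpoly N e; set m_ := lowpoly N em.
  rewrite -!mul_polyC; set two := 2%:P; move: ('X^N) => X.
  clearbody B Bh E_ Eh_ e_ m_ two; move=> H1 H2 H3 H4.
  (* The cofactor collects the multiples of ['X^N] left by the six identities as they are
     substituted below. *)
  exists (u4 + m_ * (e_ + 1) * u2 - m_ * Bh * u3 - m_ * u1 - (two * Bh - B) * u5 - u6).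
  transitivity (m_ * Bh * (Eh_ * e_ - u3 * X + Eh_) - m_ * (1 + u1 * X) - (two * Bh - B) * u5 * X - u6 * X).
    rewrite H3 -H1; ring.
  transitivity (m_ * (Bh * Eh_) * (e_ + 1) - m_ * Bh * u3 * X - m_ * (1 + u1 * X) - (two * Bh - B) * u5 * X - u6 * X).
    ring.
  rewrite H2; transitivity (m_ * e_ + (m_ * (e_ + 1) * u2 - m_ * Bh * u3 - m_ * u1 - (two * Bh - B) * u5 - u6) * X).
    ring.
  rewrite H4; ring.
move=> [u Hu]; have := congr1 (fun q : {poly R} => q`_p) Hu.
rewrite coef_poly ltnSn coefD coef1 coefMXn ltnSn addr0 => <-.
by apply: eq_bigr => i _; rewrite /bh -/(b i); congr (_ * _); ring.
Qed.

(** [midpoint_coef] vanishes at odd indices. For even [p] this removes the terms with odd [i] from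
    the full sum; for odd [p] it makes every term of the even sum vanish. *)
Lemma bernoulli_midpoint p :
  \sum_(j < p./2.+1) (2 / 2 ^+ (2 * j) - 1) * (bernoulli (2 * j) / (2 * j)`!%:R) *
    midpoint_coef (p - 2 * j) = (p == 0%N)%:R :> R.
Proof.
pose f i : R := (2 / 2 ^+ i - 1) * (bernoulli i / i`!%:R) * midpoint_coef (p - i).
rewrite -[LHS]/(\sum_(j < p./2.+1) f (2 * j)%N).
have [op|ep] := boolP (odd p).
  rewrite big1 => [|j _]; first by case: p op {f}.
  rewrite /f midpoint_coef_odd ?mulr0 // oddB; last by have := ltn_ord j; lia.
  by rewrite op oddM.
rewrite -bernoulli_midpoint_all -[RHS]/(\sum_(i < p.+1) f i).
have o i : odd i -> (i <= p)%N -> f i = 0.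
  by move=> oi ip; rewrite /f midpoint_coef_odd ?mulr0 // oddB // (negbTE ep) oi.
have pE : p = (2 * p./2)%N by lia.
rewrite [in RHS]pE; have : (2 * p./2 <= p)%N by lia.
elim: (p./2) => [|m IH] mp; first by rewrite !big_ord1.
rewrite big_ord_recr /= IH; last lia.
rewrite (_ : (2 * m.+1).+1 = (2 * m).+3); last lia.
rewrite [RHS]big_ord_recr [in RHS]big_ord_recr /= (o (2 * m).+1) ?addr0; [|lia|lia].
by rewrite (_ : (2 * m).+2 = 2 * m.+1)%N //; lia.
Qed.

End Bernoulli.

(** * Expansions of blown-up discrete Lagrangians *)

Section Edge.
Context {R : realType} {n : nat}.
Variable Omega : set 'rV[R]_n.
Hypothesis Omega_open : open Omega.
Implicit Types (F G : 'rV[R]_(n + n + 1) -> R) (z : jet R n).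

(** Analyticity along [h = 0] for all velocities: the coefficients of the expansions in [h] are
    computed from the germs there. *)
Definition edge F := forall w, Omega (lsubmx w) -> an (row_mx w 0) F.

Lemma edge_pd b F : edge F -> edge (pd b F).
Proof. by move=> FE w wO; apply: an_pd; exact: FE. Qed.

(* the expansion in h of (x, v, h) with x = q(c h) and x + h v = q((c+1) h),
   for a curve q with jet z *)
Definition chord (c : R) z (m : nat) : 'rV[R]_(n + n + 1) :=
  row_mx (row_mx ((c ^+ m / m`!%:R) *: z m)
                 ((((c + 1) ^+ m.+1 - c ^+ m.+1) / m.+1`!%:R) *: z m.+1))
         (const_mx (m == 1%N)%:R).

(** For a blow-up [F] of [G] this is the coefficient of [h ^ p] in [G] itself, so that the
    Lagrangian density of order [p] corresponds to the index [p.+1]. *)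
Definition density (c : R) (p : nat) F z : R := taylor_coef p F (chord c z).

Lemma chord0 c z : chord c z 0 = row_mx (state z) 0.
Proof.
by rewrite /chord /state !expr0 !expr1 !divr1 addrAC subrr add0r !scale1r.
Qed.

Lemma edge_an c z F : edge F -> Omega (z 0%N) -> an (chord c z 0) F.
Proof. by move=> FE zO; rewrite chord0; apply: FE; rewrite row_mxKl. Qed.

Lemma sum_coords (u : 'I_(n + n + 1) -> R) :
  \sum_b u b = \sum_a u (lshift 1 (lshift n a)) + \sum_a u (lshift 1 (rshift n a)) + u (rshift (n + n) 0).
Proof. by rewrite big_split_ord /= big_split_ord big_ord1. Qed.

Lemma chordx c z m a : chord c z m 0 (lshift 1 (lshift n a)) = c ^+ m / m`!%:R * z m 0 a.
Proof. by rewrite !row_mxEl mxE. Qed.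

Lemma chordv c z m a : chord c z m 0 (lshift 1 (rshift n a)) =
  ((c + 1) ^+ m.+1 - c ^+ m.+1) / m.+1`!%:R * z m.+1 0 a.
Proof. by rewrite row_mxEl row_mxEr mxE. Qed.

Lemma chordh c z m : chord c z m 0 (rshift (n + n) 0) = (m == 1%N)%:R.
Proof. by rewrite row_mxEr mxE. Qed.

Lemma coordP (P : 'I_(n + n + 1) -> Prop) :
  (forall a, P (lshift 1 (lshift n a))) -> (forall a, P (lshift 1 (rshift n a))) ->
  P (rshift (n + n) 0) -> forall b, P b.
Proof.
move=> Px Pv Ph b; rewrite -[b]splitK; case: (fintype.split b) => d /=.
  by rewrite -[d]splitK; case: (fintype.split d) => a /=.
by rewrite ord1.
Qed.

Lemma dp_chord c m b : dp Omega (fun z => chord c z m 0 b).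
Proof.
move: b; apply: coordP => [a|a|].
- by apply: dp_ext (dp_scale (c ^+ m / m`!%:R) (dp_coord Omega m a)) _ => z _; exact: chordx.
- apply: dp_ext (dp_scale (((c + 1) ^+ m.+1 - c ^+ m.+1) / m.+1`!%:R) (dp_coord Omega m.+1 a)) _.
  by move=> z _; exact: chordv.
- by apply: dp_ext (dp_cst Omega (m == 1%N)%:R) _ => z _; exact: chordh.
Qed.

Lemma dp_density c p F : edge F -> dp Omega (density c p F).
Proof.
have [k] := ubnP p; elim: k p F => // k IH [|p] F pk FE.
  apply: (dp_ext (F := fun z => F (row_mx (state z) 0))).
    apply: (dp_an (f := fun w => F (row_mx w 0))) => w wO.
    by apply: an_restrict; exact: FE.
  by move=> z _; rewrite /density taylor_coef0 chord0.
apply: (dp_ext (F := fun z => p.+1%:R^-1 * \sum_b \sum_(m < p.+1)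
   m.+1%:R * chord c z m.+1 0 b * density c (p - m) (pd b F) z)); last first.
  by move=> z _; rewrite /density taylor_coefS mulrC.
apply: dp_scale; apply: dp_sum => b _; apply: dp_sum => m _; apply: dp_mul.
  by apply: dp_scale; exact: dp_chord.
by apply: IH; [lia|exact: edge_pd].
Qed.

Lemma density_isd c p F z (Z : R -> jet R n) (Z' : jet R n) : edge F -> Omega (z 0%N) ->
  Z 0 = z -> (forall l a, isd (fun s => Z s l 0 a) 0 (Z' l 0 a)) ->
  isd (fun s => density c p F (Z s)) 0
    (\sum_a \sum_(m < p.+1) (c ^+ m / m`!%:R * Z' m 0 a *
         density c (p - m) (pd (lshift 1 (lshift n a)) F) z +
       ((c + 1) ^+ m.+1 - c ^+ m.+1) / m.+1`!%:R * Z' m.+1 0 a *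
         density c (p - m) (pd (lshift 1 (rshift n a)) F) z)).
Proof.
move=> FE zO Zz Zd.
pose A' m : 'rV[R]_(n + n + 1) := row_mx (row_mx ((c ^+ m / m`!%:R) *: Z' m)
   ((((c + 1) ^+ m.+1 - c ^+ m.+1) / m.+1`!%:R) *: Z' m.+1)) 0.
have Ad m b : isd (fun s => chord c (Z s) m 0 b) 0 (A' m 0 b).
  move: b; apply: coordP => [a|a|]; rewrite /A'.
  - rewrite !row_mxEl mxE; apply: isd_ext (isdZ _ (Zd m a)) => s.
    by rewrite chordx.
  - rewrite row_mxEl row_mxEr mxE; apply: isd_ext (isdZ _ (Zd m.+1 a)) => s.
    by rewrite chordv.
  - rewrite row_mxEr mxE; apply: isd_ext (isd_cst (m == 1%N)%:R 0) => s.
    by rewrite chordh.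
have := @taylor_coef_isd R _ p F (fun s => chord c (Z s)) A' 0 _ Ad.
rewrite Zz => /(_ (edge_an c FE zO)); rewrite sum_coords.
rewrite [X in _ + X]big1 ?addr0 => [|m _]; last by rewrite /A' row_mxEr mxE mul0r.
rewrite -big_split /=; congr isd; apply: eq_bigr => a _.
rewrite -big_split; apply: eq_bigr => m _ /=.
by rewrite /A' !row_mxEl row_mxEr !mxE.
Qed.

Lemma sum_single_ord (p l : nat) (u : nat -> R) :
  \sum_(m < p) (if (m : nat) == l then u m else 0) = if (l < p)%N then u l else 0.
Proof.
case: ifP => lp.
  by rewrite (bigD1 (Ordinal lp)) //= eqxx big1 ?addr0 // => m; rewrite -val_eqE => /negbTE ->.
by rewrite big1 // => m _; case: eqP => // ml; rewrite -ml ltn_ord in lp.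
Qed.

(** For [c = 0] the start point is constant, so [z l.+1] enters through the end point only, at order
    [l] of the velocity slot and with weight [1 / (l+1)!]. This produces the single family to which
    the triangular argument applies. *)
Lemma density_partial p F l a z : edge F -> Omega (z 0%N) ->
  jp l.+1 a (density 0 p F) z =
  if (l <= p)%N then density 0 (p - l) (pd (lshift 1 (rshift n a)) F) z / l.+1`!%:R else 0.
Proof.
move=> FE zO; apply: isd_jp.
pose Z s : jet R n := fun l' => if l' == l.+1 then z l' + s *: delta_mx 0 a else z l'.
pose Z' : jet R n := fun l' => if l' == l.+1 then delta_mx 0 a else 0.
have Z0 : Z 0 = z by apply/funext => l'; rewrite /Z scale0r addr0 if_same.
have Zd l' b : isd (fun s => Z s l' 0 b) 0 (Z' l' 0 b).
  rewrite /Z /Z'; case: eqP => _; first exact: isd_line.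
  by rewrite mxE; exact: isd_cst.
have := density_isd 0 p FE zO Z0 Zd; congr isd.
rewrite (bigD1 a) //= [X in _ + X]big1 ?addr0 => [|b /negbTE ba]; last first.
  have Z'b l' : Z' l' 0 b = 0 by rewrite /Z'; case: ifP; rewrite !mxE ?ba.
  by apply: big1 => m _; rewrite !Z'b !mulr0 !mul0r addr0.
rewrite -ltnS -(sum_single_ord _ _ (fun m => density 0 (p - m) (pd (lshift 1 (rshift n a)) F) z / m.+1`!%:R)).
apply: eq_bigr => m _; rewrite /Z' eqSS; case: (eqVneq (m : nat) l) => [ml|_]; last first.
  case: ifP => [/eqP ->|_]; rewrite ?mxE ?mulr0 ?mul0r ?addr0 //.
  by rewrite expr0n /= !mul0r.
rewrite ml (_ : l == l.+1 = false); last by rewrite ltn_eqF.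
by rewrite !mxE !eqxx add0r expr1n (expr0n _ l.+1) subr0 mulr0 mul0r add0r mulr1 mul1r mulrC.
Qed.

(* d/dc and the total derivative shift the chord in the same way *)
Lemma density_shift_isd p F c z : edge F -> Omega (z 0%N) ->
  isd (fun c => density c p.+1 F z) c (tot (density c p F) z).
Proof.
move=> FE zO.
pose D m : 'rV[R]_(n + n + 1) := row_mx (row_mx ((c ^+ m / m`!%:R) *: z m.+1)
   ((((c + 1) ^+ m.+1 - c ^+ m.+1) / m.+1`!%:R) *: z m.+2)) 0.
pose A' m := if m is m'.+1 then D m' else 0.
have Q (k : nat) u : isd (fun c : R => (c + u) ^+ k.+1 / k.+1`!%:R) c ((c + u) ^+ k / k`!%:R).
  have /(isdZ (k.+1`!%:R^-1)) := isd_comp_lin (f := fun c => c ^+ k.+1) (a := u) (b := 1) (t := c) (isdX k.+1 _).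
  rewrite mulr1 mulr1 addrC => H.
  rewrite (_ : _ / k`!%:R = k.+1`!%:R^-1 * (k.+1%:R * (c + u) ^+ k)).
    by apply: isd_ext H => s; rewrite mulr1 addrC mulrC.
  have := fact_neq0 (R := R) k; rewrite factS natrM; move: k`!%:R => x x0; field.
  by rewrite x0 /= addrC natr1 pnatr_eq0.
have Ad m b : isd (fun c => chord c z m 0 b) c (A' m 0 b).
  move: b; apply: coordP => [a|a|]; rewrite /A'.
  - case: m => [|m].
      rewrite mxE; apply: isd_ext (isd_cst (z 0%N 0 a) c) => s.
      by rewrite chordx expr0 divr1 mul1r.
    rewrite !row_mxEl mxE mulrC; have := Q m 0; rewrite addr0 => /(isdZ (z m.+1 0 a)).
    by apply: isd_ext => s; rewrite chordx addr0 mulrC.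
  - have := isdZ (z m.+1 0 a) (isdB (Q m 1) (Q m 0)).
    rewrite addr0 -mulrBl => H.
    have {}H : isd (fun c => chord c z m 0 (lshift 1 (rshift n a))) c
        (z m.+1 0 a * (((c + 1) ^+ m - c ^+ m) / m`!%:R)).
      by apply: isd_ext H => s; rewrite chordv addr0 -mulrBl mulrC.
    by case: m H => [|m] H; rewrite ?row_mxEl ?row_mxEr mxE; move: H; rewrite ?subrr ?mul0r ?mulr0 // mulrC.
  - rewrite (_ : (if m is m'.+1 then D m' else 0) 0 _ = 0); last first.
      by case: m => [|m]; rewrite ?row_mxEr mxE.
    by apply: isd_ext (isd_cst (m == 1%N)%:R c) => s; rewrite chordh.
have := @taylor_coef_isd R _ p.+1 F (fun c => chord c z) A' c (edge_an c FE zO) Ad.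
congr isd; apply/esym; apply: isd_tot.
have Zd l a : isd (fun s => (fun l => z l + s *: z l.+1) l 0 a) 0 (z l.+1 0 a) by exact: isd_line.
have Z0 : (fun l => z l + 0 *: z l.+1) = z by apply/funext => l; rewrite scale0r addr0.
have := density_isd c p FE zO (Z := fun s l => z l + s *: z l.+1) Z0 Zd; congr isd.
rewrite [RHS]sum_coords [X in _ = _ + X]big1 ?addr0 => [|[[|m] mp] _]; last 2 first.
- by rewrite mxE mul0r.
- by rewrite /= row_mxEr mxE mul0r.
rewrite -big_split /=; apply: eq_bigr => a _.
rewrite -[RHS]big_split [RHS]big_ord_recl /A' /= !mxE !mul0r !add0r; apply: eq_bigr => m _ /=.
by rewrite /D !row_mxEl row_mxEr !mxE subSS.
Qed.

Lemma density_shift0 F c c' z : density c 0 F z = density c' 0 F z.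
Proof. by rewrite /density !taylor_coef0 !chord0. Qed.

(** Taylor's formula for the shift of the base time: as functions of [c] both sides have the same
    derivative, by [density_shift_isd] and induction, and they agree at [c = 0]. *)
Lemma density_shift p F c : edge F -> eqO Omega (density c p F)
  (fun z => \sum_(i < p.+1) c ^+ i / i`!%:R * iter i tot (density 0 (p - i) F) z).
Proof.
move=> FE; elim: p c => [|p IH] c z zO.
  by rewrite big_ord1 expr0 divr1 mul1r (density_shift0 F c 0).
have dF i m : dp Omega (iter i tot (density 0 m F)).
  by apply: dp_iter_total => //; exact: dp_density.
pose S c := \sum_(i < p.+2) c ^+ i / i`!%:R * iter i tot (density 0 (p.+1 - i) F) z.
have Sd t : isd S t (tot (density t p F) z).
  rewrite (eqO_total Omega_open (IH t) zO).
  rewrite (total_sum Omega_open _ zO) => [|i _]; last exact: dp_scale.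
  rewrite -[X in isd _ _ X]add0r.
  apply: (@isd_ext _ (fun c => iter 0 tot (density 0 (p.+1 - 0) F) z +
     \sum_(i < p.+1) c ^+ i.+1 / i.+1`!%:R * iter i.+1 tot (density 0 (p.+1 - i.+1) F) z)).
    by move=> s; rewrite /S [RHS]big_ord_recl expr0 divr1 mul1r.
  apply: isdD; first exact: isd_cst.
  apply: isd_sum => i _; rewrite (total_scale Omega_open _ (dF _ _) zO) subSS -iterS.
  have := isdZ (iter i.+1 tot (density 0 (p - i) F) z / i.+1`!%:R) (isdX i.+1 t).
  rewrite [X in isd _ _ X -> _](_ : _ = t ^+ i / i`!%:R * iter i.+1 tot (density 0 (p - i) F) z).
    by apply: isd_ext => s; rewrite mulrC mulrA mulrAC.
  have := fact_neq0 (R := R) i; rewrite factS natrM; move: i`!%:R => x x0; field.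
  by rewrite x0 /= addrC natr1 pnatr_eq0.
have := @mvt0 R (fun c => density c p.+1 F z - S c) (fun _ => 0) c 0.
have -> : density 0 p.+1 F z - S 0 = 0.
  apply/eqP; rewrite subr_eq0 /S big_ord_recl expr0 divr1 mul1r big1 ?addr0 //= => i _.
  by rewrite expr0n /= !mul0r.
rewrite subr0 mul0r => H; apply/eqP; rewrite -subr_eq0 -normr_le0; apply: H => [t _|t _].
  by rewrite -(subrr (tot (density t p F) z)); apply: isdB; [exact: density_shift_isd|exact: Sd].
by rewrite normr0.
Qed.

Lemma densityD c p F G z : edge F -> edge G -> Omega (z 0%N) ->
  density c p (fun y => F y + G y) z = density c p F z + density c p G z.
Proof. by move=> FE GE zO; apply: taylor_coefD; exact: edge_an. Qed.

Lemma edge_mulXn j F : edge F -> edge (fun y => y 0 (rshift (n + n) 0) ^+ j * F y).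
Proof.
move=> FE w wO; apply: an_mul; last exact: FE.
apply: (an_eq (f := fun y => \prod_(i < j) y 0 (rshift (n + n) 0))).
  by move=> y; rewrite prodr_const card_ord.
by apply: an_prod => i _; exact: an_coord.
Qed.

Lemma density_mulXn c p j F z : edge F -> Omega (z 0%N) ->
  density c p (fun y => y 0 (rshift (n + n) 0) ^+ j * F y) z =
  if (j <= p)%N then density c (p - j) F z else 0.
Proof.
move=> FE zO; pose P := (j + p).+1.
have pP : (p <= j + P)%N by rewrite /P; lia.
apply: (taylor_coef_unique (c := fun p => if (j <= p)%N then density c (p - j) F z else 0) pP).
  by apply: edge_an => //; exact: edge_mulXn.
have := asymXn j (taylor_coef_jet_curve (P := P) (M := j + P) (leq_addl _ _) (edge_an c FE zO)).
apply: asym_near; exists 1 => // h _; congr (_ ^+ _ * _).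
rewrite jet_curveE (_ : (j + P).+1 = (j + P).-1.+2); last by rewrite /P; lia.
rewrite !big_ord_recl !chordh /= mul0r add0r mul1r expr1 big1 ?addr0 // => i _.
by rewrite chordh mul0r.
Qed.

Lemma pd_edge0 a F w : edge F -> (forall w, Omega (lsubmx w) -> F (row_mx w 0) = 0) ->
  Omega (lsubmx w) -> pd (lshift 1 a) F (row_mx w 0) = 0.
Proof.
move=> FE F0 wO; have [e e0 He] := open_box Omega_open wO.
apply: isd_pd; apply: isd_near (isd_cst 0 0); exists e => // h he; rewrite add0r.
have -> : row_mx w 0 + h *: delta_mx 0 (lshift 1 a) = row_mx (w + h *: delta_mx 0 a) 0 :> 'rV[R]_(n + n + 1).
  apply/rowP => b; rewrite -[b]splitK; case: (fintype.split b) => d /=; rewrite !mxE.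
    by rewrite !(unsplitK (inl _)) !mxE eq_lshift.
  by rewrite !(unsplitK (inr _)) eq_rlshift andbF mulr0 addr0.
rewrite F0 // lsubmxD; apply: He; apply: le_lt_trans (norm_lsubmx _) _.
rewrite normrZ; apply: le_lt_trans he; rewrite -[leRHS]mulr1 ler_wpM2l //.
exact: norm_delta_rV.
Qed.

(** At order 1 the derivatives in [x] and [v] are taken along [h = 0], where [F] vanishes. The
    acceleration drops out with them, and the result depends on the state only. *)
Lemma density1 c F z : edge F -> (forall w, Omega (lsubmx w) -> F (row_mx w 0) = 0) ->
  Omega (z 0%N) -> density c 1 F z = pd (rshift (n + n) 0) F (row_mx (state z) 0).
Proof.
move=> FE F0 zO; have sO : Omega (lsubmx (state z)) by rewrite row_mxKl.
rewrite /density taylor_coefS divr1 big_split_ord /= big1 ?add0r => [|a _].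
  by rewrite big_ord1 big_ord1 taylor_coef0 chord0 chordh !mul1r.
by rewrite big_ord1 taylor_coef0 chord0 (pd_edge0 _ FE F0 sO) mulr0.
Qed.

Lemma asym_in_open (x : R -> 'rV[R]_n) (c : nat -> 'rV[R]_n) P : Omega (c 0%N) ->
  (forall a, asym (fun h => x h 0 a) (fun m => c m 0 a) P) ->
  exists2 e : R, 0 < e & forall h, 0 < `|h| < e -> Omega (x h).
Proof.
move=> cO xc; have [r r0 Hr] := open_box Omega_open cO.
have [K [e [K0 e0 H]]] := asym_uniform (fun a => asym_weak (leq0n P) (xc a)).
exists (Num.min e (r / (K + 1))); first by rewrite lt_min e0 divr_gt0 // ltr_wpDl.
move=> h; rewrite lt_min => /and3P[h0 he hr]; rewrite -(subrKC (c 0%N) (x h)); apply: Hr.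
apply: (@le_lt_trans _ _ (K * `|h|)).
  apply: norm_rV_le => [|a]; first by rewrite mulr_ge0.
  by have := H h; rewrite h0 he => /(_ isT a); rewrite big_ord1 expr0 mulr1 expr1 !mxE.
move: hr; rewrite ltr_pdivlMr ?ltr_wpDl // => hr; apply: le_lt_trans hr.
by rewrite mulrC ler_wpM2l // lerDl.
Qed.

Lemma endpoints_asym F c z P (x y : R -> 'rV[R]_n) : edge F -> Omega (z 0%N) ->
  (forall a, asym (fun h => x h 0 a) (fun m => c ^+ m / m`!%:R * z m 0 a) P.+1) ->
  (forall a, asym (fun h => y h 0 a) (fun m => (c + 1) ^+ m / m`!%:R * z m 0 a) P.+1) ->
  asym (fun h => F (row_mx (row_mx (x h) (h^-1 *: (y h - x h))) (const_mx h)))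
    (fun p => density c p F z) P.
Proof.
move=> FE zO hx hy; apply: taylor_coef_asym; first exact: edge_an.
apply: coordP => [a|a|].
- apply: asym_near (asym_coef _ (asym_trunc (hx a))); last by move=> m _; rewrite chordx.
  by exists 1 => // h _; rewrite !row_mxEl.
- have := asym_shift (asymD (hy a) (asymZ (-1) (hx a))).
  rewrite !expr0 mulN1r subrr => H; apply: asym_near (asym_coef _ H).
    by exists 1 => // h _; rewrite row_mxEl row_mxEr !mxE mulN1r subr0 mulrC.
  by move=> m _; rewrite chordv; ring.
- apply: asym_near (asym_coef _ (asym_poly (fun m => (m == 1%N)%:R) (ltn_addr 1 (ltnSn P)))).
    exists 1 => // h _; rewrite row_mxEr mxE addn1 !big_ord_recl big1 ?addr0.
      by rewrite mul0r add0r mul1r expr1.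
    by move=> i _; rewrite mul0r.
  by move=> m _; rewrite chordh.
Qed.

End Edge.

(** Taylor's formula, obtained by integrating the expansion of the next jet entry. *)
Lemma asym_jets {R : realType} {n : nat} (Z : R -> jet R n) l a P :
  (exists2 e : R, 0 < e & forall t l a, `|t| < e -> isd (fun s => Z s l 0 a) t (Z t l.+1 0 a)) ->
  asym (fun h => Z h l 0 a) (fun m => Z 0 (l + m)%N 0 a / m`!%:R) P.
Proof.
move=> [e e0 Zd]; elim: P l => [|P IH] l.
  have [|K [r [K0 r0 H]]] := isd_lipschitz (Zd 0 l a _); first by rewrite normr0.
  exists K, r; split=> // h /andP[_ /H].
  by rewrite add0r big_ord1 addn0 divr1 expr0 mulr1 expr1.
have V0 : Z 0 l.+1 0 a = Z 0 (l.+1 + 0)%N 0 a / 0`!%:R by rewrite addn0 divr1.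
have V : exists2 e : R, 0 < e & forall t, `|t| < e -> isd (fun s => Z s l 0 a) t (Z t l.+1 0 a).
  by exists e => // t te; exact: Zd.
apply: asym_coef (asym_int V0 V (IH l.+1)) => -[|p] _; first by rewrite addn0 divr1.
by rewrite addSnnS -mulrA -invfM factS natrM mulrC [_ * p.+1%:R]mulrC mulrC.
Qed.

(** * Expansions of discrete Lagrangians in a chart *)

Section Blowup.
Context {R : realType} {n : nat} (Q : analyticManifold R n) (i : chart_index Q).
Implicit Types (G : Q -> Q -> R -> R) (F : 'rV[R]_n -> 'rV[R]_n -> R -> R) (z : jet R n).

Lemma blowup_edge G F : blowup G i F -> edge (chart_image i) (flat3 F).
Proof.
move=> [/analytic_onP FA _] w wO; apply: FA.
by rewrite /blowup_domain /= row_mxKl row_mxKr mxE scale0r addr0.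
Qed.

Lemma blowup_asym G F c z P (x y : R -> 'rV[R]_n) : blowup G i F -> chart_image i (z 0%N) ->
  (forall a, asym (fun h => x h 0 a) (fun m => c ^+ m / m`!%:R * z m 0 a) P.+1) ->
  (forall a, asym (fun h => y h 0 a) (fun m => (c + 1) ^+ m / m`!%:R * z m 0 a) P.+1) ->
  asym (fun h => G (param i (x h)) (param i (y h)) h) (fun p => density c p (flat3 F) z) P.
Proof.
move=> GF zO hx hy; have oi := @chart_image_open R n Q i.
have in_chart (d : R) (u : R -> 'rV[R]_n) :
    (forall a, asym (fun h => u h 0 a) (fun m => d ^+ m / m`!%:R * z m 0 a) P.+1) ->
    exists2 e : R, 0 < e & forall h, 0 < `|h| < e -> chart_image i (u h).
  move=> hu; apply: (@asym_in_open _ _ _ oi u (fun m => (d ^+ m / m`!%:R) *: z m) P.+1).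
    by rewrite expr0 divr1 scale1r.
  by move=> a; apply: asym_coef (hu a) => m _; rewrite mxE.
have [e e0 He] := in_chart _ _ hx; have [r r0 Hr] := in_chart _ _ hy.
apply: asym_near (endpoints_asym (blowup_edge GF) zO hx hy).
exists (Num.min e r); first by rewrite lt_min e0.
move=> h; rewrite lt_min => /and3P[h0 he hr]; have hn0 : h != 0 by rewrite -normr_gt0.
have yE : x h + h *: (h^-1 *: (y h - x h)) = y h by rewrite scalerA mulfV // scale1r subrKC.
rewrite /flat3 !row_mxKl !row_mxKr mxE.
have [_ /(_ (x h) (h^-1 *: (y h - x h)) h)] := GF; rewrite yE => <- //.
  by apply: He; rewrite h0.
by apply: Hr; rewrite h0.
Qed.

(** The Taylor polynomial of degree [j.+2] is exact enough for the coefficient of [h ^ j.+1]: one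
    order is lost to the division by [h]. *)
Lemma expansion_density G F (a b : R) j z : blowup G i F -> chart_image i (z 0%N) -> b = a + 1 ->
  expansion G i a b j z = density a j.+1 (flat3 F) z.
Proof.
move=> GF zO ->; have T (c : R) d : asym (fun h => taylor_curve j.+2 z (c * h) 0 d)
    (fun m => c ^+ m / m`!%:R * z m 0 d) j.+2.
  apply: asym_near (asym_poly (fun m => c ^+ m / m`!%:R * z m 0 d) (ltnSn j.+2)).
  exists 1 => // h _; rewrite /taylor_curve summxE; apply: eq_bigr => m _.
  by rewrite mxE exprMn; ring.
exact: (series_coef_asym (leqnn _) (blowup_asym GF zO (T a) (T (a + 1)))).
Qed.

End Blowup.

(** * Change of charts *)

Lemma isd_cst_rV {R : realType} {n : nat} (x : 'rV[R]_n) (t : R) a :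
  isd (fun=> x 0 a) t ((0 : 'rV[R]_n) 0 a).
Proof. by rewrite [X in isd _ _ X]mxE; exact: isd_cst. Qed.

Lemma sum_mul0 {R : realType} {n : nat} (u : 'I_n -> R) : \sum_e u e * (0 : 'rV[R]_n) 0 e = 0.
Proof. by apply: big1 => e _; rewrite mxE mulr0. Qed.

Section ChangeOfCoordinates.
Context {R : realType} {n : nat}.
Variable O : set 'rV[R]_n.
Hypothesis O_open : open O.
Variable phi : 'rV[R]_n -> 'rV[R]_n.
Let phi_ a x := phi x 0 a.
Hypothesis phi_an : forall x a, O x -> an x (phi_ a).

Definition dphi (x v : 'rV[R]_n) : 'rV[R]_n := \row_a \sum_b pd b (phi_ a) x * v 0 b.

Definition lift_phi (w : 'rV[R]_(n + n)) : 'rV[R]_(n + n) :=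
  row_mx (phi (lsubmx w)) (dphi (lsubmx w) (rsubmx w)).

Lemma isd_phi (c : R -> 'rV[R]_n) (c' : 'rV[R]_n) t : O (c t) ->
  (forall a, isd (fun s => c s 0 a) t (c' 0 a)) ->
  forall a, isd (fun s => phi (c s) 0 a) t (dphi (c t) c' 0 a).
Proof. by move=> cO cd a; rewrite mxE; apply: an_chain => //; exact: phi_an. Qed.

Lemma isd_jacobian (c : R -> 'rV[R]_n) (c' : 'rV[R]_n) a b t : O (c t) ->
  (forall d, isd (fun s => c s 0 d) t (c' 0 d)) ->
  isd (fun s => pd b (phi_ a) (c s)) t (\sum_e pd e (pd b (phi_ a)) (c t) * c' 0 e).
Proof. by move=> cO cd; apply: an_chain => //; apply: an_pd; exact: phi_an. Qed.

Lemma isd_dphi (c v : R -> 'rV[R]_n) (c' v' : 'rV[R]_n) t : O (c t) ->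
  (forall a, isd (fun s => c s 0 a) t (c' 0 a)) ->
  (forall a, isd (fun s => v s 0 a) t (v' 0 a)) ->
  forall a, isd (fun s => dphi (c s) (v s) 0 a) t
    (\sum_b ((\sum_e pd e (pd b (phi_ a)) (c t) * c' 0 e) * v t 0 b + pd b (phi_ a) (c t) * v' 0 b)).
Proof.
move=> cO cd vd a; apply: (@isd_ext _ (fun s => \sum_b pd b (phi_ a) (c s) * v s 0 b)).
  by move=> s; rewrite mxE.
by apply: isd_sum => b _; apply: isdM; [exact: isd_jacobian|exact: vd].
Qed.

Variables lam mu : 'rV[R]_(n + n) -> R.
Hypothesis mu_an : forall w, O (lsubmx w) -> an w mu.
Hypothesis lam_an : forall w, O (lsubmx w) -> an (lift_phi w) lam.
Hypothesis mu_lam : forall w, O (lsubmx w) -> mu w = lam (lift_phi w).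

Lemma sum_state (u : 'I_(n + n) -> R) :
  \sum_b u b = \sum_a u (lshift n a) + \sum_a u (rshift n a).
Proof. exact: big_split_ord. Qed.

Lemma state_delta_l a : delta_mx 0 (lshift n a) = row_mx (delta_mx 0 a) 0 :> 'rV[R]_(n + n).
Proof.
apply/rowP => b; rewrite -[b]splitK; case: (fintype.split b) => d /=; rewrite !mxE.
  by rewrite (unsplitK (inl _)) mxE eq_lshift.
by rewrite (unsplitK (inr _)) mxE eq_rlshift andbF.
Qed.

Lemma state_delta_r a : delta_mx 0 (rshift n a) = row_mx 0 (delta_mx 0 a) :> 'rV[R]_(n + n).
Proof.
apply/rowP => b; rewrite -[b]splitK; case: (fintype.split b) => d /=; rewrite !mxE.
  by rewrite (unsplitK (inl _)) mxE eq_lrshift andbF.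
by rewrite (unsplitK (inr _)) mxE eq_rshift.
Qed.

Lemma isd_mu_lam (c v : R -> 'rV[R]_n) (c' v' : 'rV[R]_n) (f : 'rV[R]_(n + n) -> R) t : O (c t) ->
  (forall a, isd (fun s => c s 0 a) t (c' 0 a)) ->
  (forall a, isd (fun s => v s 0 a) t (v' 0 a)) ->
  an (lift_phi (row_mx (c t) (v t))) f ->
  isd (fun s => f (lift_phi (row_mx (c s) (v s)))) t
   (\sum_d pd (lshift n d) f (lift_phi (row_mx (c t) (v t))) * dphi (c t) c' 0 d +
    \sum_d pd (rshift n d) f (lift_phi (row_mx (c t) (v t))) *
     (\sum_b ((\sum_e pd e (pd b (phi_ d)) (c t) * c' 0 e) * v t 0 b + pd b (phi_ d) (c t) * v' 0 b))).
Proof.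
move=> cO cd vd fA.
pose u : 'rV[R]_n := \row_d (\sum_b ((\sum_e pd e (pd b (phi_ d)) (c t) * c' 0 e) * v t 0 b + pd b (phi_ d) (c t) * v' 0 b)).
have Sd b : isd (fun s => lift_phi (row_mx (c s) (v s)) 0 b) t ((row_mx (dphi (c t) c') u) 0 b).
  apply: (@isd_ext _ (fun s => (row_mx (phi (c s)) (dphi (c s) (v s))) 0 b)).
    by move=> s; rewrite /lift_phi row_mxKl row_mxKr.
  apply: isd_row_mx => a; first exact: isd_phi.
  by rewrite mxE; exact: isd_dphi.
have := an_chain fA Sd; rewrite sum_state.
congr isd; congr (_ + _); apply: eq_bigr => d _; first by rewrite row_mxEl.
by rewrite row_mxEr mxE.
Qed.

Lemma isd_local (f : R -> R) (g : R -> R) (w u : 'rV[R]_(n + n)) d : O (lsubmx w) ->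
  (forall s, O (lsubmx (w + s *: u)) -> f s = g s) -> isd f 0 d -> isd g 0 d.
Proof.
move=> wO fg; apply: isd_near.
have cd a : isd (fun s => (lsubmx (w + s *: u)) 0 a) 0 (lsubmx u 0 a).
  rewrite [X in isd _ _ X]mxE; have := isd_line w u 0 (lshift n a).
  by apply: isd_ext => s; rewrite !mxE.
have [|e e0 He] := curve_in_Omega O_open (t := 0) _ cd; first by rewrite scale0r addr0.
by exists e => // h he; apply: fg; apply: He.
Qed.

Lemma pd_v_change c w : O (lsubmx w) -> pd (rshift n c) mu w =
  \sum_d pd c (phi_ d) (lsubmx w) * pd (rshift n d) lam (lift_phi w).
Proof.
move=> wO; apply: isd_pd.
have := @isd_mu_lam (fun _ => lsubmx w) (fun s => rsubmx w + s *: delta_mx 0 c) 0 (delta_mx 0 c) lam 0 wO.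
rewrite scale0r addr0 hsubmxK => /(_ _ _ (lam_an wO)) H.
have {}H := H (isd_cst_rV _ 0) (isd_line _ _ _).
rewrite [X in isd _ _ X](_ : _ = \sum_d pd (lshift n d) lam (lift_phi w) * dphi (lsubmx w) 0 0 d +
   \sum_d pd (rshift n d) lam (lift_phi w) *
   (\sum_b ((\sum_e pd e (pd b (phi_ d)) (lsubmx w) * (0 : 'rV_n) 0 e) * rsubmx w 0 b + pd b (phi_ d) (lsubmx w) * (delta_mx 0 c : 'rV_n) 0 b))).
  apply: (isd_local (u := delta_mx 0 (rshift n c))) wO _ H => s sO; rewrite mu_lam // state_delta_r.
  by congr (lam (lift_phi _)); rewrite scale_row_mx scaler0 -[w in RHS]hsubmxK add_row_mx addr0.
rewrite [X in _ = X + _]big1 ?add0r => [|d _]; last by rewrite mxE sum_mul0 mulr0.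
apply: eq_bigr => d _; rewrite mulrC; congr (_ * _).
by rewrite big_split /= sum_delta big1 ?add0r // => b _; rewrite sum_mul0 mul0r.
Qed.

Lemma pd_x_change c w : O (lsubmx w) -> pd (lshift n c) mu w =
  \sum_d pd c (phi_ d) (lsubmx w) * pd (lshift n d) lam (lift_phi w) +
  \sum_d (\sum_b pd c (pd b (phi_ d)) (lsubmx w) * rsubmx w 0 b) * pd (rshift n d) lam (lift_phi w).
Proof.
move=> wO; apply: isd_pd.
have := @isd_mu_lam (fun s => lsubmx w + s *: delta_mx 0 c) (fun s => rsubmx w) (delta_mx 0 c) 0 lam 0.
rewrite scale0r addr0 hsubmxK => /(_ wO (isd_line _ _ _) _ (lam_an wO)) H.
have {}H := H (isd_cst_rV _ 0).
rewrite [X in isd _ _ X](_ : _ = \sum_d pd (lshift n d) lam (lift_phi w) * dphi (lsubmx w) (delta_mx 0 c) 0 d +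
   \sum_d pd (rshift n d) lam (lift_phi w) *
   (\sum_b ((\sum_e pd e (pd b (phi_ d)) (lsubmx w) * (delta_mx 0 c : 'rV_n) 0 e) * rsubmx w 0 b + pd b (phi_ d) (lsubmx w) * (0 : 'rV_n) 0 b))).
  apply: (isd_local (u := delta_mx 0 (lshift n c))) wO _ H => s sO; rewrite mu_lam // state_delta_l.
  by congr (lam (lift_phi _)); rewrite scale_row_mx scaler0 -[w in RHS]hsubmxK add_row_mx addr0.
congr (_ + _); apply: eq_bigr => d _; rewrite mulrC; congr (_ * _).
  by rewrite mxE sum_delta.
by apply: eq_bigr => b _; rewrite sum_delta [X in _ + _ * X]mxE mulr0 addr0.
Qed.

(** The Euler-Lagrange expression with velocity and acceleration together as an independent argument
    [u]; it involves no jets or curves and can be transported between charts pointwise. *)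
Definition el_form (f : 'rV[R]_(n + n) -> R) (c : 'I_n) (w u : 'rV[R]_(n + n)) : R :=
  pd (lshift n c) f w - \sum_b pd b (pd (rshift n c) f) w * u 0 b.

(** Terms with second derivatives of the coordinate change come once from the derivative in [x] and
    once from the time derivative of the momentum. They cancel by symmetry, because the first half
    of [u] is the velocity. *)
Lemma el_form_change c w u : O (lsubmx w) -> rsubmx w = lsubmx u ->
  el_form mu c w u = \sum_d pd c (phi_ d) (lsubmx w) * el_form lam d (lift_phi w)
    (row_mx (dphi (lsubmx w) (lsubmx u))
       (\row_d \sum_b ((\sum_e pd e (pd b (phi_ d)) (lsubmx w) * lsubmx u 0 e) * rsubmx w 0 b
                        + pd b (phi_ d) (lsubmx w) * rsubmx u 0 b))).
Proof.
move=> wO wu; pose x (s : R) := lsubmx w + s *: lsubmx u; pose v (s : R) := rsubmx w + s *: rsubmx u.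
have xd a t : isd (fun s => x s 0 a) t (lsubmx u 0 a) by exact: isd_line.
have vd a t : isd (fun s => v s 0 a) t (rsubmx u 0 a) by exact: isd_line.
have x0 : x 0 = lsubmx w by rewrite /x scale0r addr0.
have v0 : v 0 = rsubmx w by rewrite /v scale0r addr0.
have xO : O (x 0) by rewrite x0.
have xv : row_mx (x 0) (v 0) = w by rewrite x0 v0 hsubmxK.
have H1 := an_isd_line u (an_pd (rshift n c) (mu_an wO)).
have H2 : isd (fun s => \sum_d pd c (phi_ d) (x s) * pd (rshift n d) lam (lift_phi (row_mx (x s) (v s)))) 0
   (\sum_d ((\sum_e pd e (pd c (phi_ d)) (x 0) * lsubmx u 0 e) * pd (rshift n d) lam (lift_phi (row_mx (x 0) (v 0))) +
      pd c (phi_ d) (x 0) * (\sum_e pd (lshift n e) (pd (rshift n d) lam) (lift_phi (row_mx (x 0) (v 0))) * dphi (x 0) (lsubmx u) 0 e +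
    \sum_e pd (rshift n e) (pd (rshift n d) lam) (lift_phi (row_mx (x 0) (v 0))) *
     (\sum_b ((\sum_e' pd e' (pd b (phi_ e)) (x 0) * lsubmx u 0 e') * v 0 0 b + pd b (phi_ e) (x 0) * rsubmx u 0 b))))).
  apply: isd_sum => d _; apply: isdM; first exact: isd_jacobian.
  by apply: isd_mu_lam => //; rewrite xv; apply: an_pd; exact: lam_an.
move: H2; set D2 := (X in isd _ _ X) => H2.
have E : isd (fun s => pd (rshift n c) mu (w + s *: u)) 0 D2.
  apply: (isd_local (u := u)) wO _ H2 => s sO; rewrite pd_v_change //.
  by rewrite /x /v -[w in RHS]hsubmxK -[u in RHS]hsubmxK scale_row_mx add_row_mx row_mxKl; exact: erefl.
have {}E := isd_unique H1 E.
rewrite /el_form pd_x_change // E /D2 xv x0 v0 big_split /=.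
rewrite [X in _ + X - _](_ : _ = \sum_d (\sum_e pd e (pd c (phi_ d)) (lsubmx w) * lsubmx u 0 e) * pd (rshift n d) lam (lift_phi w)).
  rewrite opprD addrA addrK -sumrB; apply: eq_bigr => d _; rewrite -mulrBr; congr (_ * (_ - _)).
  rewrite sum_state; congr (_ + _); apply: eq_bigr => e _; first by rewrite row_mxEl.
  by rewrite row_mxEr mxE.
apply: eq_bigr => d _; congr (_ * _); apply: eq_bigr => b _; rewrite wu.
by rewrite an_pdC //; exact: phi_an.
Qed.

Definition hessian (f : 'rV[R]_(n + n) -> R) w : 'M[R]_n :=
  \matrix_(a, b) pd (rshift n a) (pd (rshift n b) f) w.

(** The Hessian transforms by congruence, so a zero determinant in one chart is a zero determinant
    in the other. *)
Lemma hessian_change w : O (lsubmx w) -> exists J : 'M[R]_n,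
  hessian mu w = J *m hessian lam (lift_phi w) *m J^T.
Proof.
move=> wO; exists (\matrix_(c, d) pd c (phi_ d) (lsubmx w)); apply/matrixP => a b; rewrite !mxE.
apply: isd_pd.
apply: (@isd_local (fun s => \sum_d pd b (phi_ d) (lsubmx w) *
   pd (rshift n d) lam (lift_phi (row_mx (lsubmx w) (rsubmx w + s *: delta_mx 0 a)))) _ w (delta_mx 0 (rshift n a)) _ wO).
  move=> s sO; rewrite pd_v_change // state_delta_r scale_row_mx scaler0 -[w in RHS]hsubmxK add_row_mx addr0.
  by rewrite !row_mxKl.
have -> : \sum_j (( \matrix_(c, d) pd c (phi_ d) (lsubmx w)) *m hessian lam (lift_phi w)) a j *
    (\matrix_(c, d) pd c (phi_ d) (lsubmx w))^T j b =
   \sum_d pd b (phi_ d) (lsubmx w) * \sum_e pd (rshift n e) (pd (rshift n d) lam) (lift_phi w) * pd a (phi_ e) (lsubmx w).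
  apply: eq_bigr => d _; rewrite !mxE mulrC; congr (_ * _).
  by apply: eq_bigr => e _; rewrite !mxE mulrC.
apply: isd_sum => d _; apply: isdZ.
have := @isd_mu_lam (fun _ => lsubmx w) (fun s => rsubmx w + s *: delta_mx 0 a) 0 (delta_mx 0 a) (pd (rshift n d) lam) 0 wO.
rewrite scale0r addr0 hsubmxK => /(_ _ _ (an_pd _ (lam_an wO))) H.
have {H} := H (isd_cst_rV _ 0) (isd_line _ _ _).
congr isd; rewrite [X in X + _ = _]big1 ?add0r => [|e _]; last by rewrite mxE sum_mul0 mulr0.
apply: eq_bigr => e _; congr (_ * _).
by rewrite big_split /= sum_delta big1 ?add0r // => b' _; rewrite sum_mul0 mul0r.
Qed.

End ChangeOfCoordinates.

(** * Transition maps and the identity theorem on the tangent bundle *)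

Section Transitions.
Context {R : realType} {n : nat} (Q : analyticManifold R n).
Implicit Types (i j k : chart_index Q) (x v : 'rV[R]_n) (w : 'rV[R]_(n + n)).

Definition overlap i j : set 'rV[R]_n :=
  [set x | chart_image i x /\ chart_dom j (param i x)].

Definition transition i j x : 'rV[R]_n := chart j (param i x).

Lemma chart_imageP i x : chart_image i x -> chart_dom i (param i x) /\ chart i (param i x) = x.
Proof. by move=> [m mi <-]; rewrite chartK ?inE. Qed.

Lemma param_chart i (m : Q) : chart_dom i m -> param i (chart i m) = m.
Proof. by move=> mi; rewrite chartK ?inE. Qed.

Lemma chart_in_image i (m : Q) : chart_dom i m -> chart_image i (chart i m).
Proof. by move=> mi; exists m. Qed.

Lemma chart_overlap i j (m : Q) : chart_dom i m -> chart_dom j m -> overlap i j (chart i m).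
Proof. by move=> mi mj; split; [exact: chart_in_image|rewrite param_chart]. Qed.

Lemma overlap_open i j : open (overlap i j).
Proof.
rewrite openE => x [xi xj]; apply: filterI.
  by apply: open_nbhs_nbhs; split; [exact: chart_image_open|].
by apply: (param_continuous xi); apply: open_nbhs_nbhs; split; [exact: chart_dom_open|].
Qed.

Lemma transition_an i j x a : overlap i j x -> an x (fun y => transition i j y 0 a).
Proof.
move=> [xi xj]; have /analytic_onP := @transition_analytic R n Q i j a; apply.
have [mi E] := chart_imageP xi; exists (param i x) => //.
Qed.

Lemma transition_diffE i j x v : overlap i j x ->
  transition_diff i j x v = dphi (transition i j) x v.
Proof.
move=> xO; apply/rowP => a; rewrite !mxE; apply: isd_derive1.
exact: an_isd_line (transition_an a xO).
Qed.

Lemma overlapP i j x : overlap i j x -> [/\ overlap j i (transition i j x),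
  param j (transition i j x) = param i x & transition j i (transition i j x) = x].
Proof.
move=> [xi xj]; have [mi E] := chart_imageP xi.
have pE : param j (transition i j x) = param i x by rewrite /transition param_chart.
split=> //; last by rewrite /transition -/(transition i j x) pE.
by split; [exact: chart_in_image|rewrite pE].
Qed.

Lemma overlap_refl i x : chart_image i x -> overlap i i x.
Proof. by move=> xi; split=> //; have [] := chart_imageP xi. Qed.

Lemma overlap_trans i j k x : overlap i j x -> overlap i k x -> overlap j k (transition i j x).
Proof.
move=> xO [_ xk]; have [[yj _] pE _] := overlapP xO.
by split=> //; rewrite pE.
Qed.

Lemma near_line (O : set 'rV[R]_n) x v : open O -> O x ->
  exists2 e : R, 0 < e & forall h, `|h| < e -> O (x + h *: v).
Proof.
move=> oO xO; have cd a : isd (fun s => (x + s *: v) 0 a) 0 (v 0 a) by exact: isd_line.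
have [|e e0 He] := curve_in_Omega oO (t := 0) _ cd; first by rewrite scale0r addr0.
by exists e => // h he; have := He h he; rewrite add0r.
Qed.

Lemma dphi_comp i j k x v : overlap i j x -> overlap i k x ->
  dphi (transition j k) (transition i j x) (dphi (transition i j) x v) = dphi (transition i k) x v.
Proof.
move=> xj xk; apply/rowP => a; pose c (t : R) := x + t *: v.
have c0 : c 0 = x by rewrite /c scale0r addr0.
have cd b : isd (fun s => c s 0 b) 0 (v 0 b) by exact: isd_line.
have cj : overlap i j (c 0) by rewrite c0.
have ck : overlap i k (c 0) by rewrite c0.
have d1 := isd_phi (fun x a => transition_an a) cj cd.
have d2 := isd_phi (fun x a => transition_an a) (overlap_trans cj ck) d1 a.
have d3 := isd_phi (fun x a => transition_an a) ck cd a.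
rewrite c0 in d2 d3; apply: isd_unique d2 _; apply: isd_near d3.
have [e e0 He] := near_line v (@overlap_open i j) xj; exists e => // h he.
rewrite add0r; have [_ pE _] := overlapP (He h he).
by rewrite {2}/transition pE.
Qed.

Lemma dphi_id i x v : chart_image i x -> dphi (transition i i) x v = v.
Proof.
move=> xi; apply/rowP => a; have xO := overlap_refl xi.
rewrite mxE; have := an_isd_line v (transition_an a xO); move/isd_unique; apply.
have [e e0 He] := near_line v (@chart_image_open R n Q i) xi.
apply: isd_near (isd_line x v 0 a); exists e => // h he.
by rewrite add0r /transition (chart_imageP (He h he)).2.
Qed.

Lemma dphi_inv i j x v : overlap i j x ->
  dphi (transition j i) (transition i j x) (dphi (transition i j) x v) = v.
Proof.
move=> xO; have xi : chart_image i x by case: xO.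
by rewrite (dphi_comp _ xO (overlap_refl xi)) dphi_id.
Qed.

(** A tangent vector stores its components in the preferred chart of its base point; the cocycle
    rule [dphi_comp] sends both descriptions there. *)
Lemma tangent_param_transition i j x v : overlap i j x ->
  tangent_param j (transition i j x) (dphi (transition i j) x v) = tangent_param i x v.
Proof.
move=> xO; have [yO pE _] := overlapP xO; rewrite /tangent_param pE; congr (_, _).
set k := chart_at _; have xk : overlap i k x by split; [case: xO|exact: chart_atP].
by rewrite !transition_diffE ?dphi_comp //; exact: overlap_trans.
Qed.

Definition local (L : tangent Q -> R) i : 'rV[R]_(n + n) -> R := flat2 (local_lagrangian L i).

Lemma local_change (L : tangent Q -> R) i j w : overlap i j (lsubmx w) ->
  local L i w = local L j (lift_phi (transition i j) w).
Proof.
move=> wO; rewrite /local /flat2 /local_lagrangian row_mxKl row_mxKr.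
by rewrite tangent_param_transition.
Qed.

Lemma lagrangianP (L : tangent Q -> R) : lagrangian L <-> forall i, tan (chart_image i) (local L i).
Proof. by split=> LA i; have /analytic_onP := LA i. Qed.

Lemma velocity_hessianE (L : tangent Q -> R) i x v : lagrangian L -> chart_image i x ->
  velocity_hessian (local_lagrangian L i) x v = hessian (local L i) (row_mx x v).
Proof.
move=> /lagrangianP LA xi; apply/matrixP => a b; rewrite !mxE; apply: isd_derive1.
have tE : (fun s : R => derive1 (fun r : R => local_lagrangian L i x (v + s *: delta_mx 0 a + r *: delta_mx 0 b)) 0)
   = (fun s => pd (rshift n b) (local L i) (row_mx x v + s *: delta_mx 0 (rshift n a))).
  apply/funext => s; apply: isd_derive1.
  rewrite state_delta_r scale_row_mx scaler0 add_row_mx addr0.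
  have := an_isd_pd (rshift n b) (LA i (row_mx x (v + s *: delta_mx 0 a)) _).
  rewrite row_mxKl => /(_ xi); apply: isd_ext => r.
  by rewrite state_delta_r scale_row_mx scaler0 add_row_mx addr0 /local /flat2 row_mxKl row_mxKr.
by rewrite tE; apply: an_isd_pd; apply: an_pd; apply: LA; rewrite row_mxKl.
Qed.

(** Only vanishing is compared between charts, since a quantity such as the Hessian determinant
    changes by a factor. *)
Definition covariant_zero (Z : chart_index Q -> 'rV[R]_(n + n) -> R) : Prop :=
  (forall i, tan (chart_image i) (Z i)) /\
  forall i j w, overlap i j (lsubmx w) ->
    Z j (lift_phi (transition i j) w) = 0 -> Z i w = 0.

(** The region over a ball in the base is convex and contains all velocities, so every point is
    joined to [w0] by a segment inside it, to which [an_segment_zero] applies. *)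
Lemma box_zero (f : 'rV[R]_(n + n) -> R) (x0 : 'rV[R]_n) (r e : R) w0 :
  (forall w, `|lsubmx w - x0| < r -> an w f) -> `|lsubmx w0 - x0| < r -> 0 < e ->
  (forall y, `|y| < e -> f (w0 + y) = 0) ->
  forall w, `|lsubmx w - x0| < r -> f w = 0.
Proof.
move=> fA w0r e0 fe w wr; rewrite -(subrKC w0 w); apply: an_segment_zero => [t /andP[t0 t1]|].
  apply: fA; have -> : lsubmx (w0 + t *: (w - w0)) - x0 = (1 - t) *: (lsubmx w0 - x0) + t *: (lsubmx w - x0).
    by apply/rowP => a; rewrite !mxE; ring.
  apply: (le_lt_trans (ler_normD _ _)); rewrite !normrZ (ger0_norm t0) ger0_norm ?subr_ge0 //.
  have [->|tn0] := eqVneq t 0; first by rewrite subr0 mul1r mul0r addr0.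
  have tp : 0 < t by rewrite lt_def tn0.
  have := ler_wpM2l (_ : 0 <= 1 - t) (ltW w0r); rewrite subr_ge0 => /(_ t1).
  have : t * `|lsubmx w - x0| < t * r by rewrite ltr_pM2l.
  lra.
exists (e / (`|w - w0| + 1)); first by rewrite divr_gt0 // ltr_wpDl.
move=> t; rewrite ltr_pdivlMr ?ltr_wpDl // => te; apply: fe; rewrite normrZ.
by apply: le_lt_trans te; rewrite ler_wpM2l // lerDl.
Qed.

Lemma open_ball_chart i (m : Q) e : chart_dom i m -> 0 < e ->
  nbhs m [set m' | chart_dom i m' /\ `|chart i m' - chart i m| < e].
Proof.
move=> mi e0; apply: filterI.
  by apply: open_nbhs_nbhs; split; [exact: chart_dom_open|].
have := chart_continuous mi; move=> /cvgr_dist_lt /(_ e e0); apply: filterS => m'.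
by rewrite distrC.
Qed.

(** The base points near which [Z] vanishes for all velocities form an open and closed set. Working
    on the base is possible because a zero on a small open set of states spreads to all velocities
    over a ball. *)
Theorem identity_tangent Z (Q_connected : connected [set: Q]) : covariant_zero Z ->
  (exists i w0, chart_image i (lsubmx w0) /\
     exists2 e : R, 0 < e & forall y, `|y| < e -> Z i (w0 + y) = 0) ->
  forall i w, chart_image i (lsubmx w) -> Z i w = 0.
Proof.
move=> [ZA Zcov] [i0 [w0 [w0i [e0 e00 Z0]]]].
pose flat i x e := forall w, `|lsubmx w - x| < e -> chart_image i (lsubmx w) /\ Z i w = 0.
pose S : set Q := [set m | exists i, chart_dom i m /\ exists2 e : R, 0 < e & flat i (chart i m) e].
have spread i x w : chart_image i x -> chart_image i (lsubmx w) -> (exists2 e : R, 0 < e & forall y, `|y| < e -> Z i (w + y) = 0) ->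
    forall r, (forall y, `|y| < r -> chart_image i (x + y)) -> `|lsubmx w - x| < r -> flat i x r.
  move=> xi wi [e ep Ze] r Hr wr w' w'r.
  have D w1 : `|lsubmx w1 - x| < r -> chart_image i (lsubmx w1).
    by move=> h; rewrite -(subrKC x (lsubmx w1)); exact: Hr.
  split; first exact: D.
  by apply: (box_zero _ wr ep Ze w'r) => w1 /D; exact: ZA.
have S_open : open S.
  rewrite openE => m [i [mi [e ep He]]].
  have e2 : 0 < e / 2 by rewrite divr_gt0.
  apply: filterS (open_ball_chart mi e2) => m' [m'i m'm]; exists i; split=> //.
  exists (e / 2) => // w wm; apply: He.
  rewrite (_ : lsubmx w - chart i m = (lsubmx w - chart i m') + (chart i m' - chart i m)); last first.
    by rewrite addrA subrK.
  by apply: le_lt_trans (ler_normD _ _) _; lra.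
have S_closed : closed S.
  move=> m Sm; pose i := chart_at m; have mi : chart_dom i m := @chart_atP _ _ _ _.
  have [r r0 Hr] := open_box (@chart_image_open R n Q i) (chart_in_image mi).
  have [m' [[j [m'j [e ep He]]] [m'i m'm]]] := Sm _ (open_ball_chart mi r0).
  exists i; split=> //; exists r => //.
  have xO : overlap i j (chart i m') by exact: chart_overlap.
  (* Over a nearby point [m'] of the set any state serves to carry the zeros from chart [j] to chart
     [i]; zero velocity is chosen. The neighbourhood below is shrunk until its image stays in the
     ball over which [Z j] vanishes. *)
  pose w := row_mx (chart i m') 0 : 'rV[R]_(n + n).
  apply: (spread i _ w) => //; rewrite ?row_mxKl //; try exact: chart_in_image.
  have [e1 e10 He1] := open_box (@overlap_open i j) xO.
  have [K [rho [K0 rho0 HK]]] : exists K rho : R, [/\ 0 <= K, 0 < rho & forall y, `|y| <= rho ->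
      `|transition i j (chart i m' + y) - transition i j (chart i m')| <= K * `|y|].
    have /choice[K HK] := fun a => an_lipschitz (transition_an a xO).
    have [rho rho0 Hrho] : exists2 rho : R, 0 < rho & forall u : R, `|u| < rho -> forall a, forall y, `|y| <= `|u| ->
       `|transition i j (chart i m' + y) 0 a - transition i j (chart i m') 0 a| <= K a * `|y|.
      apply: finite_radius => a; have [r' [_ r'0 Hr']] := HK a; exists r' => // u ur y yu.
      have := Hr' 0 y; rewrite normr0 addr0 subr0; apply; first exact: ltW.
      by apply: le_trans yu _; exact: ltW.
    have K0 a : 0 <= K a by have [? []] := HK a.
    exists (\sum_a K a), (rho / 2); split; [exact: sumr_ge0|exact: divr_gt0|].
    move=> y yr; apply: dist_rV_le => [|a]; first by rewrite mulr_ge0 // sumr_ge0.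
    have r2 : `|rho / 2| = rho / 2 by rewrite gtr0_norm // divr_gt0.
    apply: le_trans (Hrho (rho / 2) _ a y _) _; rewrite ?r2 //; first lra.
    by rewrite ler_wpM2r // (bigD1 a) //= lerDl sumr_ge0.
  have K1 : 0 < K + 1 by rewrite ltr_wpDl.
  exists (Num.min e1 (Num.min rho (e / (K + 1)))); first by rewrite !lt_min e10 rho0 divr_gt0.
  move=> y; rewrite !lt_min => /and3P[ye1 yrho]; rewrite ltr_pdivlMr // => yK.
  have ly : `|lsubmx y| <= `|y| := norm_lsubmx y.
  have xyO : overlap i j (lsubmx (w + y)).
    by rewrite lsubmxD row_mxKl; apply: He1; exact: le_lt_trans ye1.
  apply: (Zcov i j) => //; apply: (He _ _).2; rewrite row_mxKl lsubmxD row_mxKl.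
  have -> : chart j m' = transition i j (chart i m') by rewrite /transition param_chart.
  apply: le_lt_trans (HK _ _) _; first by apply: le_trans ly _; exact: ltW.
  apply: le_lt_trans yK; rewrite mulrC; apply: ler_pM => //.
  by rewrite lerDl.
have S_T : S = [set: Q].
  apply: Q_connected; last by exists S; rewrite ?setTI.
    have [mi E] := chart_imageP w0i; exists (param i0 (lsubmx w0)), i0; split=> //.
    have [r r0 Hr] := open_box (@chart_image_open R n Q i0) w0i.
    exists r => //; rewrite E; apply: (spread i0 _ w0) => //; first by exists e0.
    by rewrite subrr normr0.
  by exists S; rewrite ?setTI.
move=> i w wi; have : S (param i (lsubmx w)) by rewrite S_T.
move=> [j [mj [e ep He]]]; apply: (Zcov i j); first by split.
by apply: (He _ _).2; rewrite row_mxKl subrr normr0.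
Qed.

End Transitions.

(** * Consistency *)

Section Estimates.
Context {R : realType}.

Lemma Rintegral_near_cst (f : R -> R) (h c B : R) : 0 < h ->
  (forall t, 0 <= t <= h -> {for t, continuous f}) ->
  (forall t, 0 <= t <= h -> `|f t - c| <= B) ->
  `|(\int[lebesgue_measure]_(t in `[0, h]) f t)%R - h * c| <= B * h.
Proof.
move=> h0 fc fB; pose mu := @lebesgue_measure R.
have int (g : R -> R) : (forall t, 0 <= t <= h -> {for t, continuous g}) -> mu.-integrable `[0, h] (EFin \o g).
  move=> gc; apply: continuous_compact_integrable; first exact: segment_compact.
  by apply: continuous_in_subspaceT => t; rewrite inE /= in_itv /=; exact: gc.
have intc (d : R) : mu.-integrable `[0, h] (EFin \o (fun _ => d)) by apply: int => t _; exact: cst_continuous.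
have I (d : R) : (\int[mu]_(t in `[0, h]) d)%R = d * h.
  by rewrite Rintegral_cst //= /mu lebesgue_measure_itv /= lte_fin h0 /= subr0.
have mD : measurable (`[0, h]%classic : set (measurableTypeR R)) by [].
have u := le_Rintegral mD (int f fc) (intc (c + B)) _.
have l := le_Rintegral mD (intc (c - B)) (int f fc) _.
rewrite !I in u l.
have {}u : \int[mu]_(t in `[0, h]) f t <= (c + B) * h.
  by apply: u => t; rewrite /= in_itv /= => /fB; rewrite ler_norml => /andP[? ?]; lra.
have {}l : (c - B) * h <= \int[mu]_(t in `[0, h]) f t.
  by apply: l => t; rewrite /= in_itv /= => /fB; rewrite ler_norml => /andP[? ?]; lra.
move: u l; rewrite -/mu; move: (Rintegral _ _ _) => X u l.
rewrite ler_norml; lra.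
Qed.

Lemma rV_continuous n (c : R -> 'rV[R]_n) (c' : 'I_n -> R) t :
  (forall a, isd (fun s => c s 0 a) t (c' a)) -> {for t, continuous c}.
Proof.
move=> /curve_lipschitz[K [r [K0 r0 H]]]; apply/cvgrPdist_lt => e e0; apply/near0P.
have K1 : 0 < K + 1 by rewrite ltr_wpDl.
exists (Num.min r (e / (K + 1))); first by rewrite lt_min r0 divr_gt0.
move=> h; rewrite lt_min ltr_pdivlMr // => /andP[hr he].
rewrite distrC; apply: le_lt_trans (H h hr) _; apply: le_lt_trans he.
by rewrite mulrC ler_wpM2l // lerDl.
Qed.

Lemma small_linear (a b B r : R) : 0 < r ->
  (forall h, 0 < h < r -> `|a + b * h| <= B * h ^+ 2) -> a = 0 /\ b = 0.
Proof.
move=> r0 H.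
have B0 : 0 <= B.
  have /H : 0 < r / 2 < r by apply/andP; split; lra.
  move=> /(le_trans (normr_ge0 _)); rewrite pmulr_lge0 // exprn_gt0 //; lra.
have a0 : a = 0.
  apply: (@small_eq0 _ a (`|b| + B) (Num.min r 1)); [by rewrite lt_min r0 ltr01|by rewrite addr_ge0|].
  move=> h; rewrite lt_min => /and3P[h0 hr h1].
  have /H : 0 < `|h| < r by rewrite h0 hr.
  move=> K; rewrite -(addrK (b * `|h|) a) (le_trans (ler_normB _ _)) // addrC mulrDl lerD //.
    by rewrite normrM normr_id.
  apply: le_trans K _; rewrite ler_wpM2l // expr2 ler_piMl // ltW //.
split=> //; apply: (@small_eq0 _ b B r) => // h /andP[h0 hr].
have /H : 0 < `|h| < r by rewrite h0 hr.
rewrite a0 add0r normrM normr_id => K.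
by rewrite -(ler_pM2r h0) -mulrA -expr2.
Qed.

End Estimates.

(** * Solutions in one chart as solutions on the manifold *)

Section LiftedCurves.
Context {R : realType} {n : nat} (Q : analyticManifold R n).
Implicit Types (L : tangent Q -> R) (i j : chart_index Q) (z : jet R n).

Lemma el_formE (Omega : set 'rV[R]_n) lam c z : open Omega -> tan Omega lam -> Omega (z 0%N) ->
  jp 0 c (fun z => lam (state z)) z - tot (jp 1 c (fun z => lam (state z))) z
  = el_form lam c (state z) (row_mx (z 1%N) (z 2%N)).
Proof.
move=> oO lamA zO; rewrite /el_form; congr (_ - _); first by rewrite (partial_an 0 c lamA zO).
have e : eqO Omega (jp 1 c (fun z => lam (state z))) (fun z => pd (rshift n c) lam (state z)).
  by move=> y yO; rewrite (partial_an 1 c lamA yO).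
rewrite (eqO_total oO e zO); apply: isd_tot.
have := an_isd_line (row_mx (z 1%N) (z 2%N)) (an_pd (rshift n c) (lamA (state z) _)).
rewrite row_mxKl => /(_ zO); apply: isd_ext => t.
by rewrite /state scale_row_mx add_row_mx.
Qed.

Lemma el_operatorE L i c z : lagrangian L -> chart_image i (z 0%N) ->
  el_operator L i c z = el_form (local L i) c (state z) (row_mx (z 1%N) (z 2%N)).
Proof.
move=> /lagrangianP LA zi; rewrite -(el_formE c (@chart_image_open R n Q i) (LA i) zi).
have E : (fun z : jet R n => local_lagrangian L i (z 0%N) (z 1%N)) = (fun z => local L i (state z)).
  by apply/funext => y; rewrite /local /flat2 /state row_mxKl row_mxKr.
by rewrite /el_operator /euler E big_ord_recr big_ord1 /= expr0 mul1r expr1 mulN1r totE !jpE.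
Qed.

(** Velocity and acceleration are carried as separate curves, so that derivatives in other charts
    follow from the chain rule rather than from nested [derive1]. *)
Definition el_curve L i (x v a : R -> 'rV[R]_n) (r : R) : Prop :=
  forall t, `|t| < r ->
    [/\ chart_image i (x t), forall c, isd (fun s => x s 0 c) t (v t 0 c),
        forall c, isd (fun s => v s 0 c) t (a t 0 c)
      & forall c, el_form (local L i) c (row_mx (x t) (v t)) (row_mx (v t) (a t)) = 0].

Section Lift.
Variables (L : tangent Q -> R) (i : chart_index Q) (x v a : R -> 'rV[R]_n) (r : R).
Hypotheses (LA : lagrangian L) (xel : el_curve L i x v a r).
Let q t := param i (x t).

Lemma near_in_range (t : R) : `|t| < r -> exists2 e : R, 0 < e & forall h, `|h| < e -> `|t + h| < r.
Proof.
move=> tr; exists (r - `|t|); first by rewrite subr_gt0.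
by move=> h hr; apply: le_lt_trans (ler_normD _ _) _; lra.
Qed.

Lemma near_overlap t j : `|t| < r -> chart_dom j (q t) ->
  exists2 e : R, 0 < e & forall h, `|h| < e -> `|t + h| < r /\ overlap i j (x (t + h)).
Proof.
move=> tr tj; have [xi xd _ _] := xel tr.
have [e e0 He] := near_in_range tr.
have [e' e'0 He'] := curve_in_Omega (@overlap_open R n Q i j) (conj xi tj) xd.
exists (Num.min e e'); first by rewrite lt_min e0.
by move=> h; rewrite lt_min => /andP[/He ? /He' ?].
Qed.

Lemma isd_lift t j c : `|t| < r -> chart_dom j (q t) ->
  isd (fun s => coordinates j q s 0 c) t (dphi (transition i j) (x t) (v t) 0 c).
Proof.
move=> tr tj; have [xi xd _ _] := xel tr.
exact: (isd_phi (fun x a => @transition_an R n Q i j x a) (conj xi tj) xd).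
Qed.

Lemma jet1_lift t j : `|t| < r -> chart_dom j (q t) ->
  jet_of (coordinates j q) t 1%N = dphi (transition i j) (x t) (v t).
Proof. by move=> tr tj; apply/rowP => c; rewrite [LHS]mxE; exact: isd_derive1 (isd_lift c tr tj). Qed.

Lemma tangent_lift_curve t : `|t| < r -> tangent_lift q t = tangent_param i (x t) (v t).
Proof.
move=> tr; have [xi _ _ _] := xel tr; rewrite /tangent_lift /tangent_param; congr (_, _).
rewrite jet1_lift //; last exact: chart_atP.
by rewrite transition_diffE //; split=> //; exact: chart_atP.
Qed.

(** The expression in chart [j] is pulled back by [el_form_change] to chart [i], where it
    vanishes. *)
Lemma isd2_lift t j : `|t| < r -> chart_dom j (q t) -> exists y2 : 'rV[R]_n,
  [/\ forall c, isd (derive1 (fun s => coordinates j q s 0 c)) t (y2 0 c) &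
      forall c, el_form (local L j) c (row_mx (coordinates j q t) (dphi (transition i j) (x t) (v t)))
        (row_mx (dphi (transition i j) (x t) (v t)) y2) = 0].
Proof.
move=> tr tj; have [xi xd vd El] := xel tr; have xO : overlap i j (x t) by [].
have tA i j x a := @transition_an R n Q i j x a.
pose y1 s := dphi (transition i j) (x s) (v s).
pose y2 : 'rV[R]_n := \row_c (\sum_b ((\sum_e pd e (pd b (fun x => transition i j x 0 c)) (x t) * v t 0 e) * v t 0 b
   + pd b (fun x => transition i j x 0 c) (x t) * a t 0 b)).
have y1d c : isd (fun s => y1 s 0 c) t (y2 0 c).
  by rewrite [X in isd _ _ X]mxE; exact: (isd_dphi (tA i j) xO xd vd).
have [e e0 He] := near_overlap tr tj.
exists y2; split=> c.
  apply: isd_near (y1d c); exists e => // h /He[hr [_ hj]]; symmetry.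
  by apply: isd_derive1; exact: isd_lift.
have [yO pE yE] := overlapP xO.
set y := coordinates j q t; have yT : y = transition i j (x t) by [].
have w1 : overlap j i (lsubmx (row_mx y (y1 t))) by rewrite row_mxKl.
have w2 : rsubmx (row_mx y (y1 t)) = lsubmx (row_mx (y1 t) y2) by rewrite row_mxKl row_mxKr.
have muA w : overlap j i (lsubmx w) -> an w (local L j).
  by move=> [wj _]; apply: (lagrangianP _).1.
have lamA w : overlap j i (lsubmx w) -> an (lift_phi (transition j i) w) (local L i).
  move=> wO; apply: (lagrangianP _).1 => //; rewrite row_mxKl.
  by have [[? _]] := overlapP wO.
have := @el_form_change R n _ (@overlap_open R n Q j i) _ (tA j i) (local L i) (local L j) muA lamA
   (fun w => @local_change R n Q L j i w) c _ _ w1 w2 => ->.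
rewrite big1 // => d _; rewrite /lift_phi !row_mxKl !row_mxKr yT yE dphi_inv //.
(* Transporting the acceleration to chart [j] and back gives the second derivative of the same
   curve, so it returns [a t] by uniqueness of derivatives. *)
rewrite (_ : \row__ _ = a t) ?El ?mulr0 //.
apply/rowP => b; rewrite mxE; apply: isd_unique (vd b).
have cd c' : isd (fun s => transition i j (x s) 0 c') t (y1 t 0 c') by exact: (isd_phi (tA i j) xO xd).
apply: isd_near (isd_dphi (tA j i) yO cd y1d b).
exists e => // h /He[_ hO]; by rewrite /y1 dphi_inv.
Qed.

Lemma el_solution_lift : el_solution L q (- r) r.
Proof.
move=> t tr'; have tr : `|t| < r by rewrite ltr_norml.
have [xi xd _ _] := xel tr; split.
  by apply: continuous_comp; [exact: rV_continuous xd|exact: param_continuous].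
move=> j tj c; have [y2 [y2d y2el]] := isd2_lift tr tj.
split; last split.
- apply/near0P; have [e e0 He] := near_overlap tr tj; exists e => // h /He[hr [_ hj]].
  exact: isd_derivable (isd_lift c hr hj).
- exact: isd_derivable (y2d c).
have j0 : jet_of (coordinates j q) t 0%N = coordinates j q t by apply/rowP => b; rewrite mxE.
have j2 : jet_of (coordinates j q) t 2%N = y2.
  by apply/rowP => b; rewrite mxE derive1nS; exact: isd_derive1 (y2d b).
rewrite el_operatorE //; last first.
  by rewrite j0; exact: chart_in_image.
by rewrite /state j0 j2 !jet1_lift.
Qed.

End Lift.
End LiftedCurves.

Section NearbyUnits.
Context {R : realType} {N : nat}.

Lemma unitmx_near m (A : 'rV[R]_N -> 'M[R]_m) x : (forall i j, an x (fun y => A y i j)) ->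
  A x \in unitmx -> exists2 e : R, 0 < e & forall y, `|y| < e -> A (x + y) \in unitmx.
Proof.
move=> Ax; rewrite unitmxE unitfE => d0.
have [K [rho [K0 rho0 H]]] := an_lipschitz (an_det Ax).
have K1 : 0 < K + 1 by rewrite ltr_wpDl.
have d0' : 0 < `|\det (A x)| by rewrite normr_gt0.
exists (Num.min rho (`|\det (A x)| / (K + 1))); first by rewrite lt_min rho0 divr_gt0.
move=> y; rewrite lt_min ltr_pdivlMr // => /andP[yr yK].
rewrite unitmxE unitfE; apply: contraTneq yK => dy; rewrite -leNgt.
have := H 0 y; rewrite normr0 addr0 subr0 dy sub0r normrN => /(_ (ltW rho0) (ltW yr)) h.
by apply: le_trans h _; rewrite mulrC ler_wpM2l // lerDl.
Qed.

End NearbyUnits.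

(** At [s = 0] the matrix is [B], and invertibility is an open condition; [e / 2] is small enough
    and nonzero. *)
Lemma unit_perturbation {R : realType} m (A B : 'M[R]_m) : B \in unitmx ->
  exists2 s : R, s != 0 & s *: A + B \in unitmx.
Proof.
move=> Bu; pose C (y : 'rV[R]_1) := y 0 0 *: A + B.
have [||e e0 He] := @unitmx_near R 1 m C 0.
- move=> i j; apply: (an_eq (f := fun y : 'rV[R]_1 => A i j * y 0 0 + B i j)).
    by move=> y; rewrite !mxE mulrC.
  by apply: an_add; [apply: an_scale; exact: an_coord|exact: an_cst].
- by rewrite /C mxE scale0r add0r.
have e2 : e / 2 != 0 by rewrite gt_eqF // divr_gt0.
exists (e / 2) => //; have := He (const_mx (e / 2)); rewrite add0r /C mxE; apply.
apply: norm_rV_lt => // a; rewrite mxE gtr0_norm ?divr_gt0 //.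
by rewrite ltr_pdivrMr // ltr_pMr // ltr1n.
Qed.

(** * First-order coefficients from consistency *)

Section FirstOrder.
Context {R : realType} {n : nat} (Q : analyticManifold R n).
Implicit Types (L : tangent Q -> R) (G : Q -> Q -> R -> R) (i j : chart_index Q) (z : jet R n).

Definition jet_of_state (w : 'rV[R]_(n + n)) (u : 'rV[R]_n) : jet R n :=
  fun l => if l == 0%N then lsubmx w else if l == 1%N then rsubmx w else if l == 2%N then u else 0.

Lemma state_jet w u : state (jet_of_state w u) = w.
Proof. exact: hsubmxK. Qed.

(** The Hessian is known to be invertible at [w0] only, so the equation is solved for the
    acceleration near [w0] and the solution restricted to the times it spends there. The derivative
    of the acceleration at 0 gives the curve an expansion with cubic remainder. *)
Lemma el_curve_exists L i w0 : lagrangian L -> chart_image i (lsubmx w0) ->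
  hessian (local L i) w0 \in unitmx ->
  exists x v a r, [/\ 0 < r, el_curve L i x v a r, x 0 = lsubmx w0, v 0 = rsubmx w0 &
    exists a1 : 'I_n -> R, forall c, isd (fun s => a s 0 c) 0 (a1 c)].
Proof.
move=> /lagrangianP LA w0i Hu; pose lam := local L i.
pose H w := (hessian lam w)^T.
pose alpha c w := pd (lshift n c) lam w - \sum_b pd (lshift n b) (pd (rshift n c) lam) w * rsubmx w 0 b.
pose f w : 'rV[R]_n := \row_b \sum_d invmx (H w) b d * alpha d w.
have oi := @chart_image_open R n Q i.
have lamA w : chart_image i (lsubmx w) -> an w lam by exact: LA.
have H_an c b : an w0 (fun w => H w c b).
  apply: (an_eq (f := pd (rshift n b) (pd (rshift n c) lam))) => [w|]; first by rewrite !mxE.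
  by apply: an_pd; apply: an_pd; exact: lamA.
have Hu' : H w0 \in unitmx by rewrite unitmx_tr.
have [e e0 He] := unitmx_near H_an Hu'.
have f_an b : an w0 (fun w => f w 0 b).
  apply: (an_eq (f := fun w => \sum_d invmx (H w) b d * alpha d w)) => [w|]; first by rewrite mxE.
  apply: an_sum => d _; apply: an_mul; first by apply: an_invmx => //; exists e.
  apply: an_sub; first by apply: an_pd; exact: lamA.
  apply: an_sum => b' _; apply: an_mul; first by apply: an_pd; apply: an_pd; exact: lamA.
  by apply: (an_eq (f := fun w => w 0 (rshift n b'))) => [w|]; [rewrite mxE|exact: an_coord].
have [|y y0 [r r0 yd]] := @picard R _ (fun w => row_mx (rsubmx w) (f w)) w0.
  move=> b; rewrite -[b]splitK; case: (fintype.split b) => d /=.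
    apply: (an_eq (f := fun w => w 0 (rshift n d))) => [w|]; last exact: an_coord.
    by rewrite row_mxEl mxE.
  by apply: (an_eq (f := fun w => f w 0 d)) => [w|]; [rewrite row_mxEr|].
have [e' e'0 He'] := open_box oi w0i.
have [K [rho [K0 rho0 HK]]] := curve_lipschitz (fun b => yd 0 b (ltac:(rewrite normr0; exact: r0))).
have K1 : 0 < K + 1 by rewrite ltr_wpDl.
pose r1 := Num.min (Num.min r rho) (Num.min e e' / (K + 1)).
have r10 : 0 < r1 by rewrite !lt_min r0 rho0 divr_gt0 // lt_min e0.
have near t : `|t| < r1 -> `|t| < r /\ `|y t - w0| < Num.min e e'.
  rewrite !lt_min => /andP[/andP[tr trho]]; rewrite ltr_pdivlMr // => tK; split=> //.
  have := HK t trho; rewrite add0r y0 => h; rewrite -lt_min; apply: le_lt_trans h _.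
  by apply: le_lt_trans tK; rewrite mulrC ler_wpM2l // lerDl.
have xd t c : `|t| < r -> isd (fun s => lsubmx (y s) 0 c) t (rsubmx (y t) 0 c).
  move=> tr; have := yd t (lshift n c) tr; rewrite row_mxEl.
  by apply: isd_ext => s; rewrite mxE.
have vd t c : `|t| < r -> isd (fun s => rsubmx (y s) 0 c) t (f (y t) 0 c).
  move=> tr; have := yd t (rshift n c) tr; rewrite row_mxEr.
  by apply: isd_ext => s; rewrite mxE.
exists (fun t => lsubmx (y t)), (fun t => rsubmx (y t)), (fun t => f (y t)), r1; split=> //; first last.
- have fy : forall c, an (y 0) (fun w => f w 0 c) by move=> c; rewrite y0.
  by have /choice[a1 Ha1] := fun c => ex_intro _ _ (an_chain (fy c) (fun b => yd 0 b (ltac:(rewrite normr0; exact: r0))));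
    exists a1.
- by rewrite y0.
- by rewrite y0.
move=> t /near[tr]; rewrite lt_min => /andP[ye ye'].
have yi : chart_image i (lsubmx (y t)).
  rewrite -(subrKC w0 (y t)) lsubmxD; apply: He'.
  by apply: le_lt_trans ye'; exact: norm_lsubmx.
split=> // [c|c|c]; [exact: xd|exact: vd|].
rewrite hsubmxK /el_form sum_state.
under eq_bigr do rewrite row_mxEl; under [X in _ - (_ + X)]eq_bigr do rewrite row_mxEr.
have Hy : H (y t) \in unitmx by rewrite -(subrKC w0 (y t)); exact: He.
have := linear_solve (fun d => alpha d (y t)) c Hy.
rewrite -/(f (y t)) => E.
rewrite (_ : \sum_(i0 < n) _ * f (y t) 0 i0 = alpha c (y t)); first by rewrite /alpha; ring.
by rewrite -E; apply: eq_bigr => b _; rewrite !mxE.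
Qed.

Lemma blowup_asym_start G i F z P (x : R -> 'rV[R]_n) : blowup G i F -> chart_image i (z 0%N) ->
  (forall a, asym (fun h => x h 0 a) (fun m => z m 0 a / m`!%:R) P.+1) ->
  asym (fun h => G (param i (z 0%N)) (param i (x h)) h) (fun p => density 0 p (flat3 F) z) P.
Proof.
move=> GF zi hx; apply: (@blowup_asym R n Q i G F 0 z P (fun _ => z 0%N) x) => // a.
  apply: asym_near (asym_coef _ (asym_poly (fun m => if m == 0%N then z 0%N 0 a else 0) (ltnSn P.+1))).
    exists 1 => // h _; rewrite big_ord_recl /= mulr1 big1 ?addr0 // => m _.
    by rewrite mul0r.
  by case=> [|m] _; rewrite ?expr0 ?divr1 ?mul1r // expr0n /= !mul0r.
by apply: asym_coef (hx a) => m _; rewrite add0r expr1n mul1r mulrC.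
Qed.

Lemma asym_taylor_curve P M z a : (P <= M)%N ->
  asym (fun h => taylor_curve M z h 0 a) (fun m => z m 0 a / m`!%:R) P.
Proof.
move=> PM; apply: asym_near (asym_poly (fun m => z m 0 a / m`!%:R) (_ : (P < M.+1)%N)) => //.
exists 1 => // h _; rewrite /taylor_curve summxE; apply: eq_bigr => m _.
by rewrite mxE mulrC mulrA mulrAC.
Qed.

(** The higher entries of [z'] are the Taylor coefficients that happen to result; only its state has
    to be known explicitly. *)
Lemma asym_transition i j P (x : R -> 'rV[R]_n) z : overlap i j (z 0%N) ->
  (forall a, asym (fun h => x h 0 a) (fun m => z m 0 a / m`!%:R) P) ->
  exists z', state z' = lift_phi (transition i j) (state z) /\
    forall a, asym (fun h => transition i j (x h) 0 a) (fun m => z' m 0 a / m`!%:R) P.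
Proof.
move=> zO hx; pose A m := (m`!%:R)^-1 *: z m.
have A0 : A 0%N = z 0%N by rewrite /A invr1 scale1r.
exists (fun m => \row_a (m`!%:R * taylor_coef m (fun y => transition i j y 0 a) A)); split.
  rewrite /state /lift_phi row_mxKl row_mxKr; congr row_mx; apply/rowP => a; rewrite !mxE.
    by rewrite mul1r taylor_coef0 A0.
  rewrite mul1r taylor_coefS divr1; apply: eq_bigr => b _.
  by rewrite big_ord1 taylor_coef0 A0 mul1r mxE invr1 mul1r mulrC.
move=> a; apply: asym_coef (_ : asym _ (fun m => taylor_coef m (fun y => transition i j y 0 a) A) P).
  by move=> m _; rewrite mxE mulrC mulKf // fact_neq0.
apply: taylor_coef_asym; first by rewrite A0; exact: transition_an.
by move=> b; apply: asym_coef (hx b) => m _; rewrite mxE mulrC.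
Qed.

Lemma density_change G i j F F' z P : blowup G i F -> blowup G j F' -> overlap i j (z 0%N) ->
  exists z', state z' = lift_phi (transition i j) (state z) /\
    forall p, (p <= P)%N -> density 0 p (flat3 F') z' = density 0 p (flat3 F) z.
Proof.
move=> GF GF' zO; pose x := taylor_curve P.+1 z.
have hx a : asym (fun h => x h 0 a) (fun m => z m 0 a / m`!%:R) P.+1 by exact: asym_taylor_curve.
have [z' [sz' hy]] := asym_transition zO hx; exists z'; split=> // p pP.
have z'0 : z' 0%N = transition i j (z 0%N).
  by have := congr1 lsubmx sz'; rewrite /state /lift_phi !row_mxKl.
have zi : chart_image i (z 0%N) by case: zO.
have [[zj _] pE _] := overlapP zO.
have z'j : chart_image j (z' 0%N) by rewrite z'0.
have A1 := blowup_asym_start GF zi hx; have A2 := blowup_asym_start GF' z'j hy.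
rewrite -(series_coef_asym pP A1) -(series_coef_asym pP A2); apply: series_coef_near.
have [||e e0 He] := asym_in_open (@overlap_open R n Q i j) (x := x) (c := fun m => (m`!%:R)^-1 *: z m) (P := P.+1).
- by rewrite invr1 scale1r.
- by move=> a; apply: asym_coef (hx a) => m _; rewrite mxE mulrC.
exists e => // h /He hO; rewrite z'0 pE; congr (G _ _ h).
by have [_ -> _] := overlapP hO.
Qed.

Definition first_order G L : Prop := forall i F, blowup G i F -> forall z, chart_image i (z 0%N) ->
  density 0 0 (flat3 F) z = 0 /\ density 0 1 (flat3 F) z = local L i (state z).

(** Along one exact solution [G = T0 + T1 * h + O(h ^ 2)], whereas the action is [h * L + O(h ^ 2)];
    the consistency bound forces [T0 = 0] and [T1 = L]. *)
Lemma consistent_at L G i F w0 : lagrangian L -> blowup G i F -> chart_image i (lsubmx w0) ->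
  hessian (local L i) w0 \in unitmx ->
  (exists c tau : R, 0 < tau /\
      forall (q : R -> Q) (a b : R), a < 0 < b -> el_solution L q a b ->
        tangent_lift q 0 = tangent_param i (lsubmx w0) (rsubmx w0) -> forall h : R, 0 < h <= tau -> h < b ->
          `|G (q 0) (q h) h - \int[lebesgue_measure]_(t in `[0, h]) L (tangent_lift q t)| <= c * h ^+ 2) ->
  exists u, let z := jet_of_state w0 u in
    density 0 0 (flat3 F) z = 0 /\ density 0 1 (flat3 F) z = local L i w0.
Proof.
move=> LA GF w0i Hu [c [tau [tau0 HG]]].
have [x [v [a [r [r0 xel x0 v0 [a1 ad]]]]]] := el_curve_exists LA w0i Hu.
exists (a 0); set z := jet_of_state w0 (a 0).
have r00 : `|0 : R| < r by rewrite normr0.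
have Va d : exists2 e : R, 0 < e & forall t, `|t| < e -> isd (fun s => v s 0 d) t (a t 0 d).
  by exists r => // t /xel[].
have Xv d : exists2 e : R, 0 < e & forall t, `|t| < e -> isd (fun s => x s 0 d) t (v t 0 d).
  by exists r => // t /xel[].
have hx d : asym (fun h => x h 0 d) (fun m => z m 0 d / m`!%:R) 2.
  have [K [e [K0 e0 HK]]] := isd_lipschitz (ad d).
  have A0 : asym (fun h => a h 0 d) (fun _ => a 0 0 d) 0.
    exists K, e; split=> // h /andP[_ /HK]; rewrite add0r.
    by rewrite big_ord1 expr0 mulr1 expr1.
  have A1 := asym_int (erefl (a 0 0 d)) (Va d) A0.
  have A2 := asym_int (erefl (v 0 0 d)) (Xv d) A1.
  apply: asym_coef A2 => -[|[|[|//]]] _ /=; rewrite /z /jet_of_state /= ?divr1 ?x0 ?v0 //.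
have zi : chart_image i (z 0%N) by [].
have [C [e [C0 e0 HC]]] := blowup_asym_start GF zi hx.
pose q t := param i (x t).
have qel := el_solution_lift LA xel.
have q0 : tangent_lift q 0 = tangent_param i (lsubmx w0) (rsubmx w0).
  by rewrite (tangent_lift_curve xel r00) x0 v0.
pose l t := local L i (row_mx (x t) (v t)).
have ld t : `|t| < r -> exists d, isd l t d.
  move=> tr; have [xi xd vd _] := xel t tr; eexists.
  apply: (an_chain (c := fun t => row_mx (x t) (v t)) (c' := fun b => (row_mx (v t) (a t)) 0 b)).
    by apply: (lagrangianP _).1 => //; rewrite row_mxKl.
  by move=> b; exact: isd_row_mx.
have [d0 l0d] := ld 0 r00; have [K [rho [K0 rho0 HK]]] := isd_lipschitz l0d.
have l0 : l 0 = local L i w0 by rewrite /l x0 v0 hsubmxK.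
pose s := Num.min (Num.min r rho) (Num.min tau e).
have s0 : 0 < s by rewrite !lt_min r0 rho0 tau0.
suff [E0 E] : density 0 0 (flat3 F) z = 0 /\ density 0 1 (flat3 F) z - local L i w0 = 0.
  by split; [exact: E0|apply/eqP; rewrite -subr_eq0 E].
apply: (@small_linear R _ _ (C + c + K) s) => // h; rewrite !lt_min.
move=> /andP[h0 /andP[/andP[hr hrho] /andP[htau he]]].
have hn : `|h| = h by rewrite gtr0_norm.
have r0' : - r < 0 < r by rewrite r0 oppr_lt0 r0.
have h1 : 0 < h <= tau by rewrite h0 ltW.
have := HG q (- r) r r0' qel q0 h h1 hr.
have -> : (\int[lebesgue_measure]_(t in `[0, h]) L (tangent_lift q t))%R =
    (\int[lebesgue_measure]_(t in `[0, h]) l t)%R.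
  apply: eq_Rintegral => t; rewrite inE /= in_itv /= => /andP[t0 th].
  have tr : `|t| < r by rewrite ger0_norm //; exact: le_lt_trans hr.
  by rewrite (tangent_lift_curve xel tr) /l /local /flat2 row_mxKl row_mxKr.
have Il : `|(\int[lebesgue_measure]_(t in `[0, h]) l t)%R - h * l 0| <= K * h * h.
  apply: Rintegral_near_cst => // t /andP[t0 th].
    have [|d ltd] := ld t; first by rewrite ger0_norm //; exact: le_lt_trans hr.
    exact: isd_continuous ltd.
  have := HK t; rewrite add0r ger0_norm // => H; apply: le_trans (H _) _; first exact: le_lt_trans hrho.
  by rewrite ler_wpM2l.
have := HC h; rewrite hn h0 he !big_ord_recl big_ord0 /= => /(_ isT).
move: Il; rewrite /q -l0 expr0 mulr1 expr1 addr0 /bump /= x0.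
move: (Rintegral _ _ _) (G _ _ _) (density _ _ _ _) (density _ _ _ _) (l 0) => Y g T0 T1 l00.
rewrite !ler_norml => /andP[? ?] /andP[? ?] /andP[? ?]; apply/andP; split; lra.
Qed.

Lemma covariant_edge0 G F : (forall i, blowup G i (F i)) ->
  covariant_zero (fun i w => flat3 (F i) (row_mx w 0)).
Proof.
move=> GF; split=> [i w wi|i j w wO].
  by apply: an_restrict; exact: (blowup_edge (GF i)).
have zO : overlap i j (jet_of_state w 0 0%N) by [].
have [z' [sz' E]] := density_change 0 (GF i) (GF j) zO.
have := E 0%N (leqnn _); rewrite /density !taylor_coef0 !chord0 sz' state_jet => ->.
by [].
Qed.

(** The derivative in [h] transforms like a function on the tangent bundle once the values at
    [h = 0] vanish in all charts: by [density1] it is then the coefficient of order 1, which is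
    intrinsic. *)
Lemma covariant_edge1 G L F : lagrangian L -> (forall i, blowup G i (F i)) ->
  (forall i w, chart_image i (lsubmx w) -> flat3 (F i) (row_mx w 0) = 0) ->
  covariant_zero (fun i w => pd (rshift (n + n) 0) (flat3 (F i)) (row_mx w 0) - local L i w).
Proof.
move=> LA GF F0; split=> [i w wi|i j w wO].
  apply: an_sub; last exact: (lagrangianP _).1.
  by apply: an_restrict; apply: an_pd; exact: (blowup_edge (GF i)).
have zO : overlap i j (jet_of_state w 0 0%N) by [].
have [z' [sz' E]] := density_change 1 (GF i) (GF j) zO.
have wi : chart_image i (lsubmx w) by case: wO.
have z'j : chart_image j (z' 0%N).
  have := congr1 lsubmx sz'; rewrite state_jet /lift_phi !row_mxKl => ->.
  by have [[]] := overlapP wO.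
have := E 1%N (leqnn _).
rewrite (density1 (@chart_image_open R n Q j) 0 (blowup_edge (GF j)) (F0 j) z'j).
rewrite (density1 (@chart_image_open R n Q i) 0 (blowup_edge (GF i)) (F0 i) wi).
by rewrite sz' state_jet (local_change L wO) => ->.
Qed.

Lemma covariant_det L : lagrangian L -> covariant_zero (fun i w => \det (hessian (local L i) w)).
Proof.
move=> /lagrangianP LA; split=> [i w wi|i j w wO].
  apply: an_det => a b; apply: (an_eq (f := pd (rshift n a) (pd (rshift n b) (local L i)))).
    by move=> y; rewrite mxE.
  by apply: an_pd; apply: an_pd; exact: LA.
have [||J ->] := hessian_change (@overlap_open R n Q i j) (fun x a => @transition_an R n Q i j x a)
    (lam := local L j) (mu := local L i) _ _ wO.
- by move=> y yO; apply: LA; rewrite row_mxKl; have [[]] := overlapP yO.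
- by move=> y; exact: local_change.
by rewrite !det_mulmx => ->; rewrite mulr0 mul0r.
Qed.

Lemma tangent_open_box (U : set (tangent Q)) i w : open U -> chart_image i (lsubmx w) ->
  U (tangent_param i (lsubmx w) (rsubmx w)) -> exists2 e : R, 0 < e & forall y, `|y| < e ->
    chart_image i (lsubmx (w + y)) /\ U (tangent_param i (lsubmx (w + y)) (rsubmx (w + y))).
Proof.
move=> oU wi Uw; have oW : tangent_open U by exact: oU.
have /nbhs_ballP[e /= e0 He] : nbhs (lsubmx w, rsubmx w) [set p : 'rV[R]_n * 'rV[R]_n |
    chart_image i p.1 /\ U (tangent_param i p.1 p.2)].
  by apply: open_nbhs_nbhs; split.
exists e => // y ye; apply: (He (lsubmx (w + y), rsubmx (w + y))); split; rewrite -ball_normE /ball_ /=.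
  by rewrite lsubmxD opprD addNKr normrN; apply: le_lt_trans ye; exact: norm_lsubmx.
apply: le_lt_trans ye; apply: norm_rV_le => // a; rewrite !mxE opprD addNKr normrN.
exact: coord_le_norm.
Qed.

Lemma first_order_consistent G L : connected [set: Q] -> lagrangian L -> somewhere_regular L ->
  discrete_lagrangian G -> consistent_discretisation L G -> first_order G L.
Proof.
move=> Qc LA [i1 [x1 [v1 [x1i Hu1]]]] [_ GF] [U [oU [[m w] Umw] _ [c [tau [tau0 HG]]]]].
have oi i := @chart_image_open R n Q i.
have [F HF] : exists F : chart_index Q -> 'rV[R]_n -> 'rV[R]_n -> R -> R, forall i, blowup G i (F i).
  by have [F HF] := choice GF; exists F.
pose i0 := chart_at m; have mi : chart_dom i0 m := chart_atP m.
pose w1 := row_mx (chart i0 m) w : 'rV[R]_(n + n).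
have w1i : chart_image i0 (lsubmx w1) by rewrite row_mxKl; exact: chart_in_image.
have Uw1 : U (tangent_param i0 (lsubmx w1) (rsubmx w1)).
  rewrite row_mxKl row_mxKr /tangent_param param_chart // transition_diffE; last exact: overlap_refl (chart_in_image mi).
  by rewrite dphi_id //; exact: chart_in_image.
have [e e0 He] := tangent_open_box oU w1i Uw1.
(* The open set of consistency is not known to contain a regular state. If the Hessian determinant
   vanished on this box, the identity theorem would contradict the regularity at [(x1, v1)]. *)
have [y1 [y1e y1d]] : exists y, `|y| < e /\ \det (hessian (local L i0) (w1 + y)) != 0.
  apply: contrapT => H.
  have D : exists i w0, chart_image i (lsubmx w0) /\
      exists2 e : R, 0 < e & forall y, `|y| < e -> \det (hessian (local L i) (w0 + y)) = 0.
    exists i0, w1; split=> //; exists e => // y ye; apply/eqP; apply: contrapT => /negP d.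
    by apply: H; exists y.
  have := identity_tangent Qc (covariant_det LA) D (i := i1) (w := row_mx x1 v1).
  rewrite row_mxKl => /(_ x1i) E.
  by move: Hu1; rewrite velocity_hessianE // unitmxE unitfE E eqxx.
pose w2 := w1 + y1; have [w2i Uw2] := He y1 y1e.
have H_an a b : an w2 (fun w => hessian (local L i0) w a b).
  apply: (an_eq (f := pd (rshift n a) (pd (rshift n b) (local L i0)))) => [y|]; first by rewrite mxE.
  by apply: an_pd; apply: an_pd; exact: (lagrangianP _).1.
have Hu2 : hessian (local L i0) w2 \in unitmx by rewrite unitmxE unitfE.
have [e' e'0 He'] := unitmx_near H_an Hu2.
have [e'' e''0 He''] := tangent_open_box oU w2i Uw2.
have C y : `|y| < Num.min e' e'' -> exists u, density 0 0 (flat3 (F i0)) (jet_of_state (w2 + y) u) = 0 /\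
    density 0 1 (flat3 (F i0)) (jet_of_state (w2 + y) u) = local L i0 (w2 + y).
  rewrite lt_min => /andP[ye' ye'']; have [yi Uy] := He'' y ye''.
  apply: (consistent_at LA (HF i0) yi (He' y ye')).
  exists c, tau; split=> // q a b ab qel qU h h1 hb; apply: (HG q a b) => //.
  by rewrite qU.
have emin : 0 < Num.min e' e'' by rewrite lt_min e'0.
have F0 i0' w0 : chart_image i0' (lsubmx w0) -> flat3 (F i0') (row_mx w0 0) = 0.
  apply: (identity_tangent Qc (covariant_edge0 HF)); exists i0, w2; split=> //.
  exists (Num.min e' e'') => // y /C[u []].
  by rewrite /density taylor_coef0 chord0 state_jet.
have F1 : forall i w0, chart_image i (lsubmx w0) ->
    pd (rshift (n + n) 0) (flat3 (F i)) (row_mx w0 0) - local L i w0 = 0.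
  apply: (identity_tangent Qc (covariant_edge1 LA HF F0)); exists i0, w2; split=> //.
  exists (Num.min e' e'') => // y ye; have [u [_ <-]] := C y ye.
  have yi : chart_image i0 (jet_of_state (w2 + y) u 0%N) by move: ye; rewrite lt_min => /andP[_ /He''[]].
  by rewrite (density1 (oi i0) 0 (blowup_edge (HF i0)) (F0 i0) yi) state_jet subrr.
move=> i F' GF' z zi.
(* An arbitrary blow-up [F'] in chart [i] is compared with the chosen one by [density_change] for
   the identity transition. *)
have zO : overlap i i (z 0%N) := overlap_refl zi.
have [z' [sz' E]] := density_change 1 GF' (HF i) zO.
have si : chart_image i (lsubmx (state z)) by rewrite row_mxKl.
have sz : state z' = state z.
  rewrite sz' /lift_phi /state row_mxKl row_mxKr dphi_id // /transition.
  by have [_ ->] := chart_imageP zi.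
have z'0 : z' 0%N = z 0%N by have := congr1 lsubmx sz; rewrite /state !row_mxKl.
have z'i : chart_image i (z' 0%N) by rewrite z'0.
rewrite -(E 0%N) // -(E 1%N) //; split.
  by rewrite /density taylor_coef0 chord0 sz F0.
rewrite (density1 (oi i) 0 (blowup_edge (HF i)) (F0 i) z'i) sz.
by apply/eqP; rewrite -subr_eq0 F1.
Qed.

(** Linearity of the integrator concerns values at [h != 0] rather than blow-ups, so the
    coefficients are compared through expansions of [G] along a Taylor curve. *)
Lemma density_linear G G1 G2 i F F1 F2 (c : R) z p :
  (forall q0 q1 (h : R), h != 0 -> G q0 q1 h = c * G1 q0 q1 h + G2 q0 q1 h) ->
  blowup G i F -> blowup G1 i F1 -> blowup G2 i F2 -> chart_image i (z 0%N) ->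
  density 0 p (flat3 F) z = c * density 0 p (flat3 F1) z + density 0 p (flat3 F2) z.
Proof.
move=> GE GF GF1 GF2 zi.
have hx a : asym (fun h => taylor_curve p.+1 z h 0 a) (fun m => z m 0 a / m`!%:R) p.+1 by exact: asym_taylor_curve.
have A := blowup_asym_start GF zi hx.
have A1 := asymD (asymZ c (blowup_asym_start GF1 zi hx)) (blowup_asym_start GF2 zi hx).
rewrite -(series_coef_asym (leqnn p) A) -[RHS](series_coef_asym (leqnn p) A1).
apply: series_coef_near; exists 1 => // h /andP[h0 _].
by rewrite GE // -normr_gt0.
Qed.

Lemma local_linear (c : R) L1 L2 i w : local (fun p => c * L1 p + L2 p) i w = c * local L1 i w + local L2 i w.
Proof. by []. Qed.

Lemma lagrangian_linear (c : R) L1 L2 : lagrangian L1 -> lagrangian L2 ->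
  lagrangian (fun p => c * L1 p + L2 p).
Proof.
move=> /lagrangianP A1 /lagrangianP A2; apply/lagrangianP => i w wi.
by apply: an_add; [apply: an_scale; exact: A1|exact: A2].
Qed.

Lemma hessian_linear (c : R) L1 L2 i w : lagrangian L1 -> lagrangian L2 -> chart_image i (lsubmx w) ->
  hessian (local (fun p => c * L1 p + L2 p) i) w = c *: hessian (local L1 i) w + hessian (local L2 i) w.
Proof.
move=> /lagrangianP A1 /lagrangianP A2 wi; apply/matrixP => a b; rewrite !mxE.
have oi := @chart_image_open R n Q i.
have E : eqT (chart_image i) (pd (rshift n b) (local (fun p => c * L1 p + L2 p) i))
    (fun y => c * pd (rshift n b) (local L1 i) y + pd (rshift n b) (local L2 i) y).
  move=> y yi; rewrite (pdD (f := fun y => c * local L1 i y)) ?pdZ //; [exact: A1| |exact: A2].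
  by apply: an_scale; exact: A1.
rewrite (eqT_pd oi _ E wi) (pdD (f := fun y => c * pd (rshift n b) (local L1 i) y)) ?pdZ //.
- by apply: an_pd; exact: A1.
- by apply: an_scale; apply: an_pd; exact: A1.
- by apply: an_pd; exact: A2.
Qed.

(* a degenerate M is reached through the Lagrangians s M + L, regular
   somewhere for a suitable s *)
Lemma first_order_integrator (I : (tangent Q -> R) -> Q -> Q -> R -> R) L M :
  connected [set: Q] -> variational_integrator I -> consistent_integrator I ->
  lagrangian L -> regular L -> lagrangian M -> first_order (I M) M.
Proof.
move=> Qc [Idisc Ilin _] Icons LA Lreg MA i FM GM z zi.
have si : chart_image i (lsubmx (state z)) by rewrite row_mxKl.
have HL : hessian (local L i) (state z) \in unitmx by rewrite -velocity_hessianE //; exact: Lreg.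
have [s s0 HN] := unit_perturbation (hessian (local M i) (state z)) HL.
pose N p := s * M p + L p; have NA : lagrangian N by exact: lagrangian_linear.
have Nreg : somewhere_regular N.
  exists i, (z 0%N), (z 1%N); split=> //; rewrite velocity_hessianE //.
  by rewrite -/(state z) hessian_linear.
have Lsreg : somewhere_regular L by exists i, (z 0%N), (z 1%N); split=> //; exact: Lreg.
have [[_ /(_ i)[FN GN]] [_ /(_ i)[FL GL]]] := (Idisc N NA, Idisc L LA).
have [N0 N1] := first_order_consistent Qc NA Nreg (Idisc N NA) (Icons N NA Nreg) GN zi.
have [L0 L1] := first_order_consistent Qc LA Lsreg (Idisc L LA) (Icons L LA Lsreg) GL zi.
have D p := density_linear p (Ilin s M L MA LA) GN GM GL zi.
have := D 0%N; have := D 1%N; rewrite N0 N1 L0 L1 local_linear addr0 => /addIr h1 h0.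
split; first by apply: (mulfI s0); rewrite mulr0.
by apply: (mulfI s0); rewrite h1.
Qed.

End FirstOrder.

(** * Expansions along solutions *)

Section Solutions.
Context {R : realType} {n : nat}.
Variables (Omega : set 'rV[R]_n) (f : 'rV[R]_n -> 'rV[R]_n -> 'rV[R]_n) (x : R -> 'rV[R]_n).
Hypotheses (Omega_open : open Omega) (fO : tan_field Omega f).
Hypotheses (xf : ode_solution f x) (x0 : Omega (x 0)).
Let c t := row_mx (x t) (jet_of x t 1%N).

Lemma solution_isd : exists2 e : R, 0 < e & forall t, `|t| < e ->
  [/\ Omega (x t), forall a, isd (fun s => x s 0 a) t (jet_of x t 1%N 0 a),
      forall a, isd (fun s => jet_of x s 1%N 0 a) t (f (x t) (jet_of x t 1%N) 0 a)
    & forall g, tan Omega g -> isd (fun s => g (c s)) t (lie f g (c t))].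
Proof.
have /near0P[e e0 He] := xf; have [e' e'0 He'] := ode_solution_on_shell Omega_open fO xf x0.
exists (Num.min e e'); first by rewrite lt_min e0.
move=> t; rewrite lt_min => /andP[te te']; have [xO _] := He' t te'.
have xd a : isd (fun s => x s 0 a) t (jet_of x t 1%N 0 a).
  by rewrite mxE; have [/derivable_isd] := He t te a; rewrite add0r.
have vd a : isd (fun s => jet_of x s 1%N 0 a) t (f (x t) (jet_of x t 1%N) 0 a).
  have [_ []] := He t te a; rewrite add0r => /derivable_isd h <-.
  by rewrite mxE; apply: isd_ext h => s; rewrite mxE.
split=> // g gO; have := gO (c t); rewrite row_mxKl => /(_ xO) gA.
apply: an_chain => // b; rewrite /direction row_mxKl row_mxKr.
exact: isd_row_mx.
Qed.

Lemma asym_solution a P :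
  asym (fun h => x h 0 a) (fun m => on_shell f (c 0) m 0 a / m`!%:R) P.
Proof.
have [e e0 He] := solution_isd.
have Z : exists2 e : R, 0 < e & forall t l a, `|t| < e ->
    isd (fun s => on_shell f (c s) l 0 a) t (on_shell f (c t) l.+1 0 a).
  exists e => // t l b /He[xO _ _ H]; have lO := @tan_flat_prolong _ _ _ Omega_open f l b fO.
  have := H _ lO; rewrite -(flat_prolongS lO) //.
  by rewrite row_mxKl.
apply: asym_near (asym_jets 0 a P Z); exists 1 => // h _.
by rewrite /on_shell /= row_mxKl.
Qed.

Lemma asym_along g P : tan Omega g ->
  asym (fun h => g (c h)) (fun m => iter m (lie f) g (c 0) / m`!%:R) P.
Proof.
move=> gO; have [e e0 He] := solution_isd.
(* [asym_jets] is about vector-valued jets; [g] and its iterated derivatives are placed in row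
   vectors of length 1. *)
have Z : exists2 e : R, 0 < e & forall t l (a : 'I_1), `|t| < e ->
    isd (fun s => (const_mx (iter l (lie f) g (c s)) : 'rV[R]_1) 0 a) t
        ((const_mx (iter l.+1 (lie f) g (c t)) : 'rV[R]_1) 0 a).
  exists e => // t l a /He[_ _ _ H]; rewrite mxE.
  apply: isd_ext (H _ (tan_iter_lie Omega_open l fO gO)) => s.
  by rewrite mxE.
apply: asym_near (asym_coef _ (asym_jets 0 (0 : 'I_1) P Z)).
  by exists 1 => // h _; rewrite mxE.
by move=> m _; rewrite mxE.
Qed.

End Solutions.

(** * The exact Euler-Lagrange flow in charts *)

Section Flow.
Context {R : realType} {n : nat} (Q : analyticManifold R n).
Variable L : tangent Q -> R.
Hypotheses (LA : lagrangian L) (Lreg : regular L).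
Implicit Types (i j : chart_index Q) (w : 'rV[R]_(n + n)).

Definition el_source i (c : 'I_n) w : R :=
  pd (lshift n c) (local L i) w -
  \sum_b pd (lshift n b) (pd (rshift n c) (local L i)) w * rsubmx w 0 b.

(** The transpose matches the index order of the equation: its component [c] is the inner derivative
    in [el_form]. *)
Definition el_matrix i w : 'M[R]_n := (hessian (local L i) w)^T.

Definition el_flow i := el_field (el_source i) (el_matrix i).

Lemma el_form_split i c (z : jet R n) :
  el_form (local L i) c (state z) (row_mx (z 1%N) (z 2%N)) =
  el_source i c (state z) - \sum_b el_matrix i (state z) c b * z 2%N 0 b.
Proof.
rewrite /el_form sum_state /el_source opprD addrA; congr (_ - _ - _).
  by apply: eq_bigr => b _; rewrite row_mxEl row_mxKr.
by apply: eq_bigr => b _; rewrite row_mxEr !mxE.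
Qed.

Lemma local_tan i : tan (chart_image i) (local L i).
Proof. exact: (lagrangianP _).1. Qed.

Lemma tan_el_matrix i c b : tan (chart_image i) (fun w => el_matrix i w c b).
Proof.
move=> w wi; apply: (an_eq (f := pd (rshift n b) (pd (rshift n c) (local L i)))) => [y|].
  by rewrite !mxE.
by apply: an_pd; apply: an_pd; exact: local_tan.
Qed.

Lemma tan_el_source i c : tan (chart_image i) (el_source i c).
Proof.
move=> w wi; apply: an_sub; first by apply: an_pd; exact: local_tan.
apply: an_sum => b _; apply: an_mul; first by apply: an_pd; apply: an_pd; exact: local_tan.
by apply: (an_eq (f := fun w => w 0 (rshift n b))) => [y|]; [rewrite mxE|exact: an_coord].
Qed.

Lemma el_matrix_unit i w : chart_image i (lsubmx w) -> el_matrix i w \in unitmx.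
Proof.
by move=> wi; rewrite unitmx_tr -[w]hsubmxK -velocity_hessianE //; exact: Lreg.
Qed.

Lemma tan_el_flow i : tan_field (chart_image i) (el_flow i).
Proof.
apply: tan_solve; [exact: chart_image_open|exact: tan_el_matrix|exact: el_matrix_unit|exact: tan_el_source].
Qed.

Lemma el_flowP i (z : jet R n) : chart_image i (z 0%N) ->
  (forall c, el_form (local L i) c (state z) (row_mx (z 1%N) (z 2%N)) = 0) <->
  z 2%N = el_flow i (z 0%N) (z 1%N).
Proof.
move=> zi; exact: (@el_fieldP R n (chart_image i)
  (fun _ c z => el_form (local L i) c (state z) (row_mx (z 1%N) (z 2%N)))
  _ _ (@el_matrix_unit i) (fun c z _ => el_form_split i c z)).
Qed.

Lemma el_curve_flow i x : ode_solution (el_flow i) x -> chart_image i (x 0) ->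
  exists2 r : R, 0 < r & el_curve L i x (fun t => jet_of x t 1%N)
    (fun t => el_flow i (x t) (jet_of x t 1%N)) r.
Proof.
move=> xf xi.
have [e e0 He] := solution_isd (@chart_image_open R n Q i) (@tan_el_flow i) xf xi.
exists e => // t /He[xti xd vd _]; split=> // c.
pose z := jet_of_state (row_mx (x t) (jet_of x t 1%N)) (el_flow i (x t) (jet_of x t 1%N)).
have zi : chart_image i (z 0%N) by rewrite /z /jet_of_state /= row_mxKl.
have := (el_flowP zi).2; rewrite state_jet /z /jet_of_state /= row_mxKl row_mxKr => H.
exact: H.
Qed.

Lemma transition_solution i j x : ode_solution (el_flow i) x -> overlap i j (x 0) ->
  ode_solution (el_flow j) (fun t => transition i j (x t)) /\
  jet_of (fun t => transition i j (x t)) 0 1%N = dphi (transition i j) (x 0) (jet_of x 0 1%N).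
Proof.
move=> xf xO; have xi : chart_image i (x 0) by case: xO.
have [r r0 xel] := el_curve_flow xf xi; have r00 : `|0 : R| < r by rewrite normr0.
have xj : chart_dom j (param i (x 0)) by case: xO.
split; last exact: (jet1_lift xel r00 xj).
have [e e0 He] := near_overlap xel r00 xj.
apply/near0P; exists e => // t /He[]; rewrite add0r => tr [xti tj] a.
have [y2 [y2d y2el]] := isd2_lift LA xel tr tj.
split; first exact: isd_derivable (isd_lift xel a tr tj).
split; first exact: isd_derivable (y2d a).
pose w := row_mx (transition i j (x t)) (dphi (transition i j) (x t) (jet_of x t 1%N)).
have zj : chart_image j (jet_of_state w y2 0%N).
  by rewrite /jet_of_state /= row_mxKl; have [[]] := overlapP (conj xti tj).
have := (el_flowP zj).1; rewrite state_jet /jet_of_state /= row_mxKl row_mxKr => /(_ y2el).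
rewrite (jet1_lift xel tr tj) => <-.
by rewrite mxE derive1nS; exact: isd_derive1 (y2d a).
Qed.

Lemma lift_phiE i j x : lift_phi (transition i j) (row_mx (x 0) (jet_of x 0 1%N)) =
  row_mx (transition i j (x 0)) (dphi (transition i j) (x 0) (jet_of x 0 1%N)) :> 'rV[R]_(n + n).
Proof. by rewrite /lift_phi row_mxKl row_mxKr. Qed.

Lemma solution_through i w : chart_image i (lsubmx w) ->
  exists2 x, ode_solution (el_flow i) x & row_mx (x 0) (jet_of x 0 1%N) = w.
Proof.
move=> wi; have [x [xf x0 v0]] := ode_solution_exists (@chart_image_open R n Q i) (@tan_el_flow i) (rsubmx w) wi.
by exists x => //; rewrite x0 v0 hsubmxK.
Qed.

Lemma density_on_shell_change G i j F F' w p : overlap i j (lsubmx w) ->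
  blowup G i F -> blowup G j F' ->
  density 0 p (flat3 F) (on_shell (el_flow i) w) =
  density 0 p (flat3 F') (on_shell (el_flow j) (lift_phi (transition i j) w)).
Proof.
move=> wO GF GF'; have wi : chart_image i (lsubmx w) by case: wO.
have [x xf xw] := solution_through wi; rewrite -xw row_mxKl in wO *.
have xi : chart_image i (x 0) by case: wO.
have [yf y1] := transition_solution xf wO; have [[yj _] pE _] := overlapP wO.
have hx a := asym_solution (@chart_image_open R n Q i) (@tan_el_flow i) xf xi a p.+1.
have hy a := asym_solution (@chart_image_open R n Q j) (@tan_el_flow j) yf yj a p.+1.
rewrite lift_phiE -y1.
have zi : chart_image i (on_shell (el_flow i) (row_mx (x 0) (jet_of x 0 1%N)) 0%N) by rewrite /on_shell /= row_mxKl.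
set w' := row_mx (transition i j (x 0)) _ in hy *.
have zj : chart_image j (on_shell (el_flow j) w' 0%N) by rewrite /on_shell /= row_mxKl.
rewrite -(series_coef_asym (leqnn p) (blowup_asym_start GF zi hx)).
rewrite -(series_coef_asym (leqnn p) (blowup_asym_start GF' zj hy)).
apply: series_coef_near.
have [e e0 He] := solution_isd (@chart_image_open R n Q i) (@tan_el_flow i) xf xi.
have xd a : isd (fun s => x s 0 a) 0 (jet_of x 0 1%N 0 a) by have [] := He 0 (ltac:(by rewrite normr0)).
have [r r0 Hr] := curve_in_Omega (@overlap_open R n Q i j) wO xd.
exists r => // h /andP[_ /Hr]; rewrite add0r => hO.
rewrite /on_shell /= !row_mxKl pE; congr (G _ _ h).
by have [_ -> _] := overlapP hO.
Qed.

Lemma lie_change i j w m : overlap i j (lsubmx w) ->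
  iter m (lie (el_flow i)) (local L i) w =
  iter m (lie (el_flow j)) (local L j) (lift_phi (transition i j) w).
Proof.
move=> wO; have wi : chart_image i (lsubmx w) by case: wO.
have [x xf xw] := solution_through wi; rewrite -xw row_mxKl in wO *.
have xi : chart_image i (x 0) by case: wO.
have [yf y1] := transition_solution xf wO; have [[yj _] pE _] := overlapP wO.
have hx := asym_along (@chart_image_open R n Q i) (@tan_el_flow i) xf xi m (@local_tan i).
have hy := asym_along (@chart_image_open R n Q j) (@tan_el_flow j) yf yj m (@local_tan j).
rewrite lift_phiE -y1.
suff E : iter m (lie (el_flow i)) (local L i) (row_mx (x 0) (jet_of x 0 1%N)) / m`!%:R =
    iter m (lie (el_flow j)) (local L j) (row_mx (transition i j (x 0)) (jet_of (fun t => transition i j (x t)) 0 1%N)) / m`!%:R.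
  by apply: (mulIf _ E); rewrite invr_eq0 fact_neq0.
rewrite -(series_coef_asym (leqnn m) hx) -(series_coef_asym (leqnn m) hy).
apply: series_coef_near.
have [r r0 xel] := el_curve_flow xf xi; have r00 : `|0 : R| < r by rewrite normr0.
have xj : chart_dom j (param i (x 0)) by case: wO.
have [e e0 He] := near_overlap xel r00 xj.
exists e; first exact: e0.
move=> h /andP[_ he]; have [hr [hi hj]] := He h he; rewrite add0r in hr hi hj.
have hO : overlap i j (lsubmx (row_mx (x h) (jet_of x h 1%N) : 'rV[R]_(n + n))) by rewrite row_mxKl.
rewrite (local_change L hO) /lift_phi row_mxKl row_mxKr; congr (local L j (row_mx _ _)).
by rewrite -(jet1_lift xel hr hj).
Qed.

End Flow.

(** * The inverse modified Lagrangian *)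

Lemma sum_truncate {R : realType} (u : nat -> R) p k : (p <= k)%N -> (forall j, (p < j)%N -> u j = 0) ->
  \sum_(j < k.+1) u j = \sum_(j < p.+1) u j.
Proof.
move=> pk u0; rewrite -(subnKC pk); elim: (k - p)%N => [|d IH]; first by rewrite addn0.
by rewrite addnS big_ord_recr /= IH u0 ?addr0 // ltnS leq_addr.
Qed.

Section DensitySum.
Context {R : realType} {n : nat}.
Variable Omega : set 'rV[R]_n.

Definition weighted_sum (F : nat -> 'rV[R]_(n + n + 1) -> R) m (y : 'rV[R]_(n + n + 1)) : R :=
  \sum_(j < m) y 0 (rshift (n + n) 0) ^+ j * F j y.

Lemma edge_weighted_sum F m : (forall j, (j < m)%N -> edge Omega (F j)) -> edge Omega (weighted_sum F m).
Proof.
elim: m => [|m IH] FE w wO.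
  by apply: (an_eq (f := fun=> 0)) => [y|]; [rewrite /weighted_sum big_ord0|exact: an_cst].
apply: (an_eq (f := fun y => weighted_sum F m y + y 0 (rshift (n + n) 0) ^+ m * F m y)).
  by move=> y; rewrite /weighted_sum big_ord_recr.
apply: an_add; first by apply: IH => // j jm; apply: FE; exact: ltnW.
by apply: (edge_mulXn (Omega := Omega)) => //; exact: FE.
Qed.

Lemma density_weighted_sum c p F m z : (forall j, (j < m)%N -> edge Omega (F j)) -> Omega (z 0%N) ->
  density c p (weighted_sum F m) z = \sum_(j < m) if (j <= p)%N then density c (p - j) (F j) z else 0.
Proof.
move=> + zO; elim: m => [|m IH] FE.
  rewrite big_ord0; apply: (taylor_coef_unique (c := fun=> 0) (leqnn p)).
    by apply: (edge_an (Omega := Omega)) => //; exact: edge_weighted_sum.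
  apply: asym_near (asym0 p); exists 1 => // h _.
  by rewrite /weighted_sum big_ord0.
have FE' j : (j < m)%N -> edge Omega (F j) by move=> jm; apply: FE; exact: ltnW.
rewrite big_ord_recr /= -IH // -(density_mulXn c p m (FE m (ltnSn m)) zO).
rewrite -(densityD c p (edge_weighted_sum FE') (edge_mulXn m (FE m (ltnSn m))) zO).
by apply: taylor_coef_ext => y; rewrite /weighted_sum big_ord_recr.
Qed.

End DensitySum.

Section InverseModified.
Context {R : realType} {n : nat} (Q : analyticManifold R n).
Hypothesis Q_connected : connected [set: Q].
Variable L : tangent Q -> R.
Hypotheses (LA : lagrangian L) (Lreg : regular L).
Variable I : (tangent Q -> R) -> Q -> Q -> R -> R.
Hypotheses (I_int : variational_integrator I) (I_cons : consistent_integrator I).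
Implicit Types (i : chart_index Q) (j : nat) (w : 'rV[R]_(n + n)) (z : jet R n).

Definition partial_integral (Ls : nat -> tangent Q -> R) (m : nat) : Q -> Q -> R -> R :=
  fun q0 q1 h => \sum_(j < m) h ^+ j * I (Ls j) q0 q1 h.

Definition partial_blowup (Fs : nat -> 'rV[R]_n -> 'rV[R]_n -> R -> R) (m : nat) :
    'rV[R]_n -> 'rV[R]_n -> R -> R :=
  fun x v h => \sum_(j < m) h ^+ j * Fs j x v h.

Lemma flat3_partial Fs m : flat3 (partial_blowup Fs m) = weighted_sum (fun j => flat3 (Fs j)) m.
Proof.
by apply/funext => y; rewrite /flat3 /partial_blowup; apply: eq_bigr => j _; rewrite mxE.
Qed.

Lemma blowup_partial Ls i Fs m : (forall j, (j < m)%N -> blowup (I (Ls j)) i (Fs j)) ->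
  blowup (partial_integral Ls m) i (partial_blowup Fs m).
Proof.
move=> HF; split=> [|x v h xi xhi h0]; last first.
  by apply: eq_bigr => j _; have [_ ->] := HF j (ltn_ord j).
apply/analytic_onP => y yi; rewrite flat3_partial.
apply: an_sum => j _; have [/analytic_onP FA _] := HF j (ltn_ord j).
apply: an_mul; last exact: FA.
apply: (an_eq (f := fun y => \prod_(i < j) y 0 (rshift (n + n) 0))).
  by move=> u; rewrite prodr_const card_ord.
by apply: an_prod => d _; exact: an_coord.
Qed.

(** A function on [tangent] arises by computing in the preferred chart at the base point, whose
    components the tangent vector stores. The value is the coefficient that exactness prescribes
    minus the one already produced by the earlier terms; index [k] of [expansion] refers to
    [h ^ k.+1]. *)
Definition inverse_step (k : nat) (Ls : nat -> tangent Q -> R) (p : tangent Q) : R :=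
  let i := chart_at (p : Q * 'rV[R]_n).1 in
  let w := row_mx (chart i (p : Q * 'rV[R]_n).1) (p : Q * 'rV[R]_n).2 in
  iter k (lie (el_flow L i)) (local L i) w / k.+1`!%:R
  - expansion (partial_integral Ls k) i 0 1 k (on_shell (el_flow L i) w).

Definition inverse_modified : nat -> tangent Q -> R := strong_rec (fun=> 0) inverse_step.

Lemma inverse_step_ext k Ls Ls' : (forall j, (j < k)%N -> Ls j = Ls' j) ->
  inverse_step k Ls = inverse_step k Ls'.
Proof.
move=> E; rewrite /inverse_step.
have -> // : partial_integral Ls k = partial_integral Ls' k.
apply/funext => q0; apply/funext => q1; apply/funext => h.
by apply: eq_bigr => j _; rewrite E.
Qed.

Lemma inverse_modifiedE k : inverse_modified k = inverse_step k inverse_modified.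
Proof.
by rewrite {1}/inverse_modified strong_recE; apply: inverse_step_ext => j ->.
Qed.

(** The claims are proved together: analyticity of the earlier terms provides blow-ups, hence a
    formula in every chart, and the formula gives analyticity of the next term. The definition alone
    would not, as [chart_at] may jump from point to point. *)
Lemma local_inverse_modified k : lagrangian (inverse_modified k) /\
  forall i w, chart_image i (lsubmx w) -> local (inverse_modified k) i w =
    iter k (lie (el_flow L i)) (local L i) w / k.+1`!%:R
    - expansion (partial_integral inverse_modified k) i 0 1 k (on_shell (el_flow L i) w).
Proof.
elim/ltn_ind: k => k IH.
have /choice[Fs HFs] i : exists Fs : nat -> 'rV[R]_n -> 'rV[R]_n -> R -> R,
    forall j, (j < k)%N -> blowup (I (inverse_modified j)) i (Fs j).
  have /choice[Fs HFs] j : exists F, (j < k)%N -> blowup (I (inverse_modified j)) i F.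
    have [jk|kj] := ltnP j k; last by exists (fun _ _ _ => 0).
    have [Idisc _ _] := I_int; have [_ /(_ i)[F HF]] := Idisc _ (IH j jk).1.
    by exists F.
  by exists Fs.
have HB i := blowup_partial (HFs i).
have zi i w : chart_image i (lsubmx w) -> chart_image i (on_shell (el_flow L i) w 0%N) by [].
have E i w : chart_image i (lsubmx w) -> local (inverse_modified k) i w =
    iter k (lie (el_flow L i)) (local L i) w / k.+1`!%:R
    - density 0 k.+1 (flat3 (partial_blowup (Fs i) k)) (on_shell (el_flow L i) w).
  move=> wi; pose m := param i (lsubmx w); pose j := chart_at m.
  have wO : overlap i j (lsubmx w) by split=> //; exact: chart_atP.
  pose w' := lift_phi (transition i j) w.
  have w'j : chart_image j (lsubmx w') by rewrite row_mxKl; have [[]] := overlapP wO.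
  have W' : row_mx (chart j m) (transition_diff i j (lsubmx w) (rsubmx w)) = w'.
    by rewrite transition_diffE.
  transitivity (inverse_modified k (m, transition_diff i j (lsubmx w) (rsubmx w))); first by [].
  have D : expansion (partial_integral inverse_modified k) j 0 1 k (on_shell (el_flow L j) w') =
      density 0 k.+1 (flat3 (partial_blowup (Fs j) k)) (on_shell (el_flow L j) w').
    by apply: expansion_density; [exact: HB|exact: zi|rewrite add0r].
  transitivity (iter k (lie (el_flow L j)) (local L j) w' / k.+1`!%:R -
      expansion (partial_integral inverse_modified k) j 0 1 k (on_shell (el_flow L j) w')).
    by rewrite inverse_modifiedE -W'.
  exact: (f_equal2 (fun a b : R => a / k.+1`!%:R - b) (esym (lie_change LA Lreg k wO))
    (etrans D (esym (density_on_shell_change LA Lreg k.+1 wO (HB i) (HB j))))).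
split=> [|i w wi]; last first.
  by rewrite E // (expansion_density (b := 1) k (HB i) (zi _ _ wi)) ?add0r.
apply/lagrangianP => i; have oi := @chart_image_open R n Q i.
have fO := @tan_el_flow R n Q L LA Lreg i.
apply: (tan_ext oi _ (fun w wi => esym (E i w wi))) => w wi.
apply: an_sub.
  apply: (an_eq (f := fun w => (k.+1`!%:R)^-1 * iter k (lie (el_flow L i)) (local L i) w)).
    by move=> y; rewrite mulrC.
  by apply: an_scale; apply: (tan_iter_lie oi k fO) => //; exact: local_tan.
have H := (tan_pull oi fO (dp_density 0 k.+1 (blowup_edge (HB i))) wi).
exact: H.
Qed.

Lemma blowups_exist i : exists Fs : nat -> 'rV[R]_n -> 'rV[R]_n -> R -> R,
  forall j, blowup (I (inverse_modified j)) i (Fs j).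
Proof.
have [Idisc _ _] := I_int.
have /choice[Fs HFs] j : exists F, blowup (I (inverse_modified j)) i F.
  by have [_ /(_ i)] := Idisc _ (local_inverse_modified j).1.
by exists Fs.
Qed.

Section Chart.
Variables (i : chart_index Q) (Fs : nat -> 'rV[R]_n -> 'rV[R]_n -> R -> R) (k : nat).
Hypothesis HFs : forall j, blowup (I (inverse_modified j)) i (Fs j).
Let Omega := chart_image i.
Let oi : open Omega := @chart_image_open R n Q i.
Let F := flat3 (partial_blowup Fs k.+1).
Let f := el_flow L i.
Let lam := local L i.

Let fO : tan_field Omega f. Proof. exact: tan_el_flow. Qed.
Let lamO : tan Omega lam. Proof. exact: local_tan. Qed.

Let edge_F : edge Omega F.
Proof. by apply: blowup_edge (blowup_partial (fun j _ => HFs j)). Qed.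

Let first_order_Fs j z : Omega (z 0%N) ->
  density 0 0 (flat3 (Fs j)) z = 0 /\ density 0 1 (flat3 (Fs j)) z = local (inverse_modified j) i (state z).
Proof.
exact: (first_order_integrator Q_connected I_int I_cons LA Lreg (local_inverse_modified j).1 (HFs j)).
Qed.

Lemma density_step p z : (p <= k)%N -> Omega (z 0%N) -> density 0 p.+1 F z =
  density 0 p.+1 (flat3 (partial_blowup Fs p)) z + local (inverse_modified p) i (state z).
Proof.
move=> pk zO; have eF j : edge Omega (flat3 (Fs j)) := blowup_edge (HFs j).
rewrite /F !flat3_partial !(density_weighted_sum (Omega := Omega)) //.
pose u j : R := if (j <= p.+1)%N then density 0 (p.+1 - j) (flat3 (Fs j)) z else 0.
(* The term [j = p.+1] would contribute the value of the blow-up [Fs p.+1] at [h = 0], which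
   vanishes by consistency. *)
rewrite (sum_truncate (u := u) pk) => [|j pj]; last first.
  rewrite /u; case: ifP => // jp; have -> : j = p.+1 by lia.
  by rewrite subnn; have [] := first_order_Fs p.+1 zO.
rewrite big_ord_recr /=; congr (_ + _).
by rewrite /u leqnSn subSnn; have [] := first_order_Fs p zO.
Qed.

Lemma density_exact p : (p <= k)%N -> eqT Omega (pull f (density 0 p.+1 F))
  (fun w => iter p (lie f) lam w / p.+1`!%:R).
Proof.
move=> pk w wi; rewrite /pull density_step // state_on_shell (local_inverse_modified p).2 //.
rewrite (expansion_density (b := 1) p (blowup_partial (fun j _ => HFs j))) ?add0r //.
by rewrite addrC subrK.
Qed.

Lemma density0_edge : eqO Omega (density 0 0 F) (fun=> 0).
Proof.
move=> z zO; have eF j : edge Omega (flat3 (Fs j)) := blowup_edge (HFs j).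
rewrite /F flat3_partial (density_weighted_sum (Omega := Omega)) // big1 // => j _.
case: ifP => //; rewrite leqn0 => /eqP ->; rewrite subn0.
by have [] := first_order_Fs 0 zO.
Qed.

Let edge0 (w : 'rV[R]_(n + n)) : Omega (lsubmx w) -> F (row_mx w 0) = 0.
Proof.
move=> wi; have := @density0_edge (jet_of_state w 0) wi.
by rewrite /density taylor_coef0 chord0 state_jet.
Qed.

(** Both the coefficient of order 1 and [lam] depend on the state only, so the on-shell identity for
    [p = 0] extends to all jets. *)
Lemma density_lag z : Omega (z 0%N) -> density 0 1 F z = lam (state z).
Proof.
move=> zO; have := density_exact (leq0n k) (w := state z).
rewrite row_mxKl => /(_ zO); rewrite /pull /= divr1 => <-.
rewrite (density1 oi 0 edge_F edge0 zO) (density1 oi 0 edge_F edge0) ?state_on_shell //.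
by rewrite /on_shell /= row_mxKl.
Qed.

Lemma density_partial_exact p l a z : Omega (z 0%N) -> jp l.+1 a (density 0 p.+1 F) z =
  if (l <= p)%N then density 0 (p - l).+1 (pd (lshift 1 (rshift n a)) F) z / l.+1`!%:R else 0.
Proof.
move=> zO; rewrite (density_partial p.+1 l a edge_F zO).
have [lp|pl] := leqP l p; first by rewrite (leq_trans lp) // subSn.
case: ifP => // lp; have -> : l = p.+1 by lia.
(* At [l = p.+1] the velocity derivative of [F] is taken along [h = 0], where [F] vanishes; this
   shortens the range of [l] by one. *)
rewrite subnn /density taylor_coef0 chord0 (pd_edge0 oi _ edge_F edge0) ?mul0r //.
by rewrite row_mxKl.
Qed.

Lemma lam_on_shell w a : Omega (lsubmx w) ->
  jp 0 a (fun z => lam (state z)) (on_shell f w) =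
  tot (jp 1 a (fun z => lam (state z))) (on_shell f w).
Proof.
move=> wi; apply/eqP; rewrite -subr_eq0 (el_formE a oi lamO) //.
by apply/eqP; apply: (el_flowP LA Lreg _).2 => //; rewrite /on_shell prolong2 prolong1.
Qed.

Lemma euler_exact p c w : (p <= k)%N -> Omega (lsubmx w) ->
  euler p.+2 (density 0 p.+1 F) c (on_shell f w) = 0.
Proof.
have H := (euler_on_shell oi fO lamO lam_on_shell (Phi := fun p => density 0 p.+1 F)
  (b := fun m a => density 0 m.+1 (pd (lshift 1 (rshift n a)) F))
  (fun p => dp_density 0 p.+1 edge_F) density_partial_exact density_exact).
exact: H.
Qed.

Lemma iter_tot0 m : eqO Omega (iter m tot (fun=> 0 : R)) (fun=> 0).
Proof.
elim: m => //= m IH z zO; rewrite (eqO_total oi IH zO).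
by apply: isd_tot; exact: isd_cst.
Qed.

Lemma density_midpoint p : eqO Omega (density (- 2^-1) p.+1 F)
  (fun z => \sum_(m < p.+1) (- 2^-1) ^+ m / m`!%:R * iter m tot (density 0 (p - m).+1 F) z).
Proof.
move=> z zO; rewrite (density_shift oi p.+1 (- 2^-1) edge_F zO) big_ord_recr /= subnn.
(* The top term of the shift formula involves the coefficient of [h ^ 0], which is zero, so only
   genuine densities remain. *)
rewrite -iterS (eqO_iter_total oi p.+1 density0_edge zO) iter_tot0 // mulr0 addr0.
by apply: eq_bigr => m _; rewrite subSn // -ltnS.
Qed.

Lemma mesh_exact p (c : nat -> R) w : (p <= k)%N -> Omega (lsubmx w) ->
  \sum_(j < p./2.+1) c j * iter (2 * j) total_derivative (density (- 2^-1) (p - 2 * j).+1 F) (on_shell f w) =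
  (\sum_(j < p./2.+1) c j * midpoint_coef (p - 2 * j)) * iter p (lie f) lam w.
Proof.
have H := (mesh_on_shell oi fO lamO (Phi := fun p => density 0 p.+1 F) (Psi := fun p => density (- 2^-1) p.+1 F)
  (fun p => dp_density 0 p.+1 edge_F) density_exact density_midpoint).
exact: H.
Qed.

End Chart.
End InverseModified.

(** * The Euler operator on differential polynomials *)

Section Euler.
Context {R : realType} {n : nat}.
Variable Omega : set 'rV[R]_n.
Hypothesis Omega_open : open Omega.
Implicit Types (F G : jet R n -> R) (z : jet R n).

Lemma euler_eqO m F G c : eqO Omega F G -> eqO Omega (euler m F c) (euler m G c).
Proof.
move=> FG z zO; apply: eq_bigr => j _; rewrite totE !jpE; congr (_ * _).
by apply: (eqO_iter_total Omega_open) => //; exact: eqO_partial.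
Qed.

Lemma dp_euler m F c : dp Omega F -> dp Omega (euler m F c).
Proof.
move=> FO; apply: dp_sum => j _; apply: dp_scale; rewrite totE jpE.
by apply: dp_iter_total => //; exact: dp_jet_partial.
Qed.

(** [modified_equation] applies the Euler operator of order [j.+2] to the coefficient [j]; for
    [j = 0] its term of order 2 vanishes because [lam] depends on [q] and [q'] only. *)
Lemma euler_state lam c : tan Omega lam -> eqO Omega (euler 2 (fun z => lam (state z)) c)
  (fun z => el_form lam c (state z) (row_mx (z 1%N) (z 2%N))).
Proof.
move=> lamO z zO; rewrite -(el_formE c Omega_open lamO zO) /euler !big_ord_recl big_ord0 /= /bump /=.
rewrite totE !jpE expr0 mul1r expr1 mulN1r addr0.
have E : eqO Omega (jp 2 c (fun z => lam (state z))) (fun=> 0).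
  by move=> y yO; rewrite (partial_an 2 c lamO yO).
have := eqO_iter_total Omega_open 2 E zO; rewrite !addn0 /= => ->.
rewrite (_ : tot (tot (fun=> 0)) z = 0); first by rewrite mulr0 addr0.
have E0 : tot (fun=> 0 : R) = (fun=> 0) :> (jet R n -> R).
  by apply/funext => y; apply: isd_tot; exact: isd_cst.
by rewrite !E0.
Qed.

Lemma prolong_ext (f f' : 'rV[R]_n -> 'rV[R]_n -> 'rV[R]_n) l : tan_field Omega f -> tan_field Omega f' ->
  (forall w, Omega (lsubmx w) -> f (lsubmx w) (rsubmx w) = f' (lsubmx w) (rsubmx w)) ->
  forall w, Omega (lsubmx w) -> on_shell f w l = on_shell f' w l.
Proof.
move=> fO fO' ff' w wO; apply/rowP => a.
suff : eqT Omega (flat_prolong f l a) (flat_prolong f' l a) by apply.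
elim: l => [|l IH] // y yO.
have lO := @tan_flat_prolong _ _ _ Omega_open f l a fO.
have lO' := @tan_flat_prolong _ _ _ Omega_open f' l a fO'.
rewrite (flat_prolongS lO yO) (flat_prolongS lO' yO) (eqT_lie Omega_open f IH yO).
by apply: eq_bigr => b _; rewrite /direction ff'.
Qed.

End Euler.

(** * The modified equation as congruences in the step size *)

Section ModifiedEquation.
Context {R : realType} {n : nat} (Q : analyticManifold R n).
Variables (G : Q -> Q -> R -> R) (i : chart_index Q).
Let Omega := chart_image i.
Let oi : open Omega := @chart_image_open R n Q i.
Let E j (c : 'I_n) := euler j.+2 (expansion G i 0 1 j) c.
Hypothesis E_dp : forall j c, dp Omega (E j c).
Implicit Type g : nat -> 'rV[R]_n -> 'rV[R]_n -> 'rV[R]_n.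

(** Existence of solutions through every state turns the estimates along solutions into estimates of
    the residual at each state, and [pol_small] turns these into divisibility. Conversely, a [pol]
    family is bounded for [|s| <= 1] at a fixed state. *)
Lemma modified_equationP g : modified_equation G i g <->
  tan_family Omega g /\ forall p c, cong Omega p.+1 (residual E p g c) (fun _ _ => 0).
Proof.
have on0 K s x : tan_family Omega g -> ode_solution (truncated_field g K s) x -> Omega (x 0) ->
    jet_of x 0 = on_shell (truncated_field g K s) (row_mx (x 0) (jet_of x 0 1%N)).
  move=> gO xs xO; have fO := tan_pol_field oi s (pol_truncated K gO).
  have [e e0 He] := ode_solution_on_shell oi fO xs xO.
  by have [|_] := He 0; rewrite ?normr0.
split=> [[gA gE]|[gO gE]].
  have gO : tan_family Omega g by move=> j a; have /analytic_onP := gA j a.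
  split=> // p c; apply/cong0_pol; apply: pol_small; first exact: pol_residual.
  move=> w wi; have [C [d [d0 H]]] := gE p (lsubmx w) (rsubmx w) wi.
  exists C, d; split=> // s /andP[_ sd].
  have fO := tan_pol_field oi s (pol_truncated p gO).
  have [x [xs x0 v0]] := ode_solution_exists oi fO (rsubmx w) wi.
  have := H s sd x xs x0 v0 c; rewrite (on0 p s x gO xs) ?x0 // v0 hsubmxK.
  exact.
split=> [j c|K q0 v0 q0i]; first by apply/analytic_onP; exact: gO.
pose w := row_mx q0 v0 : 'rV[R]_(n + n); have wi : Omega (lsubmx w) by rewrite row_mxKl.
have /choice[B HB] c : exists B : R, 0 <= B /\
    forall s : R, `|s| <= 1 -> `|residual E K g c s w| <= B * `|s| ^+ K.+1.
  have /cong0_pol[Psi pPsi HPsi] := gE K c.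
  have [B [B0 H]] := pol_bounded pPsi wi; exists B; split=> // s s1.
  by rewrite HPsi // normrM normrX mulrC ler_wpM2r ?exprn_ge0 // H.
exists (\sum_c B c), 1; split=> // s s1 x xs x0 v0' c.
rewrite (on0 K s x gO xs) ?x0 // v0' -/w.
apply: le_trans ((HB c).2 s (ltW s1)) _; rewrite ler_wpM2r ?exprn_ge0 //.
rewrite (bigD1 c) //= lerDl sumr_ge0 // => d _.
by have [] := HB d.
Qed.

End ModifiedEquation.

(** * Exactness of the modified equation and of the modified Lagrangian *)

Section InverseTheorem.
Context {R : realType} {n : nat} (Q : analyticManifold R n).
Hypothesis Q_connected : connected [set: Q].
Variable L : tangent Q -> R.
Hypotheses (LA : lagrangian L) (Lreg : regular L).
Variable I : (tangent Q -> R) -> Q -> Q -> R -> R.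
Hypotheses (I_int : variational_integrator I) (I_cons : consistent_integrator I).
Variables (k : nat) (i : chart_index Q).

Let Omega := chart_image i.
Let oi : open Omega := @chart_image_open R n Q i.
Let G := integrate_truncation I (inverse_modified L I) k.
Let E j (c : 'I_n) := euler j.+2 (expansion G i 0 1 j) c.
Let f := el_flow L i.
Let lam := local L i.
Let fO : tan_field Omega f. Proof. exact: tan_el_flow. Qed.

(** What the final argument takes from the discrete Lagrangian: the form and the leading term of the
    Euler expressions, for solving the modified equation, and the two on-shell identities up to
    order [k]. *)
Lemma inverse_expansions : [/\ forall j c, dp Omega (E j c),
  forall c z, Omega (z 0%N) -> E 0 c z = el_source L i c (state z) - \sum_b el_matrix L i (state z) c b * z 2%N 0 b,
  forall p c w, (p <= k)%N -> Omega (lsubmx w) -> E p c (on_shell f w) = 0 &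
  forall p w, (p <= k)%N -> Omega (lsubmx w) ->
    meshed G i p (on_shell f w) = if p == 0%N then lam w else 0].
Proof.
have [Fs HFs] := blowups_exist LA Lreg I_int i.
have GF : blowup G i (partial_blowup Fs k.+1) by exact: (blowup_partial (fun j _ => HFs j)).
pose F := flat3 (partial_blowup Fs k.+1).
have eF : edge Omega F := blowup_edge GF.
have X j : eqO Omega (expansion G i 0 1 j) (density 0 j.+1 F).
  by move=> z zO; rewrite (expansion_density j GF zO) ?add0r.
have X0 : eqO Omega (expansion G i 0 1 0) (fun z => lam (state z)).
  by move=> z zO; rewrite X // (density_lag Q_connected LA Lreg I_int I_cons k HFs zO).
split.
- move=> j c; apply: (dp_ext (F := euler j.+2 (density 0 j.+1 F) c)).
    by apply: (dp_euler oi); exact: dp_density.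
  exact: euler_eqO (X j).
- move=> c z zO; rewrite /E (euler_eqO oi 2 c X0 zO) (euler_state oi c (local_tan LA (i := i)) zO).
  exact: el_form_split.
- move=> p c w pk wi; rewrite /E (euler_eqO oi p.+2 c (X p) wi).
  exact: (euler_exact Q_connected LA Lreg I_int I_cons HFs c pk wi).
move=> p w pk wi; rewrite /meshed.
pose c j : R := (2 / 2 ^+ (2 * j) - 1) * (bernoulli (2 * j) / (2 * j)`!%:R).
transitivity (\sum_(j < p./2.+1) c j * iter (2 * j) total_derivative
    (density (- 2^-1) (p - 2 * j).+1 F) (on_shell f w)).
  apply: eq_bigr => j _; congr (_ * _); rewrite totE.
  apply: (eqO_iter_total oi) => // z zO.
  by rewrite (expansion_density _ GF zO) //; lra.
rewrite (mesh_exact Q_connected LA Lreg I_int I_cons HFs c pk wi) /c bernoulli_midpoint.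
by case: p pk => [|p] _; rewrite ?mul1r ?mul0r.
Qed.

Lemma inverse_modified_equation : exists g, modified_equation G i g.
Proof.
have [E_dp E0 _ _] := inverse_expansions.
have [g Hg] := residual_exists oi E_dp (tan_el_matrix LA (i := i)) (el_matrix_unit LA Lreg (i := i)) E0.
by exists g; apply/modified_equationP.
Qed.

Lemma inverse_modified_unique g : modified_equation G i g ->
  tan_family Omega g /\ forall j w, (j <= k)%N -> Omega (lsubmx w) ->
    g j (lsubmx w) (rsubmx w) = if j == 0%N then f (lsubmx w) (rsubmx w) else 0.
Proof.
have [E_dp E0 Ek _] := inverse_expansions.
move=> /(modified_equationP E_dp)[gO gE]; split=> // j w jk wi.
(* The candidate is the exact field with zero corrections. Its truncations all equal [f], so every
   residual up to order [k] vanishes, and uniqueness identifies [g] with it. *)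
pose g' j : 'rV[R]_n -> 'rV[R]_n -> 'rV[R]_n := if j == 0%N then f else fun _ _ => 0.
have gO' : tan_family Omega g'.
  move=> m a u ui; rewrite /g'; case: (m == 0%N); first exact: fO.
  by apply: (an_eq (f := fun=> 0)) => [y|]; [rewrite mxE|exact: an_cst].
have T p s : truncated_field g' p s = f.
  apply/funext => q; apply/funext => v; rewrite /truncated_field big_ord_recl expr0 scale1r.
  by rewrite big1 ?addr0 // => m _; rewrite /g' /= scaler0.
have gE' p c : (p <= k)%N -> cong Omega p.+1 (residual E p g' c) (fun _ _ => 0).
  move=> pk; apply/cong0_pol; exists (fun _ _ => 0); first by apply: pol_tan => u _; exact: an_cst.
  move=> s u ui; rewrite mulr0 /residual big1 // => m _.
  by rewrite T Ek ?mulr0 // (leq_trans _ pk) // -ltnS.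
have := residual_unique oi E_dp (tan_el_matrix LA (i := i)) (el_matrix_unit LA Lreg (i := i)) E0
  gO gO' (fun p c _ => gE p c) gE'.
move=> /(_ j w); rewrite ltnS => /(_ jk wi) ->.
by rewrite /g'; case: ifP.
Qed.

Lemma inverse_equivalent g : modified_equation G i g -> equivalent_to_el L i g k.
Proof.
move=> /inverse_modified_unique[gO gE]; split=> [z zi|j q v /andP[j0 jk] qi].
  have -> : g 0%N (z 0%N) (z 1%N) = f (z 0%N) (z 1%N).
    have := gE 0%N (row_mx (z 0%N) (z 1%N)) (leq0n k); rewrite row_mxKl row_mxKr; exact.
  rewrite -(el_flowP LA Lreg zi); split=> H c; have := H c; by rewrite el_operatorE.
have := gE j (row_mx q v) jk; rewrite row_mxKl row_mxKr => -> //.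
by case: j j0 {jk}.
Qed.

Lemma inverse_coincides g : modified_equation G i g ->
  coincides_with L i (modified_lagrangian G i g k) k.
Proof.
move=> /inverse_modified_unique[gO gE] p q v pk qi.
have [_ _ _ M] := inverse_expansions.
pose w := row_mx q v : 'rV[R]_(n + n); have wi : Omega (lsubmx w) by rewrite row_mxKl.
(* The truncated field does not depend on [h], hence neither do the substituted jets, and the sum is
   a polynomial in [h] whose coefficients are the meshed ones. *)
have T h u : Omega (lsubmx u) -> truncated_field g k h (lsubmx u) (rsubmx u) = f (lsubmx u) (rsubmx u).
  move=> ui; rewrite /truncated_field big_ord_recl expr0 scale1r gE // big1 ?addr0 // => j _.
  by rewrite gE //= ?scaler0 // -ltnS /bump /= add1n ltnS.
pose u j : R := if j == 0%N then lam w else 0.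
rewrite /modified_lagrangian (series_coef_asym (c := u) (leqnn p)).
  by rewrite /u /lam /local /flat2 row_mxKl row_mxKr.
apply: asym_near (asym_poly u (pk : (p < k.+1)%N)); exists 1 => // h _.
apply: eq_bigr => j _; rewrite mulrC; congr (_ * _).
have jk : (j <= k)%N by rewrite -ltnS.
rewrite /u -(M j w jk wi); congr (meshed G i j _); apply/funext => l.
have fO' := tan_pol_field oi h (pol_truncated k gO).
have := prolong_ext oi l fO fO' (fun u ui => esym (T h u ui)) wi.
by rewrite /on_shell row_mxKl row_mxKr.
Qed.

End InverseTheorem.

(** The separate existence of a modified equation keeps the quantification over all [g] from being
    vacuous. [Linvmod] is chosen before [k] and [i], so that one series serves all truncations and
    charts. *)
Theorem theorem4p3 (R : realType) (n : nat) (Q : analyticManifold R n)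
    (Q_connected : connected [set: Q])
    (L : tangent Q -> R) (L_analytic : lagrangian L) (L_regular : regular L)
    (I : (tangent Q -> R) -> Q -> Q -> R -> R)
    (I_integrator : variational_integrator I)
    (I_consistent : consistent_integrator I) :
  exists Linvmod : nat -> tangent Q -> R,
    (forall j, lagrangian (Linvmod j)) /\
    forall (k : nat) (i : chart_index Q),
      let G := integrate_truncation I Linvmod k in
      (exists g, modified_equation G i g) /\
      forall g, modified_equation G i g ->
        equivalent_to_el L i g k /\
        coincides_with L i (modified_lagrangian G i g k) k.
Proof.
exists (inverse_modified L I); split=> [j|k i G].
  exact: (local_inverse_modified L_analytic L_regular I_integrator j).1.
split; first exact: inverse_modified_equation.
move=> g Hg; split.
  exact: (inverse_equivalent Q_connected L_analytic L_regular I_integrator I_consistent Hg).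
exact: (inverse_coincides Q_connected L_analytic L_regular I_integrator I_consistent Hg).
Qed.
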